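(* Let $K$ be a stable ternary lattice. Then the class number $h(K)$ equals $$2\,\mathfrak{w}(K)+\sum_{\substack{m\mid \mathfrak{P}\mathfrak{Q},\ \delta\in\{1,2\}\\ \delta \text{ represented by } \mathrm{gen}(\lambda_m(K))}} t_{m,\delta}\cdot 2^{\nu(m)-\nu(\mathfrak{P}\mathfrak{Q})}\cdot\frac{h_E}{\mu_E}+\frac{1}{3}\big(b_{12}(K)+b_{24}(K)\big)+\frac14 b_{16}(K),$$ where the sum is over positive divisors $m$ of $\mathfrak P\mathfrak Q$ and $\delta\in\{1,2\}$ such that $\delta$ is represented by some lattice in $\mathrm{gen}(\lambda_m(K))$, $E=\mathbb{Q}(\sqrt{-\delta\, d(\lambda_m(K))})$, $h_E$ is the class number of $E$ and $\mu_E$ the number of roots of unity in $E$, and $t_{m,\delta}$ is given as follows: if $\delta=1$: $t_{m,1}=3$ if $\lambda_m(K)_2\cong\langle1,1,3\rangle$, $t_{m,1}=1$ if $\lambda_m(K)_2\cong\langle 3,3,3\rangle$, $t_{m,1}=2$ if $\lambda_m(K)_2\cong\langle 1,1,7\rangle$, $t_{m,1}=\frac12$ if $dK\equiv1\pmod 4$; if $\delta=2$: $t_{m,2}=4,1,1,2$ if $\lambda_m(K)_2\cong A\perp\langle 2\rangle, A\perp\langle 14\rangle, A\perp\langle 6\rangle, A\perp\langle 10\rangle$ respectively, where $A=\begin{pmatrix}2&1\\1&2\end{pmatrix}$, and $t_{m,2}=\frac12$ if $\lambda_m(K)_2$ is odd.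
   Context: Quadratic spaces are positive definite over $\mathbb{Q}$; lattices are $\mathbb{Z}$-lattices with quadratic map $Q$, bilinear form $B$, $Q(x)=B(x,x)$; primitive means the ideal generated by $B(L,L)$ is $\mathbb{Z}$; $L$ is even if $Q(L)\subseteq 2\mathbb{Z}$ and odd otherwise; $dL$ is the Gram determinant; $L_q=\mathbb{Z}_q\otimes L$. A primitive ternary lattice $K$ is stable if $\mathrm{ord}_q(dK)\le1$ for all primes $q$ and $\mathrm{ord}_2(dK)=1$ if and only if $K$ is even. $\mathfrak P$ (resp. $\mathfrak Q$) is the product of the odd primes $q\mid dK$ with $\mathbb{Q}_q\otimes K$ anisotropic (resp. isotropic). $\nu(a)$ is the number of distinct prime divisors of $a$. For a positive integer $m$, $\Lambda_m(K)=\{x\in K: Q(x+y)\equiv Q(y)\pmod m\ \forall y\in K\}$ and $\lambda_m(K)$ is the primitive lattice obtained from $\Lambda_m(K)$ by scaling its quadratic map by a suitable positive rational number. $b_t(K)$ is the number of isometry classes in $\mathrm{gen}(K)$ whose isometry group has order $t$. The mass is $\mathfrak{w}(K)=\sum_{[M]\in\mathrm{gen}(K)}1/|O(M)|$. A $\mathbb{Z}_2$-lattice is odd if its norm ideal is $\mathbb{Z}_2$.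
   Formalization: The lattice ⟨1,1,1⟩ is excluded, since there the printed formula gives 5/12 instead of 1; and t_{m,1}=1/2 is taken when d(λ_m(K))≡1 (mod 4) rather than dK≡1 (mod 4), since otherwise t_{m,1} is undefined, e.g. for K=⟨1,1,3⟩, m=3. *)

(* Defs.v *)
From HB Require Import structures.
From mathcomp Require Import all_boot all_order all_algebra all_field.
From mathcomp Require Import finmap.
From mathcomp Require Import boolp classical_sets functions cardinality fsbigop.

Set Implicit Arguments.
Unset Strict Implicit.
Unset Printing Implicit Defensive.

Import Order.TTheory GRing.Theory Num.Theory.

Local Open Scope classical_set_scope.
Local Open Scope ring_scope.

(* Number of elements of a finite set; 0 on an infinite set. *)
Definition ncard (T : choiceType) (A : set T) : nat := #|` fset_set A|.

Definition eq_classes (T : Type) (A : set T) (r : T -> T -> Prop) : set (set T) :=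
  [set [set y | A y /\ r x y] | x in A].

Definition ideal_gen (R : comNzRingType) (S : set R) : set R :=
  [set r | exists2 s : seq (R * R),
     (forall t, t \in s -> S t.2) & r = \sum_(t <- s) t.1 * t.2].

(* p-adic integers: the inverse limit of the rings Z/p^k, a class modulo p^k  *)
(* being represented by its least nonnegative residue.  As with 'F_p, the     *)
(* type is a domain for every p: the base is p if p is prime, else 2.         *)

Definition padic_base (p : nat) : nat := if prime p then p else 2%N.

Lemma padic_base_prime p : prime (padic_base p).
Proof. by rewrite /padic_base; case: ifP. Qed.

Lemma modz_dvdm (n e d : int) : (d %| e)%Z -> ((n %% e)%Z = n %[mod d])%Z.
Proof.
by case/dvdzP=> c ->; rewrite [in RHS](divz_eq n (c * d)) mulrA modzMDl.
Qed.

Record padic_int (p : nat) := PadicInt {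
  padic_res :> nat -> int;
  padic_resP : forall k,
    padic_res k = (padic_res k.+1 %% (padic_base p ^ k)%N%:Z)%Z
}.

Section PadicInt.
Variable p : nat.
Let P := padic_base p.
Let m k : int := (P ^ k)%N%:Z.
Implicit Types x y z : padic_int p.

HB.instance Definition _ := gen_eqMixin (padic_int p).
HB.instance Definition _ := gen_choiceMixin (padic_int p).

Lemma padic_ext x y : (forall k, x k = y k) -> x = y.
Proof.
case: x y => [x xP] [y yP] /= e.
have exy : x = y by apply/funext.
by case: y / exy yP e => yP _; congr PadicInt; apply: Prop_irrelevance.
Qed.

Lemma m_neq0 k : m k != 0.
Proof. by rewrite /m eqz_nat -lt0n expn_gt0 prime_gt0 ?padic_base_prime. Qed.

Lemma padic_resE x k : (x k %% m k)%Z = x k.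
Proof. by rewrite padic_resP modz_mod. Qed.

Lemma padic_resD x k l : (x (k + l)%N %% m k)%Z = x k.
Proof.
elim: l => [|l IHl]; first by rewrite addn0 padic_resE.
rewrite -[RHS]IHl [in RHS]padic_resP addnS.
have /modz_dvdm -> // : (m k %| m (k + l))%Z.
by apply/dvdnP; exists (P ^ l)%N; rewrite !absz_nat expnD mulnC.
Qed.

Lemma dvd_mS k : (m k %| m k.+1)%Z.
Proof. by apply/dvdnP; exists P; rewrite !absz_nat expnS. Qed.

Lemma padic_modP (f : nat -> int) :
  (forall k, (f k.+1 = f k %[mod m k])%Z) ->
  forall k, (f k %% m k)%Z = ((f k.+1 %% m k.+1)%Z %% m k)%Z.
Proof. by move=> fP k; rewrite modz_dvdm ?dvd_mS// fP. Qed.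

Definition padic_of f fP : padic_int p := PadicInt (@padic_modP f fP).

Fact padic_cst_subproof (n : int) k : (n = n %[mod m k])%Z.
Proof. by []. Qed.
Fact padic_opp_subproof x k : (- x k.+1 = - x k %[mod m k])%Z.
Proof. by rewrite [x k]padic_resP modzNm. Qed.
Fact padic_add_subproof x y k : (x k.+1 + y k.+1 = x k + y k %[mod m k])%Z.
Proof. by rewrite [x k]padic_resP [y k]padic_resP modzDm. Qed.
Fact padic_mul_subproof x y k : (x k.+1 * y k.+1 = x k * y k %[mod m k])%Z.
Proof. by rewrite [x k]padic_resP [y k]padic_resP modzMm. Qed.

Definition padic_cst n := padic_of (padic_cst_subproof n).
Definition padic_opp x := padic_of (padic_opp_subproof x).
Definition padic_add x y := padic_of (padic_add_subproof x y).
Definition padic_mul x y := padic_of (padic_mul_subproof x y).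

Fact padic_addA : associative padic_add.
Proof. by move=> x y z; apply: padic_ext => k /=; rewrite modzDml modzDmr addrA. Qed.
Fact padic_addC : commutative padic_add.
Proof. by move=> x y; apply: padic_ext => k /=; rewrite addrC. Qed.
Fact padic_add0 : left_id (padic_cst 0) padic_add.
Proof. by move=> x; apply: padic_ext => k /=; rewrite mod0z add0r padic_resE. Qed.
Fact padic_addN : left_inverse (padic_cst 0) padic_opp padic_add.
Proof. by move=> x; apply: padic_ext => k /=; rewrite modzDml addNr. Qed.

HB.instance Definition _ := GRing.isZmodule.Build (padic_int p)
  padic_addA padic_addC padic_add0 padic_addN.

Fact padic_mulA : associative padic_mul.
Proof. by move=> x y z; apply: padic_ext => k /=; rewrite modzMml modzMmr mulrA. Qed.
Fact padic_mulC : commutative padic_mul.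
Proof. by move=> x y; apply: padic_ext => k /=; rewrite mulrC. Qed.
Fact padic_mul1 : left_id (padic_cst 1) padic_mul.
Proof.
by move=> x; apply: padic_ext => k /=; rewrite modzMml mul1r padic_resE.
Qed.
Fact padic_mulDl : left_distributive padic_mul padic_add.
Proof.
by move=> x y z; apply: padic_ext => k /=; rewrite modzMml modzDm mulrDl.
Qed.
Fact padic_1neq0 : padic_cst 1 != 0.
Proof.
apply/eqP => /(congr1 (fun x : padic_int p => x 1%N)) /=.
rewrite mod0z modz_small // /m expn1.
by rewrite ltz_nat prime_gt1 // padic_base_prime.
Qed.

HB.instance Definition _ := GRing.Zmodule_isComNzRing.Build (padic_int p)
  padic_mulA padic_mulC padic_mul1 padic_mulDl padic_1neq0.

Definition padic_unit : {pred padic_int p} :=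
  fun x => `[< exists y : padic_int p, y * x = 1 >].
Definition padic_inv x : padic_int p :=
  if x \in padic_unit then xget x [set y | y * x = 1] else x.

Fact padic_mulV : {in padic_unit, left_inverse 1 padic_inv *%R}.
Proof.
move=> x xU; rewrite /padic_inv xU; case: xgetP => [y _ //|none].
by move/asboolP: xU => [y yx1]; case: (none y).
Qed.
Fact padic_unitP x y : y * x = 1 -> x \in padic_unit.
Proof. by move=> yx1; apply/asboolP; exists y. Qed.
Fact padic_inv_out : {in [predC padic_unit], padic_inv =1 id}.
Proof. by move=> x; rewrite inE /padic_inv => /negPf ->. Qed.

HB.instance Definition _ := GRing.ComNzRing_hasMulInverse.Build (padic_int p)
  padic_mulV padic_unitP padic_inv_out.

Lemma padic_neq0 x : x != 0 -> exists k, ~~ (m k %| x k)%Z.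
Proof.
move=> x0; apply: contra_neqP x0 => /forallNP xN; apply: padic_ext => k /=.
have /negP := xN k; rewrite negbK mod0z => /dvdz_mod0P.
by rewrite padic_resE.
Qed.

Lemma Ndvd_logn (k : nat) (n : int) : ~~ (m k %| n)%Z -> n != 0 /\ (logn P `|n| < k)%N.
Proof.
move=> kn; have n0 : n != 0 by apply: contraNneq kn => ->; rewrite dvdz0.
split=> //; rewrite ltnNge; apply: contra kn => le_k.
by rewrite dvdzE absz_nat pfactor_dvdn ?padic_base_prime ?absz_gt0.
Qed.

Fact padic_integral x y : x * y = 0 -> (x == 0) || (y == 0).
Proof.
move=> xy0; apply/negPn/negP; rewrite negb_or => /andP[].
move=> /padic_neq0[k xk] /padic_neq0[l yl].
have xkl : ~~ (m k %| x (k + l)%N)%Z.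
  by apply: contra xk => /dvdz_mod0P; rewrite padic_resD => ->; rewrite dvdz0.
have ykl : ~~ (m l %| y (k + l)%N)%Z.
  apply: contra yl => /dvdz_mod0P.
  by rewrite addnC padic_resD => ->; rewrite dvdz0.
have [x0 lx] := Ndvd_logn xkl; have [y0 ly] := Ndvd_logn ykl.
have := congr1 (fun z : padic_int p => z (k + l)%N) xy0.
rewrite /= mod0z => /dvdz_mod0P.
rewrite dvdzE absz_nat abszM pfactor_dvdn ?padic_base_prime//; last first.
  by rewrite muln_gt0 !absz_gt0 x0.
rewrite lognM ?absz_gt0// leqNgt => /negP; apply.
by rewrite -addSn leq_add // ltnW.
Qed.

HB.instance Definition _ :=
  GRing.ComUnitRing_isIntegral.Build (padic_int p) padic_integral.

End PadicInt.

Notation padic_num p := {fraction padic_int p}.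

(* A lattice of rank n with integral bilinear form is given by its Gram matrix *)
(* in a Z-basis, so that its elements are the row vectors 'rV[int]_n; spaces   *)
(* and local lattices are obtained by extension of scalars.                    *)

Section Forms.
Variable n : nat.

Definition bform (R : comNzRingType) (G : 'M[R]_n) (x y : 'rV[R]_n) : R :=
  (x *m G *m y^T) 0 0.
Definition qform (R : comNzRingType) (G : 'M[R]_n) (x : 'rV[R]_n) : R :=
  bform G x x.

Definition isometric (R : comUnitRingType) (G H : 'M[R]_n) : Prop :=
  exists2 U : 'M[R]_n, U \in unitmx & U *m G *m U^T = H.

Definition ext (R : comNzRingType) (G : 'M[int]_n) : 'M[R]_n := map_mx intr G.

Definition isotropic (F : fieldType) (G : 'M[F]_n) : Prop :=
  exists2 x : 'rV[F]_n, x != 0 & qform G x = 0.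
Definition anisotropic (F : fieldType) (G : 'M[F]_n) : Prop := ~ isotropic G.

Definition scale_ideal (R : comNzRingType) (G : 'M[R]_n) : set R :=
  ideal_gen [set bform G xy.1 xy.2 | xy in [set: 'rV[R]_n * 'rV[R]_n]].
Definition norm_ideal (R : comNzRingType) (G : 'M[R]_n) : set R :=
  ideal_gen (range (qform G)).

Definition lattice (G : 'M[int]_n) : Prop :=
  G^T = G /\ (forall x : 'rV[rat]_n, x != 0 -> 0 < qform (ext rat G) x).

Definition primitive (G : 'M[int]_n) : Prop := scale_ideal G = [set: int].

Definition even_lattice (G : 'M[int]_n) : Prop :=
  forall x, (2 %| qform G x)%Z.

Definition locally_isometric (q : nat) (G H : 'M[int]_n) : Prop :=
  isometric (ext (padic_int q) G) (ext (padic_int q) H).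

Definition genus (G : 'M[int]_n) : set 'M[int]_n :=
  [set H | [/\ lattice H, isometric (ext rat G) (ext rat H)
             & forall q, prime q -> locally_isometric q G H]].

Definition represented (G : 'M[int]_n) (a : int) : Prop :=
  exists x, qform G x = a.
Definition represented_by_genus (G : 'M[int]_n) (a : int) : Prop :=
  exists2 H, genus G H & represented H a.

Definition ortho (G : 'M[int]_n) : set 'M[int]_n :=
  [set U | U \in unitmx /\ U *m G *m U^T = G].

Definition genus_classes (G : 'M[int]_n) : set (set 'M[int]_n) :=
  eq_classes (genus G) (@isometric int).

Definition class_number (G : 'M[int]_n) : nat := ncard (genus_classes G).

(* |O(M)| for any lattice M in the isometry class C *)
Definition ortho_order (C : set 'M[int]_n) : nat := ncard (ortho (xget 0 C)).

Definition b_ (t : nat) (G : 'M[int]_n) : nat :=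
  ncard [set C | genus_classes G C /\ ortho_order C = t].

Definition mass (G : 'M[int]_n) : rat :=
  \sum_(C \in genus_classes G) ((ortho_order C)%:R^-1 : rat).

Definition Lambda (m : nat) (G : 'M[int]_n) : set 'rV[int]_n :=
  [set x | forall y, (qform G (x + y) = qform G y %[mod m])%Z].

(* The rows of T form a Z-basis of Lambda m G and N is the Gram matrix of that *)
(* basis after scaling.                                                        *)
Definition is_lambda (m : nat) (G N : 'M[int]_n) : Prop :=
  exists T : 'M[int]_n, exists c : rat,
    [/\ (forall x, Lambda m G x <-> exists! a : 'rV[int]_n, x = a *m T),
        0 < c, ext rat N = c *: ext rat (T *m G *m T^T) & primitive N].

(* Only the isometry class of lambda m G is meaningful. *)
Definition lambda (m : nat) (G : 'M[int]_n) : 'M[int]_n :=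
  xget 0 [set N | is_lambda m G N].

End Forms.

Definition stable (K : 'M[int]_3) : Prop :=
  [/\ lattice K, primitive K,
      forall q, prime q -> (logn q `|\det K| <= 1)%N
    & logn 2 `|\det K| = 1%N <-> even_lattice K].

Definition frakP (K : 'M[int]_3) : nat :=
  \prod_(q <- primes `|\det K| |
         odd q && `[< anisotropic (ext (padic_num q) K) >]) q.
Definition frakQ (K : 'M[int]_3) : nat :=
  \prod_(q <- primes `|\det K| |
         odd q && `[< isotropic (ext (padic_num q) K) >]) q.

Definition nu (a : nat) : nat := size (primes a).

(* The field Q(sqrt D), its ring of integers and its invariants, in algC *)

Definition quad_field (D : int) : set algC :=
  [set x | exists a b : rat, x = ratr a + ratr b * sqrtC D%:~R].

Definition integers (E : set algC) : set algC := [set x | E x /\ x \in Aint].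

Definition integral_ideal (E I : set algC) : Prop :=
  [/\ I `<=` integers E, (exists2 x, I x & x != 0),
      forall x y, I x -> I y -> I (x + y)
    & forall a x, integers E a -> I x -> I (a * x)].

Definition ideal_equiv (E I J : set algC) : Prop :=
  exists a b, [/\ integers E a /\ a != 0, integers E b /\ b != 0
    & [set a * x | x in I] = [set b * y | y in J]].

Definition field_class_number (E : set algC) : nat :=
  ncard (eq_classes (integral_ideal E) (ideal_equiv E)).

Definition roots_of_unity (E : set algC) : set algC :=
  [set x | E x /\ exists2 k : nat, (0 < k)%N & x ^+ k = 1].
Definition mu (E : set algC) : nat := ncard (roots_of_unity E).

Definition diag3 (a b c : int) : 'M[int]_3 :=
  \matrix_(i, j) (if i == j then [:: a; b; c]`_i else 0).

(* the orthogonal sum of A = (2 1; 1 2) and <c> *)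
Definition A_perp (c : int) : 'M[int]_3 :=
  block_mx (\matrix_(i < 2, j < 2) (if i == j then 2 else 1)) 0
           0 (c%:M : 'M[int]_1).

Definition odd_at2 (n : nat) (G : 'M[int]_n) : Prop :=
  norm_ideal (ext (padic_int 2) G) = [set: padic_int 2].

(* t_{m,delta} as a function of L = lambda_m(K).  The congruence in the case    *)
(* delta = 1 bears on d(L) = m * dK, not on dK: it is then exclusive of the     *)
(* three previous cases, and when delta is represented by gen(L) exactly one of *)
(* the listed cases holds, so that the default value 0 is not used.             *)
Definition tcoef (L : 'M[int]_3) (delta : nat) : rat :=
  if delta == 1%N then
    if `[< locally_isometric 2 L (diag3 1 1 3) >] then 3
    else if `[< locally_isometric 2 L (diag3 3 3 3) >] then 1
    else if `[< locally_isometric 2 L (diag3 1 1 7) >] then 2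
    else if (\det L == 1 %[mod 4])%Z then 1 / 2
    else 0
  else if delta == 2%N then
    if `[< locally_isometric 2 L (A_perp 2) >] then 4
    else if `[< locally_isometric 2 L (A_perp 14) >] then 1
    else if `[< locally_isometric 2 L (A_perp 6) >] then 1
    else if `[< locally_isometric 2 L (A_perp 10) >] then 2
    else if `[< odd_at2 L >] then 1 / 2
    else 0
  else 0.

(* Main.v *)
(** For a lattice H in gen K of squarefree determinant, a rotation of order
    greater than 2 forces H to be <n> + <1, 1>, <n> + A_2 or a trigonal lattice;
    reading off the groups, |O(H)| = #{U in O(H) | U^2 = 1} + |O(H)| c, with
    c = 1/3 if |O(H)| is 12 or 24, c = 1/4 if it is 16, and c = 0 otherwise.
    The involutions are 1, -1 and, up to sign, the reflections, and v defines a
    reflection iff Q(v) = m delta and B(v, H) <= m Z for some m | PQ and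
    delta in {1, 2}.  Summing 1 = (2 + #reflections) / |O(H)| + c over the classes
    reduces the formula to the weighted count of such v, for each (m, delta).

    The complement of v is a plane similar to the norm form of E, and H is glued
    from v and an ideal I of E with I conj(I) = (c).  Since such a determinant
    and the parity determine the genus inside a rational class, every gluing of
    every such ideal lies in gen K, so the count is the number of gluings times
    the number of ideals I with I conj(I) = (c) modulo elements of norm 1.  This
    number is h_E / 2^(t - 1), with t the number of ramified primes: if J0 is one
    such ideal, every other one is J0 a / conj(a), where a is determined up to
    ambiguous ideals. *)

Require Import Defs.
From mathcomp Require Import all_boot all_order all_algebra all_field.
From mathcomp Require Import finmap.
From mathcomp Require Import boolp classical_sets functions cardinality fsbigop.
From mathcomp Require Import zify ring.

Set Implicit Arguments.
Unset Strict Implicit.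
Unset Printing Implicit Defensive.

Import Order.TTheory GRing.Theory Num.Theory.

Local Open Scope classical_set_scope.
Local Open Scope ring_scope.

(** * Three by three matrices *)

Notation o0 := (@Ordinal 3 0 isT).
Notation o1 := (@Ordinal 3 1 isT).
Notation o2 := (@Ordinal 3 2 isT).

Lemma I3P (P : 'I_3 -> Prop) : P o0 -> P o1 -> P o2 -> forall i, P i.
Proof.
move=> P0 P1 P2 [[|[|[|//]]] Hi].
- by rewrite (_ : Ordinal Hi = o0) //; apply: val_inj.
- by rewrite (_ : Ordinal Hi = o1) //; apply: val_inj.
- by rewrite (_ : Ordinal Hi = o2) //; apply: val_inj.
Qed.

Lemma sum_ord3 (V : nmodType) (F : 'I_3 -> V) : \sum_i F i = F o0 + F o1 + F o2.
Proof.
rewrite !big_ord_recl big_ord0 addr0 addrA.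
by congr (_ + _ + _); congr F; apply: val_inj.
Qed.

Section Mx3.
Variable T : Type.

Definition mx3 (a b c d e f g h i : T) : 'M[T]_3 :=
  \matrix_(x, y) nth a (nth [::] [:: [:: a; b; c]; [:: d; e; f]; [:: g; h; i]] x) y.
Definition rv3 (a b c : T) : 'rV[T]_3 := \row_y nth a [:: a; b; c] y.

Lemma mx3E (A : 'M[T]_3) :
  A = mx3 (A o0 o0) (A o0 o1) (A o0 o2) (A o1 o0) (A o1 o1) (A o1 o2)
          (A o2 o0) (A o2 o1) (A o2 o2).
Proof.
by apply/matrixP; apply: I3P; apply: I3P; rewrite mxE.
Qed.

Lemma rv3E (x : 'rV[T]_3) : x = rv3 (x 0 o0) (x 0 o1) (x 0 o2).
Proof. by apply/rowP; apply: I3P; rewrite mxE. Qed.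

Lemma mx3P (A : 'M[T]_3) : exists a b c d e f g h i, A = mx3 a b c d e f g h i.
Proof. by rewrite [A]mx3E; do 9 eexists. Qed.

Lemma rv3P (x : 'rV[T]_3) : exists a b c, x = rv3 a b c.
Proof. by rewrite [x]rv3E; do 3 eexists. Qed.

Lemma mx3_inj a b c d e f g h i a' b' c' d' e' f' g' h' i' :
  mx3 a b c d e f g h i = mx3 a' b' c' d' e' f' g' h' i' ->
  [/\ a = a', b = b' & c = c'] /\ [/\ d = d', e = e' & f = f'] /\
  [/\ g = g', h = h' & i = i'].
Proof.
move=> /matrixP E.
by have := (E o0 o0, E o0 o1, E o0 o2, (E o1 o0, E o1 o1, E o1 o2),
  (E o2 o0, E o2 o1, E o2 o2)); rewrite !mxE /= => -[[[[-> ->] ->] [[-> ->] ->]] [[-> ->] ->]].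
Qed.

Lemma rv3_inj a b c a' b' c' :
  rv3 a b c = rv3 a' b' c' -> [/\ a = a', b = b' & c = c'].
Proof.
move=> /rowP E; have := (E o0, E o1, E o2); rewrite !mxE /=.
by move=> [[-> ->] ->].
Qed.

Lemma tr_mx3 a b c d e f g h i :
  (mx3 a b c d e f g h i)^T = mx3 a d g b e h c f i.
Proof. by apply/matrixP; apply: I3P; apply: I3P; rewrite !mxE. Qed.

End Mx3.

Lemma map_mx3 (T U : Type) (k : T -> U) a b c d e f g h i :
  map_mx k (mx3 a b c d e f g h i) =
  mx3 (k a) (k b) (k c) (k d) (k e) (k f) (k g) (k h) (k i).
Proof. by apply/matrixP; apply: I3P; apply: I3P; rewrite !mxE. Qed.

Section Mx3Ring.
Variable R : comNzRingType.
Implicit Types a b c d e f g h i : R.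

Lemma scale_mx3 k a b c d e f g h i :
  k *: mx3 a b c d e f g h i =
  mx3 (k * a) (k * b) (k * c) (k * d) (k * e) (k * f) (k * g) (k * h) (k * i).
Proof. by apply/matrixP; apply: I3P; apply: I3P; rewrite !mxE. Qed.

Lemma mul_mx3 a b c d e f g h i a' b' c' d' e' f' g' h' i' :
  mx3 a b c d e f g h i *m mx3 a' b' c' d' e' f' g' h' i' =
  mx3 (a * a' + b * d' + c * g') (a * b' + b * e' + c * h') (a * c' + b * f' + c * i')
      (d * a' + e * d' + f * g') (d * b' + e * e' + f * h') (d * c' + e * f' + f * i')
      (g * a' + h * d' + i * g') (g * b' + h * e' + i * h') (g * c' + h * f' + i * i').
Proof. by apply/matrixP; apply: I3P; apply: I3P; rewrite !mxE sum_ord3 !mxE. Qed.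

Lemma mul_rv3 x y z a b c d e f g h i :
  rv3 x y z *m mx3 a b c d e f g h i =
  rv3 (x * a + y * d + z * g) (x * b + y * e + z * h) (x * c + y * f + z * i).
Proof. by apply/rowP; apply: I3P; rewrite !mxE sum_ord3 !mxE. Qed.

Lemma opp_rv3 a b c : - rv3 a b c = rv3 (- a) (- b) (- c).
Proof. by apply/rowP; apply: I3P; rewrite !mxE. Qed.

Lemma scale_rv3 k a b c : k *: rv3 a b c = rv3 (k * a) (k * b) (k * c).
Proof. by apply/rowP; apply: I3P; rewrite !mxE. Qed.

Lemma rv3_0 : rv3 0 0 0 = 0 :> 'rV[R]_3.
Proof. by apply/rowP; apply: I3P; rewrite !mxE. Qed.

Lemma mx3_1 : 1%:M = mx3 1 0 0 0 1 0 0 0 1 :> 'M[R]_3.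
Proof. by apply/matrixP; apply: I3P; apply: I3P; rewrite !mxE. Qed.

Lemma det_mx3 a b c d e f g h i :
  \det (mx3 a b c d e f g h i) =
  a * (e * i - f * h) - b * (d * i - f * g) + c * (d * h - e * g).
Proof.
rewrite (expand_det_row _ o0) sum_ord3 !mxE /= /cofactor.
have det2 (M : 'M[R]_2) : \det M = M 0 0 * M 1 1 - M 0 1 * M 1 0.
  rewrite (expand_det_row _ 0) !big_ord_recl big_ord0 addr0 /cofactor.
  rewrite !det_mx11 !mxE /= !addn0 expr0 mul1r expr1 mulN1r mulrN.
  by congr (_ * M _ _ - M _ _ * M _ _); apply: val_inj.
rewrite !det2 !mxE /= !add0n expr0 expr1; ring.
Qed.

Lemma bform_rv3 a b c d e f g h i x y z x' y' z' :
  bform (mx3 a b c d e f g h i) (rv3 x y z) (rv3 x' y' z') =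
  (x * a + y * d + z * g) * x' + (x * b + y * e + z * h) * y' +
  (x * c + y * f + z * i) * z'.
Proof. by rewrite /bform mul_rv3 !mxE sum_ord3 !mxE. Qed.

Lemma qform_rv3 a b c d e f g h i x y z :
  qform (mx3 a b c d e f g h i) (rv3 x y z) =
  (x * a + y * d + z * g) * x + (x * b + y * e + z * h) * y +
  (x * c + y * f + z * i) * z.
Proof. exact: bform_rv3. Qed.

Lemma row0E (A : 'M[R]_3) : row o0 A = rv3 1 0 0 *m A.
Proof. by rewrite rowE; congr (_ *m A); apply/rowP; apply: I3P; rewrite !mxE. Qed.

Lemma fix_e0P (W : 'M[R]_3) : rv3 1 0 0 *m W = rv3 1 0 0 ->
  exists x i j z k l, W = mx3 1 0 0 x i j z k l.
Proof.
rewrite -row0E => /rowP fixW; exists (W o1 o0), (W o1 o1), (W o1 o2), (W o2 o0), (W o2 o1),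
  (W o2 o2).
have := (fixW o0, fixW o1, fixW o2); rewrite !mxE /= => -[[E0 E1] E2].
by rewrite [LHS]mx3E E0 E1 E2.
Qed.

End Mx3Ring.

Lemma diag3E a b c : diag3 a b c = mx3 a 0 0 0 b 0 0 0 c.
Proof. by apply/matrixP; apply: I3P; apply: I3P; rewrite !mxE. Qed.

Lemma A_perpE c : A_perp c = mx3 2 1 0 1 2 0 0 0 c.
Proof.
apply/matrixP; apply: I3P; apply: I3P; rewrite /A_perp /block_mx /col_mx /row_mx !mxE;
  by case: splitP => -[[|[|//]] ?] //= ; rewrite !mxE; case: splitP => -[[|[|//]] ?] //=;
    rewrite !mxE.
Qed.

Definition smx3 (R : Type) (a b c d e f : R) : 'M[R]_3 := mx3 a d e d b f e f c.

Lemma smx3P (R : Type) (G : 'M[R]_3) :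
  G^T = G -> exists a b c d e f, G = smx3 a b c d e f.
Proof.
have [a [b [c [d [e [f [g [h [i ->]]]]]]]]] := mx3P G.
rewrite tr_mx3 => E; have [[_ Eb Ec] [[_ _ Ef] _]] := mx3_inj E.
by exists a, e, i, b, c, f; rewrite /smx3 -Eb -Ec -Ef.
Qed.

Tactic Notation "isometry3" uconstr(U) := refine (ex_intro2 _ _ U _ _);
  [by rewrite unitmxE det_mx3; first [rewrite (_ : _ + _ = 1) ?unitr1 //;
    ring | rewrite (_ : _ + _ = -1) ?unitrN1 //; ring]
  |by rewrite tr_mx3 !mul_mx3; congr mx3; ring].

(** * Forms and isometries *)

Lemma unitmxN (R : comUnitRingType) n (U : 'M[R]_n) : (- U \in unitmx) = (U \in unitmx).
Proof. by rewrite !unitmxE -scaleN1r detZ unitrMr ?unitrX ?unitrN1. Qed.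

Lemma mulmx_detI (R : idomainType) m n (A : 'M[R]_n) (X Y : 'M[R]_(m, n)) :
  \det A != 0 -> X *m A = Y *m A -> X = Y.
Proof.
move=> dA /(congr1 (mulmx^~ (\adj A))); rewrite -!mulmxA mul_mx_adj !mul_mx_scalar.
exact: scalemx_inj.
Qed.

Section FormTheory.
Variable n : nat.

Section Ring.
Variable R : comNzRingType.
Implicit Types (G U : 'M[R]_n) (x y z : 'rV[R]_n).

Lemma bformDl G x y z : bform G (x + y) z = bform G x z + bform G y z.
Proof. by rewrite /bform !mulmxDl mxE. Qed.
Lemma bformDr G x y z : bform G x (y + z) = bform G x y + bform G x z.
Proof. by rewrite /bform linearD /= mulmxDr mxE. Qed.
Lemma bformZl G k x y : bform G (k *: x) y = k * bform G x y.
Proof. by rewrite /bform -!scalemxAl mxE. Qed.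
Lemma bformZr G k x y : bform G x (k *: y) = k * bform G x y.
Proof. by rewrite /bform linearZ /= -scalemxAr mxE. Qed.
Lemma bformNl G x y : bform G (- x) y = - bform G x y.
Proof. by rewrite -scaleN1r bformZl mulN1r. Qed.
Lemma bformNr G x y : bform G x (- y) = - bform G x y.
Proof. by rewrite -scaleN1r bformZr mulN1r. Qed.
Lemma bform0l G y : bform G 0 y = 0.
Proof. by rewrite /bform !mul0mx mxE. Qed.
Lemma bform0r G y : bform G y 0 = 0.
Proof. by rewrite /bform trmx0 mulmx0 mxE. Qed.
Lemma qform0 G : qform G 0 = 0. Proof. exact: bform0l. Qed.

Lemma bformC G x y : G^T = G -> bform G x y = bform G y x.
Proof.
move=> sG; rewrite /bform -[in LHS](trmxK (x *m G *m y^T)).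
by rewrite mxE !trmx_mul trmxK sG mulmxA.
Qed.

Lemma qformD G x y : G^T = G ->
  qform G (x + y) = qform G x + 2 * bform G x y + qform G y.
Proof.
move=> sG; rewrite /qform !bformDl !bformDr [bform G y x]bformC //; ring.
Qed.

Lemma qformZ G k x : qform G (k *: x) = k ^+ 2 * qform G x.
Proof. by rewrite /qform bformZl bformZr mulrA. Qed.

Lemma qformN G x : qform G (- x) = qform G x.
Proof. by rewrite /qform bformNl bformNr opprK. Qed.

Lemma bform_conj G U x y : bform (U *m G *m U^T) x y = bform G (x *m U) (y *m U).
Proof. by rewrite /bform trmx_mul !mulmxA. Qed.

Lemma qform_conj G U x : qform (U *m G *m U^T) x = qform G (x *m U).
Proof. exact: bform_conj. Qed.

Lemma bform_scale k G x y : bform (k *: G) x y = k * bform G x y.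
Proof. by rewrite /bform -scalemxAr -scalemxAl mxE. Qed.

Lemma qform_scale k G x : qform (k *: G) x = k * qform G x.
Proof. exact: bform_scale. Qed.

Lemma bform_delta G i j : bform G (delta_mx 0 i) (delta_mx 0 j) = G i j.
Proof. by rewrite /bform -rowE trmx_delta -colE !mxE. Qed.

End Ring.

Lemma map_bform (R S : comNzRingType) (k : {rmorphism R -> S}) (G : 'M[R]_n) x y :
  bform (map_mx k G) (map_mx k x) (map_mx k y) = k (bform G x y).
Proof. by rewrite /bform map_trmx -!map_mxM mxE. Qed.

Lemma isometric_refl (R : comUnitRingType) (G : 'M[R]_n) : isometric G G.
Proof. by exists 1%:M; rewrite ?unitmx1 // trmx1 mul1mx mulmx1. Qed.

Lemma isometric_sym (R : comUnitRingType) (G H : 'M[R]_n) :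
  isometric G H -> isometric H G.
Proof.
move=> [U uU <-]; exists (invmx U); first by rewrite unitmx_inv.
rewrite !mulmxA mulVmx // mul1mx trmx_inv -mulmxA mulmxV ?unitmx_tr //.
by rewrite mulmx1.
Qed.

Lemma isometric_trans (R : comUnitRingType) (G H K : 'M[R]_n) :
  isometric G H -> isometric H K -> isometric G K.
Proof.
move=> [U uU <-] [V uV <-]; exists (V *m U); first by rewrite unitmx_mul uV.
by rewrite trmx_mul !mulmxA.
Qed.

Lemma congr_mx_sym (R : comNzRingType) (G U : 'M[R]_n) :
  G^T = G -> (U *m G *m U^T)^T = U *m G *m U^T.
Proof. by move=> sG; rewrite !trmx_mul trmxK sG mulmxA. Qed.

Lemma isometric_sym_mx (R : comUnitRingType) (G H : 'M[R]_n) :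
  isometric G H -> G^T = G -> H^T = H.
Proof. by move=> [U _ <-]; exact: congr_mx_sym. Qed.

Lemma isometric_det (R : comUnitRingType) (G H : 'M[R]_n) :
  isometric G H -> exists2 u, u \is a GRing.unit & \det H = u ^+ 2 * \det G.
Proof.
move=> [U uU <-]; exists (\det U) => //.
by rewrite !det_mulmx det_tr; ring.
Qed.

Lemma ext_inj : injective (@ext n rat).
Proof.
move=> A B /matrixP E; apply/matrixP => i j.
by have := E i j; rewrite !mxE => /intr_inj.
Qed.

Lemma det_ext (R : comNzRingType) (G : 'M[int]_n) : \det (ext R G) = (\det G)%:~R.
Proof. exact: det_map_mx. Qed.

Lemma tr_ext (R : comNzRingType) (G : 'M[int]_n) : (ext R G)^T = ext R G^T.
Proof. by rewrite /ext map_trmx. Qed.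

Lemma ext_mul (R : comNzRingType) (A B : 'M[int]_n) : ext R (A *m B) = ext R A *m ext R B.
Proof. exact: map_mxM. Qed.

Lemma ext_scale (R : comNzRingType) (k : int) (A : 'M[int]_n) : ext R (k *: A) = k%:~R *: ext R A.
Proof. by apply/matrixP => i j; rewrite !mxE rmorphM. Qed.

Lemma ext_int (A : 'M[int]_n) : ext int A = A.
Proof. by apply/matrixP => i j; rewrite mxE intz. Qed.

Lemma ext1 (R : comNzRingType) : ext R (1%:M : 'M[int]_n) = 1%:M.
Proof. exact: map_mx1. Qed.

Lemma unitmx_ext (S : comUnitRingType) (U : 'M[int]_n) : U \in unitmx -> ext S U \in unitmx.
Proof. by move=> uU; rewrite unitmxE det_ext rmorph_unit // -unitmxE. Qed.

Lemma isometric_ext (S : comUnitRingType) (G H : 'M[int]_n) :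
  isometric G H -> isometric (ext S G) (ext S H).
Proof.
by move=> [U uU <-]; exists (ext S U); rewrite ?unitmx_ext // tr_ext !ext_mul.
Qed.

Lemma qform_ext (R : comNzRingType) (G : 'M[int]_n) (x : 'rV[int]_n) :
  qform (ext R G) (map_mx intr x) = (qform G x)%:~R.
Proof. exact: map_bform. Qed.

Lemma isometric_even (G H : 'M[int]_n) : isometric G H -> even_lattice G -> even_lattice H.
Proof. by move=> [U _ <-] ev x; rewrite qform_conj. Qed.

End FormTheory.

Lemma ext_mx3 (R : comNzRingType) (a b c d e f g h i : int) :
  ext R (mx3 a b c d e f g h i) =
  mx3 a%:~R b%:~R c%:~R d%:~R e%:~R f%:~R g%:~R h%:~R i%:~R.
Proof. exact: map_mx3. Qed.

Lemma ext_smx3 (R : comNzRingType) (a b c d e f : int) :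
  ext R (smx3 a b c d e f) = smx3 a%:~R b%:~R c%:~R d%:~R e%:~R f%:~R.
Proof. exact: ext_mx3. Qed.

Lemma evenE (k : int) : (2 %| k)%Z -> exists k', k = 2 * k'.
Proof. by case/dvdzP => k' ->; exists k'; rewrite mulrC. Qed.

Lemma oddE (k : int) : ~~ (2 %| k)%Z -> exists k', k = 2 * k' + 1.
Proof. by move=> h; exists (k %/ 2)%Z; clear -h; lia. Qed.

Lemma dvd2M (a b : int) : (2 %| a * b)%Z = (2 %| a)%Z || (2 %| b)%Z.
Proof. by rewrite !dvdzE abszM Euclid_dvdM. Qed.

Lemma sq_mod4 (k : int) : exists z, k ^+ 2 = 4 * z + (k %% 2)%Z.
Proof.
exists ((k %/ 2)%Z * (k %/ 2)%Z + (k %/ 2)%Z * (k %% 2)%Z).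
by have := divz_eq k 2; have : (k %% 2)%Z = 0 \/ (k %% 2)%Z = 1 by [lia|]; move=> [] -> {1}->; ring.
Qed.

Lemma sq_mod8 (k : int) : ~~ (2 %| k)%Z -> exists t, k ^+ 2 = 8 * t + 1.
Proof.
case/oddE => c ->; have [t Et] : exists t, c * (c + 1) = 2 * t.
  by apply: evenE; rewrite dvd2M; clear; lia.
by exists t; transitivity (4 * (c * (c + 1)) + 1); [ring|rewrite Et; ring].
Qed.

Lemma odd_dvdz_pmull (n m : nat) (x : int) : odd n -> (n%:Z %| (2 ^ m)%N%:Z * x)%Z = (n%:Z %| x)%Z.
Proof. by move=> on; rewrite Gauss_dvdzr // coprimezE !absz_nat coprimeXr // coprimen2. Qed.

Lemma dvdz_pow2_odd (m : nat) (o x : int) : ~~ (2 %| o)%Z ->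
  ((2 ^ m)%N%:Z %| o * x)%Z = ((2 ^ m)%N%:Z %| x)%Z.
Proof.
by move=> odd_o; rewrite Gauss_dvdzr // coprimezE coprimeXl // coprime2n; clear -odd_o; lia.
Qed.

Lemma even_smx3P a b c d e f :
  even_lattice (smx3 a b c d e f) <-> [/\ (2 %| a)%Z, (2 %| b)%Z & (2 %| c)%Z].
Proof.
split=> [ev|[/evenE[a' ->] /evenE[b' ->] /evenE[c' ->]] x].
  by split; [have := ev (rv3 1 0 0)|have := ev (rv3 0 1 0)|have := ev (rv3 0 0 1)];
    rewrite qform_rv3 !(mul0r, mul1r, mulr0, mulr1, addr0, add0r).
have [x1 [x2 [x3 ->]]] := rv3P x; rewrite qform_rv3; apply/dvdzP.
exists (a' * x1 ^+ 2 + b' * x2 ^+ 2 + c' * x3 ^+ 2 + (d * x1 * x2 + e * x1 * x3 + f * x2 * x3)).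
by ring.
Qed.

Lemma intr_unit (u : int) : u \is a GRing.unit -> u ^+ 2 = 1.
Proof. by rewrite qualifE /= => /pred2P[] ->. Qed.

Lemma isometric_det_int n (G H : 'M[int]_n) : isometric G H -> \det G = \det H.
Proof. by case/isometric_det => _ /intr_unit -> ->; rewrite mul1r. Qed.

Lemma smith3 (M : 'M[int]_3) : exists L R : 'M[int]_3, exists a b c : int,
  [/\ L \in unitmx, R \in unitmx, (a %| b)%Z, (b %| c)%Z
    & M = L *m mx3 a 0 0 0 b 0 0 0 c *m R].
Proof.
have [L uL [R uR [d sd ->]]] := int_Smith_normal_form M.
exists L, R, d`_0, d`_1, d`_2; split => //.
- case: d sd => [|x [|y s]] //=; rewrite ?dvdz0 //.
  by case/andP.
- case: d sd => [|x [|y [|z s]]] //=; rewrite ?dvdz0 //.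
  by case/and3P.
- congr (_ *m _ *m _); apply/matrixP; apply: I3P; apply: I3P; rewrite !mxE //=.
Qed.

Lemma unit_mx3P (U : 'M[int]_3) : (U \in unitmx) = (\det U == 1) || (\det U == -1).
Proof. by rewrite unitmxE qualifE /=; case: eqP => // ->. Qed.

Definition primitive_vec (v : 'rV[int]_3) := exists2 U : 'M[int]_3, U \in unitmx & v = row o0 U.

Lemma primitive_vec_multiple (v : 'rV[int]_3) : exists w k, primitive_vec w /\ v = k *: w.
Proof.
have [L _ [R uR [d _ Ev]]] := int_Smith_normal_form v.
exists (row o0 R), (L 0 0 * d`_0); split; first by exists R.
rewrite row0E scalemxAl [LHS]Ev; congr (_ *m R).
apply/rowP => i; rewrite !mxE big_ord1 !mxE; move: i.
by apply: I3P; rewrite /= ?mulr1n ?mulr0n ?mulr1 ?mulr0.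
Qed.

Lemma primitive_vecN v : primitive_vec v -> primitive_vec (- v).
Proof. by move=> [U uU ->]; exists (- U); rewrite ?unitmxN // linearN. Qed.

Lemma primitive_vec_neq0 v : primitive_vec v -> v != 0.
Proof.
move=> [U uU ->]; rewrite row0E; apply/eqP => /(canRL (mulmxK uU)); rewrite mul0mx => /rowP/(_ o0).
by rewrite !mxE.
Qed.

Lemma primitive_vec_dvd v w k l : primitive_vec v -> k *: v = l *: w -> l != 0 ->
  exists j, k = l * j /\ w = j *: v.
Proof.
move=> [U uU vU] E l0; have /(congr1 (fun x => (x *m invmx U) 0 o0)) := E.
rewrite vU rowE -!scalemxAl mulmxK // !mxE eqxx mulr1.
set j := \sum_ _ _; move=> Ek; exists j; split=> //.
by apply: (scalemx_inj l0); rewrite /= scalerA -Ek -rowE -vU.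
Qed.

Lemma primitive_vec_collinear v w k l : primitive_vec v -> primitive_vec w ->
  k *: v = l *: w -> l != 0 -> w = v \/ w = - v.
Proof.
move=> pv pw E l0; have [j [_ Ew]] := primitive_vec_dvd pv E l0.
have j0 : j != 0 by apply: contraTneq (primitive_vec_neq0 pw) => j0; rewrite negbK Ew j0 scale0r.
have E1 : 1 *: w = j *: v by rewrite scale1r.
have [i [ji _]] := primitive_vec_dvd pw E1 j0.
have : j \is a GRing.unit by apply/unitrP; exists i; rewrite [i * j]mulrC -ji.
by rewrite qualifE /= Ew => /pred2P[] ->; [left; rewrite scale1r|right; rewrite scaleN1r].
Qed.

(** * Arithmetic of the p-adic integers *)

Section Padic.
Variable q : nat.
Hypothesis pq : prime q.
Local Notation Zq := (padic_int q).
Implicit Types x y z u w : Zq.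

Let baseE : padic_base q = q. Proof. by rewrite /padic_base pq. Qed.

Definition qpow k : int := (q ^ k)%N%:Z.

Lemma qpowE k : (padic_base q ^ k)%N%:Z = qpow k.
Proof. by rewrite baseE. Qed.

Lemma qpowS k : qpow k.+1 = q%:Z * qpow k.
Proof. by rewrite /qpow expnS PoszM. Qed.

Lemma qpow1 : qpow 1 = q%:Z. Proof. by rewrite /qpow expn1. Qed.

Lemma padicDE x y k : (x + y) k = ((x k + y k) %% qpow k)%Z.
Proof. by rewrite -qpowE. Qed.
Lemma padicME x y k : (x * y) k = ((x k * y k) %% qpow k)%Z.
Proof. by rewrite -qpowE. Qed.
Lemma padicNE x k : (- x) k = ((- x k) %% qpow k)%Z.
Proof. by rewrite -qpowE. Qed.
Lemma padic0E k : (0 : Zq) k = 0.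
Proof. by rewrite [LHS](mod0z _). Qed.
Lemma padic_modE x k : (x k %% qpow k)%Z = x k.
Proof. by rewrite -qpowE padic_resE. Qed.
Lemma padic_stepE x k : (x k.+1 %% qpow k)%Z = x k.
Proof. by rewrite -qpowE -padic_resP. Qed.

Lemma intr_padic (n : int) : n%:~R = padic_cst q n.
Proof.
have DE a b : padic_cst q (a + b) = padic_cst q a + padic_cst q b.
  by apply: padic_ext => k; rewrite padicDE /= qpowE modzDm.
have NE a : padic_cst q (- a) = - padic_cst q a.
  by apply: padic_ext => k; rewrite padicNE /= qpowE modzNm.
have nE (a : nat) : (a%:Z)%:~R = padic_cst q a.
  elim: a => [|a IH]; first by apply: padic_ext => k; rewrite [LHS]padic0E [RHS]mod0z.
  by rewrite -addn1 PoszD rmorphD /= IH DE.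
by case: (intP n) => [|a|a]; rewrite ?rmorphN /= ?nE ?NE.
Qed.

Lemma intr_padicE (n : int) k : (n%:~R : Zq) k = (n %% qpow k)%Z.
Proof. by rewrite intr_padic /= qpowE. Qed.

Lemma natr_padicE (n : nat) k : (n%:R : Zq) k = (n%:Z %% qpow k)%Z.
Proof. by rewrite -intr_padicE. Qed.

Lemma padic0res x : x 0%N = 0.
Proof. by rewrite -padic_modE /qpow expn0 modz1. Qed.

Lemma intr_padic_eq0 (n : int) : (n%:~R == 0 :> Zq) = (n == 0).
Proof.
apply/eqP/eqP => [E|->] //.
have /(congr1 (fun x : Zq => x `|n|%N)) := E.
rewrite intr_padicE padic0E => /dvdz_mod0P; rewrite dvdzE absz_nat.
have := ltn_expl `|n| (prime_gt1 pq).
by case: (posnP `|n|) => [/eqP|n0 lt /(dvdn_leq n0)]; [rewrite absz_eq0 => /eqP|lia].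
Qed.

Definition pi_dvd x : bool := x 1%N == 0.
Local Notation "'pi" := (q%:R : Zq).

Lemma pi_dvdP x : reflect (exists y, x = 'pi * y) (pi_dvd x).
Proof.
apply: (iffP eqP) => [x1|[y ->]]; last first.
  by rewrite padicME natr_padicE qpow1 modzz mul0r mod0z.
have dv k : (q %| x k.+1)%Z.
  apply/dvdz_mod0P; elim: k => [|k IH]; first by rewrite x1 mod0z.
  by rewrite -IH -[x k.+1]padic_stepE modz_dvdm // qpowS dvdz_mulr.
have fP k : ((x k.+2 %/ q)%Z = (x k.+1 %/ q)%Z %[mod (padic_base q ^ k)%N%:Z])%Z.
  rewrite qpowE; apply/eqP; rewrite eqz_mod_dvd.
  have: (qpow k.+1 %| x k.+2 - x k.+1)%Z.
    by rewrite -eqz_mod_dvd padic_stepE padic_modE.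
  rewrite -{1}(divzK (dv k.+1)) -{1}(divzK (dv k)) -mulrBl qpowS mulrC.
  by rewrite dvdz_mul2l // eqz_nat -lt0n prime_gt0.
exists (padic_of fP); apply: padic_ext => k.
rewrite padicME natr_padicE /= qpowE modzMml modzMmr mulrC divzK //.
by rewrite padic_stepE.
Qed.

Lemma padic_unitE x : (x \is a GRing.unit) = ~~ pi_dvd x.
Proof.
apply/idP/idP => [/unitrP[y [yx _]]|x1].
  apply/pi_dvdP => -[z xz]; move: yx; rewrite xz => /(congr1 (fun t : Zq => t 1%N)).
  rewrite mulrCA padicME natr_padicE qpow1 modzz mul0r mod0z.
  rewrite (_ : 1 = (1%:~R : Zq)) // intr_padicE qpow1 modz_small //.
  by rewrite /= ltz_nat prime_gt1.
have cop k : coprimez (x k) (qpow k).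
  rewrite coprimezE absz_nat; case: k => [|k]; first by rewrite expn0 coprimen1.
  rewrite coprimeXr // coprime_sym prime_coprime //.
  apply: contra x1; rewrite /pi_dvd => d.
  have: (q %| x 1%N)%Z.
    elim: k d => // k IH d; apply: IH; rewrite -[x k.+1]padic_stepE.
    have d' : (q %| x k.+2)%Z by [].
    suff : (q %| x k.+2 %% qpow k.+1)%Z by [].
    move: d'; rewrite {1}(divz_eq (x k.+2) (qpow k.+1)) rpredDl //.
    by rewrite qpowS mulrCA; apply: dvdz_mulr.
  by move=> /dvdz_mod0P; rewrite -qpow1 padic_modE => ->.
pose f k := (egcdz (x k) (qpow k)).1.
have fx k : (f k * x k = 1 %[mod qpow k])%Z.
  rewrite /f; case: egcdzP => u v E _ /=.
  have /eqP g1 := cop k; rewrite g1 in E.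
  by rewrite -E addrC modzMDl.
have fP k : (f k.+1 = f k %[mod (padic_base q ^ k)%N%:Z])%Z.
  rewrite qpowE; apply/eqP; rewrite eqz_mod_dvd.
  rewrite -(Gauss_dvdzl _ (p := x k)); last by rewrite coprimez_sym.
  rewrite mulrBl -eqz_mod_dvd fx -[x k]padic_stepE modzMmr.
  apply/eqP; have /eqP := fx k.+1; rewrite eqz_mod_dvd => d.
  apply/eqP; rewrite eqz_mod_dvd; apply: dvdz_trans d.
  by rewrite qpowS dvdz_mull.
apply/unitrP; exists (padic_of fP); rewrite mulrC; split.
  apply: padic_ext => k; rewrite padicME /= qpowE modzMmr mulrC fx.
  by rewrite -intr_padicE.
apply: padic_ext => k; rewrite padicME /= qpowE modzMmr mulrC fx.
by rewrite -intr_padicE.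
Qed.

Lemma pi_dvdD x y : pi_dvd x -> pi_dvd y -> pi_dvd (x + y).
Proof.
by move=> /pi_dvdP[a ->] /pi_dvdP[b ->]; apply/pi_dvdP; exists (a + b); rewrite mulrDr.
Qed.

Lemma pi_dvd_mulr x y : pi_dvd x -> pi_dvd (x * y).
Proof. by move=> /pi_dvdP[a ->]; apply/pi_dvdP; exists (a * y); rewrite mulrA. Qed.

Lemma pi_dvd_mull x y : pi_dvd x -> pi_dvd (y * x).
Proof. by rewrite mulrC; apply: pi_dvd_mulr. Qed.

Lemma pi_dvdN x : pi_dvd (- x) = pi_dvd x.
Proof.
by apply/pi_dvdP/pi_dvdP => -[y E]; exists (- y); rewrite ?mulrN -E ?opprK.
Qed.

Lemma pi_dvd_int (n : int) : pi_dvd (n%:~R) = (q %| n)%Z.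
Proof. by rewrite /pi_dvd intr_padicE qpow1; apply/eqP/idP => /dvdz_mod0P. Qed.

Lemma padic_unit_int (n : int) : ((n%:~R : Zq) \is a GRing.unit) = ~~ (q %| n)%Z.
Proof. by rewrite padic_unitE pi_dvd_int. Qed.

Lemma pi_neq0 : 'pi != 0.
Proof. by rewrite -[q%:R]/((q%:Z)%:~R) intr_padic_eq0 eqz_nat -lt0n prime_gt0. Qed.

Lemma padic_unitD x y : x \is a GRing.unit -> pi_dvd y -> x + y \is a GRing.unit.
Proof.
rewrite !padic_unitE => x1 dy; apply: contra x1 => d.
by rewrite -[x](addrK y); apply: pi_dvdD => //; rewrite pi_dvdN.
Qed.

Lemma padic_unit2 : q != 2 -> (2 : Zq) \is a GRing.unit.
Proof.
move=> q2; rewrite (_ : 2 = (2%:~R : Zq)) // padic_unit_int.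
by apply/negP => d; have : (q %| 2)%N by []; rewrite dvdn_prime2 // (negPf q2).
Qed.

Lemma pi_expE k : 'pi ^+ k = (qpow k)%:~R.
Proof. by rewrite /qpow -natrX. Qed.

Lemma pi_exp_mul_res k y : ('pi ^+ k * y) k = 0.
Proof. by rewrite pi_expE padicME intr_padicE modzz mul0r mod0z. Qed.

Lemma padic_limit (s : nat -> Zq) : (forall k, s k.+1 k = s k k) ->
  exists x : Zq, forall k, x k = s k k.
Proof.
move=> sS; have fP k : (s k.+1 k.+1 = s k k %[mod (padic_base q ^ k)%N%:Z])%Z.
  by rewrite qpowE padic_stepE sS padic_modE.
by exists (padic_of fP) => k; rewrite /= qpowE padic_modE.
Qed.

Lemma hensel a b c : b \is a GRing.unit -> pi_dvd c ->
  exists2 x, pi_dvd x & a * x ^+ 2 + b * x + c = 0.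
Proof.
move=> ub dc; pose f x := a * x ^+ 2 + b * x + c.
pose s := fix s k := if k is k'.+1 then s k' - f (s k') / b else 0.
have newton k : f (s k.+1) = f (s k) * (a * f (s k) / b / b - 2 * a * s k / b).
  rewrite /=; set F := f (s k); rewrite /f.
  have -> : c = F - a * s k ^+ 2 - b * s k by rewrite /F /f; ring.
  transitivity (F * (a * F / b / b - 2 * a * s k / b) + F * (1 - b / b)); first by ring.
  by rewrite divrr // subrr mulr0 addr0.
have sP k : pi_dvd (s k) /\ exists y, f (s k) = 'pi ^+ k.+1 * y.
  elim: k => [|k [d [y E]]].
    split; first exact/pi_dvdP/(ex_intro _ 0)/esym/mulr0.
    by have /pi_dvdP[y E] := dc; exists y; rewrite /f /= E; ring.
  split.
    apply: pi_dvdD => //; rewrite pi_dvdN E exprS; apply/pi_dvdP.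
    by exists ('pi ^+ k * y / b); ring.
  have /pi_dvdP[z sz] := d.
  exists (y * (a * ('pi ^+ k * y) / b / b - 2 * a * z / b)).
  by rewrite newton E sz [_ ^+ k.+2]exprS [_ ^+ k.+1]exprS; ring.
have [k|x xk] := @padic_limit s.
  have [_ [y E]] := sP k; rewrite (_ : s k.+1 = s k - f (s k) / b) // padicDE padicNE E.
  by rewrite exprSr -!mulrA pi_exp_mul_res oppr0 mod0z addr0 padic_modE.
exists x.
  rewrite /pi_dvd xk; have [/pi_dvdP[y E] _] := sP 1%N.
  by rewrite E -{1}['pi]expr1 pi_exp_mul_res.
apply: padic_ext => k; rewrite padic0E.
have -> : (a * x ^+ 2 + b * x + c) k = f (s k) k.
  by rewrite /f !expr2 !(padicDE, padicME) xk.
by have [_ [y ->]] := sP k; rewrite exprSr -mulrA pi_exp_mul_res.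
Qed.

Lemma padic_primitive3 x y z : ~~ [&& x == 0, y == 0 & z == 0] ->
  exists j x' y' z', [/\ x = 'pi ^+ j * x', y = 'pi ^+ j * y', z = 'pi ^+ j * z'
    & [|| x' \is a GRing.unit, y' \is a GRing.unit | z' \is a GRing.unit]].
Proof.
move=> nz.
have [k Hk] : exists k, [|| x k != 0, y k != 0 | z k != 0].
  apply: contra_notP (negP nz) => /forallNP H; apply/and3P.
  by split; apply/eqP/padic_ext => k; rewrite padic0E; apply/eqP; have /negP := H k;
    rewrite !negb_or !negbK => /and3P[].
elim: k x y z Hk {nz} => [|k IH] x y z; first by rewrite !padic0res eqxx.
move=> H; case: (boolP [&& pi_dvd x, pi_dvd y & pi_dvd z]) => [|u]; last first.
  exists 0%N, x, y, z; rewrite expr0 !mul1r; split=> //.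
  by move: u; rewrite !negb_and -!padic_unitE.
move=> /and3P[/pi_dvdP[x1 E1] /pi_dvdP[y1 E2] /pi_dvdP[z1 E3]].
have nzk t : ('pi * t) k.+1 != 0 -> t k != 0.
  apply: contra => /eqP tk; apply/eqP.
  rewrite padicME natr_padicE modzMml.
  have /dvdz_mod0P/dvdzP[c Ec] : (t k.+1 %% qpow k)%Z = 0 by rewrite padic_stepE.
  by rewrite Ec mulrCA -qpowS modzMl.
have [|j [x2 [y2 [z2 [F1 F2 F3 u]]]]] := IH x1 y1 z1.
  by move: H; rewrite E1 E2 E3; case/or3P => /nzk ->; rewrite ?orbT.
by exists j.+1, x2, y2, z2; rewrite E1 E2 E3 F1 F2 F3 exprS !mulrA.
Qed.

Lemma intr_dvd_padic k (n : int) y : n%:~R = 'pi ^+ k * y -> (qpow k %| n)%Z.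
Proof.
by move=> /(congr1 (fun t : Zq => t k)); rewrite intr_padicE pi_exp_mul_res => /dvdz_mod0P.
Qed.

End Padic.

Lemma unit_square8 (u w : padic_int 2) : u \is a GRing.unit ->
  exists2 s, s \is a GRing.unit & u + 8 * w = u * s ^+ 2.
Proof.
move=> uu; have p2 : prime 2 by [].
have [||t _ E] := @hensel 2 p2 1 1 (- (2 * w / u)); first by rewrite unitr1.
  by rewrite pi_dvdN //; apply/(pi_dvdP p2); exists (w / u); rewrite mulrA.
exists (1 + 2 * t).
  by apply: padic_unitD => //; rewrite ?unitr1 //; apply/(pi_dvdP p2); exists t.
have -> : (1 + 2 * t) ^+ 2 = 1 + 4 * (1 * t ^+ 2 + 1 * t + - (2 * w / u)) + 8 * w / u by ring.
rewrite E; transitivity (u + 8 * w * (u / u)); last by ring.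
by rewrite divrr // mulr1.
Qed.

Lemma int_square8 (a b : int) : ~~ (2 %| a)%Z -> (8 %| b - a)%Z ->
  exists2 s : padic_int 2, s \is a GRing.unit & b%:~R = a%:~R * s ^+ 2.
Proof.
move=> oa /dvdzP[k Ek]; have [|s us Es] := @unit_square8 a%:~R k%:~R.
  by rewrite padic_unit_int.
by exists s => //; rewrite -Es -[b](subrK a) Ek rmorphD rmorphM /= addrC mulrC.
Qed.

(** * Ternary lattices over the p-adic integers *)

Section Local.
Variable q : nat.
Hypothesis pq : prime q.
Local Notation Zq := (padic_int q).
Local Notation "'pi" := (q%:R : Zq).
Implicit Types (G H U : 'M[Zq]_3) (a b c d e f x y z u : Zq).

Definition isotropic n (G : 'M[Zq]_n) := exists2 x : 'rV[Zq]_n, x != 0 & qform G x = 0.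
Definition sqfree_at (d : Zq) := ~ exists z : Zq, d = 'pi ^+ 2 * z.
Definition padic_even n (G : 'M[Zq]_n) := forall x : 'rV[Zq]_n, exists w : Zq, qform G x = 2 * w.

Lemma rv3_neq0 x y z : (rv3 x y z != 0) = ~~ [&& x == 0, y == 0 & z == 0].
Proof.
congr negb; apply/eqP/and3P => [|[/eqP-> /eqP-> /eqP->]]; last exact: rv3_0.
by rewrite -rv3_0 => E; have [-> -> ->] := rv3_inj E.
Qed.

Lemma isometric_isotropic G H : isometric G H -> isotropic H -> isotropic G.
Proof.
move=> [U uU <-] [x x0]; rewrite qform_conj => E; exists (x *m U) => //.
by apply: contra x0 => /eqP xU; rewrite -(mulmxK uU x) xU mul0mx.
Qed.

Lemma isometric_padic_even G H : isometric G H -> padic_even G -> padic_even H.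
Proof. by move=> [U _ <-] ev x; rewrite qform_conj. Qed.

Lemma isometric_sqfree G H : isometric G H -> sqfree_at (\det G) -> sqfree_at (\det H).
Proof.
move=> /isometric_sym/isometric_det[u _ E] sG [z Ez]; apply: sG.
by exists (u ^+ 2 * z); rewrite E Ez; ring.
Qed.

Lemma unit_padic_even G : q != 2 -> padic_even G.
Proof.
by move=> q2 x; exists (qform G x / 2); rewrite mulrCA mulrV ?mulr1 // padic_unit2.
Qed.

Lemma unit3E x y z :
  [|| x \is a GRing.unit, y \is a GRing.unit | z \is a GRing.unit] =
  ~~ [&& pi_dvd x, pi_dvd y & pi_dvd z].
Proof. by rewrite !negb_and -!padic_unitE. Qed.

Lemma complete_prim x y z :
  [|| x \is a GRing.unit, y \is a GRing.unit | z \is a GRing.unit] ->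
  exists2 U, U \in unitmx & rv3 1 0 0 *m U = rv3 x y z.
Proof.
case/or3P => u.
- exists (mx3 x y z 0 1 0 0 0 1); last by rewrite mul_rv3; congr rv3; ring.
  by rewrite unitmxE det_mx3 (_ : _ + _ = x) //; ring.
- exists (mx3 x y z 1 0 0 0 0 1); last by rewrite mul_rv3; congr rv3; ring.
  by rewrite unitmxE det_mx3 (_ : _ + _ = - y) ?unitrN //; ring.
- exists (mx3 x y z 1 0 0 0 1 0); last by rewrite mul_rv3; congr rv3; ring.
  by rewrite unitmxE det_mx3 (_ : _ + _ = z) //; ring.
Qed.

Lemma prim_first G x y z : G^T = G ->
  [|| x \is a GRing.unit, y \is a GRing.unit | z \is a GRing.unit] ->
  exists b c d e f, isometric G (smx3 (qform G (rv3 x y z)) b c d e f).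
Proof.
move=> sG /complete_prim[U uU E].
have iG : isometric G (U *m G *m U^T) by exists U.
have [a [b [c [d [e [f EG]]]]]] := smx3P (isometric_sym_mx iG sG).
exists b, c, d, e, f; rewrite -E -qform_conj EG qform_rv3.
by rewrite (_ : _ + _ = a); [rewrite -EG | ring].
Qed.

Lemma unit_value_prim G x y z : G^T = G -> qform G (rv3 x y z) \is a GRing.unit ->
  exists b c d e f, isometric G (smx3 (qform G (rv3 x y z)) b c d e f).
Proof.
move=> sG uQ; apply: prim_first => //; rewrite unit3E.
apply: contraL uQ => /and3P[dx dy dz]; rewrite padic_unitE // negbK.
have [a [b [c [d [e [f ->]]]]]] := smx3P sG; rewrite qform_rv3.
by do !apply: pi_dvdD => //; apply: pi_dvd_mull.
Qed.

Lemma iso_prim G : isotropic G -> exists x y z, qform G (rv3 x y z) = 0 /\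
  [|| x \is a GRing.unit, y \is a GRing.unit | z \is a GRing.unit].
Proof.
move=> [v]; have [x [y [z ->]]] := rv3P v; rewrite rv3_neq0.
move=> /(padic_primitive3 pq)[j [x' [y' [z' [-> -> -> u]]]]].
rewrite -scale_rv3 qformZ => /eqP; rewrite mulf_eq0 expf_eq0 /= expf_eq0.
by rewrite (negPf (pi_neq0 pq)) andbF /= => /eqP E; exists x', y', z'.
Qed.

Lemma hyp_shape G : G^T = G -> sqfree_at (\det G) -> isotropic G ->
  exists b c, isometric G (smx3 0 b c 1 0 0).
Proof.
move=> sG sq iG; have [x [y [z [Q0 u]]]] := iso_prim iG.
have [b [c [d [e [f iGG]]]]] := prim_first sG u; rewrite Q0 in iGG.
have [d' [e' [b' [c' [f' [ud iG2]]]]]] : exists d e b c f,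
    d \is a GRing.unit /\ isometric G (smx3 0 b c d e f).
  case: (boolP (d \is a GRing.unit)) => [ud|nd]; first by exists d, e, b, c, f.
  case: (boolP (e \is a GRing.unit)) => [ue|ne].
    exists e, d, c, b, f; split => //; apply: isometric_trans iGG _.
    isometry3 (mx3 1 0 0 0 0 1 0 1 0).
  case: (isometric_sqfree iGG sq).
  move: nd ne; rewrite !padic_unitE // !negbK => /(pi_dvdP pq)[d1 ->] /(pi_dvdP pq)[e1 ->].
  by eexists; rewrite det_mx3 /smx3; rewrite [RHS]mulrC;
    instantiate (1 := - (d1 * (d1 * c - f * e1) - e1 * (d1 * f - b * e1))); ring.
exists (b' / d' ^+ 2), (c' - 2 * f' * e' / d' + b' * (e' / d') ^+ 2).
apply: isometric_trans iG2 _.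
exists (mx3 1 0 0 0 d'^-1 0 (b' * e' / d' / d' - f' / d') (- e' / d') 1).
  by rewrite unitmxE det_mx3 (_ : _ + _ = d'^-1) ?unitrV //; ring.
rewrite tr_mx3 !mul_mx3; have dd := divrr ud; set w := d'^-1 in dd *.
have -> : d' ^- 2 = w ^+ 2 by rewrite /w exprVn.
by congr mx3; ring: dd.
Qed.

Lemma hyp_form G : G^T = G -> sqfree_at (\det G) -> isotropic G ->
  padic_even G \/ q = 2 /\ \det G \is a GRing.unit ->
  isometric G (smx3 0 0 (- \det G) 1 0 0).
Proof.
move=> sG sq iG ev; have [b [c iGG]] := hyp_shape sG sq iG.
suff [c' iG2] : exists c, isometric G (smx3 0 0 c 1 0 0).
  have [u uu E] := isometric_det iG2; apply: isometric_trans iG2 _.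
  exists (mx3 1 0 0 0 1 0 0 0 u^-1).
    by rewrite unitmxE det_mx3 (_ : _ + _ = u^-1) ?unitrV //; ring.
  have Ec : c' = - (u ^+ 2 * \det G) by rewrite -E det_mx3; ring.
  rewrite tr_mx3 !mul_mx3 Ec; have uu1 := divrr uu; set w := u^-1 in uu1 *.
  by congr mx3; ring: uu1.
have shift h c0 : isometric (smx3 0 (2 * h) c0 1 0 0) (smx3 0 0 c0 1 0 0).
  isometry3 (mx3 1 0 0 (- h) 1 0 0 0 1).
case: ev => [ev|[q2 ud]].
  have [h Eh] := isometric_padic_even iGG ev (rv3 0 1 0).
  exists c; apply: isometric_trans iGG _.
  have -> : b = 2 * h by rewrite -Eh qform_rv3; ring.
  exact: shift.
have pi2 : 'pi = 2 := congr1 (fun n => n%:R : Zq) q2.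
have uc : c \is a GRing.unit.
  have [u uu E] := isometric_det iGG.
  have -> : c = - (u ^+ 2 * \det G) by rewrite -E det_mx3; ring.
  by rewrite unitrN unitrMl // unitrX.
exists c; apply: isometric_trans iGG _.
case: (boolP (pi_dvd b)) => [/(pi_dvdP pq)[h ->]|ub]; first by rewrite pi2; exact: shift.
have /(pi_dvdP pq)[h Eh] : pi_dvd (b + c).
  move: uc ub (padic_modE pq b 1) (padic_modE pq c 1).
  rewrite padic_unitE // /pi_dvd padicDE // qpow1.
  by move: (b 1%N) (c 1%N) => b1 c1; rewrite q2; lia.
apply: (@isometric_trans _ _ _ (smx3 0 (b + c) c 1 0 0)); last by rewrite Eh pi2; exact: shift.
isometry3 (mx3 1 0 0 0 1 1 (- c) 0 1).
Qed.

Lemma split_unit a b c d e f : a \is a GRing.unit -> isometric (smx3 a b c d e f)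
  (mx3 a 0 0 0 (b - d ^+ 2 / a) (f - d * e / a) 0 (f - d * e / a) (c - e ^+ 2 / a)).
Proof.
move=> ua; exists (mx3 1 0 0 (- d / a) 1 0 (- e / a) 0 1).
  by rewrite unitmxE det_mx3 (_ : _ + _ = 1) ?unitr1 //; ring.
rewrite tr_mx3 !mul_mx3; have aa := divrr ua; set w := a^-1 in aa *.
by congr mx3; ring: aa.
Qed.

Lemma split_unit2 a b c f : b \is a GRing.unit ->
  isometric (mx3 a 0 0 0 b f 0 f c) (mx3 a 0 0 0 b 0 0 0 (c - f ^+ 2 / b)).
Proof.
move=> ub; exists (mx3 1 0 0 0 1 0 0 (- f / b) 1).
  by rewrite unitmxE det_mx3 (_ : _ + _ = 1) ?unitr1 //; ring.
rewrite tr_mx3 !mul_mx3; have aa := divrr ub; set w := b^-1 in aa *.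
by congr mx3; ring: aa.
Qed.

End Local.

(** ** Odd residue characteristic *)

Section FinSquares.
Variable F : finFieldType.
Hypothesis F2 : (2 : F) != 0.

Lemma card_squares : (#|F| < (#|[set x ^+ 2 | x : F]%SET|).*2)%N.
Proof.
set S := [set x ^+ 2 | x : F]%SET.
have S0 : 0 \in S by apply/imsetP; exists 0; rewrite ?expr0n.
have -> : #|F| = (\sum_(y in S) #|[set x : F | x ^+ 2 == y]%SET|)%N.
  rewrite -sum1_card (partition_big (fun x : F => x ^+ 2) (mem S)) /=; last first.
    by move=> x _; apply/imsetP; exists x.
  by apply: eq_bigr => y _; rewrite -sum1_card; apply: eq_bigl => x; rewrite !inE.
rewrite (bigD1 0) //= (cardsD1 0 S) S0 doubleD.
have -> : #|[set x : F | x ^+ 2 == 0]%SET| = 1%N.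
  by rewrite -(cards1 (0 : F)); congr #|pred_of_set _|; apply/setP => x; rewrite !inE expf_eq0.
rewrite addSn add0n !ltnS -muln2 -sum_nat_const.
rewrite (eq_bigl (mem (S :\ 0)%SET)); last by move=> y; rewrite !inE andbC.
apply: leq_sum => y; rewrite !inE => /andP[_ /imsetP[x0 _ ->]].
apply: (@leq_trans #|[set x0; - x0]%SET|); last by rewrite cards2; case: (_ != _).
by apply/subset_leq_card/fintype.subsetP => x; rewrite !inE eqf_sqr.
Qed.

Lemma squares_meet (a b c : F) : a != 0 -> b != 0 ->
  exists x y, a * x ^+ 2 + b * y ^+ 2 = c.
Proof.
move=> a0 b0; pose S := [set x ^+ 2 | x : F]%SET.
pose A := [set a * s | s in S]%SET; pose B := [set c - b * s | s in S]%SET.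
have cA : #|A| = #|S| by apply: card_imset => s t /(mulfI a0).
have cB : #|B| = #|S|.
  by apply: card_imset => s t /addrI/oppr_inj/(mulfI b0).
have : (#|(A :&: B)%SET| > 0)%N.
  have := cardsUI A B; rewrite cA cB addnn => E.
  have : (#|(A :|: B)%SET| <= #|F|)%N by apply: max_card.
  have := card_squares; rewrite -/S -E; lia.
case/card_gt0P => z; rewrite inE =>
  /andP[/imsetP[s /imsetP[x _ ->] ->] /imsetP[t /imsetP[y _ ->] E]].
by exists x, y; rewrite E subrK.
Qed.

Lemma nonsquare_mul (a b : F) : a != 0 ->
  (forall x, x ^+ 2 != a) -> (forall x, x ^+ 2 != b) -> exists x, b = a * x ^+ 2.
Proof.
move=> a0 na nb; pose S := [set x ^+ 2 | x : F]%SET.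
pose A := [set a * s | s in S]%SET.
have cA : #|A| = #|S| by apply: card_imset => s t /(mulfI a0).
have SA : (S :&: A)%SET \subset [set 0]%SET.
  apply/fintype.subsetP => z; rewrite !inE => /andP[/imsetP[x _ ->] /imsetP[s /imsetP[y _ ->] E]].
  have [y0|y0] := eqVneq y 0; first by rewrite E y0 expr0n mulr0.
  by case/eqP: (na (x / y)); rewrite expr_div_n E mulfK // expf_eq0.
have: (#|(S :|: A)%SET| == #|F|)%N.
  have := cardsUI S A; rewrite cA addnn => E.
  have : (#|(S :|: A)%SET| <= #|F|)%N by apply: max_card.
  have := subset_leq_card SA; rewrite cards1.
  have := card_squares; rewrite -/S -E; lia.
rewrite -cardsT => /eqP cST.
have /eqP SAT : (S :|: A)%SET == [set: F]%SET by rewrite eqEcard finset.subsetT cST leqnn.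
have : b \in (S :|: A)%SET by rewrite SAT inE.
rewrite inE => /orP[/imsetP[x _ E]|/imsetP[s /imsetP[x _ ->] ->]]; last by exists x.
by case/eqP: (nb x).
Qed.

End FinSquares.

Lemma intr_modz (R : nzRingType) (q : nat) (n : int) :
  q%:R = 0 :> R -> ((n %% q)%Z)%:~R = n%:~R :> R.
Proof.
move=> q0; have E : n%:~R = ((n %/ q)%Z * q)%:~R + ((n %% q)%Z)%:~R :> R.
  by rewrite -rmorphD -divz_eq.
by rewrite [RHS]E intrM -[q%:~R]/(q%:R) q0 mulr0 add0r.
Qed.

Section OddLocal.
Variable q : nat.
Hypotheses (pq : prime q) (oq : q != 2).
Local Notation Zq := (padic_int q).
Implicit Types (G H U : 'M[Zq]_3) (a b c d e f x y z u : Zq).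

Let res x : 'F_q := (x 1%N)%:~R.

Let intr_mod (n : int) : ((n %% q)%Z)%:~R = n%:~R :> 'F_q.
Proof.
by apply: intr_modz; apply/eqP; rewrite -(dvdn_pcharf (pchar_Fp pq)).
Qed.
Let resD x y : res (x + y) = res x + res y.
Proof. by rewrite /res padicDE // qpow1 intr_mod rmorphD. Qed.
Let resM x y : res (x * y) = res x * res y.
Proof. by rewrite /res padicME // qpow1 intr_mod rmorphM. Qed.
Let resN x : res (- x) = - res x.
Proof. by rewrite /res padicNE // qpow1 intr_mod rmorphN. Qed.
Let resX2 x : res (x ^+ 2) = res x ^+ 2.
Proof. by rewrite !expr2 resM. Qed.
Let res0 x : (res x == 0) = pi_dvd x.
Proof.
rewrite /pi_dvd -[x 1%N]padic_modE // qpow1 /res.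
have := modz_ge0 (x 1%N) (_ : q%:Z != 0); have := ltz_mod (x 1%N) (_ : q%:Z != 0).
have q0 : q%:Z != 0 by rewrite eqz_nat -lt0n prime_gt0.
move=> /(_ q0) lt /(_ q0); rewrite -[x 1%N]padic_modE // qpow1.
rewrite modz_mod; case: modz lt => // n lt _.
rewrite -[n%:~R]/(n%:R) -(dvdn_pcharf (pchar_Fp pq)).
apply/idP/idP => [d|/eqP[->]] //; rewrite ?dvdn0 //.
rewrite eqz_nat -leqn0 leqNgt; apply/negP => n0.
by have := dvdn_leq n0 d; move: lt; rewrite gtr0_norm ?ltz_nat ?prime_gt0 //; lia.
Qed.
Let lift (t : 'F_q) : exists x, res x = t.
Proof.
exists ((t : nat)%:R); rewrite /res natr_padicE // qpow1 intr_mod.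
by rewrite -[(_ : nat)%:~R]/((t : nat)%:R) natr_Zp.
Qed.
Let two_neq0 : (2 : 'F_q) != 0.
Proof.
rewrite -(dvdn_pcharf (pchar_Fp pq)); apply/negP.
by rewrite dvdn_prime2 // (negPf oq).
Qed.
Let unitE x : (x \is a GRing.unit) = (res x != 0).
Proof. by rewrite padic_unitE // res0. Qed.

Let unit2 : (2 : Zq) \is a GRing.unit := padic_unit2 pq oq.

Lemma square_lift x w : w \is a GRing.unit -> pi_dvd (x ^+ 2 - w) ->
  exists2 s, s \is a GRing.unit & s ^+ 2 = w.
Proof.
move=> uw dv; have ux : x \is a GRing.unit.
  move: uw; rewrite !unitE; apply: contra => /eqP x0.
  by move: dv; rewrite -res0 resD resN resX2 x0 expr0n /= add0r oppr_eq0.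
have [||t dt E] := @hensel q pq 1 (2 * x) (x ^+ 2 - w) => //.
  by rewrite unitrMl.
exists (x + t); first by apply: padic_unitD.
by rewrite -[w]addr0 -E; ring.
Qed.

Lemma odd_repr a b c : a \is a GRing.unit -> b \is a GRing.unit ->
  c \is a GRing.unit -> exists x y, a * x ^+ 2 + b * y ^+ 2 = c.
Proof.
move=> ua ub uc.
have a0 : res a != 0 by rewrite -unitE.
have b0 : res b != 0 by rewrite -unitE.
have [x0 [y0]] := squares_meet two_neq0 (res c) a0 b0.
have [x <-] := lift x0; have [y <-] := lift y0 => /eqP.
rewrite -subr_eq0 -!resX2 -!resM -!resD -resN -resD res0 => dv.
have [ux|nx] := boolP (x \is a GRing.unit).
  have [||t dt E] := @hensel q pq a (2 * a * x) (a * x ^+ 2 + b * y ^+ 2 - c) => //.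
    by rewrite !unitrMl.
  by exists (x + t), y; rewrite -[RHS]addr0 -E; ring.
have uy : y \is a GRing.unit.
  move: uc nx; rewrite !unitE negbK => c0 /eqP x00; apply: contra c0 => /eqP y00.
  move: dv; rewrite -res0 !resD !resM resN x00 y00 !mul0r !mulr0 !add0r.
  by rewrite oppr_eq0.
have [||t dt E] := @hensel q pq b (2 * b * y) (a * x ^+ 2 + b * y ^+ 2 - c) => //.
  by rewrite !unitrMl.
by exists x, (y + t); rewrite -[RHS]addr0 -E; ring.
Qed.

Lemma odd_nonsquare u v : u \is a GRing.unit -> v \is a GRing.unit ->
  (forall s, s ^+ 2 <> u) -> (forall s, s ^+ 2 <> v) ->
  exists2 s, s \is a GRing.unit & v = u * s ^+ 2.
Proof.
move=> uu uv nu nv.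
have ns w : w \is a GRing.unit -> (forall s, s ^+ 2 <> w) -> forall t, t ^+ 2 != res w.
  move=> uw nw t; have [x <-] := lift t; apply/negP => /eqP E.
  have [||s _ /nw //] := @square_lift x w => //.
  by rewrite -res0 resD resN resX2 E subrr.
have u0 : res u != 0 by rewrite -unitE.
have [t] := nonsquare_mul two_neq0 u0 (ns _ uu nu) (ns _ uv nv).
have [x <-] := lift t => E.
have [||s us Es] := @square_lift x (v / u).
- by rewrite unitrMl ?unitrV.
- have : res (u * (x ^+ 2 - v / u)) = 0.
    have -> : u * (x ^+ 2 - v / u) = u * x ^+ 2 - v * (u / u) by ring.
    by rewrite divrr // mulr1 resD resN resM resX2 E subrr.
  by rewrite resM => /eqP; rewrite mulf_eq0 -res0; move: uu; rewrite unitE => /negPf ->.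
- by exists s => //; rewrite Es mulrCA mulrV // mulr1.
Qed.

Lemma unit_value G : G^T = G -> sqfree_at (\det G) ->
  exists x y z, qform G (rv3 x y z) \is a GRing.unit.
Proof.
move=> /smx3P[a [b [c [d [e [f ->]]]]]] sq.
case: (boolP (a \is a GRing.unit)) => [ua|na].
  by exists 1, 0, 0; rewrite qform_rv3 (_ : _ + _ = a) //; ring.
case: (boolP (b \is a GRing.unit)) => [ua|nb].
  by exists 0, 1, 0; rewrite qform_rv3 (_ : _ + _ = b) //; ring.
case: (boolP (c \is a GRing.unit)) => [ua|nc].
  by exists 0, 0, 1; rewrite qform_rv3 (_ : _ + _ = c) //; ring.
move: (na) (nb) (nc); rewrite !padic_unitE // !negbK => da db dc.
case: (boolP (d \is a GRing.unit)) => [ua|nd].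
  exists 1, 1, 0; rewrite qform_rv3 (_ : _ + _ = 2 * d + (a + b)); last by ring.
  by apply: padic_unitD => //; rewrite ?unitrMl //; apply: pi_dvdD.
case: (boolP (e \is a GRing.unit)) => [ua|ne].
  exists 1, 0, 1; rewrite qform_rv3 (_ : _ + _ = 2 * e + (a + c)); last by ring.
  by apply: padic_unitD => //; rewrite ?unitrMl //; apply: pi_dvdD.
case: (boolP (f \is a GRing.unit)) => [ua|nf].
  exists 0, 1, 1; rewrite qform_rv3 (_ : _ + _ = 2 * f + (b + c)); last by ring.
  by apply: padic_unitD => //; rewrite ?unitrMl //; apply: pi_dvdD.
case: sq; move: nd ne nf; rewrite !padic_unitE // !negbK.
move=> /(pi_dvdP pq)[d1 ->] /(pi_dvdP pq)[e1 ->] /(pi_dvdP pq)[f1 ->].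
move: da => /(pi_dvdP pq)[a1 ->]; move: db => /(pi_dvdP pq)[b1 ->].
exists (a1 * (b1 * c - q%:R * f1 ^+ 2) - d1 * (d1 * c - q%:R * f1 * e1)
  + q%:R * e1 * (d1 * f1 - b1 * e1)).
by rewrite det_mx3; ring.
Qed.

Lemma odd_diag G : G^T = G -> sqfree_at (\det G) ->
  exists a b c, [/\ a \is a GRing.unit, b \is a GRing.unit
    & isometric G (mx3 a 0 0 0 b 0 0 0 c)].
Proof.
move=> sG sq; have [x [y [z uQ]]] := unit_value sG sq.
have [b [c [d [e [f]]]]] := unit_value_prim pq sG uQ; move: uQ; set a := qform _ _ => ua iG.
have [b1 [c1 [f1 iG1]]] : exists b c f, isometric G (mx3 a 0 0 0 b f 0 f c).
  by do 3 eexists; exact: isometric_trans iG (split_unit _ _ _ _ _ ua).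
suff [b2 [c2 [f2 [ub2 iG2]]]] : exists b c f,
  b \is a GRing.unit /\ isometric G (mx3 a 0 0 0 b f 0 f c).
  exists a, b2, (c2 - f2 ^+ 2 / b2); split => //.
  exact: isometric_trans iG2 (split_unit2 _ _ _ ub2).
case: (boolP (b1 \is a GRing.unit)) => [ub|nb]; first by exists b1, c1, f1.
case: (boolP (c1 \is a GRing.unit)) => [uc|nc].
  exists c1, b1, f1; split=> //; apply: isometric_trans iG1 _.
  isometry3 (mx3 1 0 0 0 0 1 0 1 0).
case: (boolP (f1 \is a GRing.unit)) => [uf|nf].
  exists (2 * f1 + (b1 + c1)), c1, (f1 + c1); split.
    apply: padic_unitD => //; rewrite ?unitrMl //.
    by move: nb nc; rewrite !padic_unitE // !negbK; apply: pi_dvdD.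
  apply: isometric_trans iG1 _; isometry3 (mx3 1 0 0 0 1 1 0 0 1).
have := isometric_sqfree iG1 sq; case.
move: nb nc nf; rewrite !padic_unitE // !negbK.
move=> /(pi_dvdP pq)[b2 ->] /(pi_dvdP pq)[c2 ->] /(pi_dvdP pq)[f2 ->].
by exists (a * (b2 * c2 - f2 ^+ 2)); rewrite det_mx3; ring.
Qed.

Lemma diag_isotropic_sq a b c s : s ^+ 2 = - (a * b) -> a \is a GRing.unit ->
  isotropic (mx3 a 0 0 0 b 0 0 0 c).
Proof.
move=> Es ua; exists (rv3 s a 0).
  by rewrite rv3_neq0; apply/and3P => -[_ /eqP a0]; rewrite a0 unitr0 in ua.
rewrite qform_rv3; transitivity (a * (s ^+ 2 + a * b)); first by ring.
by rewrite Es addNr mulr0.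
Qed.

Lemma odd_aniso_form G : G^T = G -> sqfree_at (\det G) -> ~ isotropic G ->
  exists u c, [/\ u \is a GRing.unit, forall s, s ^+ 2 <> - u
    & isometric G (mx3 1 0 0 0 u 0 0 0 c)].
Proof.
move=> sG sq nG; have [a [b [c [ua ub iG]]]] := odd_diag sG sq.
have [x [y /(canRL (addrK _)) E]] := odd_repr ua ub (unitr1 _).
have iG2 : isometric G (mx3 1 0 0 0 (a * b) 0 0 0 c).
  apply: isometric_trans iG _; exists (mx3 x y 0 (- b * y) (a * x) 0 0 0 1).
    by rewrite unitmxE det_mx3 (_ : _ + _ = 1) ?unitr1 //; ring: E.
  by rewrite tr_mx3 !mul_mx3; congr mx3; ring: E.
exists (a * b), c; split => //; first by rewrite unitrMl.
move=> s Es; apply: nG; apply: (isometric_isotropic iG2).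
by apply: (@diag_isotropic_sq _ _ _ s); rewrite ?unitr1 // mul1r.
Qed.

Lemma odd_local G H : G^T = G -> H^T = H -> \det G = \det H ->
  sqfree_at (\det G) -> (isotropic G <-> isotropic H) -> isometric G H.
Proof.
move=> sG sH dGH sq iso.
have [iG|nG] := pselect (isotropic G).
  have iH : isotropic H by apply/iso.
  have isoG := hyp_form pq sG sq iG (or_introl (unit_padic_even pq _ oq)).
  have sq' := sq; rewrite dGH in sq'.
  have isoH := hyp_form pq sH sq' iH (or_introl (unit_padic_even pq _ oq)).
  by apply: isometric_trans isoG _; rewrite dGH; apply: isometric_sym.
have nH : ~ isotropic H by move/iso.
have [u [c [uu nu iG]]] := odd_aniso_form sG sq nG.
have sq' := sq; rewrite dGH in sq'.
have [v [c' [uv nv iH]]] := odd_aniso_form sH sq' nH.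
have [||||s us] := @odd_nonsquare (- u) (- v); rewrite ?unitrN // => /eqP.
rewrite mulNr eqr_opp => /eqP Ev.
have [g ug Eg] := isometric_det iG; have [h uh Eh] := isometric_det iH.
have {Eg} Eg : u * c = g ^+ 2 * \det G by rewrite -Eg det_mx3; ring.
have {Eh} Eh : v * c' = h ^+ 2 * \det G by rewrite dGH -Eh det_mx3; ring.
have Ec : c' = c * (h / g / s) ^+ 2.
  apply: (@mulrI _ (g ^+ 2 * v)); first by rewrite unitrMl // unitrX.
  rewrite -mulrA Eh Ev; have gg := divrr ug; have ss := divrr us.
  by set g' := g^-1 in gg *; set s' := s^-1 in ss *; ring: gg ss Eg.
apply: isometric_trans iG _; apply: isometric_trans (isometric_sym iH).
exists (mx3 1 0 0 0 s 0 0 0 (h / g / s)).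
  rewrite unitmxE det_mx3 (_ : _ + _ = s * (h / g / s)); last by ring.
  by rewrite !unitrM !unitrV us ug uh.
by rewrite tr_mx3 !mul_mx3 Ev Ec; congr mx3; ring.
Qed.

End OddLocal.

(** ** The prime two *)

Section Two.
Local Notation Z2 := (padic_int 2).
Implicit Types (G H U : 'M[Z2]_3) (a b c d e f x y z u : Z2).
Let p2 : prime 2 := isT.

Lemma pi_dvd_unitD a b : a \is a GRing.unit -> b \is a GRing.unit -> pi_dvd (a + b).
Proof.
move: (padic_modE p2 a 1) (padic_modE p2 b 1).
rewrite !padic_unitE // /pi_dvd padicDE // qpow1.
by move: (a 1%N) (b 1%N) => a1 b1; lia.
Qed.

Lemma pi_dvd_double x : pi_dvd (2 * x).
Proof. by apply/(pi_dvdP p2); exists x. Qed.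

Lemma pi_dvd_half x : pi_dvd x -> exists y, x = 2 * y.
Proof. by case/(pi_dvdP p2) => y ->; exists y. Qed.

Lemma even_entries G : G^T = G -> padic_even G ->
  exists a b c d e f, G = smx3 (2 * a) (2 * b) (2 * c) d e f.
Proof.
move=> /smx3P[a [b [c [d [e [f ->]]]]]] ev.
have [a' Ea] := ev (rv3 1 0 0); have [b' Eb] := ev (rv3 0 1 0).
have [c' Ec] := ev (rv3 0 0 1).
exists a', b', c', d, e, f; rewrite -Ea -Eb -Ec !qform_rv3.
by congr (smx3 _ _ _ _ _ _); ring.
Qed.

Lemma even_isotropic_unit a b c d e f : d \is a GRing.unit ->
  sqfree_at (\det (smx3 (2 * a) (2 * b) (2 * c) d e f)) ->
  isotropic (smx3 (2 * a) (2 * b) (2 * c) d e f).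
Proof.
set G := smx3 _ _ _ _ _ _ => ud sq.
pose D := 4 * a * b - d ^+ 2.
have uD : D \is a GRing.unit.
  rewrite /D addrC; apply: padic_unitD => //; first by rewrite unitrN unitrX.
  by rewrite (_ : 4 * a * b = 2 * (2 * a * b)) ?pi_dvd_double //; ring.
have DD := divrr uD; set D' := D^-1 in DD.
pose s := D' * (d * f - 2 * b * e); pose t := D' * (d * e - 2 * a * f).
pose c' := c + s * e + t * f + a * s ^+ 2 + d * s * t + b * t ^+ 2.
have iG : isometric G (smx3 (2 * a) (2 * b) (2 * c') d 0 0).
  exists (mx3 1 0 0 0 1 0 s t 1).
    by rewrite unitmxE det_mx3 (_ : _ + _ = 1) ?unitr1 //; ring.
  have E1 : e + 2 * a * s + d * t = 0.
    by transitivity (e * (1 - D * D')); [rewrite /s /t /D; ring | rewrite DD subrr mulr0].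
  have E2 : f + d * s + 2 * b * t = 0.
    by transitivity (f * (1 - D * D')); [rewrite /s /t /D; ring | rewrite DD subrr mulr0].
  rewrite tr_mx3 !mul_mx3; congr mx3; try ring.
  - by rewrite -[RHS]E1; ring.
  - by rewrite -[RHS]E2; ring.
  - by rewrite -[RHS]E1; ring.
  - by rewrite -[RHS]E2; ring.
  by rewrite /c'; ring.
apply: (isometric_isotropic iG).
have [uc'|nc'] := boolP (c' \is a GRing.unit); last first.
  case: (isometric_sqfree iG sq); move: nc'; rewrite padic_unitE // negbK.
  by move=> /pi_dvd_half[w ->]; exists (D * w); rewrite det_mx3 /D; ring.
have [ua|na] := boolP (a \is a GRing.unit).
  have [||y _ E] := @hensel 2 p2 b d (a + c') => //; first exact: pi_dvd_unitD.
  exists (rv3 1 y 1); first by rewrite rv3_neq0 oner_eq0.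
  rewrite qform_rv3; transitivity (2 * (b * y ^+ 2 + d * y + (a + c'))); first by ring.
  by rewrite E mulr0.
have [||y _ E] := @hensel 2 p2 b d a => //; first by move: na; rewrite padic_unitE // negbK.
exists (rv3 1 y 0); first by rewrite rv3_neq0 oner_eq0.
rewrite qform_rv3; transitivity (2 * (b * y ^+ 2 + d * y + a)); first by ring.
by rewrite E mulr0.
Qed.

Lemma even_isotropic G : G^T = G -> padic_even G -> sqfree_at (\det G) -> isotropic G.
Proof.
move=> sG /(even_entries sG)[a [b [c [d [e [f EG]]]]]] sq.
have iG : isometric G (smx3 (2 * a) (2 * b) (2 * c) d e f) by rewrite -EG; apply: isometric_refl.
have [ud|nd] := boolP (d \is a GRing.unit).
  by apply: (isometric_isotropic iG); apply: even_isotropic_unit => //; rewrite -EG.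
have [ue|ne] := boolP (e \is a GRing.unit).
  have i2 : isometric G (smx3 (2 * a) (2 * c) (2 * b) e d f).
    apply: isometric_trans iG _; isometry3 (mx3 1 0 0 0 0 1 0 1 0).
  by apply: (isometric_isotropic i2); apply: even_isotropic_unit => //;
    apply: (isometric_sqfree i2).
have [uf|nf] := boolP (f \is a GRing.unit).
  have i2 : isometric G (smx3 (2 * b) (2 * c) (2 * a) f d e).
    apply: isometric_trans iG _; isometry3 (mx3 0 1 0 0 0 1 1 0 0).
  by apply: (isometric_isotropic i2); apply: even_isotropic_unit => //;
    apply: (isometric_sqfree i2).
case: sq; move: nd ne nf; rewrite !padic_unitE // !negbK.
move=> /pi_dvd_half[d' Ed] /pi_dvd_half[e' Ee] /pi_dvd_half[f' Ef].
exists (2 * (a * (b * c - f' ^+ 2) - d' * (d' * c - f' * e') + e' * (d' * f' - b * e'))).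
by rewrite EG det_mx3 Ed Ee Ef; ring.
Qed.

Lemma padic_even_neg G : G^T = G -> ~ padic_even G ->
  exists b c d e f a, a \is a GRing.unit /\ isometric G (smx3 a b c d e f).
Proof.
move=> sG nev.
have [x [y [z u]]] : exists x y z, qform G (rv3 x y z) \is a GRing.unit.
  apply: contra_notP nev => /forallNP H v; have [x [y [z ->]]] := rv3P v.
  apply: pi_dvd_half; apply/negPn; rewrite -padic_unitE //; apply/negP => u.
  by apply: (H x); exists y, z.
have [b [c [d [e [f iG]]]]] := unit_value_prim p2 sG u.
by exists b, c, d, e, f; eexists; split; last exact: iG.
Qed.

Lemma unit_diag_even_plane a b c : a \is a GRing.unit -> b \is a GRing.unit -> c \is a GRing.unit ->
  exists a' b' c' f, [/\ a' \is a GRing.unit, f \is a GRing.unit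
    & isometric (mx3 a 0 0 0 b 0 0 0 c) (mx3 a' 0 0 0 (2 * b') f 0 f (2 * c'))].
Proof.
move=> ua ub uc; have [g Eg] := pi_dvd_half (pi_dvd_unitD ua ub).
have [h Eh] := pi_dvd_half (pi_dvd_unitD ub uc).
have us : a + b + c \is a GRing.unit.
  by rewrite addrC Eg; apply: padic_unitD => //; apply: pi_dvd_double.
exists (a + b + c), (a * b * g), (b * c * h), (- (a * b * c)); split => //.
  by rewrite unitrN !unitrM ua ub.
exists (mx3 1 1 1 b (- a) 0 0 c (- b)).
  rewrite unitmxE det_mx3 (_ : _ + _ = b * (a + b + c)) ?unitrM ?ub ?us //; ring.
rewrite tr_mx3 !mul_mx3; congr mx3; try ring.
  by transitivity (a * b * (a + b)); [ring|rewrite Eg; ring].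
by transitivity (b * c * (b + c)); [ring|rewrite Eh; ring].
Qed.

Lemma odd2_form G : G^T = G -> \det G \is a GRing.unit -> ~ padic_even G ->
  exists a b c f, [/\ a \is a GRing.unit, f \is a GRing.unit
    & isometric G (mx3 a 0 0 0 (2 * b) f 0 f (2 * c))].
Proof.
move=> sG ud nev; have [b [c [d [e [f [a [ua iG]]]]]]] := padic_even_neg sG nev.
have [b1 [c1 [f1 iG1]]] : exists b c f, isometric G (mx3 a 0 0 0 b f 0 f c).
  by do 3 eexists; exact: isometric_trans iG (split_unit _ _ _ _ _ ua).
have uD : b1 * c1 - f1 ^+ 2 \is a GRing.unit.
  have [u uu] := isometric_det iG1; rewrite det_mx3 => E.
  have : a * (b1 * c1 - f1 ^+ 2) \is a GRing.unit.
    by rewrite (_ : _ * _ = u ^+ 2 * \det G) ?unitrM ?unitrX ?uu // -E; ring.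
  by rewrite unitrM => /andP[].
have diagonalize b2 c2 f2 : b2 \is a GRing.unit -> b2 * c2 - f2 ^+ 2 \is a GRing.unit ->
    isometric G (mx3 a 0 0 0 b2 f2 0 f2 c2) ->
    exists a b c f, [/\ a \is a GRing.unit, f \is a GRing.unit
    & isometric G (mx3 a 0 0 0 (2 * b) f 0 f (2 * c))].
  move=> ub uD2 iG2.
  have uc : c2 - f2 ^+ 2 / b2 \is a GRing.unit.
    rewrite (_ : _ - _ = (b2 * c2 - f2 ^+ 2) / b2) ?unitrM ?unitrV ?ub ?uD2 //.
    by rewrite mulrBl [b2 * c2]mulrC mulrK.
  have [a' [b' [c' [f' [ua' uf' i]]]]] := unit_diag_even_plane ua ub uc.
  exists a', b', c', f'; split=> //.
  exact: isometric_trans (isometric_trans iG2 (split_unit2 _ _ _ ub)) i.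
have [ub|nb] := boolP (b1 \is a GRing.unit); first exact: (diagonalize b1 c1 f1).
have [uc|nc] := boolP (c1 \is a GRing.unit).
  apply: (diagonalize c1 b1 f1) => //; first by rewrite [c1 * _]mulrC.
  apply: isometric_trans iG1 _; isometry3 (mx3 1 0 0 0 0 1 0 1 0).
move: nb nc; rewrite !padic_unitE // !negbK => /pi_dvd_half[b2 Eb] /pi_dvd_half[c2 Ec].
exists a, b2, c2, f1; split=> //; last by rewrite -Eb -Ec.
apply: contraLR uD; rewrite !padic_unitE // !negbK => df.
apply: pi_dvdD => //; first by rewrite Eb -mulrA; apply: pi_dvd_double.
by rewrite pi_dvdN // expr2; apply: pi_dvd_mulr.
Qed.

Lemma even_plane_isotropic a b c f : f \is a GRing.unit -> pi_dvd b ->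
  isotropic (mx3 a 0 0 0 (2 * b) f 0 f (2 * c)).
Proof.
move=> uf db; have [||y _ E] := @hensel 2 p2 c f b => //.
exists (rv3 0 1 y); first by rewrite rv3_neq0 oner_eq0 !andbF.
rewrite qform_rv3; transitivity (2 * (c * y ^+ 2 + f * y + b)); first by ring.
by rewrite E mulr0.
Qed.

(* The plane represents 2, primitively, by a root x of b X^2 + f X + c = 1;
   a second root makes the other diagonal entry equal to 2. *)
Lemma even_plane_normal a b c f : b \is a GRing.unit -> c \is a GRing.unit -> f \is a GRing.unit ->
  isometric (mx3 a 0 0 0 (2 * b) f 0 f (2 * c)) (mx3 a 0 0 0 2 1 0 1 2).
Proof.
move=> ub uc uf; have [||x _ E] := @hensel 2 p2 b f (c - 1) => //.
  by apply: pi_dvd_unitD; rewrite ?unitrN1.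
pose g := 2 * b * x + f.
have ug : g \is a GRing.unit.
  by rewrite /g addrC; apply: padic_unitD => //; rewrite -mulrA; apply: pi_dvd_double.
have gg := divrr ug; pose c2 := b / g / g.
have uc2 : c2 \is a GRing.unit by rewrite !unitrM !unitrV ub ug.
apply: (@isometric_trans _ _ _ (mx3 a 0 0 0 2 1 0 1 (2 * c2))).
  exists (mx3 1 0 0 0 x 1 0 g^-1 0).
    by rewrite unitmxE det_mx3 (_ : _ + _ = - g^-1) ?unitrN ?unitrV //; ring.
  have E' : b * x ^+ 2 = 1 - c - f * x by rewrite -[RHS]addr0 -E; ring.
  rewrite tr_mx3 !mul_mx3 /c2; set g' := g^-1 in gg *; congr mx3; try ring: E'.
  - by transitivity (g * g'); [rewrite /g; ring | exact: gg].
  - by transitivity (g * g'); [rewrite /g; ring | exact: gg].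
have [||y _ E2] := @hensel 2 p2 (4 * c2 - 1) (1 - 4 * c2) (c2 - 1).
- apply: padic_unitD; rewrite ?unitr1 // pi_dvdN //.
  by rewrite (_ : 4 * c2 = 2 * (2 * c2)) ?pi_dvd_double //; ring.
- by apply: pi_dvd_unitD; rewrite ?unitrN1.
exists (mx3 1 0 0 0 1 0 0 y (1 - 2 * y)).
  rewrite unitmxE det_mx3 (_ : _ + _ = 1 - 2 * y); last by ring.
  by apply: padic_unitD; rewrite ?unitr1 // pi_dvdN // pi_dvd_double.
rewrite tr_mx3 !mul_mx3; congr mx3; try ring.
transitivity (2 + 2 * ((4 * c2 - 1) * y ^+ 2 + (1 - 4 * c2) * y + (c2 - 1))); first by ring.
by rewrite E2 mulr0 addr0.
Qed.

Lemma odd2_aniso_form G : G^T = G -> \det G \is a GRing.unit -> ~ padic_even G -> ~ isotropic G ->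
  exists2 a, a \is a GRing.unit & isometric G (mx3 a 0 0 0 2 1 0 1 2).
Proof.
move=> sG ud nev nG; have [a [b [c [f [ua uf iG]]]]] := odd2_form sG ud nev.
have iG' : isometric G (mx3 a 0 0 0 (2 * c) f 0 f (2 * b)).
  apply: isometric_trans iG _; isometry3 (mx3 1 0 0 0 0 1 0 1 0).
exists a => //; apply: (isometric_trans iG); apply: even_plane_normal => //;
  apply/negPn; rewrite padic_unitE // negbK; apply/negP => d; apply: nG.
  exact: isometric_isotropic iG (even_plane_isotropic _ _ uf d).
exact: isometric_isotropic iG' (even_plane_isotropic _ _ uf d).
Qed.

Lemma two_local G H : G^T = G -> H^T = H -> \det G = \det H ->
  sqfree_at (\det G) ->
  (padic_even G /\ padic_even H) \/ [/\ \det G \is a GRing.unit, ~ padic_even G,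
    ~ padic_even H & (isotropic G <-> isotropic H)] ->
  isometric G H.
Proof.
move=> sG sH dGH sq; have sq' := sq; rewrite dGH in sq'.
case=> [[evG evH]|[ud nG nH iso]].
  have isoG := hyp_form p2 sG sq (even_isotropic sG evG sq) (or_introl evG).
  have isoH := hyp_form p2 sH sq' (even_isotropic sH evH sq') (or_introl evH).
  by apply: isometric_trans isoG _; rewrite dGH; apply: isometric_sym.
have [iG|niG] := pselect (isotropic G).
  have isoG := hyp_form p2 sG sq iG (or_intror (conj erefl ud)).
  rewrite dGH in ud; have isoH := hyp_form p2 sH sq' (iso.1 iG) (or_intror (conj erefl ud)).
  by apply: isometric_trans isoG _; rewrite dGH; apply: isometric_sym.
have [a _ i1] := odd2_aniso_form sG ud nG niG.
have udH := ud; rewrite dGH in udH.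
have [b _ i2] := odd2_aniso_form sH udH nH (fun i => niG (iso.2 i)).
have [u uu Eu] := isometric_det i1; have [v uv Ev] := isometric_det i2.
have {Eu} Eu : 3 * a = u ^+ 2 * \det G by rewrite -Eu det_mx3; ring.
have {Ev} Ev : 3 * b = v ^+ 2 * \det G by rewrite dGH -Ev det_mx3; ring.
have u3 : (3 : Z2) \is a GRing.unit by rewrite (_ : 3 = (3%:~R : Z2)) // padic_unit_int.
apply: isometric_trans i1 _; apply: isometric_trans (isometric_sym i2).
exists (mx3 (v / u) 0 0 0 1 0 0 0 1).
  by rewrite unitmxE det_mx3 (_ : _ + _ = v / u) ?unitrM ?uv ?unitrV //; ring.
rewrite tr_mx3 !mul_mx3; congr mx3; try ring.
apply: (@mulrI _ (3 * u ^+ 2)); first by rewrite unitrM u3 unitrX.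
have uu1 := divrr uu; set w := u^-1 in uu1 *.
by transitivity (u ^+ 2 * (3 * b)); [rewrite Ev; ring: uu1 Eu|ring].
Qed.

End Two.

(** * Genera of stable lattices *)

Implicit Types G H K : 'M[int]_3.

Notation isotropic_at q G := (isotropic (ext (padic_int q) G)).

Lemma clear_den n (T : 'M[rat]_n) : exists2 N : int, N != 0 &
  exists T' : 'M[int]_n, ext rat T' = N%:~R *: T.
Proof.
pose N := \prod_(k : 'I_n * 'I_n) denq (T k.1 k.2).
have N0 : N != 0 by apply/prodf_neq0 => k _; rewrite denq_neq0.
have dN i j : (denq (T i j) %| N)%Z.
  by rewrite /N (bigD1 (i, j)) //= dvdz_mulr.
exists N => //; exists (\matrix_(i, j) (numq (T i j) * (N %/ denq (T i j))%Z)).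
apply/matrixP => i j; rewrite !mxE.
rewrite -[N in RHS](divzK (dN i j)) !rmorphM /= numqE; ring.
Qed.

Lemma lattice_gt0 n (G : 'M[int]_n) (x : 'rV[int]_n) : lattice G -> x != 0 -> 0 < qform G x.
Proof.
move=> [_ pG] x0; have := pG (map_mx intr x).
rewrite /qform map_bform ltr0z; apply; apply: contra x0 => /eqP/rowP E.
by apply/eqP/rowP => i; have := E i; rewrite !mxE => /eqP; rewrite intr_eq0 => /eqP.
Qed.

Lemma lattice_ge0 n (G : 'M[int]_n) (x : 'rV[int]_n) : lattice G -> 0 <= qform G x.
Proof.
by move=> lG; have [->|x0] := eqVneq x 0; [rewrite qform0|apply/ltW/lattice_gt0].
Qed.

Lemma lattice_minors a b c d e f : lattice (smx3 a b c d e f) ->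
  [/\ 0 < a, 0 < a * b - d ^+ 2 & 0 < \det (smx3 a b c d e f)].
Proof.
move=> lG.
have nz (x y z : int) : (x != 0) || (y != 0) || (z != 0) -> rv3 x y z != 0.
  apply: contraL => /eqP; rewrite -rv3_0 => E; have [-> -> ->] := rv3_inj E.
  by rewrite eqxx.
have a0 : 0 < a.
  have /(lattice_gt0 lG) := nz 1 0 0 isT; rewrite qform_rv3 (_ : _ + _ = a) //; ring.
have m0 : 0 < a * b - d ^+ 2.
  have /(lattice_gt0 lG) : rv3 (- d) a 0 != 0 by apply: nz; rewrite (gt_eqF a0) orbT.
  rewrite (_ : qform _ _ = a * (a * b - d ^+ 2)); last by rewrite qform_rv3; ring.
  by rewrite pmulr_rgt0.
split=> //.
have /(lattice_gt0 lG) : rv3 (d * f - b * e) (d * e - a * f) (a * b - d ^+ 2) != 0.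
  by apply: nz; rewrite (gt_eqF m0) orbT.
rewrite (_ : qform _ _ = (a * b - d ^+ 2) * \det (smx3 a b c d e f)); last first.
  by rewrite qform_rv3 det_mx3; ring.
by rewrite pmulr_rgt0.
Qed.

Lemma lattice_diag n (G : 'M[int]_n) i : lattice G -> 0 < G i i.
Proof.
rewrite -(bform_delta G) => lG; apply: (lattice_gt0 lG).
by apply/eqP => /rowP/(_ i); rewrite !mxE !eqxx.
Qed.

Lemma lattice_diag1 a b c d e f : lattice (smx3 a b c d e f) -> 0 < b.
Proof. by move=> /(lattice_diag o1); rewrite mxE. Qed.

Lemma lattice_det_gt0 G : lattice G -> 0 < \det G.
Proof.
move=> lG; have [sG _] := lG; have [a [b [c [d [e [f E]]]]]] := smx3P sG.
by rewrite E in lG *; have [] := lattice_minors lG.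
Qed.

Lemma lattice_isometric n (G H : 'M[int]_n) :
  lattice G -> isometric (ext rat G) (ext rat H) -> lattice H.
Proof.
move=> [sG pG] iGH; split.
  apply: ext_inj; rewrite -tr_ext; apply: (isometric_sym_mx iGH).
  by rewrite tr_ext sG.
case: iGH => U uU <- x x0; rewrite qform_conj; apply: pG.
by apply: contra x0 => /eqP xU; rewrite -(mulmxK uU x) xU mul0mx.
Qed.

Lemma similar_isotropic q (k : rat) (T : 'M[rat]_3) G H : prime q ->
  \det T != 0 -> T *m ext rat G *m T^T = k *: ext rat H ->
  isotropic_at q H -> isotropic_at q G.
Proof.
move=> pq dT ET [x x0 Qx]; have [N N0 [T' ET']] := clear_den T.
have E : denq k *: (T' *m G *m T'^T) = (N ^+ 2 * numq k) *: H.
  apply: ext_inj; rewrite !(ext_scale, ext_mul) -tr_ext ET' linearZ /= -!scalemxAl -scalemxAr ET.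
  by rewrite !scalerA !rmorphM /= numqE; congr (_ *: _); ring.
have dT' : \det T' != 0.
  by rewrite -(intr_eq0 rat) -det_ext ET' detZ mulf_neq0 // expf_neq0 // intr_eq0.
exists (x *m ext _ T').
  apply: contra x0 => /eqP xT; apply/eqP; apply: (@mulmx_detI _ _ _ (ext (padic_int q) T')).
    by rewrite det_ext intr_padic_eq0.
  by rewrite xT mul0mx.
apply: (@mulfI _ (denq k)%:~R); first by rewrite intr_padic_eq0 // denq_neq0.
by rewrite -qform_conj tr_ext -!ext_mul -qform_scale -ext_scale E ext_scale qform_scale Qx !mulr0.
Qed.

Lemma rational_isotropic q G H : prime q -> isometric (ext rat G) (ext rat H) ->
  isotropic_at q H -> isotropic_at q G.
Proof.
move=> pq [T uT ET]; apply: (@similar_isotropic q 1 T _ H) => //; last by rewrite scale1r ET.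
Qed.

Lemma padic_even_ext G : G^T = G ->
  padic_even (ext (padic_int 2) G) <-> even_lattice G.
Proof.
move=> sG; split=> [ev x|ev].
  have [w E] := ev (map_mx intr x); have p2 : prime 2 by [].
  rewrite qform_ext in E.
  by have := pi_dvd_int p2 (qform G x); rewrite E pi_dvd_double => /esym.
move: ev; have [a [b [c [d [e [f ->]]]]]] := smx3P sG => /even_smx3P[].
move=> /evenE[a' ->] /evenE[b' ->] /evenE[c' ->] v; have [x [y [z ->]]] := rv3P v.
exists (a'%:~R * x ^+ 2 + b'%:~R * y ^+ 2 + c'%:~R * z ^+ 2 +
        d%:~R * x * y + e%:~R * x * z + f%:~R * y * z).
by rewrite ext_smx3 qform_rv3 !rmorphM /=; ring.
Qed.

Definition sqfreez (d : int) := forall q, prime q -> ~~ ((q ^ 2)%N %| d)%Z.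

Lemma sqfreez_at d q : prime q -> sqfreez d -> sqfree_at (d%:~R : padic_int q).
Proof.
by move=> pq sd [_ /(intr_dvd_padic pq)]; rewrite /qpow => h; have := sd q pq; rewrite h.
Qed.

Lemma sqfreezP (d : int) : d != 0 ->
  (forall q, prime q -> (logn q `|d| <= 1)%N) -> sqfreez d.
Proof.
move=> d0 H q pq; apply/negP; rewrite dvdzE absz_nat pfactor_dvdn ?absz_gt0 //.
by rewrite leqNgt ltnS H.
Qed.

Lemma genus_intro K H : lattice K -> sqfreez (\det K) ->
  (even_lattice K \/ ~~ (2 %| \det K)%Z) ->
  isometric (ext rat K) (ext rat H) -> \det H = \det K ->
  (even_lattice K <-> even_lattice H) -> genus K H.
Proof.
move=> lK sd evK iKH dKH ev; have lH := lattice_isometric lK iKH.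
split=> // q pq.
have [sK _] := lK; have [sH _] := lH.
have dK0 : \det K != 0 by rewrite gt_eqF // lattice_det_gt0.
have sK' : (ext (padic_int q) K)^T = ext (padic_int q) K by rewrite tr_ext sK.
have sH' : (ext (padic_int q) H)^T = ext (padic_int q) H by rewrite tr_ext sH.
have dE : \det (ext (padic_int q) K) = \det (ext (padic_int q) H) by rewrite !det_ext dKH.
have iso : isotropic_at q K <-> isotropic_at q H.
  by split; apply: rational_isotropic => //; apply: isometric_sym.
have sq : sqfree_at (\det (ext (padic_int q) K)) by rewrite det_ext; apply: sqfreez_at.
have [q2|q2] := eqVneq q 2; last first.
  exact: (odd_local pq).
move: sK' sH' dE iso sq; rewrite q2 => sK' sH' dE iso sq.
apply: two_local => //; have [e|ne] := pselect (even_lattice K).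
  by left; split; apply/padic_even_ext => //; apply/ev.
right; split=> //; first by rewrite det_ext padic_unit_int //; case: evK.
  by move/padic_even_ext => /(_ sK).
by move/padic_even_ext => /(_ sH)/ev.
Qed.

Lemma local_isometric_dvd q k G H : prime q ->
  locally_isometric q G H -> (qpow q k %| \det G)%Z -> (qpow q k %| \det H)%Z.
Proof.
move=> pq /isometric_det[u _]; rewrite !det_ext => E /dvdzP[c Ec].
apply: (@intr_dvd_padic q pq k _ (u ^+ 2 * c%:~R)).
by rewrite E Ec rmorphM /= /qpow -natrX; ring.
Qed.

Lemma genus_sym n (G H : 'M[int]_n) : lattice G -> genus G H -> genus H G.
Proof.
move=> lG [_ iQ iL]; split => //; first exact: isometric_sym.
by move=> q pq; apply/isometric_sym/iL.
Qed.

Lemma genus_det K H : lattice K -> genus K H -> \det H = \det K.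
Proof.
move=> lK gH; have gK := genus_sym lK gH.
have dK := lattice_det_gt0 lK; have [lH _ iH] := gH; have dH := lattice_det_gt0 lH.
have [_ _ iK] := gK.
have: `|\det H|%N = `|\det K|%N; last by lia.
apply: eqn_from_log; rewrite ?absz_gt0 ?gt_eqF // => q.
have [pq|npq] := boolP (prime q); last by rewrite /logn (negPf npq).
have le (A B : 'M[int]_3) : 0 < \det A -> 0 < \det B -> locally_isometric q A B ->
    (logn q `|\det A| <= logn q `|\det B|)%N.
  move=> _ B0 iAB; rewrite -pfactor_dvdn ?absz_gt0 ?gt_eqF //.
  have := @local_isometric_dvd q (logn q `|\det A|) A B pq iAB.
  by rewrite /qpow !dvdzE absz_nat; apply; apply: pfactor_dvdnn.
by apply/eqP; rewrite eqn_leq !le //; [exact: iH | exact: iK].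
Qed.

Lemma local_even G H : G^T = G -> H^T = H ->
  locally_isometric 2 G H -> even_lattice G -> even_lattice H.
Proof.
by move=> sG sH iGH /(padic_even_ext sG) ev; apply/(padic_even_ext sH);
  apply: isometric_padic_even ev.
Qed.

Lemma genus_even K H : lattice K -> genus K H ->
  (even_lattice K <-> even_lattice H).
Proof.
move=> [sK _] [[sH _] _ iH]; split; apply: local_even => //; last first.
  exact/isometric_sym/iH.
exact: iH.
Qed.

Lemma genus_isometric n (G H H' : 'M[int]_n) : genus G H -> isometric H H' -> genus G H'.
Proof.
move=> [lH iQ iL] iH; have iE S := isometric_ext S iH; split.
- exact: lattice_isometric lH (iE _).
- exact: isometric_trans iQ (iE _).
- by move=> q pq; apply: isometric_trans (iL q pq) (iE _).
Qed.

Lemma genus_lattice n (G H : 'M[int]_n) : genus G H -> lattice H.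
Proof. by case. Qed.

Lemma stable_sqfree K : stable K -> sqfreez (\det K).
Proof.
by move=> [lK _ ord _]; apply: sqfreezP => //; rewrite gt_eqF // lattice_det_gt0.
Qed.

Lemma stable_even2 K : stable K -> (even_lattice K <-> (2 %| \det K)%Z).
Proof.
move=> [lK _ ord iff]; have d0 := lattice_det_gt0 lK; split.
  move/iff => l1; have : (2 ^ 1 %| `|\det K|)%N by rewrite pfactor_dvdn ?l1 ?absz_gt0 ?gt_eqF.
  by rewrite expn1.
move=> d2; apply/iff/eqP; rewrite eqn_leq ord //=.
by rewrite -pfactor_dvdn ?absz_gt0 ?gt_eqF // expn1.
Qed.

Lemma stable_genus K H : stable K ->
  isometric (ext rat K) (ext rat H) -> \det H = \det K ->
  (even_lattice K -> even_lattice H) -> genus K H.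
Proof.
move=> sK iKH dKH ev; have [lK _ _ _] := sK.
have [e|ne] := pselect (even_lattice K).
  by apply: genus_intro => //; [exact: stable_sqfree|left].
have d2 : ~~ (2 %| \det K)%Z by apply/negP => /(stable_even2 sK).
apply: genus_intro => //; [exact: stable_sqfree|by right|split=> // evH].
have [sH _] := lattice_isometric lK iKH.
case/negP: d2; rewrite -dKH; move: evH; have [a [b [c [d [e [f ->]]]]]] := smx3P sH.
case/even_smx3P => /evenE[a' ->] /evenE[b' ->] /evenE[c' ->]; apply/dvdzP.
exists (a' * (4 * b' * c' - f ^+ 2) - d * (d * c' - f * e) - e ^+ 2 * b').
by rewrite det_mx3; ring.
Qed.

(** * Representatives of equivalence classes and finite cardinals *)

Lemma ncard_seq (T : choiceType) (A : set T) (s : seq T) :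
  uniq s -> (forall x, A x <-> x \in s) -> ncard A = size s.
Proof.
move=> us As; have finA : finite_set A.
  by apply/finite_seqP; exists s; apply/seteqP; split=> x /=; rewrite As.
rewrite /ncard; apply: perm_size; apply: uniq_perm => // x.
by rewrite in_fset_set //; apply/idP/idP => [/set_mem/As|/As/mem_set].
Qed.

Lemma finite_enum (T : choiceType) (A : set T) : finite_set A ->
  exists2 s : seq T, uniq s & forall x, A x <-> x \in s.
Proof.
move=> finA; exists (enum_fset (fset_set A)); first exact: fset_uniq.
by move=> x; rewrite in_fset_set //; split=> [/mem_set|/set_mem].
Qed.

Lemma ncard_bij (T U : choiceType) (A : set T) (B : set U) (f : T -> U) (g : U -> T) :
  finite_set A -> (forall x, A x -> B (f x)) -> (forall y, B y -> A (g y)) ->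
  (forall x, A x -> g (f x) = x) -> (forall y, B y -> f (g y) = y) ->
  ncard A = ncard B.
Proof.
move=> /finite_enum[s us As] f_in gA fK gK.
rewrite (ncard_seq us As) (@ncard_seq _ B [seq f x | x <- s]) ?size_map //.
  by rewrite map_inj_in_uniq // => x y /As Ax /As Ay E; rewrite -(fK x) // E fK.
move=> y; split=> [By|/mapP[x /As Ax ->]]; last exact: f_in.
by apply/mapP; exists (g y); rewrite ?gK //; apply/As/gA.
Qed.

Lemma finite_box m n (M : nat) :
  finite_set [set A : 'M[int]_(m, n) | forall i j, `|A i j| <= M%:Z].
Proof.
pose F (f : {ffun 'I_m * 'I_n -> 'I_(M.*2.+1)}) : 'M[int]_(m, n) :=
  \matrix_(i, j) ((f (i, j) : nat)%:Z - M%:Z).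
apply: (@sub_finite_set _ _ (F @` setT)); last exact/finite_image/finite_finset.
move=> A /= bA; exists [ffun k => inord (absz (A k.1 k.2 + M%:Z)%R)] => //.
apply/matrixP => i j; rewrite mxE ffunE /=.
by have := bA i j; rewrite ler_norml; move: (A i j) => z; case/andP => z1 z2; rewrite inordK; lia.
Qed.

Section Reps.
Variables (T : choiceType) (A : set T) (r : T -> T -> Prop).
Hypothesis rxx : forall x, A x -> r x x.
Hypothesis rsym : forall x y, A x -> A y -> r x y -> r y x.
Hypothesis rtrans : forall x y z, A x -> A y -> A z -> r x y -> r y z -> r x z.

Definition indep (s : seq T) := [/\ uniq s, forall x, x \in s -> A x
  & forall x y, x \in s -> y \in s -> r x y -> x = y].
Definition reps (s : seq T) := indep s /\ forall x, A x -> exists2 y, y \in s & r x y.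

Lemma reps_bound B : (forall s, indep s -> (size s <= B)%N) -> exists s, reps s.
Proof.
move=> bnd; pose P n := `[< exists2 s, indep s & size s = n >].
have ex : exists n, P n by exists 0%N; apply/asboolP; exists [::].
have ub n : P n -> (n <= B)%N by move/asboolP => [s /bnd H <-].
case: (ex_maxnP ex ub) => n /asboolP[s is_ sn] mx.
exists s; split=> // x Ax; apply: contrapT => H.
have [us As rs] := is_.
suff : P n.+1 by move/mx; rewrite ltnn.
apply/asboolP; exists (x :: s); last by rewrite /= sn.
split.
- rewrite /= us andbT; apply/negP => xs; apply: H; exists x => //; exact: rxx.
- by move=> y; rewrite inE => /predU1P[->|/As].
- move=> y z; rewrite !inE => /predU1P[->|ys] /predU1P[->|zs] //.
  + by move=> ryz; case: H; exists z.
  + by move=> ryz; case: H; exists y => //; apply: rsym => //; exact: As.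
  + exact: rs.
Qed.

Lemma indep_cover (B : set T) s : finite_set B ->
  (forall x, A x -> exists2 y, B y & A y /\ r x y) -> indep s ->
  (size s <= ncard B)%N.
Proof.
move=> /finite_enum[b ub Bb] cov [us As rs]; rewrite (ncard_seq ub Bb).
have [f fP] : exists f : T -> T, forall x, A x -> [/\ B (f x), A (f x) & r x (f x)].
  suff H x : exists y, A x -> [/\ B y, A y & r x y].
    by exists (fun x => xget x [set y | A x -> [/\ B y, A y & r x y]]) => x Ax;
       case: xgetP => [y -> /(_ Ax) //|none]; have [y /none] := H x.
  have [Ax|nAx] := pselect (A x); last by exists x.
  by have [y By [Ay ry]] := cov x Ax; exists y.
rewrite -(size_map f s); apply: uniq_leq_size.
  rewrite map_inj_in_uniq // => x y xs ys E.
  have Ax := As _ xs; have Ay := As _ ys.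
  have [_ Afx rx] := fP x Ax; have [_ _ ry] := fP y Ay.
  apply: rs => //; apply: (rtrans _ Afx) => //; apply: rsym => //.
  by rewrite E.
by move=> y /mapP[x /As Ax ->]; apply/Bb; have [] := fP x Ax.
Qed.

Definition rclass x : set T := [set y | A y /\ r x y].

Lemma rclass_inj s : indep s -> {in s &, injective rclass}.
Proof.
move=> [_ As rs] x y xs ys E; apply: rs => //.
have : rclass y y by split; [exact: As | apply: rxx; exact: As].
by rewrite -E => -[].
Qed.

Lemma rclass_eq x y : A x -> A y -> r x y -> rclass x = rclass y.
Proof.
move=> Ax Ay rxy; apply/seteqP; split=> z [Az rz]; split=> //.
  by apply: (rtrans _ Ax) => //; apply: rsym.
exact: (rtrans _ Ay).
Qed.

Lemma eq_classesE s : reps s -> forall C, eq_classes A r C <-> C \in [seq rclass x | x <- s].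
Proof.
move=> [is_ cov] C; have [_ As _] := is_; split.
  move=> [x Ax <-]; have [y ys rxy] := cov x Ax.
  apply/mapP; exists y => //; apply: rclass_eq => //; exact: As.
by move=> /mapP[x xs ->]; exists x => //; exact: As.
Qed.

Lemma ncard_eq_classes s : reps s -> ncard (eq_classes A r) = size s.
Proof.
move=> rs; rewrite (@ncard_seq _ _ [seq rclass x | x <- s]) ?size_map //.
  by have [is_ _] := rs; have [us _ _] := is_; rewrite map_inj_in_uniq //; exact: rclass_inj.
exact: eq_classesE.
Qed.

Lemma fsbig_eq_classes (R : nmodType) s (F : set T -> R) : reps s ->
  \sum_(C \in eq_classes A r) F C = \sum_(x <- s) F (rclass x).
Proof.
move=> rs; have [is_ _] := rs; have [us _ _] := is_.
rewrite -(big_map rclass xpredT F).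
have um : uniq [seq rclass x | x <- s] by rewrite map_inj_in_uniq //; exact: rclass_inj.
have -> : eq_classes A r = [set` [seq rclass x | x <- s]].
  by apply/seteqP; split=> C /(eq_classesE rs).
by rewrite -fsbig_seq.
Qed.

End Reps.

(** * Reduction of positive ternary forms *)

Lemma round_ex (x n : int) : 0 < n -> exists j : int, `|2 * (x - j * n)| <= n.
Proof.
move=> n0; exists ((2 * x + n) %/ (2 * n))%Z.
have E := divz_eq (2 * x + n) (2 * n).
have := modz_ge0 (2 * x + n) (_ : 2 * n != 0).
have := ltz_mod (2 * x + n) (_ : 2 * n != 0).
have n2 : 2 * n != 0 by rewrite mulf_neq0 // gt_eqF.
move=> /(_ n2) lt /(_ n2) ge; rewrite ger0_norm in lt; last by lia.
move: E lt ge; set Q := divz _ _; set r := modz _ _ => E lt ge.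
have -> : 2 * (x - Q * n) = 2 * x - Q * (2 * n) by ring.
have -> : Q * (2 * n) = 2 * x + n - r by rewrite E; ring.
by rewrite ler_norml; lia.
Qed.

Lemma ex_min_nat (P : nat -> Prop) : (exists n, P n) ->
  exists n, P n /\ forall m, P m -> (n <= m)%N.
Proof.
move=> [n Pn]; have ex : exists n, `[< P n >] by exists n; apply/asboolP.
case: (ex_minnP ex) => m /asboolP Pm mn; exists m; split=> // k Pk.
by apply: mn; apply/asboolP.
Qed.

Lemma isometric_lattice n (G H : 'M[int]_n) : isometric G H -> lattice G -> lattice H.
Proof. by move=> iGH lG; apply: lattice_isometric lG (isometric_ext _ iGH). Qed.

Definition reduced (a b c d e f : int) :=
  let g2 := a * b - d ^+ 2 in let g3 := a * c - e ^+ 2 in let h := a * f - d * e in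
  [/\ `|2 * d| <= a, `|2 * e| <= a, a <= b, g2 <= g3 & `|2 * h| <= g2].

(* Minimize first a, then the binary minor ab - d^2; a shear bounds the remaining entries. *)
Lemma reduced_shape G : lattice G -> exists a b c d e f,
  isometric G (smx3 a b c d e f) /\ reduced a b c d e f.
Proof.
move=> lG; pose P n := exists b c d e f, isometric G (smx3 n%:Z b c d e f).
have latP a b c d e f : isometric G (smx3 a b c d e f) -> lattice (smx3 a b c d e f).
  by move=> iG; apply: isometric_lattice iG lG.
have [a [[b0 [c0 [d0 [e0 [f0 i0]]]]] amin]] : exists n, P n /\ forall m, P m -> (n <= m)%N.
  apply: ex_min_nat; have [sG _] := lG; have [a [b [c [d [e [f E]]]]]] := smx3P sG.
  have iG : isometric G (smx3 a b c d e f) by rewrite -E; apply: isometric_refl.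
  have [a0 _ _] := lattice_minors (latP _ _ _ _ _ _ iG).
  by exists `|a|%N, b, c, d, e, f; rewrite gtz0_abs.
pose P2 n := exists b c d e f, isometric G (smx3 a%:Z b c d e f) /\ a%:Z * b - d ^+ 2 = n%:Z.
have [g [[b1 [c1 [d1 [e1 [f1 [i1 g1]]]]]] gmin]] : exists n, P2 n /\ forall m, P2 m -> (n <= m)%N.
  apply: ex_min_nat; have [_ m0 _] := lattice_minors (latP _ _ _ _ _ _ i0).
  by exists (absz (a%:Z * b0 - d0 ^+ 2)%R), b0, c0, d0, e0, f0; rewrite gtz0_abs.
have [a0 m0 _] := lattice_minors (latP _ _ _ _ _ _ i1).
have [j Hj] := round_ex (a%:Z * f1 - d1 * e1) m0.
have [k Hk] := round_ex d1 a0.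
have [l Hl] := round_ex (e1 - j * d1) a0.
pose A := a%:Z.
pose b := b1 - 2 * k * d1 + k ^+ 2 * A; pose d := d1 - k * A.
pose e := e1 - j * d1 - l * A.
pose c := c1 + j ^+ 2 * b1 + l ^+ 2 * A - 2 * j * f1 - 2 * l * e1 + 2 * j * l * d1.
pose f := f1 - j * b1 - l * d1 - k * e1 + k * j * d1 + k * l * A.
have iG : isometric G (smx3 A b c d e f).
  apply: isometric_trans i1 _; exists (mx3 1 0 0 (- k) 1 0 (- l) (- j) 1).
    by rewrite unitmxE det_mx3 (_ : _ + _ = 1) ?unitr1 //; ring.
  by rewrite tr_mx3 !mul_mx3 /b /c /d /e /f; congr mx3; ring.
exists A, b, c, d, e, f; split=> //; split=> //.
- have ib : isometric G (smx3 b A c d f e).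
    apply: isometric_trans iG _; isometry3 (mx3 0 1 0 1 0 0 0 0 1).
  have [b0' _ _] := lattice_minors (latP _ _ _ _ _ _ ib).
  suff : (a <= `|b|)%N by rewrite /A; lia.
  by apply: amin; exists A, c, d, f, e; rewrite gtz0_abs.
- have ib : isometric G (smx3 A c b e d f).
    apply: isometric_trans iG _; isometry3 (mx3 1 0 0 0 0 1 0 1 0).
  have [_ m3 _] := lattice_minors (latP _ _ _ _ _ _ ib).
  have -> : A * b - d ^+ 2 = g%:Z by rewrite -g1 /b /d /A; ring.
  suff : (g <= absz (A * c - e ^+ 2)%R)%N by rewrite -lez_nat gtz0_abs.
  by apply: gmin; exists c, b, e, d, f; rewrite gtz0_abs.
- have -> : A * b - d ^+ 2 = a%:Z * b1 - d1 ^+ 2 by rewrite /b /d /A; ring.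
  have -> // : 2 * (A * f - d * e) = 2 * (a%:Z * f1 - d1 * e1 - j * (a%:Z * b1 - d1 ^+ 2)).
  by rewrite /d /e /f /A; ring.
Qed.

Lemma hermite_binary (a b d : int) : 0 <= a -> `|2 * d| <= a -> a <= b ->
  3 * a ^+ 2 <= 4 * (a * b - d ^+ 2).
Proof.
move=> a0 hd ab; have := ler_wpM2l a0 ab.
have := ler_pM (normr_ge0 _) (normr_ge0 _) hd hd; rewrite -normrM ger0_norm -?expr2 ?sqr_ge0 //.
by clear; lia.
Qed.

Section ReducedEntries.
Variables a b c d e f : int.
Hypotheses (a0 : 0 < a) (D0 : 0 < \det (smx3 a b c d e f)) (red : reduced a b c d e f).
Local Notation D := (\det (smx3 a b c d e f)).
Local Notation g2 := (a * b - d ^+ 2).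
Local Notation g3 := (a * c - e ^+ 2).

Lemma reduced_minor : 3 * g2 ^+ 2 <= 4 * (a * D).
Proof.
have [hd _ ab g23 hh] := red; have := hermite_binary (ltW a0) hd ab => g2a.
have -> : a * D = g2 * g3 - (a * f - d * e) ^+ 2 by rewrite det_mx3; ring.
by apply: hermite_binary => //; have := sqr_ge0 a; clear -g2a; lia.
Qed.

Lemma reduced_cube : 27 * a ^+ 3 <= 64 * D.
Proof.
have [hd _ ab _ _] := red; have g2a := hermite_binary (ltW a0) hd ab.
have a2 : 0 <= 3 * a ^+ 2 by rewrite mulr_ge0 ?sqr_ge0.
rewrite -(ler_pM2l a0); have := ler_pM a2 a2 g2a g2a; have := reduced_minor.
rewrite (_ : a * (27 * a ^+ 3) = 3 * (3 * a ^+ 2 * (3 * a ^+ 2))); last by ring.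
by rewrite (_ : 4 * g2 * (4 * g2) = 16 * g2 ^+ 2); [clear; lia | ring].
Qed.

Lemma reduced_bound i j : `|smx3 a b c d e f i j| <= 15 * D ^+ 2.
Proof.
have [hd he ab g23 hh] := red; have a3 := reduced_cube.
have peM (x y : int) : 1 <= x -> 0 <= y -> y <= x * y by move=> x1 y0; rewrite ler_peMl.
have a1 : 1 <= a by [].
have D1 : 1 <= D by [].
have g2a := hermite_binary (ltW a0) hd ab.
have aa : a <= a ^+ 2 by rewrite expr2; apply: peM => //; apply: ltW.
have g20 : 1 <= g2 by clear -g2a aa a1; lia.
have aD : a ^+ 2 <= 3 * D.
  have : a ^+ 2 <= a ^+ 3 by rewrite [a ^+ 3]exprS; apply: peM => //; apply: sqr_ge0.
  by clear -a3 D1; lia.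
have DD : D <= D ^+ 2 by rewrite expr2; apply: peM => //; apply: ltW.
have aDD : a * D <= 3 * D ^+ 2 by rewrite [D ^+ 2]expr2 mulrA ler_wpM2r //;
  [apply: ltW|clear -aD aa; lia].
have g3D : g3 <= 6 * D ^+ 2.
  apply: (@le_trans _ _ (g2 * g3)); first by apply: peM => //; clear -g20 g23; lia.
  have : a * D = g2 * g3 - (a * f - d * e) ^+ 2 by rewrite det_mx3; ring.
  have := hermite_binary (_ : 0 <= g2) hh (lexx _); have := ler_wpM2l (_ : 0 <= g2) g23.
  by rewrite -expr2; have g2' : 0 <= g2 by [clear -g20; lia]; move=> /(_ g2') + /(_ g2');
    clear -aDD DD D1; lia.
have bound_a x y : a * x <= y -> 0 <= y -> x <= y.
  move=> axy y0; have [x0|x0] := lerP x 0; first exact: le_trans y0.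
  by apply: le_trans axy; apply: peM => //; apply: ltW.
have e2 : e ^+ 2 <= a ^+ 2 by have := hermite_binary (ltW a0) he (lexx _); have := sqr_ge0 e;
  clear; lia.
have d2 : d ^+ 2 <= a ^+ 2 by have := hermite_binary (ltW a0) hd (lexx _); have := sqr_ge0 d;
  clear; lia.
have bb : b <= 15 * D ^+ 2 by apply: bound_a; clear -g3D g23 d2 aD DD D1; lia.
have cb : c <= 15 * D ^+ 2 by apply: bound_a; clear -g3D e2 aD DD D1; lia.
have c0 : 0 <= c by rewrite -(pmulr_rge0 _ a0); have := sqr_ge0 e; clear -g20 g23; lia.
have fb : `|f| <= 15 * D ^+ 2.
  apply: bound_a; last by clear -DD D1; lia.
  rewrite -[X in X * _](gtr0_norm a0) -normrM (_ : a * f = (a * f - d * e) + d * e); last by ring.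
  apply: le_trans (ler_normD _ _) _; have : `|d * e| <= a ^+ 2.
    by rewrite normrM expr2; apply: ler_pM => //; [clear -hd | clear -he]; lia.
  by clear -hh g3D g23 aD DD D1; lia.
by move: i j; apply: I3P; apply: I3P; rewrite mxE //=; clear -a1 hd he aa aD DD ab bb c0 cb fb; lia.
Qed.

End ReducedEntries.

Lemma lattice_bounded G : lattice G -> exists2 H, isometric G H &
  forall i j, `|H i j| <= 15 * (\det G) ^+ 2.
Proof.
move=> lG; have [a [b [c [d [e [f [iG red]]]]]]] := reduced_shape lG.
exists (smx3 a b c d e f) => //; rewrite (isometric_det_int iG).
have [a0 _ D0] := lattice_minors (isometric_lattice iG lG).
exact: reduced_bound.
Qed.

Definition class_reps K := reps (genus K) (@isometric 3 int).

Lemma genus_reps K : lattice K -> exists Hs, class_reps K Hs.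
Proof.
move=> lK; pose M := absz (15 * (\det K) ^+ 2)%R.
have finB := finite_box 3 3 M.
apply: (@reps_bound _ _ _ _ _ (ncard [set A : 'M[int]_3 | forall i j, `|A i j| <= M%:Z])).
- by move=> x _; apply: isometric_refl.
- by move=> x y _ _; apply: isometric_sym.
move=> s; apply: indep_cover => //.
- by move=> x y _ _; apply: isometric_sym.
- by move=> x y z _ _ _; apply: isometric_trans.
move=> H gH; have [H' iH bH] := lattice_bounded (genus_lattice gH).
exists H'; last by split=> //; apply: genus_isometric iH.
move=> i j; have := bH i j; rewrite (genus_det lK gH) => h; apply: le_trans h _.
by rewrite /M abszE ler_norm.
Qed.

Lemma lattice_CS n (G : 'M[int]_n) x y : lattice G ->
  (bform G x y) ^+ 2 <= qform G x * qform G y.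
Proof.
move=> lG; have [sG _] := lG; have [->|y0] := eqVneq y 0.
  by rewrite bform0r qform0 mulr0 expr0n.
have := lattice_ge0 (qform G y *: x - bform G x y *: y) lG.
rewrite qformD // qformZ qformN qformZ bformNr bformZl bformZr.
rewrite (_ : _ + _ = qform G y * (qform G x * qform G y - bform G x y ^+ 2)); last by ring.
by rewrite pmulr_rge0 ?lattice_gt0 // subr_ge0.
Qed.

Lemma finite_short G (N : int) : lattice G ->
  finite_set [set x | qform G x <= N].
Proof.
move=> lG; have D0 := lattice_det_gt0 lG.
pose M := (\sum_(i < 3) absz (N * qform G (row i (\adj G)))%R)%N.
apply: sub_finite_set (finite_box 1 3 M) => x /= Qx i j; rewrite ord1 {i}.
have Ej : x 0 j * \det G = bform G x (row j (\adj G)).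
  have [sG _] := lG; rewrite /bform tr_row trmx_adj sG colE mulmxA -[x *m G *m _]mulmxA.
  by rewrite mul_mx_adj mul_mx_scalar -scalemxAl mxE -colE mxE mulrC.
have := lattice_CS x (row j (\adj G)) lG; rewrite -Ej => H.
have Mj : N * qform G (row j (\adj G)) <= M%:Z.
  apply: le_trans (ler_norm _) _; rewrite -abszE lez_nat /M (bigD1 j) //=.
  exact: leq_addr.
have CS : (x 0 j * \det G) ^+ 2 <= M%:Z.
  apply: le_trans H _; apply: le_trans Mj; apply: ler_wpM2r => //.
  exact: lattice_ge0.
apply: le_trans CS; have [->|x0] := eqVneq (x 0 j) 0.
  by rewrite normr0 sqr_ge0.
rewrite -real_normK ?num_real // normrM (gtr0_norm D0).
have : 1 <= `|x 0 j| by rewrite -gtz0_ge1 normr_gt0.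
have : 1 <= \det G by lia.
move: `|x 0 j| (\det G) => u v v1 u1.
have : u <= u * v by rewrite ler_peMr //; lia.
move=> uv; apply: le_trans uv _; rewrite expr2 ler_peMr //; last by lia.
by have := ler_pM (_ : 0 <= 1) (_ : 0 <= 1) u1 v1; rewrite mulr1; lia.
Qed.

Lemma finite_vec G (N : int) : lattice G -> finite_set [set x | qform G x = N].
Proof.
by move=> lG; apply: sub_finite_set (finite_short N lG) => _ /= ->.
Qed.

Lemma finite_ortho G : lattice G -> finite_set (Defs.ortho G).
Proof.
move=> lG.
pose F (t : 'rV[int]_3 * 'rV[int]_3 * 'rV[int]_3) : 'M[int]_3 :=
  \matrix_(i, j) nth 0 [:: t.1.1; t.1.2; t.2] i 0 j.
pose V (i : 'I_3) := [set x | qform G x = G i i].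
apply: (@sub_finite_set _ _ (F @` (V o0 `*` V o1 `*` V o2))); last first.
  by apply: finite_image; apply: finite_setX; [apply: finite_setX|]; apply: finite_vec.
move=> U [_ E]; exists (row o0 U, row o1 U, row o2 U).
  by split; [split|]; rewrite /V /= !rowE -qform_conj E /qform bform_delta.
by apply/matrixP; apply: I3P => j; rewrite !mxE.
Qed.

(** * Involutions and reflections *)

Definition involutions n (G : 'M[int]_n) : set 'M[int]_n :=
  [set U | Defs.ortho G U /\ U *m U = 1%:M].

(* The reflection in a primitive vector v preserves the lattice exactly when  *)
(* 2 B(v, -) / Q(v) is integral.                                              *)
Definition reflvec G : set 'rV[int]_3 :=
  [set v | primitive_vec v /\ exists c : 'rV[int]_3, 2 *: (v *m G) = qform G v *: c].

Lemma rank_le1_outer (A : 'M[int]_3) : (\rank (ext rat A) <= 1)%N ->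
  exists k v : 'rV[int]_3, primitive_vec v /\ A = k^T *m v.
Proof.
have [L [R [a [b [c [uL uR dab dbc ->]]]]]] := smith3 A => rk.
have [b0 c0] : b = 0 /\ c = 0.
  suff b0 : b = 0 by split=> //; move: dbc; rewrite b0 dvd0z => /eqP.
  apply: contraTeq rk => b0; rewrite -ltnNge.
  have a0 : a != 0 by apply: contraNneq b0 => a0; move: dab; rewrite a0 dvd0z.
  rewrite !ext_mul mxrankMfree ?row_free_unit ?unitmx_ext // -mxrank_tr trmx_mul.
  rewrite mxrankMfree ?row_free_unit ?unitmx_tr ?unitmx_ext // mxrank_tr ext_mx3.
  set S := mx3 _ _ _ _ _ _ _ _ _; pose C : 'M[rat]_3 := (1 - c%:~R) *: delta_mx o2 o2.
  have uSC : S + C \in unitmx.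
    have -> : S + C = mx3 a%:~R 0 0 0 b%:~R 0 0 0 1.
      by apply/matrixP; apply: I3P; apply: I3P; rewrite !mxE //= ?mulr0 ?addr0 // mulr1 addrC subrK.
    by rewrite unitmxE det_mx3 unitfE !(mul0r, mulr0, subr0, addr0, mulr1) mulf_neq0 ?intr_eq0.
  have := mxrank_add S C; rewrite (mxrank_unit uSC).
  have : (\rank C <= 1)%N by apply: leq_trans (mxrank_scale _ _) _; rewrite mxrank_delta.
  by clear; lia.
exists (a *: (col o0 L)^T), (row o0 R); split; first by exists R.
rewrite b0 c0 linearZ /= trmxK -scalemxAl.
apply/matrixP => i j; rewrite !mxE sum_ord3 !mxE !sum_ord3 !mxE big_ord1 !mxE.
by rewrite /= !mulr0 !addr0 !mul0r !addr0; ring.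
Qed.

Lemma outer_involution (R : idomainType) n (k v : 'rV[R]_n) (U : 'M[R]_n) :
  U = 1%:M - k^T *m v -> U *m U = 1%:M -> U != 1%:M -> v *m k^T = 2%:M.
Proof.
move=> -> U2 nU; have kv0 : k^T *m v != 0 by apply: contra nU => /eqP ->; rewrite subr0.
move: U2; rewrite mulmxBl mul1mx mulmxBr mulmx1 mulmxA -[k^T *m v *m _]mulmxA.
rewrite [v *m k^T]mx11_scalar mul_mx_scalar -scalemxAl; set x := (v *m k^T) 0 0.
rewrite -addrA -[RHS]addr0 => /addrI; rewrite opprB addrCA -opprD -mulr2n -scaler_nat -scalerBl =>
  /eqP.
move/eqP => E; congr (_%:M); apply/eqP; rewrite -subr_eq0; apply: contraNT kv0 => x2.
by apply/eqP/(scalemx_inj x2); rewrite E scaler0.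
Qed.

Section Reflections.
Variable G : 'M[int]_3.
Hypothesis lG : lattice G.
Let sG : G^T = G. Proof. by case: lG. Qed.

Definition coroot (v : 'rV[int]_3) : 'rV[int]_3 :=
  xget 0 [set c | 2 *: (v *m G) = qform G v *: c].
Definition refl v : 'M[int]_3 := 1%:M - (coroot v)^T *m v.

Lemma reflvec_neq0 v : reflvec G v -> v != 0.
Proof. by case=> /primitive_vec_neq0. Qed.

Lemma corootP v : reflvec G v -> 2 *: (v *m G) = qform G v *: coroot v.
Proof. by move=> [_ [c Hc]]; rewrite /coroot; case: xgetP => [_ _ //|/(_ c)]. Qed.

Lemma reflvec_gt0 v : reflvec G v -> 0 < qform G v.
Proof. by move=> /reflvec_neq0; apply: lattice_gt0. Qed.

Lemma coroot_mul v x : reflvec G v -> qform G v * (x *m (coroot v)^T) 0 0 = 2 * bform G x v.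
Proof.
move=> sv.
have -> : qform G v * (x *m (coroot v)^T) 0 0 = (x *m (qform G v *: coroot v)^T) 0 0.
  by rewrite linearZ /= -scalemxAr [in RHS]mxE.
rewrite -corootP // linearZ /= -scalemxAr [in LHS]mxE; congr (_ * _).
by rewrite /bform trmx_mul sG mulmxA.
Qed.

Lemma coroot2 v : reflvec G v -> v *m (coroot v)^T = 2%:M.
Proof.
move=> sv; rewrite [LHS]mx11_scalar; congr (_%:M).
apply: (mulfI (lt0r_neq0 (reflvec_gt0 sv))).
by rewrite coroot_mul // mulrC.
Qed.

Lemma refl_sqr v : reflvec G v -> refl v *m refl v = 1%:M.
Proof.
move=> sv; rewrite /refl; set c := (coroot v)^T.
rewrite mulmxBl mul1mx mulmxBr mulmx1 mulmxA -[c *m v *m c]mulmxA coroot2 //.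
rewrite mul_mx_scalar -scalemxAl scaler_nat mulr2n.
have -> : c *m v - (c *m v + c *m v) = - (c *m v) by rewrite opprD addrA subrr sub0r.
by rewrite opprK subrK.
Qed.

Lemma sqr1_unit (U : 'M[int]_3) : U *m U = 1%:M -> U \in unitmx.
Proof. by move=> E; have [] := mulmx1_unit E. Qed.

Lemma refl_ortho v : reflvec G v -> involutions G (refl v).
Proof.
move=> sv; have S2 := refl_sqr sv; split=> //; split; first exact: sqr1_unit.
suff E : refl v *m G = G *m (refl v)^T by rewrite E -mulmxA -trmx_mul S2 trmx1 mulmx1.
rewrite /refl linearB /= trmx1 mulmxBl mulmxBr mul1mx mulmx1 trmx_mul trmxK.
congr (_ - _); set c := coroot v.
have E2 := corootP sv; have q0 := lt0r_neq0 (reflvec_gt0 sv).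
apply: (@scalemx_inj _ _ _ (2 : int)) => //; rewrite -mulmxA scalemxAr E2 -scalemxAr mulmxA.
have -> : G *m v^T = (v *m G)^T by rewrite trmx_mul sG.
have -> : 2 *: ((v *m G)^T *m c) = (2 *: (v *m G))^T *m c by rewrite linearZ /= scalemxAl.
by rewrite E2 linearZ /= -scalemxAl.
Qed.

Lemma mxtrace_refl v : reflvec G v -> \tr (refl v) = 1.
Proof.
move=> sv; rewrite /refl linearB /= mxtrace1 mxtrace_mulC coroot2 //.
by rewrite mxtrace_scalar.
Qed.

Lemma refl_inj v w : reflvec G v -> reflvec G w -> refl v = refl w -> w = v \/ w = - v.
Proof.
move=> sv sw /addrI/oppr_inj E.
have /(congr1 (mulmx v)) := E; rewrite !mulmxA coroot2 // mul_scalar_mx.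
rewrite [v *m _]mx11_scalar mul_scalar_mx => E2.
apply: (primitive_vec_collinear sv.1 sw.1 E2); apply: contra (reflvec_neq0 sv) => /eqP l0.
by apply/eqP/(@scalemx_inj _ _ _ (2 : int)); rewrite // E2 l0 scale0r scaler0.
Qed.

Lemma coroot_uniq v k : reflvec G v -> 2 *: (v *m G) = qform G v *: k -> coroot v = k.
Proof.
move=> sv; rewrite corootP //; apply: scalemx_inj.
exact: lt0r_neq0 (reflvec_gt0 sv).
Qed.

Lemma rank_one_refl (U : 'M[int]_3) : involutions G U -> (\rank (ext rat (1%:M - U)) <= 1)%N ->
  U != 1%:M -> exists2 v, reflvec G v & U = refl v.
Proof.
move=> [[_ oU] U2] /rank_le1_outer[k [v [pv Ek]]] nU.
have EU : U = 1%:M - k^T *m v by rewrite -Ek opprB addrC subrK.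
have vk := outer_involution EU U2 nU.
have kG : 2 *: (v *m G) = qform G v *: k.
  have UG : U *m G = G *m U^T.
    by rewrite -{2}oU -!mulmxA -[X in _ *m (_ *m X)]trmx_mul U2 trmx1 mulmx1.
  move: UG; rewrite EU linearB /= trmx1 mulmxBl mulmxBr mul1mx mulmx1 trmx_mul trmxK.
  move=> /addrI/oppr_inj /(congr1 (mulmx v)); rewrite !mulmxA vk mul_scalar_mx.
  rewrite -scalemxAl => ->.
  by rewrite [X in X *m k]mx11_scalar mul_scalar_mx.
have sv : reflvec G v by split=> //; exists k.
by exists v => //; rewrite /refl (coroot_uniq sv kG).
Qed.

Definition posvec (v : 'rV[int]_3) : bool :=
  if v 0 o0 != 0 then 0 < v 0 o0 else if v 0 o1 != 0 then 0 < v 0 o1 else 0 < v 0 o2.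

Lemma posvecN v : v != 0 -> posvec (- v) = ~~ posvec v.
Proof.
rewrite [v]rv3E; move: (v 0 o0) (v 0 o1) (v 0 o2) => x y z; rewrite opp_rv3 => nz.
have : [|| x != 0, y != 0 | z != 0].
  apply: contraNT nz; rewrite !negb_or !negbK => /and3P[/eqP-> /eqP-> /eqP->].
  by rewrite rv3_0.
rewrite /posvec !mxE /= !oppr_eq0; case: eqP => [->|] /=; [case: eqP => [->|] /=|]; lia.
Qed.

Lemma reflvecN v : reflvec G v -> reflvec G (- v).
Proof.
move=> [pv [c Hc]]; split; first exact: primitive_vecN.
by exists (- c); rewrite qformN mulNmx !scalerN Hc.
Qed.

Lemma corootN v : reflvec G v -> coroot (- v) = - coroot v.
Proof.
move=> sv; apply: coroot_uniq; first exact: reflvecN.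
by rewrite qformN mulNmx !scalerN corootP.
Qed.

Lemma reflN v : reflvec G v -> refl (- v) = refl v.
Proof. by move=> sv; rewrite /refl corootN // [(- _)^T]linearN /= mulNmx mulmxN opprK. Qed.

Lemma finite_reflvec : finite_set (reflvec G).
Proof.
pose D := \det G.
have D0 := lattice_det_gt0 lG.
apply: sub_finite_set (finite_short (2 * D) lG) => v sv /=.
have := congr1 (mulmx^~ (\adj G)) (corootP sv).
rewrite -scalemxAl -mulmxA mul_mx_adj mul_mx_scalar scalerA -scalemxAl => E.
have [j [Ej _]] := primitive_vec_dvd sv.1 E (lt0r_neq0 (reflvec_gt0 sv)).
have q0 := reflvec_gt0 sv.
have j0 : 0 < j by rewrite -(pmulr_rgt0 _ q0) -Ej mulr_gt0.
by rewrite /D Ej ler_peMr // ?ltW //; lia.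
Qed.

Definition srefl v := if posvec v then refl v else - refl v.

Lemma involutions1 : involutions G 1%:M.
Proof. by split; [split; rewrite ?unitmx1 // trmx1 mul1mx mulmx1 | rewrite mul1mx]. Qed.

Lemma involutionsN U : involutions G U -> involutions G (- U).
Proof.
move=> [[uU oU] U2]; split; last by rewrite mulmxN mulNmx opprK.
by split; [rewrite unitmxN | rewrite linearN /= mulmxN !mulNmx opprK].
Qed.

Lemma mxtrace_srefl v : reflvec G v -> \tr (srefl v) = if posvec v then 1 else -1.
Proof. by move=> sv; rewrite /srefl; case: ifP => _; rewrite ?linearN /= mxtrace_refl. Qed.

Lemma sreflN v : reflvec G v -> srefl (- v) = - srefl v.
Proof.
move=> sv; rewrite /srefl posvecN ?(reflvec_neq0 sv) // reflN //.
by case: (posvec v); rewrite ?opprK.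
Qed.

Lemma srefl_neq1 v : reflvec G v -> srefl v != 1%:M.
Proof.
move=> sv; apply/eqP => /(congr1 mxtrace); rewrite mxtrace_srefl // mxtrace1.
by case: ifP.
Qed.

Lemma srefl_inj v w : reflvec G v -> reflvec G w -> srefl v = srefl w -> v = w.
Proof.
move=> sv sw E; have pvw : posvec v = posvec w.
  by have := congr1 mxtrace E; rewrite !mxtrace_srefl //; do 2 case: (posvec _).
have : refl v = refl w by move: E; rewrite /srefl pvw; case: ifP => // _ /oppr_inj.
case/refl_inj => // Ew; move: pvw; rewrite Ew // posvecN ?(reflvec_neq0 sv) //.
by case: (posvec v).
Qed.

Lemma involutionsP U : involutions G U <-> U = 1%:M \/ U = - 1%:M \/ exists2 v,
  reflvec G v & U = srefl v.
Proof.
split=> [iU|[->|[->|[v sv ->]]]]; last first.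
- by have iS := refl_ortho sv; rewrite /srefl; case: ifP => _ //; exact: involutionsN.
- exact/involutionsN/involutions1.
- exact: involutions1.
have [->|n1] := eqVneq U 1%:M; [by left | right].
have [->|n2] := eqVneq U (- 1%:M); [by left | right].
have refl_sinv v : reflvec G v -> refl v = srefl v \/ refl v = srefl (- v).
  by move=> sv; rewrite sreflN // /srefl; case: (posvec v); rewrite ?opprK; [left|right].
have [_ U2] := iU; have : (1%:M - U) *m (1%:M - (- U)) = 0.
  by rewrite opprK mulmxBl mul1mx mulmxDr mulmx1 U2 [U + _]addrC subrr.
move/(congr1 (ext rat)); rewrite ext_mul [ext rat 0]map_mx0 => /mulmx0_rank_max.
have [r1 _|r1 rk] := leqP (\rank (ext rat (1%:M - U))) 1.
  have [v sv ->] := rank_one_refl iU r1 n1.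
  by case: (refl_sinv v sv) => ->; [exists v|exists (- v) => //; apply: reflvecN].
have nU : - U != 1%:M by apply: contra n2 => /eqP <-; rewrite opprK.
have [|v sv Ev] := rank_one_refl (involutionsN iU) _ nU; first by move: r1 rk; clear; lia.
rewrite -[U]opprK Ev; case: (refl_sinv v sv) => ->; last by exists v; rewrite ?sreflN ?opprK.
by exists (- v); [apply: reflvecN|rewrite sreflN].
Qed.

Lemma ncard_involutions : ncard (involutions G) = (ncard (reflvec G)).+2.
Proof.
have [s us Gs] := finite_enum finite_reflvec.
pose t := 1%:M :: (- 1%:M) :: [seq srefl v | v <- s].
have ut : uniq t.
  rewrite /t /= !inE !negb_or -!andbA; apply/and4P; split.
  - by apply/eqP => /(congr1 mxtrace); rewrite linearN /= mxtrace1.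
  - by apply/mapP => -[v /Gs sv E]; have /eqP[] := srefl_neq1 sv.
  - apply/mapP => -[v /Gs sv E]; have /eqP[] := srefl_neq1 (reflvecN sv).
    by rewrite sreflN // -E opprK.
  by rewrite map_inj_in_uniq // => v w /Gs sv /Gs sw; apply: srefl_inj.
have Gt U : involutions G U <-> U \in t.
  rewrite involutionsP /t !inE;
    split=> [[->|[->|[v /Gs sv ->]]]|/or3P[/eqP|/eqP|/mapP[v /Gs sv]] ->].
  - by rewrite eqxx.
  - by rewrite eqxx orbT.
  - by rewrite map_f ?orbT.
  - by left.
  - by right; left.
  - by right; right; exists v.
by rewrite (ncard_seq us Gs) (ncard_seq ut Gt) /= size_map.
Qed.

Lemma refl_comm v w : reflvec G v -> reflvec G w -> refl v *m refl w = refl w *m refl v ->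
  [\/ w = v, w = - v | bform G v w = 0].
Proof.
move=> sv sw; set c := (coroot v)^T; set d := (coroot w)^T.
pose x := (v *m d) 0 0; pose y := (w *m c) 0 0 => E.
have Exy : x *: (c *m w) = y *: (d *m v).
  have e1 (a b : 'cV[int]_3) (p r : 'rV[int]_3) :
      (1%:M - a *m p) *m (1%:M - b *m r) = 1%:M - a *m p - b *m r + ((p *m b) 0 0) *: (a *m r).
    rewrite mulmxBl mul1mx mulmxBr mulmx1 mulmxA -[a *m p *m b]mulmxA [p *m b]mx11_scalar.
    by rewrite mul_mx_scalar -scalemxAl !mxE /= mulr1n; apply/matrixP => i j; rewrite !mxE; ring.
  by move: E; rewrite /refl !e1 -/c -/d -/x -/y [1%:M - d *m w - _]addrAC => /addrI.
have [b0|b0] := eqVneq (bform G v w) 0; first by constructor 3.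
have /(congr1 (mulmx v)) := Exy; rewrite -!scalemxAr !mulmxA coroot2 // -/d.
rewrite [v *m d]mx11_scalar -/x !mul_scalar_mx !scalerA => E2.
have x0 : x != 0.
  have := coroot_mul v sw; rewrite -/d -/x => H; apply: contraNneq b0 => x0.
  by move: H; rewrite x0 mulr0 => /esym/eqP; rewrite mulf_eq0.
have [||] := primitive_vec_collinear sv.1 sw.1 (esym E2);
  [by rewrite mulf_neq0 | by constructor 1 | by constructor 2].
Qed.

End Reflections.

Lemma orthogonal_le3 G (s : seq 'rV[int]_3) : lattice G ->
  uniq s -> (forall v, v \in s -> v != 0) ->
  (forall v w, v \in s -> w \in s -> v != w -> bform G v w = 0) -> (size s <= 3)%N.
Proof.
move=> lG us nz orth; rewrite leqNgt; apply/negP => s4.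
pose A : 'M[rat]_(size s, 3) := \matrix_(i, j) (s`_i 0 j)%:~R.
have : (\rank A <= 3)%N by apply: rank_leq_col.
move=> rA; have : kermx A != 0.
  by rewrite -mxrank_eq0 mxrank_ker subn_eq0 -ltnNge (leq_ltn_trans rA).
case/rowV0Pn => k /sub_kermxP kA k0.
case/negP: k0; apply/eqP/rowP => j; rewrite mxE.
have sj : s`_j \in s by rewrite mem_nth.
have : (k *m A *m ext rat G *m (map_mx intr s`_j)^T) 0 0 = 0 by rewrite kA !mul0mx mxE.
have Eb i : (row i A *m ext rat G *m (map_mx intr s`_j)^T) 0 0 = (bform G s`_i s`_j)%:~R.
  have -> : row i A = map_mx intr s`_i by apply/rowP => l; rewrite !mxE.
  exact: map_bform.
have -> : k *m A = \sum_i k 0 i *: row i A by rewrite mulmx_sum_row.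
rewrite !mulmx_suml summxE (bigD1 j) //= big1 ?addr0; last first.
  move=> i ij; rewrite -!scalemxAl mxE Eb orth ?mem_nth ?mulr0 //.
  by rewrite nth_uniq.
rewrite -!scalemxAl mxE Eb => /eqP; rewrite mulf_eq0 => /orP[/eqP //|].
rewrite intr_eq0 => /eqP H; have := lattice_gt0 lG (nz _ sj).
by rewrite /qform H ltxx.
Qed.

Lemma involutive_le8 G : lattice G ->
  (forall U, Defs.ortho G U -> U *m U = 1%:M) -> (ncard (reflvec G) <= 6)%N.
Proof.
move=> lG allinv; have [s us Gs] := finite_enum (finite_reflvec lG).
rewrite (ncard_seq us Gs).
have comm U V : Defs.ortho G U -> Defs.ortho G V -> U *m V = V *m U.
  move=> oU oV; have [uU eU] := oU; have [uV eV] := oV.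
  have oUV : Defs.ortho G (U *m V).
    by split; rewrite ?unitmx_mul ?uU // trmx_mul !mulmxA -[U *m V *m G]mulmxA
      -[U *m (_ *m _) *m _]mulmxA eV.
  have := allinv _ oUV; rewrite mulmxA => /(congr1 (mulmx^~ V)).
  rewrite -mulmxA (allinv _ oV) mulmx1 mul1mx => /(congr1 (mulmx U)).
  by rewrite !mulmxA (allinv _ oU) mul1mx.
pose p := [seq v <- s | posvec v]; pose n := [seq v <- s | ~~ posvec v].
have -> : size s = (size p + size n)%N by rewrite !size_filter count_predC.
have bound (a : pred 'rV[int]_3) : (forall v, reflvec G v -> a v -> a (- v) = false) ->
    (size [seq v <- s | a v] <= 3)%N.
  move=> aN; apply: (orthogonal_le3 lG); first exact: filter_uniq.
    by move=> v; rewrite mem_filter => /andP[_ /Gs]; apply: reflvec_neq0.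
  move=> v w; rewrite !mem_filter => /andP[av /Gs sv] /andP[aw /Gs sw] vw.
  have [oS _] := refl_ortho lG sv; have [oT _] := refl_ortho lG sw.
  case: (refl_comm lG sv sw (comm _ _ oS oT)) => // E.
    by rewrite E eqxx in vw.
  by move: aw; rewrite E aN.
apply: (@leq_trans (3 + 3)) => //; apply: leq_add; apply: bound => v sv.
  by move=> pv; rewrite posvecN ?(reflvec_neq0 sv) // pv.
by move=> /negPf pv /=; rewrite posvecN ?(reflvec_neq0 sv) // pv.
Qed.

(** * Orders of the isometry groups *)

Lemma ortho_conj n (G H : 'M[int]_n) (V : 'M[int]_n) : V \in unitmx -> V *m G *m V^T = H ->
  forall U, Defs.ortho G U -> Defs.ortho H (V *m U *m invmx V).
Proof.
move=> uV <- U [uU EU]; split; first by rewrite !unitmx_mul unitmx_inv uU uV.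
rewrite !trmx_mul !mulmxA mulmxKV // -[in RHS]EU.
by rewrite -!mulmxA [in LHS](mulmxA V^T) -trmx_mul mulVmx // trmx1 mul1mx.
Qed.

Lemma ncard_ortho_isometric G H : lattice G -> isometric G H ->
  ncard (Defs.ortho G) = ncard (Defs.ortho H) /\ ncard (involutions G) = ncard (involutions H).
Proof.
move=> lG [V uV E].
have uV' : invmx V \in unitmx by rewrite unitmx_inv.
have E' : invmx V *m H *m (invmx V)^T = G.
  by rewrite -E !mulmxA mulVmx // mul1mx trmx_inv mulmxK // unitmx_tr.
have K1 U : invmx V *m (V *m U *m invmx V) *m invmx (invmx V) = U.
  by rewrite invmxK !mulmxA mulVmx // mul1mx mulmxKV.
have K2 U : V *m (invmx V *m U *m invmx (invmx V)) *m invmx V = U.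
  by rewrite invmxK !mulmxA mulmxV // mul1mx mulmxK.
have sq (W U : 'M[int]_3) : W \in unitmx -> U *m U = 1%:M ->
    (W *m U *m invmx W) *m (W *m U *m invmx W) = 1%:M.
  by move=> uW UU; rewrite !mulmxA mulmxKV // -[W *m U *m U]mulmxA UU mulmx1 mulmxV.
have fO := finite_ortho lG.
split.
  apply: (@ncard_bij _ _ _ _ (fun U => V *m U *m invmx V)
          (fun U => invmx V *m U *m invmx (invmx V))) => // U.
  - exact: ortho_conj.
  - exact: ortho_conj.
apply: (@ncard_bij _ _ _ _ (fun U => V *m U *m invmx V)
          (fun U => invmx V *m U *m invmx (invmx V))) => //.
- by apply: sub_finite_set fO => U [].
- by move=> U [oU UU]; split; [exact: ortho_conj oU | exact: sq].
- by move=> U [oU UU]; split; [exact: ortho_conj oU | exact: sq].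
Qed.

(** ** Rotations of order greater than two *)

Lemma bin_reduce (b f c : int) : 0 < b -> 0 < b * c - f ^+ 2 ->
  exists p q r t : int, let b' := p ^+ 2 * b + 2 * p * q * f + q ^+ 2 * c in
    let c' := r ^+ 2 * b + 2 * r * t * f + t ^+ 2 * c in
    let f' := p * r * b + (p * t + q * r) * f + q * t * c in
    [/\ (p * t - q * r) ^+ 2 = 1, 0 < b', `|2 * f'| <= b' & b' <= c'].
Proof.
move=> b0 D0.
pose B (p q : int) := p ^+ 2 * b + 2 * p * q * f + q ^+ 2 * c.
have Bpos p q : (p != 0) || (q != 0) -> 0 < B p q.
  move=> pq; rewrite -(pmulr_rgt0 _ b0).
  have -> : b * B p q = (p * b + q * f) ^+ 2 + q ^+ 2 * (b * c - f ^+ 2) by rewrite /B; ring.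
  have [q0|q0] := eqVneq q 0.
    by move: pq; rewrite q0 eqxx orbF => p0;
      rewrite mul0r addr0 expr0n /= mul0r addr0 exprn_even_gt0 //= mulf_neq0 // gt_eqF.
  by apply: ltr_wpDl; rewrite ?sqr_ge0 // mulr_gt0 // exprn_even_gt0.
pose P n := exists p q r t : int, (p * t - q * r) ^+ 2 = 1 /\ B p q = n%:Z.
have [n [[p [q [r [t [dt En]]]]] mn]] : exists n, P n /\ forall m, P m -> (n <= m)%N.
  apply: ex_min_nat; exists `|b|%N, 1, 0, 0, 1; split; first by [].
  by rewrite gtz0_abs // /B; ring.
have pq0 (p' q' r' t' : int) : (p' * t' - q' * r') ^+ 2 = 1 -> (p' != 0) || (q' != 0).
  by apply: contra_eqT; rewrite negb_or !negbK => /andP[/eqP-> /eqP->]; rewrite !mul0r subrr expr0n.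
have n0 : 0 < n%:Z by rewrite -En; apply: Bpos; apply: pq0 dt.
have [j Hj] := round_ex (p * r * b + (p * t + q * r) * f + q * t * c) n0.
have dt' : (p * (t - j * q) - q * (r - j * p)) ^+ 2 = 1 by rewrite -dt; ring.
exists p, q, (r - j * p), (t - j * q); split=> //.
- by rewrite -/(B p q) En.
- rewrite -/(B p q) En; apply: le_trans Hj; rewrite le_eqVlt; apply/orP; left.
  by apply/eqP; congr `|_|; rewrite -En /B; ring.
- rewrite -/(B p q) -/(B (r - j * p) (t - j * q)) En.
  have dt2 : ((r - j * p) * q - (t - j * q) * p) ^+ 2 = 1 by rewrite -dt; ring.
  have B0 : 0 < B (r - j * p) (t - j * q) by apply: Bpos; apply: pq0 dt2.
  have /mn : P (absz (B (r - j * p) (t - j * q))).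
    by exists (r - j * p), (t - j * q), p, q; rewrite gtz0_abs.
  by rewrite -lez_nat gtz0_abs.
Qed.

Definition rot3 (a b c d e f x y i j k l : int) :=
  mx3 1 x y 0 i j 0 k l *m smx3 a b c d e f *m (mx3 1 x y 0 i j 0 k l)^T = smx3 a b c d e f.

Lemma rotE a b c d e f x y i j k l : rot3 a b c d e f x y i j k l ->
  [/\ i * (d + x * b + y * f) + j * (e + x * f + y * c) = d,
      k * (d + x * b + y * f) + l * (e + x * f + y * c) = e,
      i ^+ 2 * b + 2 * i * j * f + j ^+ 2 * c = b,
      i * k * b + (i * l + j * k) * f + j * l * c = f
    & k ^+ 2 * b + 2 * k * l * f + l ^+ 2 * c = c].
Proof.
rewrite /rot3 tr_mx3 !mul_mx3 => E.
have [[_ E1 E2] [[_ E3 E4] [_ _ E5]]] := mx3_inj E.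
by split; [rewrite -[RHS]E1|rewrite -[RHS]E2|rewrite -[RHS]E3|rewrite -[RHS]E4|rewrite -[RHS]E5];
  ring.
Qed.

Lemma rotation_entries a b c d e f x y i j k l : i * l - j * k = 1 ->
  rot3 a b c d e f x y i j k l -> b * (l - i) = 2 * f * j /\ j * c = - (b * k).
Proof.
move=> dW' /rotE[_ _ R3 R4 _].
split.
  have : i * b + j * f - (b * l - f * j) =
     (i ^+ 2 * b + 2 * i * j * f + j ^+ 2 * c - b) * l
     - (i * k * b + (i * l + j * k) * f + j * l * c - f) * j
     - (i * b + f * j) * (i * l - j * k - 1) by ring.
  by rewrite R3 R4 dW' !subrr !mul0r mulr0 !subr0 => H; rewrite -[LHS]addr0 -[X in _ + X]H; ring.
have : f * i + j * c - (f * i - b * k) =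
   (i * k * b + (i * l + j * k) * f + j * l * c - f) * i
   - (i ^+ 2 * b + 2 * i * j * f + j ^+ 2 * c - b) * k
   - (f * i + j * c) * (i * l - j * k - 1) by ring.
by rewrite R3 R4 dW' !subrr !mul0r mulr0 !subr0 => H; rewrite -[RHS]addr0 -[X in _ + X]H; ring.
Qed.

(* Base change by 1 + V with V in GL_2(Z). *)
Lemma rot_conj a b c d e f x y i j k l p q r t : (p * t - q * r) ^+ 2 = 1 ->
  i * l - j * k = 1 -> rot3 a b c d e f x y i j k l ->
  exists x' y' i' j' k' l' d' e',
  let b' := p ^+ 2 * b + 2 * p * q * f + q ^+ 2 * c in
  let c' := r ^+ 2 * b + 2 * r * t * f + t ^+ 2 * c in
  let f' := p * r * b + (p * t + q * r) * f + q * t * c in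
  [/\ isometric (smx3 a b c d e f) (smx3 a b' c' d' e' f'),
      rot3 a b' c' d' e' f' x' y' i' j' k' l', i' * l' - j' * k' = 1 & i' + l' = i + l].
Proof.
move=> dt dW E; set s := p * t - q * r in dt.
pose V := mx3 1 0 0 0 p q 0 r t : 'M[int]_3.
pose V' := mx3 1 0 0 0 (s * t) (- s * q) 0 (- s * r) (s * p) : 'M[int]_3.
have VV' : V' *m V = 1%:M.
  by rewrite /V /V' mul_mx3 mx3_1; congr mx3; rewrite ?mul0r ?mulr0 ?addr0 ?add0r ?mul1r ?mulr1 //;
     rewrite -?dt /s; ring.
pose W := mx3 1 x y 0 i j 0 k l : 'M[int]_3.
pose G := smx3 a b c d e f.
have uV : V \in unitmx by have [_] := mulmx1_unit VV'.
have EG : V *m G *m V^T = smx3 a (p ^+ 2 * b + 2 * p * q * f + q ^+ 2 * c)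
   (r ^+ 2 * b + 2 * r * t * f + t ^+ 2 * c) (p * d + q * e) (r * d + t * e)
   (p * r * b + (p * t + q * r) * f + q * t * c).
  by rewrite /V /G tr_mx3 !mul_mx3; congr mx3; ring.
pose x' := s * (x * t - y * r); pose y' := s * (y * p - x * q).
pose i' := s * ((p * i + q * k) * t - (p * j + q * l) * r).
pose j' := s * ((p * j + q * l) * p - (p * i + q * k) * q).
pose k' := s * ((r * i + t * k) * t - (r * j + t * l) * r).
pose l' := s * ((r * j + t * l) * p - (r * i + t * k) * q).
have EW : V *m W *m V' = mx3 1 x' y' 0 i' j' 0 k' l'.
  by rewrite /V /V' /W !mul_mx3; congr mx3; rewrite /x' /y' /i' /j' /k' /l'; ring.
exists x', y', i', j', k', l', (p * d + q * e), (r * d + t * e).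
have ss : s * s = 1 by rewrite -expr2.
split.
- by exists V.
- rewrite /rot3 -EW -EG -/G !trmx_mul !mulmxA -[V *m W *m V' *m V]mulmxA VV' mulmx1.
  rewrite -[_ *m V^T *m V'^T]mulmxA -trmx_mul VV' trmx1 mulmx1.
  have E' : W *m G *m W^T = G := E.
  have -> : V *m W *m G *m W^T *m V^T = V *m (W *m G *m W^T) *m V^T by rewrite !mulmxA.
  by rewrite E'.
- transitivity (s * s * (s * s) * (i * l - j * k)); last by rewrite ss dW.
  by rewrite /i' /j' /k' /l' /s; ring.
- transitivity (s * s * (i + l)); last by rewrite ss mul1r.
  by rewrite /i' /l' /s; ring.
Qed.

Lemma lattice_plane a b c d e f : lattice (smx3 a b c d e f) -> 0 < b /\ 0 < b * c - f ^+ 2.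
Proof.
move=> lG; have iG : isometric (smx3 a b c d e f) (smx3 b c a f d e).
  isometry3 (mx3 0 1 0 0 0 1 1 0 0).
by have [] := lattice_minors (isometric_lattice iG lG).
Qed.

Lemma rotation_axis (G W : 'M[int]_3) : \det G != 0 -> Defs.ortho G W -> \det W = 1 ->
  exists2 w, primitive_vec w & W *m w^T = w^T.
Proof.
move=> D0 [_ oW] dW; have d0 : \det (W - 1%:M) = 0.
  have E : (W - 1%:M) *m G *m W^T = - (G *m (W - 1%:M)^T).
    by rewrite !mulmxBl mul1mx oW linearB /= trmx1 mulmxBr mulmx1 opprB.
  have dN : \det (- (G *m (W - 1%:M)^T)) = - (\det (W - 1%:M) * \det G).
    set A := G *m _; rewrite -[- A]scaleN1r detZ /A det_mulmx det_tr; ring.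
  have := congr1 determinant E; rewrite dN !det_mulmx det_tr dW mulr1 => H.
  have /eqP : 2 * \det (W - 1%:M) * \det G = 0.
    by rewrite -mulrA; move: (_ * _) H => z; clear; lia.
  by rewrite !mulf_eq0 (negPf D0) orbF /= => /eqP.
have /det0P[v v0 Ev] : \det (W - 1%:M)^T == 0 by rewrite det_tr d0.
have [w [n [pw vw]]] := primitive_vec_multiple v.
have n0 : n != 0 by apply: contraNneq v0 => n0; rewrite vw n0 scale0r.
exists w => //; apply/eqP; rewrite -subr_eq0 -{2}[w^T]mul1mx -mulmxBl; apply/eqP/trmx_inj.
by rewrite trmx_mul trmxK trmx0; apply: (scalemx_inj n0); rewrite scaler0 scalemxAl -vw Ev.
Qed.

Lemma rotation_basis (G W : 'M[int]_3) : lattice G -> Defs.ortho G W -> \det W = 1 ->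
  exists X a b c d e f x y i j k l, [/\ X \in unitmx, X *m G *m X^T = smx3 a b c d e f,
    X *m W *m invmx X = mx3 1 x y 0 i j 0 k l, rot3 a b c d e f x y i j k l & i * l - j * k = 1].
Proof.
move=> lG oW dW; have [sG _] := lG.
have [w [U uU wU] Ew] := rotation_axis (lt0r_neq0 (lattice_det_gt0 lG)) oW dW.
pose X := invmx U^T; have uX : X \in unitmx by rewrite unitmx_inv unitmx_tr.
have Xw : X *m w^T = (rv3 1 0 0)^T by rewrite wU row0E trmx_mul mulKmx ?unitmx_tr.
pose W' := X *m W *m invmx X.
have /fix_e0P[x [i [k [y [j [l EW]]]]]] : rv3 1 0 0 *m W'^T = rv3 1 0 0.
  apply: trmx_inj; rewrite trmx_mul trmxK.
  by rewrite /W' -Xw mulmxA mulmxKV // -mulmxA Ew.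
have {}EW : W' = mx3 1 x y 0 i j 0 k l by rewrite -[LHS]trmxK EW tr_mx3.
have [a [b [c [d [e [f EG]]]]]] := smx3P (congr_mx_sym X sG).
exists X, a, b, c, d, e, f, x, y, i, j, k, l; split=> //.
  by have [_] := ortho_conj uX EG oW; rewrite -/W' EW.
have : \det W' = 1 by rewrite /W' !det_mulmx dW mulr1 -det_mulmx mulmxV // det1.
by rewrite EW det_mx3 => <-; ring.
Qed.

Lemma rot_involution a b c d e f x y i j k l : lattice (smx3 a b c d e f) ->
  rot3 a b c d e f x y i j k l -> i * l - j * k = 1 -> j = 0 ->
  mx3 1 x y 0 i j 0 k l *m mx3 1 x y 0 i j 0 k l = 1%:M.
Proof.
move=> lG R dW j0; have [b0 bc0] := lattice_plane lG.
have [R1 R2 _ _ _] := rotE R; have [P1 P2] := rotation_entries dW R.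
have k0 : k = 0.
  move: P2; rewrite j0 mul0r => /esym/eqP; rewrite oppr_eq0 mulf_eq0 (gt_eqF b0).
  by move/eqP.
have li : l = i.
  by move: P1; rewrite j0 mulr0 => /eqP; rewrite mulf_eq0 (gt_eqF b0) subr_eq0 => /eqP.
have i2 : i * i = 1 by rewrite -dW j0 li; ring.
have [i1|i1] : i = 1 \/ i = -1.
  have /eqP : (i - 1) * (i + 1) = 0 by transitivity (i * i - 1); [ring|rewrite i2].
  by rewrite mulf_eq0 subr_eq0 addr_eq0 => /orP[/eqP|/eqP]; auto.
- have e1 : x * b + y * f = 0 by move: R1; rewrite i1 j0 => H; rewrite -[RHS](subrr d) -{1}H; ring.
  have e2 : x * f + y * c = 0 by move: R2; rewrite k0 li i1 => H; rewrite -[RHS](subrr e) -{1}H;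
    ring.
  have y0 : y = 0.
    have /eqP : y * (b * c - f ^+ 2) = 0.
      by transitivity (b * (x * f + y * c) - f * (x * b + y * f));
        [ring|rewrite e1 e2 !mulr0 subrr].
    by rewrite mulf_eq0 (gt_eqF bc0) orbF => /eqP.
  have x0 : x = 0 by move/eqP: e1; rewrite y0 mul0r addr0 mulf_eq0 (gt_eqF b0) orbF => /eqP.
  by rewrite mul_mx3 mx3_1 x0 y0 k0 j0 li i1; congr mx3; ring.
- by rewrite mul_mx3 mx3_1 k0 j0 li i1; congr mx3; ring.
Qed.

Lemma rot_trace a b c d e f x y i j k l : 0 < b -> 0 < b * c - f ^+ 2 ->
  rot3 a b c d e f x y i j k l -> i * l - j * k = 1 -> j != 0 -> `|i + l| <= 1.
Proof.
move=> b0 bc0 R dW j0; have [P1 P2] := rotation_entries dW R.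
have trE : b ^+ 2 * ((i + l) ^+ 2 - 4) = - (4 * j ^+ 2 * (b * c - f ^+ 2)).
  transitivity ((b * (l - i)) ^+ 2 + 4 * b * j * (b * k) + 4 * b ^+ 2 * (i * l - j * k - 1));
    first by ring.
  rewrite P1 dW subrr mulr0 addr0.
  have -> : b * k = - (j * c) by rewrite P2 opprK.
  by ring.
have : (i + l) ^+ 2 < 4.
  rewrite -subr_lt0 -(pmulr_rlt0 _ (_ : 0 < b ^+ 2)); last by rewrite exprn_gt0.
  by rewrite trE oppr_lt0; do 2 apply: mulr_gt0 => //; rewrite exprn_even_gt0 ?j0.
by move: (i + l) => z; clear; nia.
Qed.

Lemma rot_shape (G W : 'M[int]_3) : lattice G -> Defs.ortho G W -> \det W = 1 ->
  W *m W != 1%:M -> exists a b c d e f x y i j k l,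
  [/\ isometric G (smx3 a b c d e f), rot3 a b c d e f x y i j k l, i * l - j * k = 1,
      j != 0 & `|i + l| <= 1].
Proof.
move=> lG oW dW W2.
have [X [a [b [c [d [e [f [x [y [i [j [k [l [uX EG EW R dil]]]]]]]]]]]]]] :=
  rotation_basis lG oW dW.
have iG : isometric G (smx3 a b c d e f) by exists X.
have lG' := isometric_lattice iG lG; have [b0 bc0] := lattice_plane lG'.
have j0 : j != 0.
  apply: contra W2 => /eqP j0; have := rot_involution lG' R dil j0; rewrite -EW !mulmxA => E.
  have <- : invmx X *m (X *m W *m invmx X *m X *m W *m invmx X) *m X = W *m W.
    by rewrite !mulmxA mulVmx // mul1mx !mulmxKV.
  by rewrite E mulmx1 mulVmx.
exists a, b, c, d, e, f, x, y, i, j, k, l; split=> //.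
exact: rot_trace R dil j0.
Qed.

Lemma sqfreez_sq (D p : int) : sqfreez D -> 0 < p -> (p ^+ 2 %| D)%Z -> p = 1.
Proof.
move=> sq p0 pD; have [//|p1] := eqVneq p 1.
have pr : prime (pdiv `|p|) by apply: pdiv_prime; lia.
have /negP[] := sq _ pr; apply: dvdz_trans pD.
by rewrite dvdzE absz_nat abszX dvdn_exp2r // pdiv_dvd.
Qed.

Lemma rot_sq a b c d e f x y i j k l : rot3 a b c d e f x y i j k l ->
  rot3 a b c d e f (x + x * i + y * k) (y + x * j + y * l)
    (i * i + j * k) (i * j + j * l) (k * i + l * k) (k * j + l * l).
Proof.
move=> E; rewrite /rot3; set W := mx3 1 x y 0 i j 0 k l; set W2 := mx3 _ _ _ _ _ _ _ _ _.
have -> : W2 = W *m W by rewrite /W /W2 mul_mx3; congr mx3; ring.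
have E' : W *m smx3 a b c d e f *m W^T = smx3 a b c d e f := E.
have -> : W *m W *m smx3 a b c d e f *m (W *m W)^T = W *m (W *m smx3 a b c d e f *m W^T) *m W^T.
  by rewrite trmx_mul !mulmxA.
by rewrite E' E'.
Qed.

(* The plane form fixed by a rotation is proportional to (-j, l - i, k). *)
Lemma rot_plane_form a b c d e f x y i j k l : rot3 a b c d e f x y i j k l ->
  i * l - j * k = 1 -> j != 0 -> exists B F C : int,
  [/\ 0 < 2 * B, 2 * B * (2 * C) - F ^+ 2 = 4 - (i + l) ^+ 2, f * (2 * B) = b * F
    & c * (2 * B) = b * (2 * C)].
Proof.
move=> R dW j0; have [P1 P2] := rotation_entries dW R.
have [jn|jp] := ltrP j 0.
  exists (- j), (i - l), k; split; first by lia.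
  - by transitivity (4 * (i * l - j * k) - (i + l) ^+ 2); [ring|rewrite dW].
  - by transitivity (- (2 * f * j)); [ring|rewrite -P1; ring].
  - by transitivity (- 2 * (j * c)); [ring|rewrite P2; ring].
exists j, (l - i), (- k); split; first by move: j0 jp; clear; lia.
- by transitivity (4 * (i * l - j * k) - (i + l) ^+ 2); [ring|rewrite dW].
- by transitivity (2 * f * j); [ring|rewrite -P1; ring].
- by transitivity (2 * (j * c)); [ring|rewrite P2; ring].
Qed.

Lemma bin_reduce_disc34 (B F C tau : int) : 0 < 2 * B ->
  2 * B * (2 * C) - F ^+ 2 = 4 - tau ^+ 2 -> tau = 0 \/ tau = -1 ->
  exists p q r t : int, [/\ (p * t - q * r) ^+ 2 = 1,
    p * r * (2 * B) + (p * t + q * r) * F + q * t * (2 * C) = tau,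
    p ^+ 2 * (2 * B) + 2 * p * q * F + q ^+ 2 * (2 * C) = 2 &
    r ^+ 2 * (2 * B) + 2 * r * t * F + t ^+ 2 * (2 * C) = 2].
Proof.
move=> B0 BC tauP.
have [|p [q [r [t [dt]]]]] := @bin_reduce _ F (2 * C) B0; first by rewrite BC; case: tauP => ->.
set B' := _ + _; set F' := _ + _; set C' := _ + _ => B'0 F'B0 BC'0.
have det' : B' * C' - F' ^+ 2 = 4 - tau ^+ 2.
  by transitivity ((p * t - q * r) ^+ 2 * (2 * B * (2 * C) - F ^+ 2));
    [rewrite /B' /C' /F'; ring|rewrite dt BC mul1r].
have [B'' EB''] : exists z, B' = 2 * z by exists (p ^+ 2 * B + p * q * F + q ^+ 2 * C);
  rewrite /B'; ring.
have [E1 E2 E3] : [/\ B' = 2, C' = 2 & F' = tau \/ F' = - tau].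
  clearbody B' C' F'; clear -tauP det' B'0 F'B0 BC'0 EB''; case: tauP det' => -> det'.
    have B1 : B' = 2 by nia.
    have F1 : F' = 0 by rewrite B1 in F'B0 det'; nia.
    by split; rewrite ?F1 //; [rewrite B1 F1 in det'; lia|left].
  have B1 : B' = 2 by nia.
  have F1 : F' = 1 \/ F' = -1 by subst B'; rewrite B1 in F'B0 det'; nia.
  by split => //; case: F1 => F1; rewrite ?B1 F1 in det' *; lia.
case: E3 => E3; first by exists p, q, r, t.
exists p, q, (- r), (- t); split=> //; first by rewrite -dt; ring.
  by transitivity (- F'); [rewrite /F'; ring | rewrite E3 opprK].
by rewrite -[RHS]E2 /C'; ring.
Qed.

Lemma rot_reduce a b c d e f x y i j k l : lattice (smx3 a b c d e f) ->
  rot3 a b c d e f x y i j k l ->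
  i * l - j * k = 1 -> j != 0 -> i + l = 0 \/ i + l = -1 ->
  exists b' f' d' e' x' y' i' j' k' l', [/\ isometric (smx3 a b c d e f) (smx3 a b' b' d' e' f'),
    rot3 a b' b' d' e' f' x' y' i' j' k' l', i' * l' - j' * k' = 1,
      i' + l' = i + l & 0 < b' /\ 2 * f' = (i + l) * b'].
Proof.
move=> lG R dW j0 tau.
have [B [F [C [B0 BC EF EC]]]] := rot_plane_form R dW j0.
have [p [q [r [t [dt F'm B'2 C'2]]]]] := bin_reduce_disc34 B0 BC tau.
have [x' [y' [i' [j' [k' [l' [d' [e' []]]]]]]]] := rot_conj dt dW R.
set b' := _ + _; set c' := _ + _; set f' := _ + _ => iG R' dW' tau'.
have Bn : 2 * B != 0 by rewrite gt_eqF.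
have Eb : 2 * B * b' = b * 2.
  rewrite -[X in b * X]B'2.
  transitivity (p ^+ 2 * b * (2 * B) + 2 * p * q * (f * (2 * B)) + q ^+ 2 * (c * (2 * B))).
    by rewrite /b'; ring.
  by rewrite EF EC; ring.
have Ec : c' = b'.
  apply: (mulfI Bn); rewrite Eb -[X in b * X]C'2.
  transitivity (r ^+ 2 * b * (2 * B) + 2 * r * t * (f * (2 * B)) + t ^+ 2 * (c * (2 * B))).
    by rewrite /c'; ring.
  by rewrite EF EC; ring.
have Ef : 2 * f' = (i + l) * b'.
  apply: (mulfI Bn); rewrite [RHS]mulrCA Eb -F'm.
  transitivity (2 * (p * r * b * (2 * B) + (p * t + q * r) * (f * (2 * B))
    + q * t * (c * (2 * B)))).
    by rewrite /f'; ring.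
  by rewrite EF EC; ring.
clearbody b' c' f'; rewrite Ec in iG R'; exists b', f', d', e', x', y', i', j', k', l'; split=> //.
by split=> //; exact: lattice_diag1 (isometric_lattice iG lG).
Qed.

Lemma rotation_trace1 a b c d e f x y i j k l : lattice (smx3 a b c d e f) ->
  sqfreez (\det (smx3 a b c d e f)) -> rot3 a b c d e f x y i j k l ->
  i * l - j * k = 1 -> j != 0 -> i + l = 0 ->
  exists n, isometric (smx3 a b c d e f) (smx3 n 1 1 0 0 0).
Proof.
move=> lG sq R dW j0 tau.
have [b' [f' [d' [e' [x' [y' [i' [j' [k' [l' [iG R' dW' tau' [b'0 Ef]]]]]]]]]]]] :=
  rot_reduce lG R dW j0 (or_introl tau).
have f0 : f' = 0 by move: Ef; rewrite tau mul0r; clear; lia.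
rewrite f0 in iG R'; have b'n : b' != 0 by rewrite gt_eqF.
have [P1' P2'] := rotation_entries dW' R'; have [R1 R2 _ _ _] := rotE R'.
have kj : k' = - j' by apply: (mulfI b'n); rewrite mulrN [b' * j']mulrC P2' opprK.
have li : l' = i' by apply/eqP; rewrite -subr_eq0; apply/eqP/(mulfI b'n); rewrite P1' !mulr0 mul0r.
have i0 : i' = 0 by move: tau'; rewrite li tau; clear; lia.
have jj : j' * j' = 1 by rewrite -dW' li kj i0; ring.
have E1 : d' = j' * (e' + y' * b') by rewrite -[LHS]R1 i0; ring.
have E2 : e' = - j' * (d' + x' * b') by rewrite -[LHS]R2 li i0 kj; ring.
have b1 : b' = 1.
  apply: (sqfreez_sq sq) => //; rewrite (isometric_det_int iG); apply/dvdzP.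
  exists (a - (j' * y' * (d' + j' * e') - e' * (j' * x' + y'))).
  have sqE : d' ^+ 2 + e' ^+ 2 = b' * (j' * y' * (d' + j' * e') - e' * (j' * x' + y')).
    have F1 : d' - j' * e' = j' * y' * b' by rewrite {1}E1; ring.
    have F2 : 2 * e' = - b' * (j' * x' + y').
      transitivity ((e' + j' * d') - j' * (d' - j' * e') + (1 - j' * j') * e'); first by ring.
      rewrite F1 jj subrr mul0r addr0 (_ : e' + j' * d' = - j' * x' * b' + (1 - j' * j') * 0).
        by rewrite !mulrA jj; ring.
      by rewrite {1}E2; ring.
    transitivity ((d' - j' * e') * (d' + j' * e') + e' * (2 * e') + (j' * j' - 1) * e' ^+ 2);
      first by ring.
    by rewrite F1 F2 jj subrr; ring.
  by rewrite det_mx3; transitivity (a * b' ^+ 2 - b' * (d' ^+ 2 + e' ^+ 2));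
    [ring|rewrite sqE; ring].
exists (a - d' ^+ 2 - e' ^+ 2); apply: isometric_trans iG _; rewrite b1.
isometry3 (mx3 1 (- d') (- e') 0 1 0 0 0 1).
Qed.

Lemma rot_order3_dvd (s d e x y i j : int) : j = 2 * i + 1 -> i = 0 \/ i = -1 ->
  i * (d + x * (2 * s) + y * - s) + j * (e + x * - s + y * (2 * s)) = d ->
  - j * (d + x * (2 * s) + y * - s) + (i - j) * (e + x * - s + y * (2 * s)) = e ->
  exists d1 e1, d = s * d1 /\ e = s * e1.
Proof.
have inj3 := mulfI (_ : 3 != 0 :> int).
move=> -> [] -> R1 R2.
- have Ee : e = s * (- y).
    apply: inj3 => //; have {}R1 : d - e = s * (2 * y - x) by rewrite -{1}R1; ring.
    have {}R2 : d + 2 * e = - s * (x + y) by transitivity (d + e + e); [ring|rewrite -{2}R2; ring].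
    by transitivity (d + 2 * e - (d - e)); [ring|rewrite R1 R2; ring].
  by exists (y - x), (- y); split=> //; rewrite -[LHS]R1 Ee; ring.
- have Ed : d = s * (- x).
    apply: inj3 => //; have {}R2 : e - d = s * (2 * x - y) by rewrite -{1}R2; ring.
    have {}R1 : e + 2 * d = - s * (x + y) by transitivity (e + d + d); [ring|rewrite -{2}R1; ring].
    by transitivity (e + 2 * d - (e - d)); [ring|rewrite R1 R2; ring].
  by exists (- x), (x - y); split=> //; rewrite -[LHS]R2 Ed; ring.
Qed.

Lemma hexagonal_shear (a d e : int) : exists n,
  isometric (smx3 a 2 2 d e (-1)) (smx3 n 2 2 0 0 (-1)) \/
  isometric (smx3 a 2 2 d e (-1)) (smx3 n 2 2 1 0 (-1)).
Proof.
have shear u v : isometric (smx3 a 2 2 d e (-1))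
    (smx3 (a + 2 * u * d + 2 * v * e + 2 * u ^+ 2 + 2 * v ^+ 2 - 2 * u * v)
      2 2 (d + 2 * u - v) (e - u + 2 * v) (-1)).
  isometry3 (mx3 1 u v 0 1 0 0 0 1).
have [v Hv] := round_ex (d + 2 * e) (isT : 0 < 3 :> int).
have := shear (e + 2 * - v) (- v).
have -> : e - (e + 2 * - v) + 2 * - v = 0 by ring.
have -> : d + 2 * (e + 2 * - v) - - v = d + 2 * e - v * 3 by ring.
move: Hv; set z := d + 2 * e - v * 3 => Hz.
have [->|[->|->]] : z = 0 \/ z = 1 \/ z = -1 by clear -Hz; lia.
- by move=> i1; eexists; left; exact: i1.
- by move=> i1; eexists; right; exact: i1.
- move=> i1; eexists; right; apply: isometric_trans i1 _.
  isometry3 (mx3 (-1) 0 0 0 1 0 0 0 1).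
Qed.

Lemma rotation_trace0 a b c d e f x y i j k l : lattice (smx3 a b c d e f) ->
  sqfreez (\det (smx3 a b c d e f)) -> rot3 a b c d e f x y i j k l ->
  i * l - j * k = 1 -> j != 0 -> i + l = -1 ->
  exists n, isometric (smx3 a b c d e f) (smx3 n 2 2 0 0 (-1)) \/
            isometric (smx3 a b c d e f) (smx3 n 2 2 1 0 (-1)).
Proof.
move=> lG sq R dW j0 tau.
have [b' [f' [d' [e' [x' [y' [i' [j' [k' [l' [iG R' dW' tau' [b'0 Ef]]]]]]]]]]]] :=
  rot_reduce lG R dW j0 (or_intror tau).
have [s bs fs] : exists2 s, b' = 2 * s & f' = - s by exists (- f'); move: Ef; rewrite tau; clear;
  lia.
rewrite bs fs in iG R'; have s0 : 0 < s by move: b'0; rewrite bs; clear; lia.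
have sn : s != 0 by rewrite gt_eqF.
have [P1' P2'] := rotation_entries dW' R'; have [R1 R2 _ _ _] := rotE R'.
have kj : k' = - j'.
  by apply: (mulfI sn); apply: (mulfI (_ : 2 != 0 :> int)) => //;
    rewrite !mulrN mulrA -[LHS]opprK -P2'; ring.
have li : l' = i' - j'.
  have : s * (l' - i' + j') = 0.
    apply: (mulfI (_ : 2 != 0 :> int)) => //; rewrite mulr0.
    by transitivity (2 * s * (l' - i') - 2 * - s * j'); [ring|rewrite P1' subrr].
  by move=> /eqP; rewrite mulf_eq0 (negPf sn) => /eqP; clear; lia.
have jE : j' = 2 * i' + 1 by rewrite tau in tau'; clear -tau' li; lia.
have icase : i' = 0 \/ i' = -1.
  have : 3 * (i' * (i' + 1)) = i' * l' - j' * k' - 1 by rewrite kj li jE; ring.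
  rewrite dW' subrr.
  by move=> /eqP; rewrite !mulf_eq0 /= addr_eq0 => /orP[/eqP|/eqP]; auto.
rewrite kj li in R2; have [d1 [e1 [Ed Ee]]] := rot_order3_dvd jE icase R1 R2.
have s1 : s = 1.
  apply: (sqfreez_sq sq) => //; rewrite (isometric_det_int iG); apply/dvdzP.
  exists (3 * a - 2 * s * (d1 ^+ 2 + d1 * e1 + e1 ^+ 2)).
  by rewrite det_mx3 Ed Ee; ring.
rewrite s1 mulr1 in iG; have [n iH] := hexagonal_shear a d' e'.
by exists n; case: iH => iH; [left|right]; apply: isometric_trans iG iH.
Qed.

Definition mat9 := ((int * int * int) * (int * int * int) * (int * int * int))%type.

Definition mx9 (t : mat9) : 'M[int]_3 :=
  mx3 t.1.1.1.1 t.1.1.1.2 t.1.1.2 t.1.2.1.1 t.1.2.1.2 t.1.2.2 t.2.1.1 t.2.1.2 t.2.2.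

Lemma mx9_inj : injective mx9.
Proof.
move=> [[[[a b] c] [[d e] f]] [[g h] i]] [[[[a' b'] c'] [[d' e'] f']] [[g' h'] i']].
rewrite /mx9 /= => E.
by have [[-> -> ->] [[-> -> ->] [-> -> ->]]] := mx3_inj E.
Qed.

Definition sq9 (t : mat9) : mat9 := let: ((a, b, c), (d, e, f), (g, h, i)) := t in
  ((a * a + b * d + c * g, a * b + b * e + c * h, a * c + b * f + c * i),
   (d * a + e * d + f * g, d * b + e * e + f * h, d * c + e * f + f * i),
   (g * a + h * d + i * g, g * b + h * e + i * h, g * c + h * f + i * i)).

Lemma mx9_sq t : mx9 t *m mx9 t = mx9 (sq9 t).
Proof. by case: t => [[[[a b] c] [[d e] f]] [[g h] i]]; rewrite /mx9 /= mul_mx3. Qed.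

Definition id9 : mat9 := ((1, 0, 0), (0, 1, 0), (0, 0, 1)).

Lemma ortho_unit (G U : 'M[int]_3) : \det G != 0 -> U *m G *m U^T = G -> U \in unitmx.
Proof.
move=> d0 /(congr1 determinant); rewrite !det_mulmx det_tr => E.
have /(mulfI d0) E2 : \det G * (\det U * \det U) = \det G * 1 by rewrite mulr1 -[RHS]E; ring.
by rewrite unitmxE; apply/unitrP; exists (\det U); rewrite E2.
Qed.

Definition isometry_counts G o i :=
  ncard (Defs.ortho G) = o /\ ncard (involutions G) = i.

Lemma isometry_counts_isometric G H o i : lattice G -> isometric G H ->
  isometry_counts H o i -> isometry_counts G o i.
Proof. by move=> lG /(ncard_ortho_isometric lG)[oE iE]; rewrite /isometry_counts oE iE. Qed.

Lemma isometry_counts_seq G l : \det G != 0 -> uniq l ->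
  (forall t, t \in l -> mx9 t *m G *m (mx9 t)^T = G) ->
  (forall U, Defs.ortho G U -> exists2 t, t \in l & U = mx9 t) ->
  isometry_counts G (size l) (count (fun t => sq9 t == id9) l).
Proof.
move=> dG ul lG Ol; have lO t : t \in l -> Defs.ortho G (mx9 t).
  by move=> /lG EG; split=> //; apply: ortho_unit EG.
split.
  rewrite (@ncard_seq _ _ [seq mx9 t | t <- l]) ?size_map //.
    by rewrite map_inj_uniq //; exact: mx9_inj.
  move=> U; split=> [/Ol[t tl ->]|/mapP[t /lO oU ->]] //; exact: map_f.
rewrite -size_filter (@ncard_seq _ _ [seq mx9 t | t <- [seq t <- l | sq9 t == id9]]) ?size_map //.
  by rewrite map_inj_uniq ?filter_uniq //; exact: mx9_inj.
have id9E : 1%:M = mx9 id9 by rewrite mx3_1.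
move=> U; split=> [[/Ol[t tl ->]]|/mapP[t]].
  rewrite mx9_sq id9E => /mx9_inj E; apply/mapP; exists t => //.
  by rewrite mem_filter E eqxx.
rewrite mem_filter => /andP[/eqP E /lO oU] ->; split=> //.
by rewrite mx9_sq E id9E.
Qed.

Lemma sqr_le1 (x : int) : x * x <= 1 -> [\/ x = 0, x = 1 | x = -1].
Proof.
move=> H; have : x = 0 \/ x = 1 \/ x = -1 by nia.
by case=> [|[]] ->; [constructor 1|constructor 2|constructor 3].
Qed.

Lemma sum2_sqr_eq1 (x y : int) : x * x + y * y = 1 ->
  [\/ x = 1 /\ y = 0, x = -1 /\ y = 0, x = 0 /\ y = 1 | x = 0 /\ y = -1].
Proof.
move=> H; have hx : x * x <= 1 by nia.
have hy : y * y <= 1 by nia.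
case: (sqr_le1 hx) H => ->; case: (sqr_le1 hy) => -> // _;
  by [constructor 1|constructor 2|constructor 3|constructor 4].
Qed.

Lemma hexagonal_units (x y : int) : x * x - x * y + y * y = 1 -> (x, y) \in
  [:: (1, 0); (-1, 0); (0, 1); (0, -1); (1, 1); (-1, -1) : int * int].
Proof.
move=> H; have hx : x * x <= 1 by nia.
have hy : y * y <= 1 by nia.
by case: (sqr_le1 hx) H => ->; case: (sqr_le1 hy) => ->.
Qed.

Lemma ortho_eqs a b c d e f x1 x2 x3 y1 y2 y3 z1 z2 z3 :
  Defs.ortho (smx3 a b c d e f) (mx3 x1 x2 x3 y1 y2 y3 z1 z2 z3) ->
  let B u1 u2 u3 v1 v2 v3 : int := a * u1 * v1 + b * u2 * v2 + c * u3 * v3 +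
    d * (u1 * v2 + u2 * v1) + e * (u1 * v3 + u3 * v1) + f * (u2 * v3 + u3 * v2) in
  [/\ B x1 x2 x3 x1 x2 x3 = a, B y1 y2 y3 y1 y2 y3 = b & B z1 z2 z3 z1 z2 z3 = c] /\
  [/\ B x1 x2 x3 y1 y2 y3 = d, B x1 x2 x3 z1 z2 z3 = e & B y1 y2 y3 z1 z2 z3 = f].
Proof.
case=> _; rewrite tr_mx3 !mul_mx3 => E /=.
have [[E1 E2 E3] [[_ E5 E6] [_ _ E9]]] := mx3_inj E.
by split; split; [rewrite -[RHS]E1|rewrite -[RHS]E5|rewrite -[RHS]E9|
  rewrite -[RHS]E2|rewrite -[RHS]E3|rewrite -[RHS]E6]; ring.
Qed.

Lemma mul_sqr_pm1 (n x : int) : n != 0 -> n * x * x = n -> x \in [:: 1; -1 : int].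
Proof.
move=> n0 H; have : n * (x * x - 1) = 0 by rewrite mulrBr mulrA H mulr1 subrr.
move=> /eqP; rewrite mulf_eq0 (negPf n0) subr_eq0 => /= /eqP xx.
have hx : x * x <= 1 by rewrite xx.
by case: (sqr_le1 hx) xx => ->.
Qed.

Definition block_mats (S : seq ((int * int) * (int * int))) : seq mat9 :=
  [seq ((e, 0, 0), (0, s.1.1, s.1.2), (0, s.2.1, s.2.2)) | e <- [:: 1; -1 : int], s <- S].

Lemma ortho_tetragonal n : 2 <= n -> isometry_counts (smx3 n 1 1 0 0 0) 16 12.
Proof.
move=> n2; have n0 : n != 0 by clear -n2; lia.
pose l := block_mats
  [:: ((1, 0), (0, 1)); ((1, 0), (0, -1)); ((-1, 0), (0, 1)); ((-1, 0), (0, -1));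
      ((0, 1), (1, 0)); ((0, 1), (-1, 0)); ((0, -1), (1, 0)); ((0, -1), (-1, 0))].
apply: (isometry_counts_seq (l := l)) => //; first by rewrite det_mx3; clear -n2; lia.
- move=> t; rewrite !inE; do ?case/orP; move=> /eqP ->;
    by rewrite /mx9 /= tr_mx3 !mul_mx3; congr mx3; ring.
- move=> U; have [x1 [x2 [x3 [y1 [y2 [y3 [z1 [z2 [z3 ->]]]]]]]]] := mx3P U.
  move=> /ortho_eqs /= [[E00 E11 E22] [E01 E02 E12]].
  have y10 : y1 = 0 by clear -n2 E11; nia.
  have z10 : z1 = 0 by clear -n2 E22; nia.
  subst y1 z1.
  have Ey : y2 * y2 + y3 * y3 = 1 by rewrite -[RHS]E11; ring.
  have Ez : z2 * z2 + z3 * z3 = 1 by rewrite -[RHS]E22; ring.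
  have {}E12 : y2 * z2 + y3 * z3 = 0 by rewrite -[RHS]E12; ring.
  have {}E01 : x2 * y2 + x3 * y3 = 0 by rewrite -[RHS]E01; ring.
  have {}E02 : x2 * z2 + x3 * z3 = 0 by rewrite -[RHS]E02; ring.
  have sy := sum2_sqr_eq1 Ey; have sz := sum2_sqr_eq1 Ez.
  have [x20 x30] : x2 = 0 /\ x3 = 0.
    by clear -sy sz E12 E01 E02; case: sy => -[? ?]; case: sz => -[? ?]; subst; split; lia.
  subst x2 x3.
  have /(mul_sqr_pm1 n0) x1E : n * x1 * x1 = n by rewrite -[RHS]E00; ring.
  exists ((x1, 0, 0), (0, y2, y3), (0, z2, z3)); last by [].
  move: x1E; rewrite !inE => /orP[]/eqP ->; clear -sy sz E12;
  by case: sy E12 => -[-> ->]; case: sz => -[-> ->].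
Qed.

(* A vector of norm 2 off the hexagonal plane would be orthogonal to it. *)
Lemma hexagonal_plane (n y1 y2 y3 z1 z2 z3 : int) : 1 <= n ->
  n * y1 * y1 + 2 * (y2 * y2 - y2 * y3 + y3 * y3) = 2 ->
  n * y1 * z1 + (2 * y2 * z2 + 2 * y3 * z3 - y2 * z3 - y3 * z2) = -1 -> y1 = 0.
Proof.
move=> n1 Ey Eyz; have [//|y10] := eqVneq y1 0; exfalso.
have y23 : 0 <= y2 * y2 - y2 * y3 + y3 * y3 by clear; nia.
have ny : 0 < n * y1 * y1 by clear -y10 n1; nia.
have {}y23 : y2 * y2 - y2 * y3 + y3 * y3 = 0 by clear -Ey y23 ny; lia.
have [e2 e3] : y2 = 0 /\ y3 = 0 by clear -y23; split; nia.
subst y2 y3; have F3 : n * y1 * y1 = 2 by rewrite -[RHS]Ey; ring.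
have F4 : n * y1 * z1 = -1 by rewrite -[RHS]Eyz; ring.
have : (n * y1 * z1) * y1 = 2 * z1 by rewrite -F3; ring.
rewrite F4 => F5; have F6 : y1 = - 2 * z1 by clear -F5; lia.
by subst y1; clear -F4; lia.
Qed.

Lemma ortho_hexagonal n : 1 <= n -> isometry_counts (smx3 n 2 2 0 0 (-1)) 24 16.
Proof.
move=> n1; have n0 : n != 0 by clear -n1; lia.
pose S : seq ((int * int) * (int * int)) :=
  [:: ((1, 0), (0, 1)); ((1, 0), (-1, -1)); ((-1, 0), (0, -1)); ((-1, 0), (1, 1));
      ((0, 1), (1, 0)); ((0, 1), (-1, -1)); ((0, -1), (-1, 0)); ((0, -1), (1, 1));
      ((1, 1), (-1, 0)); ((1, 1), (0, -1)); ((-1, -1), (1, 0)); ((-1, -1), (0, 1))].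
apply: (isometry_counts_seq (l := block_mats S)) => //; first by rewrite det_mx3; clear -n1; lia.
- move=> t; rewrite !inE; do ?case/orP; move=> /eqP ->;
    by rewrite /mx9 /= tr_mx3 !mul_mx3; congr mx3; ring.
- move=> U; have [x1 [x2 [x3 [y1 [y2 [y3 [z1 [z2 [z3 ->]]]]]]]]] := mx3P U.
  move=> /ortho_eqs /= [[E00 E11 E22] [E01 E02 E12]].
  have Y1 : n * y1 * y1 + 2 * (y2 * y2 - y2 * y3 + y3 * y3) = 2 by rewrite -[RHS]E11; ring.
  have Z1 : n * z1 * z1 + 2 * (z2 * z2 - z2 * z3 + z3 * z3) = 2 by rewrite -[RHS]E22; ring.
  have y10 : y1 = 0 by apply: (hexagonal_plane n1 (z1 := z1) (z2 := z2) (z3 := z3) Y1);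
    rewrite -[RHS]E12; ring.
  have z10 : z1 = 0 by apply: (hexagonal_plane n1 (z1 := y1) (z2 := y2) (z3 := y3) Z1);
    rewrite -[RHS]E12; ring.
  subst y1 z1.
  have Ey : y2 * y2 - y2 * y3 + y3 * y3 = 1 by clear -Y1; lia.
  have Ez : z2 * z2 - z2 * z3 + z3 * z3 = 1 by clear -Z1; lia.
  have {}E12 : 2 * y2 * z2 + 2 * y3 * z3 - y2 * z3 - y3 * z2 = -1 by rewrite -[RHS]E12; ring.
  have {}E01 : 2 * x2 * y2 + 2 * x3 * y3 - x2 * y3 - x3 * y2 = 0 by rewrite -[RHS]E01; ring.
  have {}E02 : 2 * x2 * z2 + 2 * x3 * z3 - x2 * z3 - x3 * z2 = 0 by rewrite -[RHS]E02; ring.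
  have sy := hexagonal_units Ey; have sz := hexagonal_units Ez; clear Ey Ez Y1 Z1 E11 E22.
  have [sS x2x3] : ((y2, y3), (z2, z3)) \in S /\ x2 = 0 /\ x3 = 0.
    clear -sy sz E12 E01 E02; move: sy sz; rewrite !inE !xpair_eqE.
    by do ?case/orP; move=> /andP[/eqP ? /eqP ?]; do ?case/orP; move=> /andP[/eqP ? /eqP ?];
      subst; first [exfalso; clear -E12; lia | split; [by [] | clear -E01 E02; lia]].
  have [? ?] := x2x3; subst x2 x3.
  have /(mul_sqr_pm1 n0) x1E : n * x1 * x1 = n by rewrite -[RHS]E00; ring.
  exists ((x1, 0, 0), (0, y2, y3), (0, z2, z3)); last by [].
  by apply/allpairsP; exists (x1, ((y2, y3), (z2, z3))).
Qed.

Definition trigonal_form (y u1 u2 u3 v1 v2 v3 : int) : int :=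
  (y + 1) * u1 * v1 + (y + 1) * u2 * v2 + (y + 1) * u3 * v3 +
  y * (u1 * v2 + u2 * v1) + y * (u1 * v3 + u3 * v1) + y * (u2 * v3 + u3 * v2).

Lemma trigonal_formE y u1 u2 u3 v1 v2 v3 : trigonal_form y u1 u2 u3 v1 v2 v3 =
  u1 * v1 + u2 * v2 + u3 * v3 + y * ((u1 + u2 + u3) * (v1 + v2 + v3)).
Proof. by rewrite /trigonal_form; ring. Qed.

Lemma trigonal_sum_eq y u1 u2 u3 v1 v2 v3 : 2 <= y ->
  trigonal_form y u1 u2 u3 u1 u2 u3 = y + 1 -> trigonal_form y v1 v2 v3 v1 v2 v3 = y + 1 ->
  trigonal_form y u1 u2 u3 v1 v2 v3 = y -> u1 + u2 + u3 = v1 + v2 + v3.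
Proof.
move=> y2 Eu Ev Euv; apply/eqP; rewrite -subr_eq0; set s := _ - _.
have E : (u1 - v1) ^+ 2 + (u2 - v2) ^+ 2 + (u3 - v3) ^+ 2 + y * s ^+ 2 = 2.
  transitivity (trigonal_form y u1 u2 u3 u1 u2 u3 - 2 * trigonal_form y u1 u2 u3 v1 v2 v3 +
    trigonal_form y v1 v2 v3 v1 v2 v3); first by rewrite !trigonal_formE /s; ring.
  by rewrite Eu Ev Euv; ring.
apply/negPn/negP => s0; have ys : 2 <= y * s ^+ 2 by clear -s0 y2; nia.
have := sqr_ge0 (u1 - v1); have := sqr_ge0 (u2 - v2); have := sqr_ge0 (u3 - v3) => h3 h2 h1.
have g1 : (u1 - v1) ^+ 2 = 0 by clear -h1 h2 h3 ys E; lia.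
have g2 : (u2 - v2) ^+ 2 = 0 by clear -h1 h2 h3 ys E; lia.
have g3 : (u3 - v3) ^+ 2 = 0 by clear -h1 h2 h3 ys E; lia.
move: s0; rewrite /s (_ : _ - _ = u1 - v1 + (u2 - v2) + (u3 - v3)); last by ring.
by move/eqP: g1 g2 g3; rewrite sqrf_eq0 => /eqP-> /eqP; rewrite sqrf_eq0 => /eqP-> /eqP;
  rewrite sqrf_eq0 => /eqP->.
Qed.

Lemma trigonal_dot y s u1 u2 u3 v1 v2 v3 c : s * s = 1 -> s = u1 + u2 + u3 -> s = v1 + v2 + v3 ->
  trigonal_form y u1 u2 u3 v1 v2 v3 = c -> u1 * v1 + u2 * v2 + u3 * v3 = c - y.
Proof. by move=> s1 su sv <-; rewrite trigonal_formE -su -sv s1 mulr1 addrK. Qed.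

Lemma sum3_sqr_eq1 (s u1 u2 u3 : int) : u1 * u1 + u2 * u2 + u3 * u3 = 1 -> s = u1 + u2 + u3 ->
  (u1, u2, u3) \in [:: (s, 0, 0); (0, s, 0); (0, 0, s) : int * int * int].
Proof.
move=> E ->; have u1le : u1 * u1 <= 1 by nia.
have u2le : u2 * u2 <= 1 by nia.
have u3le : u3 * u3 <= 1 by nia.
by case: (sqr_le1 u1le) E => ->; case: (sqr_le1 u2le) => ->; case: (sqr_le1 u3le) => ->.
Qed.

Lemma trigonal_row (y s u1 u2 u3 : int) : s * s = 1 -> s = u1 + u2 + u3 ->
  trigonal_form y u1 u2 u3 u1 u2 u3 = y + 1 ->
  (u1, u2, u3) \in [:: (s, 0, 0); (0, s, 0); (0, 0, s) : int * int * int].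
Proof.
by move=> s1 su E; apply: sum3_sqr_eq1 (su); rewrite (trigonal_dot s1 su su E) addrC addKr.
Qed.

Definition perm_mats (s : int) : seq mat9 :=
  [:: ((s, 0, 0), (0, s, 0), (0, 0, s)); ((s, 0, 0), (0, 0, s), (0, s, 0));
      ((0, s, 0), (s, 0, 0), (0, 0, s)); ((0, s, 0), (0, 0, s), (s, 0, 0));
      ((0, 0, s), (s, 0, 0), (0, s, 0)); ((0, 0, s), (0, s, 0), (s, 0, 0))].

Lemma ortho_trigonal y : 2 <= y ->
  isometry_counts (smx3 (y + 1) (y + 1) (y + 1) y y y) 12 8.
Proof.
move=> y2; apply: (isometry_counts_seq (l := perm_mats 1 ++ perm_mats (-1))) => //.
- by rewrite det_mx3 (_ : _ + _ = 3 * y + 1); [clear -y2; lia | ring].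
- move=> t; rewrite !inE; do ?case/orP; move=> /eqP ->;
    by rewrite /mx9 /= tr_mx3 !mul_mx3; congr mx3; ring.
move=> U; have [x1 [x2 [x3 [y1 [y2' [y3 [z1 [z2 [z3 ->]]]]]]]]] := mx3P U.
move=> oU; have [uU _] := oU; move: oU => /ortho_eqs /= [[E00 E11 E22] [E01 E02 E12]].
pose s := x1 + x2 + x3.
have sy : s = y1 + y2' + y3 := trigonal_sum_eq y2 E00 E11 E01.
have sz : s = z1 + z2 + z3 := trigonal_sum_eq y2 E00 E22 E02.
have s0 : s != 0.
  apply: contraTneq uU => s0; rewrite unitmxE det_mx3.
  have -> : x3 = - x1 - x2 by clear -s0; rewrite /s in s0; lia.
  have -> : y3 = - y1 - y2' by clear -s0 sy; lia.
  have -> : z3 = - z1 - z2 by clear -s0 sz; lia.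
  by rewrite (_ : _ + _ = 0) ?unitr0 //; ring.
have s1 : s * s = 1.
  have := trigonal_formE y x1 x2 x3 x1 x2 x3; rewrite [LHS]E00 -/s.
  move: s0; move: (s); clear -y2 => t t0 E.
  have := sqr_ge0 x1; have := sqr_ge0 x2; have := sqr_ge0 x3 => h1 h2 h3.
  have : y * (t * t) <= y + 1 by clear -h1 h2 h3 E; lia.
  by clear -t0 y2; nia.
have hx := trigonal_row s1 (erefl s) E00; have hy := trigonal_row s1 sy E11.
have hz := trigonal_row s1 sz E22.
have := trigonal_dot s1 (erefl s) sy E01; have := trigonal_dot s1 (erefl s) sz E02.
have := trigonal_dot s1 sy sz E12; rewrite subrr => Eyz Exz Exy.
have sE : s = 1 \/ s = -1.
  have hs : s * s <= 1 by rewrite s1.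
  by case: (sqr_le1 hs) s0 => ->; auto.
exists ((x1, x2, x3), (y1, y2', y3), (z1, z2, z3)); last by [].
clearbody s; clear -hx hy hz sE Exy Exz Eyz.
move: hx hy hz; rewrite !inE !xpair_eqE -!andbA.
by case: sE => ->; do ?case/orP; move=> /and3P[/eqP ? /eqP ? /eqP ?];
   do ?case/orP; move=> /and3P[/eqP ? /eqP ? /eqP ?];
   do ?case/orP; move=> /and3P[/eqP ? /eqP ? /eqP ?]; subst.
Qed.

Lemma ortho_hexagonal_plane G n : lattice G -> sqfreez (\det G) ->
  ~ isometric G (diag3 1 1 1) ->
  isometric G (smx3 n 2 2 0 0 (-1)) \/ isometric G (smx3 n 2 2 1 0 (-1)) ->
  isometry_counts G 24 16 \/ isometry_counts G 12 8.
Proof.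
move=> lG sq n111 [iG|iG].
  left; apply: (isometry_counts_isometric lG iG); apply: ortho_hexagonal.
  by have [n0 _ _] := lattice_minors (isometric_lattice iG lG); lia.
have {}iG : isometric G (smx3 n n n (n - 1) (n - 1) (n - 1)).
  by apply: isometric_trans iG _; isometry3 (mx3 1 0 0 1 (-1) 0 1 (-1) (-1)).
right; apply: (isometry_counts_isometric lG iG).
have [n0 _ _] := lattice_minors (isometric_lattice iG lG).
have n1 : n != 1 by apply/eqP => n1; apply: n111; rewrite n1 in iG; rewrite diag3E.
have n2 : n != 2.
  by apply/eqP => n2; have /negP[] := sq 2 isT; rewrite (isometric_det_int iG) n2 det_mx3.
by have := @ortho_trigonal (n - 1); rewrite subrK; apply; clear -n0 n1 n2; lia.
Qed.

Lemma ortho_cases G : lattice G -> sqfreez (\det G) ->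
  ~ isometric G (diag3 1 1 1) ->
  let o := ncard (Defs.ortho G) in let i := ncard (involutions G) in
  [\/ o = i /\ (o <= 8)%N, o = 12 /\ i = 8, o = 24 /\ i = 16 | o = 16 /\ i = 12].
Proof.
move=> lG sq n111 o i.
have [allinv|] := pselect (forall U, Defs.ortho G U -> U *m U = 1%:M).
  constructor 1; have oi : o = i.
    rewrite /o /i; congr ncard; apply/seteqP; split=> U; last by case.
    by move=> oU; split=> //; apply: allinv.
  by split=> //; rewrite oi /i (ncard_involutions lG) !ltnS; apply: involutive_le8.
move=> /existsNP[U0 /not_implyP[oU0 /eqP U02]].
have [W [oW dW W2]] : exists W, [/\ Defs.ortho G W, \det W = 1 & W *m W != 1%:M].
  have [uU0 eU0] := oU0; have := uU0; rewrite unit_mx3P => /orP[/eqP d1|/eqP d1].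
    by exists U0.
  have dN : \det (- U0) = 1 by rewrite -scaleN1r detZ d1.
  exists (- U0); split=> //; last by rewrite mulmxN mulNmx opprK.
  split; first by rewrite unitmxE dN unitr1.
  by rewrite linearN /= mulmxN !mulNmx opprK.
have [a [b [c [d [e [f [x [y [i1 [j [k [l [iG R dR j0 tau]]]]]]]]]]]]] := rot_shape lG oW dW W2.
have lG' := isometric_lattice iG lG.
have sq' : sqfreez (\det (smx3 a b c d e f)) by rewrite -(isometric_det_int iG).
have hexagonal : (exists n, isometric (smx3 a b c d e f) (smx3 n 2 2 0 0 (-1)) \/
            isometric (smx3 a b c d e f) (smx3 n 2 2 1 0 (-1))) ->
  [\/ o = i /\ (o <= 8)%N, o = 12 /\ i = 8, o = 24 /\ i = 16 | o = 16 /\ i = 12].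
  move=> [n iH]; have [||] := @ortho_hexagonal_plane G n lG sq n111; last by constructor 2.
    by case: iH => iH; [left|right]; apply: isometric_trans iG iH.
  by constructor 3.
have [t0|[t1|t2]] : i1 + l = 0 \/ i1 + l = -1 \/ i1 + l = 1 by clear -tau; lia.
- have [n iH] := rotation_trace1 lG' sq' R dR j0 t0; have {}iH := isometric_trans iG iH.
  constructor 4; rewrite /o /i; have [-> ->] := ncard_ortho_isometric lG iH.
  have [n0 _ _] := lattice_minors (isometric_lattice iH lG); apply: ortho_tetragonal.
  have n1 : n != 1 by apply/eqP => n1; apply: n111; rewrite n1 in iH; rewrite diag3E.
  by clear -n0 n1; lia.
- exact/hexagonal/(rotation_trace0 lG' sq' R dR j0 t1).
- apply/hexagonal/(rotation_trace0 lG' sq' (rot_sq R)).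
  + by transitivity ((i1 * l - j * k) ^+ 2); [ring|rewrite dR].
  + have -> : i1 * j + j * l = j * (i1 + l) by ring.
    by rewrite t2 mulr1.
  + transitivity ((i1 + l) ^+ 2 - 2 * (i1 * l - j * k)); first by ring.
    by rewrite t2 dR.
Qed.

(** * Vectors of reflections *)

Definition PQ K : nat := (frakP K * frakQ K)%N.

Definition reflvec_at (m dl : nat) H : set 'rV[int]_3 :=
  [set v | qform H v = (m * dl)%N%:Z /\ exists c : 'rV[int]_3, v *m H = m%:Z *: c].

Lemma PQ_prod K :
  PQ K = (\prod_(q <- primes `|\det K| | odd q) q)%N.
Proof.
rewrite /PQ /frakP /frakQ [RHS](bigID (fun q => `[< anisotropic (ext (padic_num q) K) >])) /=.
congr (_ * _)%N; apply: eq_bigl => q; congr (_ && _).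
apply/asboolP/idP => [iq|/asboolPn]; last by rewrite /anisotropic => /contrapT.
by apply/asboolPn; apply.
Qed.

Lemma sqfree_prod (d : nat) : (0 < d)%N -> (forall q, prime q -> (logn q d <= 1)%N) ->
  d = (\prod_(q <- primes d) q)%N.
Proof.
move=> d0 H; rewrite {1}(prod_prime_decomp d0) prime_decompE big_map.
apply: eq_big_seq => q /=; rewrite mem_primes => /and3P[pq _ q_dvd].
rewrite -[RHS]expn1; congr (_ ^ _)%N; apply/eqP; rewrite eqn_leq H //.
by rewrite -pfactor_dvdn // expn1.
Qed.

Lemma PQ_odd K : odd (PQ K).
Proof.
rewrite PQ_prod; elim/big_ind: _ => // x y; by rewrite oddM => -> ->.
Qed.

Lemma PQ_dvd_odd K m : (m %| PQ K)%N -> odd m.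
Proof. by move=> mP; apply: dvdn_odd mP (PQ_odd K). Qed.

Lemma PQ_dvd_gt0 K m : (m %| PQ K)%N -> (0 < m)%N.
Proof. by move=> /PQ_dvd_odd; case: m. Qed.

Lemma PQ_det K : stable K ->
  `|\det K|%N = (PQ K * (if `[< even_lattice K >] then 2 else 1))%N.
Proof.
move=> sK; have [lK _ ord _] := sK; have D0 := lattice_det_gt0 lK.
have d0 : (0 < `|\det K|)%N by rewrite absz_gt0 gt_eqF.
rewrite {1}(sqfree_prod d0 ord) (bigID odd) /= -PQ_prod; congr (_ * _)%N.
have [e2|ne2] := boolP `[< even_lattice K >].
  have two : (2 \in primes `|\det K|)%N.
    rewrite mem_primes /= d0; move/asboolP: e2 => /(stable_even2 sK).
    by rewrite dvdzE.
  rewrite -big_filter (bigD1_seq 2%N) ?mem_filter ?two ?filter_uniq ?primes_uniq //=.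
  rewrite big1_seq ?muln1 // => q /andP[q2]; rewrite mem_filter => /andP[oq].
  by rewrite mem_primes => /and3P[pq _ _]; case/even_prime: pq oq q2 => [->|->].
rewrite big1_seq // => q /andP[oq]; rewrite mem_primes => /and3P[pq _ dq].
have q2 : q = 2 by case/even_prime: pq oq => [//|->].
case/negP: ne2; apply/asboolP/(stable_even2 sK); rewrite dvdzE.
by rewrite q2 in dq.
Qed.

Lemma dvd_PQ_det K m : stable K -> (m %| PQ K)%N -> (m%:Z %| \det K)%Z.
Proof.
by move=> sK mP; rewrite dvdzE absz_nat (PQ_det sK); apply: dvdn_mulr.
Qed.

Lemma sqfreez_dvd (a b : int) : sqfreez b -> (a %| b)%Z -> sqfreez a.
Proof. by move=> sb ab q pq; apply: contra (sb q pq) => /dvdz_trans; apply. Qed.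

Lemma reflvec_sqfree K m dl : stable K -> (m %| PQ K)%N -> dl \in [:: 1; 2]%N ->
  sqfreez (m * dl)%N%:Z.
Proof.
move=> sK mP dl12 q pq; apply/negP; rewrite dvdzE !absz_nat => q2.
have om := PQ_dvd_odd mP;
  have sm : sqfreez m%:Z by apply: sqfreez_dvd (stable_sqfree sK) (dvd_PQ_det sK mP).
have /negP[] := sm q pq; rewrite dvdzE !absz_nat.
have [q2E|oq] := even_prime pq.
  have : (4 %| m * dl)%N by rewrite q2E in q2.
  move: dl12; rewrite !inE => /orP[]/eqP ->; rewrite ?muln1 => m4.
    have : (2 %| m)%N by apply: dvdn_trans m4.
    by rewrite dvdn2 om.
  have : (2 * 2 %| m * 2)%N by [].
  by rewrite dvdn_pmul2r // dvdn2 om.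
move: q2; rewrite mulnC Gauss_dvdr //.
rewrite coprime_sym coprimeXr // coprime_sym.
move: dl12; rewrite !inE => /orP[]/eqP ->; rewrite ?coprimen1 //.
by rewrite coprimen2.
Qed.

Lemma reflvec_primitive K H m dl v : stable K -> (m %| PQ K)%N -> dl \in [:: 1; 2]%N ->
  reflvec_at m dl H v -> primitive_vec v.
Proof.
move=> sK mP dl12 [Qv _]; have [w [k [pw vw]]] := primitive_vec_multiple v.
have sq := reflvec_sqfree sK mP dl12.
have Qk : (m * dl)%N%:Z = k ^+ 2 * qform H w by rewrite -Qv vw qformZ.
have k0 : k != 0 by apply: contraTneq (sq 2 isT) => k0; rewrite Qk k0 expr0n mul0r dvdz0.
have k1 : `|k| = 1.
  apply: (sqfreez_sq sq); first by rewrite normr_gt0.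
  by rewrite Qk -normrX ger0_norm ?sqr_ge0 // dvdz_mulr.
have [kE|kE] : k = 1 \/ k = -1 by clear -k1; lia.
  by rewrite vw kE scale1r.
by rewrite vw kE scaleN1r; apply: primitive_vecN.
Qed.

Lemma reflvec_at_reflvec K H m dl v : stable K -> (m %| PQ K)%N -> dl \in [:: 1; 2]%N ->
  reflvec_at m dl H v -> reflvec H v.
Proof.
move=> sK mP dl12 rv; split; first exact: (reflvec_primitive sK mP dl12 rv).
have [Qv [c Hc]] := rv; rewrite Qv Hc.
move: dl12; rewrite !inE => /orP[]/eqP ->.
  by exists (2 *: c); rewrite muln1 !scalerA mulrC.
by exists c; rewrite scalerA PoszM mulrC.
Qed.

Lemma reflvec_content H v : lattice H -> reflvec H v -> exists (b u : int) w,
  [/\ 0 < b, u = 1 \/ u = 2, qform H v = b * u, v *m H = b *: w & (b %| \det H)%Z].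
Proof.
move=> lH sv; have Q0 := reflvec_gt0 lH sv; have [pv [c Hc]] := sv.
have [b [w [b0 pw Ev]]] : exists (b : int) w, [/\ 0 < b, primitive_vec w & v *m H = b *: w].
  have [w [b [pw Ev]]] := primitive_vec_multiple (v *m H).
  have b0 : b != 0.
    by apply: contraTneq Q0 => b0; rewrite /qform /bform Ev b0 scale0r mul0mx mxE ltxx.
  have [bp|bn] := ltrP 0 b; first by exists b, w.
  exists (- b), (- w); split; first by rewrite oppr_gt0 lt_neqAle b0.
    exact: primitive_vecN.
  by rewrite scalerN scaleNr opprK.
have [j [Ej _]] : exists j, 2 * b = qform H v * j /\ c = j *: w.
  by apply: (primitive_vec_dvd pw); rewrite ?gt_eqF // -scalerA -Ev.
have [u Eu] : exists u, qform H v = b * u.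
  by exists ((w *m v^T) 0 0); rewrite /qform /bform Ev -scalemxAl mxE.
have uj : u * j = 2 by apply: (mulfI (lt0r_neq0 b0)); rewrite mulrA -Eu -Ej mulrC.
have u0 : 0 < u by rewrite -(pmulr_rgt0 _ b0) -Eu.
have [i [Ei _]] : exists i, \det H = b * i /\ w *m \adj H = i *: v.
  apply: (primitive_vec_dvd pv); last by rewrite gt_eqF.
  by rewrite -mul_mx_scalar -mul_mx_adj mulmxA Ev -scalemxAl.
exists b, u, w; split=> //; last by rewrite Ei dvdz_mulr.
have j0 : 0 < j by rewrite -(pmulr_rgt0 _ u0) uj.
by clear -u0 j0 uj; nia.
Qed.

(* In a basis starting with v the Gram matrix has first row (4m, 2z, 2z') and
   even diagonal, so 4 would divide the determinant. *)
Lemma even_qform_content H v w m : lattice H -> even_lattice H ->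
  sqfreez (\det H) -> primitive_vec v -> v *m H = (2 * m) *: w -> qform H v != 2 * m * 2.
Proof.
move=> [sH _] ev sq [U uU vU] Ev; apply/eqP => Qv;
  have iH : isometric H (U *m H *m U^T) by exists U.
have [x1 [x2 [x3 [x4 [x5 [x6 EG]]]]]] := smx3P (congr_mx_sym U sH).
have ent (i : 'I_3) : (U *m H *m U^T) o0 i = 2 * (m * (w *m U^T) 0 i).
  transitivity ((v *m H *m U^T) 0 i); last by rewrite Ev -scalemxAl mxE mulrA.
  by rewrite vU -!row_mul [in RHS]mxE.
have x1E : x1 = 4 * m.
  transitivity (qform H v); last by rewrite Qv; ring.
  by rewrite vU rowE -qform_conj /qform bform_delta EG mxE.
have x4E : x4 = 2 * (m * (w *m U^T) 0 o1) by rewrite -ent EG mxE.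
have x5E : x5 = 2 * (m * (w *m U^T) 0 o2) by rewrite -ent EG mxE.
have := isometric_even iH ev; rewrite EG => /even_smx3P[_ /evenE[y2 Ey2] /evenE[y3 Ey3]].
have /negP[] := sq 2 isT.
rewrite (isometric_det_int iH) EG det_mx3 x1E x4E x5E Ey2 Ey3.
set z4 := m * _; set z5 := m * _; clearbody z4 z5; apply/dvdzP.
exists (m * (4 * y2 * y3 - x6 ^+ 2) - z4 * (2 * z4 * y3 - x6 * z5) + z5 * (z4 * x6 - 2 * y2 * z5)).
by ring.
Qed.

Lemma reflvec_ex_at K H v : stable K -> genus K H -> reflvec H v ->
  exists m dl, [/\ (m %| PQ K)%N, dl \in [:: 1; 2]%N & reflvec_at m dl H v].
Proof.
move=> sK gH sv; have [lK _ _ _] := sK; have lH := genus_lattice gH.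
have [b [u [w [b0 u12 Qv Ev bD]]]] := reflvec_content lH sv.
have bP : (`|b| %| PQ K * (if `[< even_lattice K >] then 2 else 1))%N.
  by rewrite -(PQ_det sK) -(genus_det lK gH) -dvdzE.
have absb : `|b|%N%:Z = b by rewrite gtz0_abs.
have [ob|eb] := boolP (odd `|b|).
  exists `|b|%N, `|u|%N; split.
  - by move: bP; case: ifP => _; rewrite ?muln1 // Gauss_dvdl // coprimen2.
  - by case: u12 => ->.
  - by split; [rewrite PoszM absb Qv; case: u12 => -> | exists w; rewrite absb].
have evK : even_lattice K.
  apply: contrapT => nev; move: bP; rewrite (asboolF nev) muln1 => /PQ_dvd_odd.
  by rewrite (negPf eb).
have mE := divnK (etrans (dvdn2 _) eb); set m := (`|b| %/ 2)%N in mE.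
have bm : b = 2 * m%:Z by rewrite -absb -mE PoszM mulrC.
exists m, 2%N; split=> //; first by move: bP; rewrite (asboolT evK) -mE dvdn_pmul2r.
split; last by exists (2 *: w); rewrite scalerA Ev bm mulrC.
case: u12 Qv => -> Qv; first by rewrite Qv mulr1 bm PoszM mulrC.
have sqH : sqfreez (\det H) by rewrite (genus_det lK gH); apply: stable_sqfree.
rewrite bm in Ev Qv.
by have := even_qform_content lH ((genus_even lK gH).1 evK) sqH sv.1 Ev; rewrite Qv eqxx.
Qed.

Lemma odd_mul12_inj (m m' dl dl' : nat) : odd m -> odd m' ->
  dl \in [:: 1; 2]%N -> dl' \in [:: 1; 2]%N -> (m * dl = m' * dl')%N -> m = m' /\ dl = dl'.
Proof.
move=> om om' dlP dlP' E; have := congr1 odd E; rewrite !oddM om om' /=.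
move: dlP dlP' E; rewrite !inE => /orP[]/eqP -> /orP[]/eqP -> //; rewrite ?muln1 => E _ //.
by split=> //; apply/eqP; rewrite -(eqn_pmul2r (isT : 0 < 2)%N) E.
Qed.

Lemma ncard_reflvec K H : stable K -> genus K H ->
  ncard (reflvec H) = (\sum_(m <- divisors (PQ K)) \sum_(dl <- [:: 1;
    2]) ncard (reflvec_at m dl H))%N.
Proof.
move=> sK gH; have lH := genus_lattice gH.
have [s us Hs] := finite_enum (finite_reflvec lH); rewrite (ncard_seq us Hs).
have P0 : (0 < PQ K)%N by have := PQ_odd K; case: (PQ K).
have dvdP m : (m \in divisors (PQ K)) = (m %| PQ K)%N by rewrite dvdn_divisors.
have rvecE v m dl : v \in s -> (m %| PQ K)%N -> dl \in [:: 1; 2]%N ->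
    reflvec_at m dl H v <-> qform H v = (m * dl)%N%:Z.
  move=> /Hs sv mP dlP; split=> [[]//|Qv].
  have [m' [dl' [mP' dlP' rv]]] := reflvec_ex_at sK gH sv; have [Qv' _] := rv.
  have [E] : (m * dl)%N = (m' * dl')%N by apply/eqP; rewrite -eqz_nat -Qv -Qv'.
  by have [-> ->] := odd_mul12_inj (PQ_dvd_odd mP) (PQ_dvd_odd mP') dlP dlP' E.
have nE m dl : m \in divisors (PQ K) -> dl \in [:: 1; 2]%N ->
    ncard (reflvec_at m dl H) = (\sum_(v <- s) (qform H v == (m * dl)%N%:Z))%N.
  rewrite dvdP => mP dlP; rewrite -big_mkcond /= sum1_count -size_filter.
  apply: ncard_seq; first exact: filter_uniq.
  move=> v; rewrite mem_filter; split=> [rv|/andP[/eqP Qv sv]]; last exact/(rvecE v).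
  have sv : v \in s by apply/Hs/(reflvec_at_reflvec sK mP dlP rv).
  by rewrite sv ((rvecE v m dl sv mP dlP).1 rv) eqxx.
rewrite (eq_big_seq (fun m => \sum_(dl <- [:: 1;
  2]) \sum_(v <- s) (qform H v == (m * dl)%N%:Z)))%N; last first.
  by move=> m mP; apply: eq_big_seq => dl; apply: nE.
under eq_bigr do rewrite exchange_big /=.
rewrite exchange_big /= -sum1_size; apply: eq_big_seq => v /Hs sv.
have [m [dl [mP dlP [Qv _]]]] := reflvec_ex_at sK gH sv.
rewrite (bigD1_seq m) ?divisors_uniq ?dvdP //= [X in (_ + X)%N]big1_seq ?addn0 => [|m' /andP[mm']].
  rewrite !big_cons big_nil Qv !eqz_nat !eqn_pmul2l ?(PQ_dvd_gt0 mP) //.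
  by move: dlP; rewrite !inE => /orP[]/eqP ->.
rewrite dvdP => mP'; rewrite big1_seq // => dl' /andP[_ dlP']; rewrite Qv eqz_nat.
suff /negPf -> : (m * dl != m' * dl')%N by [].
apply: contra mm' => /eqP E.
by have [->] := odd_mul12_inj (PQ_dvd_odd mP) (PQ_dvd_odd mP') dlP dlP' E.
Qed.

(** * The lattices lambda_m *)

Lemma smith3_sqfree K : sqfreez (\det K) -> \det K != 0 ->
  exists L R c, [/\ L \in unitmx, R \in unitmx & K = L *m mx3 1 0 0 0 1 0 0 0 c *m R].
Proof.
move=> sq D0; have [L [R [a [b [c [uL uR dab dbc E]]]]]] := smith3 K.
have dE : \det K = \det L * (a * b * c) * \det R.
  by rewrite E !det_mulmx det_mx3; congr (_ * _ * _); ring.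
have unit_of_sq x : x != 0 -> (x ^+ 2 %| \det K)%Z -> x \is a GRing.unit.
  move=> x0 xD; have : `|x| = 1.
    apply: (sqfreez_sq sq); first by rewrite normr_gt0.
    by rewrite -normrX ger0_norm ?sqr_ge0.
  by clear; rewrite qualifE /=; lia.
have [a0 b0] : a != 0 /\ b != 0.
  by move: D0; rewrite dE !mulf_eq0 !negb_or => /andP[/andP[_ /andP[/andP[]]]].
have ub : b \is a GRing.unit.
  apply: unit_of_sq => //; have /dvdzP[c' Ec] := dbc.
  by rewrite dE; apply/dvdzP; exists (\det L * a * c' * \det R); rewrite Ec; ring.
have ua : a \is a GRing.unit.
  apply: unit_of_sq => //; have /dvdzP[b' Eb] := dab.
  by rewrite dE; apply/dvdzP; exists (\det L * b' * c * \det R); rewrite Eb; ring.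
exists L, (mx3 a 0 0 0 b 0 0 0 1 *m R), c; split=> //.
  by rewrite unitmx_mul uR andbT unitmxE det_mx3 !(mul0r, mulr0, subr0, addr0, mulr1) unitrM ua.
rewrite E mulmxA -[L *m _ *m mx3 a _ _ _ _ _ _ _ _]mulmxA mul_mx3.
by congr (_ *m _ *m _); congr mx3; ring.
Qed.

(* The rows of T lie in {x | x K = 0 mod m}, and they generate it after any extension of scalars. *)
Definition Lambda_basis K (m : nat) (T : 'M[int]_3) :=
  [/\ \det T ^+ 2 = m%:Z ^+ 4, exists C, T *m K = m%:Z *: C
    & forall (S : comUnitRingType) k (r c : 'M[S]_(k, 3)),
      r *m ext S K = m%:Z%:~R *: c -> exists a : 'M[S]_(k, 3), r = a *m ext S T].

Lemma Lambda_basis_ex K m : sqfreez (\det K) -> \det K != 0 ->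
  (m%:Z %| \det K)%Z -> exists T, Lambda_basis K m T.
Proof.
move=> sq D0 mD; have [L [R [c [uL uR E]]]] := smith3_sqfree sq D0.
have /dvdzP[c' Ec] : (m%:Z %| c)%Z.
  have /intr_unit uLR : \det L * \det R \is a GRing.unit by rewrite unitrM -!unitmxE uL.
  have -> : c = (\det L * \det R) * \det K.
    transitivity ((\det L * \det R) ^+ 2 * c); first by rewrite uLR mul1r.
    by rewrite E !det_mulmx det_mx3; ring.
  exact: dvdz_mull.
exists (mx3 m%:Z 0 0 0 m%:Z 0 0 0 1 *m invmx L); split.
- rewrite det_mulmx exprMn det_mx3 (intr_unit (_ : \det (invmx L) \is a GRing.unit)).
    by ring.
  by rewrite -unitmxE unitmx_inv.
- exists (mx3 1 0 0 0 1 0 0 0 c' *m R).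
  rewrite E !mulmxA mulmxKV // mul_mx3 scalemxAl scale_mx3 Ec.
  by congr (_ *m _); congr mx3; ring.
move=> S k r s Es; have uLS := unitmx_ext S uL; have uRS := unitmx_ext S uR.
pose x := r *m ext S L; pose s' := s *m invmx (ext S R).
have Ex : x *m ext S (mx3 1 0 0 0 1 0 0 0 c) = m%:Z%:~R *: s'.
  by rewrite /x /s' scalemxAl -Es E !ext_mul !mulmxA mulmxK.
exists (\matrix_(i, j) (if j == o2 then x i o2 else s' i j)).
have -> : r = x *m invmx (ext S L) by rewrite mulmxK.
have -> : ext S (mx3 m%:Z 0 0 0 m%:Z 0 0 0 1 *m invmx L) =
    ext S (mx3 m%:Z 0 0 0 m%:Z 0 0 0 1) *m invmx (ext S L).
  by apply: (canRL (mulmxK uLS)); rewrite -ext_mul mulmxKV.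
rewrite mulmxA; congr (_ *m _).
clear Es E uLS uRS; clearbody x s'; apply/matrixP => i; have /matrixP/(_ i) Exi := Ex.
apply: I3P; have := (Exi o0, Exi o1);
  rewrite !mxE !sum_ord3 !mxE /= !mulr0 !mulr1 ?addr0 ?add0r => -[E0 E1].
- by rewrite E0 mulrC.
- by rewrite E1 mulrC.
- by [].
Qed.

Lemma Lambda_basis_unit (K T U : 'M[int]_3) m : U \in unitmx ->
  Lambda_basis K m T -> Lambda_basis K m (U *m T).
Proof.
move=> uU [dT [C TK] univ]; split.
- by rewrite det_mulmx exprMn dT (intr_unit (_ : \det U \is a GRing.unit)) ?mul1r // -unitmxE.
- by exists (U *m C); rewrite -mulmxA TK -scalemxAr.
move=> S k _ _ /univ[a ->]; exists (a *m ext S (invmx U)).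
by rewrite ext_mul mulmxA -[a *m _ *m _]mulmxA -ext_mul mulVmx // ext1 mulmx1.
Qed.

Lemma LambdaP K m x : K^T = K -> odd m ->
  Lambda m K x <-> exists c : 'rV[int]_3, x *m K = m%:Z *: c.
Proof.
move=> sK om; have diff y : qform K (x + y) - qform K y = qform K x + 2 * bform K x y.
  by rewrite qformD //; ring.
split=> [H|[c Hc] y].
  have Qx : (m%:Z %| qform K x)%Z.
    by have /eqP := H 0; rewrite addr0 qform0 eqz_mod_dvd subr0.
  have dv y : (m%:Z %| bform K x y)%Z.
    have /eqP := H y; rewrite eqz_mod_dvd diff rpredDl //.
    by rewrite (odd_dvdz_pmull 1) // expn1.
  exists (\row_j (((x *m K) 0%R j) %/ m%:Z)%Z); apply/rowP => j; rewrite !mxE mulrC divzK //.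
  by have := dv (delta_mx 0 j); rewrite /bform trmx_delta -colE mxE [(x *m K) 0 j]mxE.
apply/eqP; rewrite eqz_mod_dvd diff.
have dv z : (m%:Z %| bform K x z)%Z by rewrite /bform Hc -scalemxAl mxE dvdz_mulr.
by rewrite rpredD //; [exact: dv | rewrite dvdz_mull].
Qed.

Lemma Lambda_basisP (K T : 'M[int]_3) m x : K^T = K -> odd m -> Lambda_basis K m T ->
  Lambda m K x <-> exists! a : 'rV[int]_3, x = a *m T.
Proof.
move=> sK om [dT [C TK] univ]; have m0 : m%:Z != 0 by case: m om {dT C TK univ}.
have dTn : \det T != 0 by rewrite -sqrf_eq0 dT expf_neq0.
rewrite (LambdaP x sK om); split=> [[c Hc]|[a [-> _]]].
  have [|a] := univ int 1 x c; rewrite ?intz ext_int //.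
  by move=> ->; exists a; split=> // b; apply: mulmx_detI.
by exists (a *m C); rewrite -mulmxA TK -scalemxAr.
Qed.

Lemma basis_change (P : 'rV[int]_3 -> Prop) (A B : 'M[int]_3) : P 0 ->
  (forall x, P x <-> exists! a : 'rV[int]_3, x = a *m A) ->
  (forall x, P x <-> exists! a : 'rV[int]_3, x = a *m B) -> exists2 U, U \in unitmx & A = U *m B.
Proof.
have inj (D : 'M[int]_3) : P 0 -> (forall x, P x <-> exists! a : 'rV[int]_3, x = a *m D) ->
    forall a b : 'rV[int]_3, a *m D = b *m D -> a = b.
  move=> P0 DP a b E; have /DP[z [_ uz]] := P0; have z0 := uz 0; rewrite mul0mx in z0.
  have := uz (a - b); rewrite mulmxBl E subrr => /(_ erefl); rewrite (z0 erefl) => /esym/eqP.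
  by rewrite subr_eq0 => /eqP.
have factor (D E : 'M[int]_3) : P 0 -> (forall x, P x <-> exists! a : 'rV[int]_3, x = a *m D) ->
    (forall x, P x <-> exists! a : 'rV[int]_3, x = a *m E) -> exists U, D = U *m E.
  move=> P0 DP EP; have /choice[f fP] : forall i, exists a : 'rV[int]_3, row i D = a *m E.
    move=> i; have /EP[a [Ea _]] : P (row i D); last by exists a.
    by apply/DP; exists (delta_mx 0 i); split=> [|b]; rewrite rowE //; apply: inj.
  by exists (\matrix_i f i); apply/row_matrixP => i; rewrite row_mul rowK fP.
move=> P0 AP BP; have [U EU] := factor A B P0 AP BP; have [V EV] := factor B A P0 BP AP.
exists U => //; suff : U *m V = 1%:M by move/mulmx1_unit => [].
by apply/row_matrixP => i; apply: (inj A P0 AP); rewrite -!row_mul mul1mx -mulmxA -EV -EU.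
Qed.

Lemma primitiveP (N : 'M[int]_3) : (forall q, prime q -> ~~ ((q ^ 3)%N %| \det N)%Z) -> primitive N.
Proof.
move=> cub; have [L [R [a [b [c [uL uR dab dbc E]]]]]] := smith3 N.
have a1 : a * a = 1.
  have [b' Eb] := dvdzP dab; have [c' Ec] := dvdzP dbc.
  have dE : \det N = a ^+ 3 * (\det L * b' ^+ 2 * c' * \det R).
    by rewrite E !det_mulmx det_mx3 Ec Eb; ring.
  have [a1|a1] := eqVneq `|a|%N 1%N; first by clear -a1; have [->|->] : a = 1 \/ a = -1 by lia.
  exfalso; have [q pq qa] : exists2 q, prime q & (q %| `|a|)%N.
    have [a0|a0] := eqVneq a 0; first by exists 2; rewrite ?a0.
    by exists (pdiv `|a|); rewrite ?pdiv_dvd // pdiv_prime //; clear -a0 a1; lia.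
  have /negP[] := cub q pq; rewrite dE dvdz_mulr // dvdzE absz_nat abszX dvdn_exp2r //.
pose x := row o0 (invmx L); pose y := (col o0 (invmx R))^T.
have bxy : bform N x y = a.
  rewrite /bform /x /y trmxK -!row_mul E !mulmxA mulVmx // mul1mx.
  by rewrite colE mulmxA mulmxK // -colE !mxE.
apply/seteqP; split=> // r _; exists [:: (r * a, bform N x y)] => [t|].
  by rewrite inE => /eqP -> /=; exists (x, y).
by rewrite big_seq1 /= bxy -mulrA a1 mulr1.
Qed.

Lemma primitive_mul (N : 'M[int]_3) (p r : int) : primitive N ->
  (forall x y, (p %| r * bform N x y)%Z) -> (p %| r)%Z.
Proof.
move=> prN H; have : scale_ideal N 1 by rewrite prN.
move=> [s sP E]; rewrite -[r]mulr1 E mulr_sumr big_seq; apply: rpred_sum => t ts.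
have [[x y] _ <-] := sP t ts; rewrite mulrCA; apply: dvdz_mull; exact: H.
Qed.

Lemma primitive_scale (N N' : 'M[int]_3) (k : rat) : primitive N -> primitive N' -> 0 < k ->
  ext rat N' = k *: ext rat N -> N' = N.
Proof.
move=> pN pN' k0 E.
have dn0 : (denq k)%:~R != 0 :> rat by rewrite intr_eq0 denq_neq0.
have E2 : denq k *: N' = numq k *: N.
  apply: ext_inj; apply/matrixP => i j; have /matrixP/(_ i j) := E.
  by rewrite !mxE !rmorphM /= numqE => ->; rewrite mulrA [k * _]mulrC.
have Eb x y : denq k * bform N' x y = numq k * bform N x y.
  by rewrite -!bform_scale E2.
have d1 : (numq k %| denq k)%Z.
  by apply: (primitive_mul pN') => x y; rewrite Eb dvdz_mulr.
have d2 : (denq k %| numq k)%Z.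
  by apply: (primitive_mul pN) => x y; rewrite -Eb dvdz_mulr.
have nk : numq k = denq k.
  have := numq_gt0 k; rewrite k0 => nk0; have dk0 := denq_gt0 k.
  apply/eqP; rewrite -[numq k]gtz0_abs // -[denq k]gtz0_abs // eqz_nat eqn_dvd.
  by move: d1 d2; rewrite !dvdzE => -> ->.
have k1 : k = 1 by rewrite -[k]divq_num_den nk divff.
by apply: ext_inj; rewrite E k1 scale1r.
Qed.

Lemma lambda_gram_primitive K m (N : 'M[int]_3) : stable K -> (m %| PQ K)%N ->
  \det N = m%:Z * \det K -> primitive N.
Proof.
move=> sK mP dN; have [lK _ ord _] := sK; have m0 := PQ_dvd_gt0 mP.
have D0 : (0 < `|\det K|)%N by rewrite absz_gt0 gt_eqF // lattice_det_gt0.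
apply: primitiveP => q pq; rewrite dN; apply/negP; rewrite dvdzE absz_nat abszM absz_nat.
rewrite pfactor_dvdn // ?muln_gt0 ?m0 ?D0 // lognM // => q3.
have := dvdn_leq_log q D0 (dvd_PQ_det sK mP : (m %| `|\det K|)%N).
by have := ord q pq; clear -q3; lia.
Qed.

Lemma lambdaP K m : stable K -> (m %| PQ K)%N -> exists T : 'M[int]_3,
  T *m K *m T^T = m%:Z *: lambda m K /\ Lambda_basis K m T.
Proof.
move=> sK mP; have [lK _ _ _] := sK; have [symK _] := lK.
have om := PQ_dvd_odd mP; have mr : m%:R != 0 :> rat by rewrite pnatr_eq0 -lt0n (PQ_dvd_gt0 mP).
have mn : m%:Z != 0 by rewrite eqz_nat -lt0n (PQ_dvd_gt0 mP).
have [T bT] := Lambda_basis_ex (stable_sqfree sK) (lt0r_neq0 (lattice_det_gt0 lK))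
  (dvd_PQ_det sK mP).
have [dT [C TK] _] := bT; have [N EN] : exists N, T *m K *m T^T = m%:Z *: N.
  by exists (C *m T^T); rewrite TK -scalemxAl.
have det_gram (M : 'M[int]_3) : T *m K *m T^T = m%:Z *: M -> \det M = m%:Z * \det K.
  move/(congr1 determinant); rewrite detZ !det_mulmx det_tr => E.
  apply: (mulfI (expf_neq0 3 mn)); rewrite -E.
  by transitivity (\det T ^+ 2 * \det K); [ring|rewrite dT; ring].
have prN := lambda_gram_primitive sK mP (det_gram N EN).
have isN : is_lambda m K N.
  exists T, (m%:R)^-1; split=> //; first by move=> x; apply: Lambda_basisP bT.
    by rewrite invr_gt0 ltr0n (PQ_dvd_gt0 mP).
  by rewrite EN ext_scale scalerA mulVf ?scale1r.
have : is_lambda m K (lambda m K) by rewrite /lambda; case: xgetP => [_ -> //|/(_ N)].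
case=> T' [k [T'P k0 EL prL]].
have [|U uU EU] := basis_change _ T'P (fun x => Lambda_basisP x symK om bT).
  by apply/(LambdaP _ symK om); exists 0; rewrite mul0mx scaler0.
have EU2 : T' *m K *m T'^T = m%:Z *: (U *m N *m U^T).
  rewrite EU trmx_mul !mulmxA -[U *m T *m K]mulmxA -[U *m (T *m K) *m T^T]mulmxA EN.
  by rewrite -scalemxAr -scalemxAl.
have -> : lambda m K = U *m N *m U^T.
  apply: (@primitive_scale _ _ (k * m%:R)) => //.
  - apply: lambda_gram_primitive sK mP _.
    have iN : isometric N (U *m N *m U^T) by exists U.
    by rewrite -(isometric_det_int iN); apply: det_gram.
  - by rewrite mulr_gt0 // ltr0n (PQ_dvd_gt0 mP).
  - by rewrite EL EU2 ext_scale scalerA.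
by exists T'; split=> //; rewrite EU; apply: Lambda_basis_unit.
Qed.

Section LambdaFacts.
Variables (K : 'M[int]_3) (m : nat).
Hypotheses (sK : stable K) (mP : (m %| PQ K)%N).
Local Notation L := (lambda m K).
Let lK : lattice K. Proof. by case: sK. Qed.
Let m_neq0 : m%:Z != 0. Proof. by rewrite eqz_nat -lt0n (PQ_dvd_gt0 mP). Qed.

Lemma lambda_det : \det L = m%:Z * \det K.
Proof.
have [T [E [dT _ _]]] := lambdaP sK mP.
have := congr1 determinant E; rewrite detZ !det_mulmx det_tr => E2.
apply: (mulfI (expf_neq0 3 m_neq0)); rewrite -E2.
by transitivity (\det T ^+ 2 * \det K); [ring|rewrite dT; ring].
Qed.

Lemma lambda_rational : exists2 T : 'M[rat]_3, T \in unitmx &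
  T *m ext rat K *m T^T = m%:R *: ext rat L.
Proof.
have [T [E [dT _ _]]] := lambdaP sK mP; exists (ext rat T).
  by rewrite unitmxE det_ext unitfE intr_eq0 -sqrf_eq0 dT expf_neq0.
by rewrite tr_ext -!ext_mul E ext_scale.
Qed.

Lemma lambda_sym : L^T = L.
Proof.
have [T [E _]] := lambdaP sK mP; have [symK _] := lK.
by apply: (scalemx_inj m_neq0); rewrite -linearZ /= -E congr_mx_sym.
Qed.

Lemma lambda_lattice : lattice L.
Proof.
split; first exact: lambda_sym.
have [T uT E] := lambda_rational; have [_ pK] := lK.
move=> x x0; have := pK (x *m T).
rewrite -qform_conj E qform_scale pmulr_rgt0 ?ltr0n ?(PQ_dvd_gt0 mP) //.
by apply; apply: contra x0 => /eqP xT; rewrite -(mulmxK uT x) xT mul0mx.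
Qed.

Lemma lambda_even : even_lattice L <-> even_lattice K.
Proof.
have [T [E [dT _ _]]] := lambdaP sK mP.
have m_odd : (2 %| m%:Z)%Z = false by rewrite dvdzE dvdn2 (PQ_dvd_odd mP).
split=> ev x; last first.
  have : (2 %| m%:Z * qform L x)%Z by rewrite -qform_scale -E qform_conj.
  by rewrite dvd2M m_odd.
have := ev (x *m \adj T) => /(dvdz_mull m%:Z); rewrite -qform_scale -E qform_conj.
by rewrite -mulmxA mul_adj_mx mul_mx_scalar qformZ dT !exprS expr0 !dvd2M m_odd.
Qed.

Lemma lambda_isotropic q : prime q -> isotropic_at q L <-> isotropic_at q K.
Proof.
move=> pq; have [T uT ET] := lambda_rational; have m0 : m%:R != 0 :> rat.
  by rewrite pnatr_eq0 -lt0n (PQ_dvd_gt0 mP).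
split; first by apply: similar_isotropic ET => //; rewrite -unitfE -unitmxE.
apply: (@similar_isotropic q m%:R^-1 (invmx T)) => //.
  by rewrite -unitfE -unitmxE unitmx_inv.
apply: (scalemx_inj m0); rewrite /= scalerA divff // scale1r scalemxAl scalemxAr -ET.
by rewrite !mulmxA mulVmx // mul1mx trmx_inv mulmxK // unitmx_tr.
Qed.

End LambdaFacts.

Lemma stable_genus_stable K H : stable K -> genus K H -> stable H.
Proof.
move=> sK gH; have [lK _ ord iff] := sK; have lH := genus_lattice gH.
have dH := genus_det lK gH; have ev := genus_even lK gH.
have Dn : \det H != 0 by rewrite gt_eqF // lattice_det_gt0.
split=> //; rewrite ?dH //; last by rewrite iff.
apply: primitiveP => q pq; rewrite dH; apply/negP.
rewrite dvdzE absz_nat pfactor_dvdn ?absz_gt0 -?dH // dH => h.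
by have := ord q pq; clear -h; lia.
Qed.

Lemma PQ_genus K H : stable K -> genus K H -> PQ H = PQ K.
Proof.
by move=> sK gH; rewrite !PQ_prod (genus_det _ gH) //; case: sK.
Qed.

Lemma adj_mulmx (R : idomainType) n (A B : 'M[R]_n) : \det A != 0 -> \det B != 0 ->
  \adj (A *m B) = \adj B *m \adj A.
Proof.
move=> dA dB.
have E1 : \adj B *m \adj A *m (A *m B) = (\det A * \det B)%:M.
  rewrite mulmxA -[\adj B *m \adj A *m A]mulmxA mul_adj_mx mul_mx_scalar -scalemxAl mul_adj_mx.
  by rewrite scale_scalar_mx.
have E : (\det A * \det B) *: \adj (A *m B) = (\det A * \det B) *: (\adj B *m \adj A).
  by rewrite -mul_scalar_mx -E1 -mulmxA mul_mx_adj mul_mx_scalar det_mulmx.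
by apply: scalemx_inj E; rewrite mulf_neq0.
Qed.

Lemma sqfree_dvd (m : nat) (b : int) : (0 < m)%N -> (forall q, prime q -> (logn q m <= 1)%N) ->
  (forall q, prime q -> (q %| m)%N -> (q%:Z %| b)%Z) -> (m%:Z %| b)%Z.
Proof.
move=> m0 lm H; rewrite dvdzE absz_nat; apply/dvdn_partP => // q.
rewrite mem_primes => /and3P[pq _ qm]; rewrite p_part.
have := H q pq qm; rewrite dvdzE absz_nat => qb.
have := lm q pq; case: (logn q m) => [|[|//]] _; by rewrite ?expn0 ?expn1 // dvd1n.
Qed.

Lemma adj_smith3_dvd (q : int) (N L R : 'M[int]_3) a b c : L \in unitmx -> R \in unitmx ->
  \det N != 0 -> N = L *m mx3 a 0 0 0 b 0 0 0 c *m R -> (forall i j, (q %| (\adj N) i j)%Z) ->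
  (q %| a * b)%Z.
Proof.
move=> uL uR dN E qN; set D := mx3 _ _ _ _ _ _ _ _ _ in E.
have [[dL dD] dR] : (\det L != 0 /\ \det D != 0) /\ \det R != 0.
  by move: dN; rewrite E !det_mulmx !mulf_eq0 !negb_or -andbA => /and3P[-> -> ->].
have : (q %| (R *m \adj N *m L) o2 o2)%Z.
  rewrite mxE; apply: rpred_sum => i _; apply: dvdz_mulr; rewrite mxE.
  by apply: rpred_sum => k _; apply: dvdz_mull.
have -> : R *m \adj N *m L = (\det R * \det L) *: \adj D.
  rewrite E adj_mulmx ?det_mulmx ?mulf_neq0 // adj_mulmx // !mulmxA mul_mx_adj.
  by rewrite -[X in X = _]mulmxA mul_adj_mx mul_scalar_mx mul_mx_scalar scalerA mulrC.
have -> : \adj D = mx3 (b * c) 0 0 0 (a * c) 0 0 0 (a * b).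
  apply: (scalemx_inj dD); rewrite -mul_mx_scalar.
  have <- : D *m mx3 (b * c) 0 0 0 (a * c) 0 0 0 (a * b) = (\det D)%:M.
    by rewrite mul_mx3 -scalemx1 mx3_1 scale_mx3 det_mx3; congr mx3; ring.
  by rewrite mulmxA mul_adj_mx mul_scalar_mx.
rewrite !mxE /=; have /intr_unit uRL : \det R * \det L \is a GRing.unit by rewrite unitrM
  -!unitmxE uR.
by move/(dvdz_mull (\det R * \det L)); rewrite mulrA -expr2 uRL mul1r.
Qed.

Section LambdaGenus.
Variables (K : 'M[int]_3) (m : nat).
Hypotheses (sK : stable K) (mP : (m %| PQ K)%N).
Let m_neq0 : m%:Z != 0. Proof. by rewrite eqz_nat -lt0n (PQ_dvd_gt0 mP). Qed.
Let mr_neq0 : m%:R != 0 :> rat. Proof. by rewrite pnatr_eq0 -lt0n (PQ_dvd_gt0 mP). Qed.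
Let mq_neq0 q : prime q -> m%:Z%:~R != 0 :> padic_int q.
Proof. by move=> pq; rewrite intr_padic_eq0. Qed.

Lemma lambda_genus H : genus K H -> genus (lambda m K) (lambda m H).
Proof.
move=> gH; have sH := stable_genus_stable sK gH.
have mP' : (m %| PQ H)%N by rewrite (PQ_genus sK gH).
split; first exact: lambda_lattice.
  have [T uT ET] := lambda_rational sK mP; have [T' uT' ET'] := lambda_rational sH mP'.
  have [_ [X uX EX] _] := gH.
  exists (T' *m X *m invmx T); first by rewrite !unitmx_mul unitmx_inv uT' uX.
  apply: (scalemx_inj mr_neq0); rewrite scalemxAl scalemxAr -ET !trmx_mul !mulmxA mulmxKV //.
  by rewrite -[_ *m T^T *m _]mulmxA trmx_inv mulmxV ?unitmx_tr // mulmx1 -ET' -EX !mulmxA.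
move=> q pq; have [_ _ /(_ q pq)[X uX EX]] := gH.
have [T [ET [dT [C EC] univ]]] := lambdaP sK mP.
have [T' [ET' [_ [C' EC'] univ']]] := lambdaP sH mP'.
have [|Y EY] := univ _ 3%N (ext _ T' *m X) (ext _ C' *m (invmx X)^T).
  rewrite scalemxAl -ext_scale -EC' ext_mul -EX -!mulmxA; congr (_ *m _).
  by rewrite trmx_inv mulmxV ?unitmx_tr // mulmx1.
have [|Y' EY'] := univ' _ 3%N (ext _ T *m invmx X) (ext _ C *m X^T).
  rewrite scalemxAl -ext_scale -EC ext_mul -EX -!mulmxA; congr (_ *m _).
  by rewrite mulKmx.
have YY : Y' *m Y = 1%:M.
  apply: (@mulmx_detI _ _ _ (ext (padic_int q) T)).
    by rewrite det_ext intr_padic_eq0 // -sqrf_eq0 dT expf_neq0.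
  by rewrite mul1mx -mulmxA -EY mulmxA -EY' mulmxKV.
exists Y; first by have [_] := mulmx1_unit YY.
apply: (scalemx_inj (mq_neq0 pq)).
rewrite scalemxAl scalemxAr -!ext_scale -ET -ET' !ext_mul -!tr_ext.
have -> : Y *m (ext _ T *m ext _ K *m (ext _ T)^T) *m Y^T =
    (Y *m ext _ T) *m ext _ K *m (Y *m ext _ T)^T by rewrite trmx_mul !mulmxA.
by rewrite -EY trmx_mul -EX !mulmxA.
Qed.

Lemma reflvec_represented H dl v : genus K H ->
  reflvec_at m dl H v -> represented_by_genus (lambda m K) dl%:Z.
Proof.
move=> gH [Qv [c Hc]]; have sH := stable_genus_stable sK gH.
have mP' : (m %| PQ H)%N by rewrite (PQ_genus sK gH).
exists (lambda m H); first exact: lambda_genus.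
have [T [ET [_ _ univ]]] := lambdaP sH mP'.
have [|a Ea] := univ int 1%N v c; first by rewrite ext_int Hc intz.
exists a; apply: (mulfI m_neq0).
by rewrite -qform_scale -ET qform_conj (_ : a *m T = v) ?Qv ?PoszM // Ea ext_int.
Qed.

(* lambda_m(K) has rank one modulo m, which the adjugate detects. *)
Lemma lambda_adj : exists W : 'M[int]_3, \adj (lambda m K) = m%:Z *: W.
Proof.
have [lK _ _ _] := sK; have D0 := lattice_det_gt0 lK.
have [T [ET [dT [C EC] univ]]] := lambdaP sK mP.
have [|T2 ET2] := univ int 3%N (m%:Z *: 1%:M) K.
  by rewrite ext_int -scalemxAl mul1mx intz.
rewrite ext_int in ET2.
have [e Ee] : exists e, \det T = m%:Z * (e * m%:Z).
  have /eqP := dT; rewrite -[m%:Z ^+ 4]/(m%:Z ^+ (2 * 2)) exprM eqf_sqr => /orP[] /eqP ->.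
    by exists 1; rewrite mul1r expr2.
  by exists (-1); rewrite expr2; ring.
have dTn : \det T != 0 by rewrite -sqrf_eq0 dT expf_neq0.
have adjT : \adj T = (e * m%:Z) *: T2.
  have E3 : \det T *: T2 = m%:Z *: \adj T.
    by rewrite -mul_mx_scalar -mul_mx_adj mulmxA -ET2 -scalemxAl mul1mx.
  by apply: (scalemx_inj m_neq0); rewrite -E3 scalerA -Ee.
have EL : lambda m K = C *m T^T.
  by apply: (scalemx_inj m_neq0); rewrite -ET EC -scalemxAl.
have dC : \det C != 0.
  have : \det (lambda m K) != 0 by rewrite lambda_det // mulf_neq0 // gt_eqF.
  by rewrite EL det_mulmx mulf_eq0 negb_or => /andP[].
exists (e *: T2^T *m \adj C).
rewrite EL adj_mulmx ?det_tr // -trmx_adj adjT linearZ /= -scalemxAl scalerA [m%:Z * e]mulrC.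
by rewrite scalemxAl.
Qed.

Lemma genus_lambda_adj_dvd N q i j : genus (lambda m K) N -> prime q -> (q %| m)%N ->
  (q%:Z %| (\adj N) i j)%Z.
Proof.
move=> gN pq qm; have [lK _ _ _] := sK; have [W EW] := lambda_adj.
have [_ _ /(_ q pq)[X uX EX]] := gN.
have dX : \det X != 0 by apply: contraTneq uX => X0; rewrite unitmxE X0 unitr0.
have dL : \det (ext (padic_int q) (lambda m K)) != 0.
  by rewrite det_ext intr_padic_eq0 // lambda_det // mulf_neq0 // gt_eqF // lattice_det_gt0.
have adj_ext (A : 'M[int]_3) : ext (padic_int q) (\adj A) = \adj (ext _ A).
  exact: map_mx_adj.
have : ext (padic_int q) (\adj N) = m%:Z%:~R *: (\adj X^T *m (ext _ W *m \adj X)).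
  rewrite adj_ext -EX adj_mulmx ?det_tr ?det_mulmx ?mulf_neq0 // adj_mulmx //.
  by rewrite -adj_ext EW ext_scale -scalemxAl -scalemxAr.
move=> /matrixP/(_ i j); rewrite [LHS]mxE [RHS]mxE => EA.
have /dvdnP[m' Em] := qm.
have := @intr_dvd_padic q pq 1 (\adj N i j) (m'%:R * (\adj X^T *m (ext _ W *m \adj X)) i j).
by rewrite qpow1 //; apply; rewrite EA Em PoszM rmorphM; ring.
Qed.

Lemma genus_lambda_smith N L R a b c : genus (lambda m K) N -> L \in unitmx -> R \in unitmx ->
  (a %| b)%Z -> N = L *m mx3 a 0 0 0 b 0 0 0 c *m R -> (m%:Z %| b)%Z.
Proof.
move=> gN uL uR dab E; have [lK _ ord _] := sK; have lL := lambda_lattice sK mP.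
apply: sqfree_dvd => [|q pq|q pq qm]; first exact: PQ_dvd_gt0 mP.
  apply: leq_trans (ord q pq); apply: dvdn_leq_log => //.
    by rewrite absz_gt0 gt_eqF // lattice_det_gt0.
  by have := dvd_PQ_det sK mP; rewrite dvdzE.
have dN : \det N != 0.
  by rewrite (genus_det lL gN) lambda_det // mulf_neq0 // gt_eqF // lattice_det_gt0.
suff : (q%:Z %| a * b)%Z.
  rewrite !dvdzE abszM absz_nat Euclid_dvdM // => /orP[qa|//].
  by apply: dvdn_trans qa _; move: dab; rewrite dvdzE.
by apply: (adj_smith3_dvd uL uR dN E) => i j; apply: genus_lambda_adj_dvd.
Qed.

(* The rows of T span {x in N | x N = 0 mod m}, which contains m N. *)
Lemma genus_lambda_dual N : genus (lambda m K) N -> exists T C : 'M[int]_3,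
  [/\ T *m N = m%:Z *: C, \det T ^+ 2 = m%:Z ^+ 2
    & forall x : 'rV[int]_3, exists v, v *m T = m%:Z *: x].
Proof.
move=> gN; have [L [R [a [b [c [uL uR dab dbc E]]]]]] := smith3 N.
have mb := genus_lambda_smith gN uL uR dab E.
have [b' Eb] := dvdzP mb; have [c' Ec] := dvdzP (dvdz_trans mb dbc).
exists (mx3 m%:Z 0 0 0 1 0 0 0 1 *m invmx L), (mx3 a 0 0 0 b' 0 0 0 c' *m R); split.
- rewrite E !mulmxA mulmxKV // mul_mx3 scalemxAl scale_mx3 Eb Ec.
  by congr (_ *m _); congr mx3; ring.
- rewrite det_mulmx exprMn det_mx3 (intr_unit (_ : \det (invmx L) \is a GRing.unit)).
    by ring.
  by rewrite -unitmxE unitmx_inv.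
move=> x; exists (x *m L *m mx3 1 0 0 0 m%:Z 0 0 0 m%:Z).
rewrite mulmxA -[_ *m _ *m mx3 m%:Z _ _ _ _ _ _ _ _]mulmxA mul_mx3.
rewrite (_ : mx3 _ _ _ _ _ _ _ _ _ = m%:Z *: 1%:M).
  by rewrite -scalemxAr mulmx1 -scalemxAl mulmxK.
by rewrite mx3_1 scale_mx3; congr mx3; ring.
Qed.

Lemma genus_lambda_descent N T H : genus (lambda m K) N -> \det T ^+ 2 = m%:Z ^+ 2 ->
  T *m N *m T^T = m%:Z *: H -> genus K H.
Proof.
move=> gN dT EH; have [_ _ _ _] := sK; have lL := lambda_lattice sK mP.
have [S uS ES] := lambda_rational sK mP; have [_ [X uX EX] _] := gN.
have uT : ext rat T \in unitmx by rewrite unitmxE det_ext unitfE intr_eq0 -sqrf_eq0 dT expf_neq0.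
apply: stable_genus => //.
- pose Y := ext rat T *m X *m S; exists (m%:R^-1 *: Y).
    by rewrite unitmxZ ?unitfE ?invr_eq0 // !unitmx_mul uT uX.
  have EY : Y *m ext rat K *m Y^T = m%:R ^+ 2 *: ext rat H.
    have -> : Y *m ext rat K *m Y^T =
        ext rat T *m (X *m (S *m ext rat K *m S^T) *m X^T) *m (ext rat T)^T.
      by rewrite !trmx_mul !mulmxA.
    rewrite ES -scalemxAr -scalemxAl EX -scalemxAr -scalemxAl tr_ext -!ext_mul EH ext_scale.
    by rewrite scalerA.
  rewrite linearZ /= -!scalemxAl -scalemxAr EY !scalerA (_ : _ * _ = 1) ?scale1r //.
  by field.
- have := congr1 determinant EH; rewrite detZ (det_mulmx (T *m N)) (det_mulmx T) det_tr.
  rewrite (genus_det lL gN) lambda_det // => E; apply: (mulfI (expf_neq0 3 m_neq0)); rewrite -E.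
  by transitivity (\det T ^+ 2 * m%:Z * \det K); [ring|rewrite dT; ring].
- move=> evK y; have evN : even_lattice N by apply/(genus_even lL gN)/(lambda_even sK mP).
  have := evN (y *m T); rewrite -qform_conj EH qform_scale dvd2M.
  by rewrite dvdzE dvdn2 (PQ_dvd_odd mP).
Qed.

Lemma represented_reflvec dl : represented_by_genus (lambda m K) dl%:Z ->
  exists H v, genus K H /\ reflvec_at m dl H v.
Proof.
move=> [N gN [x Qx]]; have [sN _] := genus_lattice gN.
have [T [C [TN dT span]]] := genus_lambda_dual gN; have [v vT] := span x.
have EH : T *m N *m T^T = m%:Z *: (C *m T^T) by rewrite TN -scalemxAl.
exists (C *m T^T), v; split; first exact: genus_lambda_descent EH.
split.
  by apply: (mulfI m_neq0); rewrite -qform_scale -EH qform_conj vT qformZ Qx PoszM; ring.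
exists (x *m C^T); apply: (scalemx_inj m_neq0); rewrite [LHS]scalemxAr.
rewrite -EH (mulmxA v) (mulmxA v T) vT -!scalemxAl -mulmxA; congr (_ *: _).
have -> : N *m T^T = (T *m N)^T by rewrite [RHS]trmx_mul sN.
by rewrite TN linearZ /= -scalemxAr.
Qed.

End LambdaGenus.

(** * The local factor at 2 *)

Lemma two_local_sq (G H : 'M[padic_int 2]_3) s : s \is a GRing.unit -> G^T = G -> H^T = H ->
  \det H = \det G * s ^+ 2 -> sqfree_at (\det G) ->
  (padic_even G /\ padic_even H) \/ [/\ \det G \is a GRing.unit, ~ padic_even G,
    ~ padic_even H & (isotropic G <-> isotropic H)] ->
  isometric G H.
Proof.
move=> us sG sH dH sq alt.
pose U := mx3 s 0 0 0 1 0 0 0 1 : 'M[padic_int 2]_3; pose G' := U *m G *m U^T.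
have uU : U \in unitmx by rewrite unitmxE det_mx3 (_ : _ + _ = s) //; ring.
have iG : isometric G G' by exists U.
have iG' := isometric_sym iG.
apply: (isometric_trans iG); apply: two_local.
- exact: congr_mx_sym.
- by [].
- by rewrite dH /G' !det_mulmx det_tr (_ : \det U = s) ?det_mx3; ring.
- exact: (isometric_sqfree iG).
case: alt => [[evG evH]|[ud nG nH iso]]; [left|right].
  by split=> //; apply: isometric_padic_even evG.
split=> //.
- by rewrite /G' !det_mulmx det_tr !unitrM ud -unitmxE uU.
- by move=> ev; apply: nG; apply: isometric_padic_even ev.
- by rewrite -iso; split; apply: isometric_isotropic.
Qed.

Lemma sqfree_at2 (d : int) : ~~ (4 %| d)%Z -> sqfree_at (d%:~R : padic_int 2).
Proof.
by move=> nd [z Ez]; have := @intr_dvd_padic 2 isT 2 d z Ez; apply/negP.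
Qed.

Lemma loc2_odd (L M : 'M[int]_3) : L^T = L -> M^T = M -> ~~ (2 %| \det L)%Z ->
  (8 %| \det M - \det L)%Z -> ~ even_lattice L -> ~ even_lattice M ->
  (isotropic_at 2 L <-> isotropic_at 2 M) -> locally_isometric 2 L M.
Proof.
move=> sL sM oL d8 eL eM iso; have [s us Es] := int_square8 oL d8.
apply: (two_local_sq us); rewrite ?tr_ext ?sL ?sM ?det_ext //.
  apply: sqfree_at2; apply: contra oL => h; exact: dvdz_trans h.
right; split=> //; rewrite ?padic_even_ext // ?padic_unit_int //.
Qed.

Lemma loc2_even (L M : 'M[int]_3) a b : L^T = L -> M^T = M -> even_lattice L -> even_lattice M ->
  \det L = 2 * a -> \det M = 2 * b -> ~~ (2 %| a)%Z -> (8 %| b - a)%Z -> locally_isometric 2 L M.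
Proof.
move=> sL sM eL eM dL dM oa d8; have [s us Es] := int_square8 oa d8.
apply: (two_local_sq us); rewrite ?tr_ext ?sL ?sM ?det_ext //.
- by rewrite dL dM !rmorphM /= Es mulrA.
- by apply: sqfree_at2; rewrite dL; apply: contra oa; clear; lia.
- by left; split; apply/padic_even_ext.
Qed.

Lemma unit_sq_mod8 (a b : int) (u : padic_int 2) : u \is a GRing.unit ->
  b%:~R = a%:~R * u ^+ 2 -> (8 %| b - a)%Z.
Proof.
move=> uu E; have p2 : prime 2 by [].
have [w Ew] : exists w : int, [/\ ~~ (2 %| w)%Z & (8 %| b - a * w ^+ 2)%Z].
  exists (u 3%N); split.
    have := uu; rewrite padic_unitE // /pi_dvd.
    have := @padic_resD 2 u 1 2; rewrite -[padic_base 2]/2%N /=.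
    by rewrite addnE /= => <-; clear; lia.
  have := congr1 (fun t : padic_int 2 => t 3%N) E.
  rewrite intr_padicE // padicME // expr2 padicME // intr_padicE // modzMmr modzMml mulrA => /eqP.
  by rewrite eqz_mod_dvd.
case: Ew => /sq_mod8[t Et] d8; have w8 : (8 %| w ^+ 2 - 1)%Z.
  by apply/dvdzP; exists t; rewrite Et; ring.
have -> : b - a = b - a * w ^+ 2 + a * (w ^+ 2 - 1) by ring.
by rewrite rpredD // dvdz_mull.
Qed.

Lemma loc2_det_odd (L M : 'M[int]_3) : locally_isometric 2 L M -> (8 %| \det M - \det L)%Z.
Proof.
move=> /isometric_det[u uu]; rewrite !det_ext => E; apply: (unit_sq_mod8 uu).
by rewrite E mulrC.
Qed.

Lemma loc2_det_even (L M : 'M[int]_3) a b : \det L = 2 * a -> \det M = 2 * b ->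
  locally_isometric 2 L M -> (8 %| b - a)%Z.
Proof.
move=> dL dM /isometric_det[u uu]; rewrite !det_ext dL dM !rmorphM /= => E.
apply: (unit_sq_mod8 uu).
have n2 : (2%:~R : padic_int 2) != 0 by rewrite intr_padic_eq0.
by apply: (mulfI n2); rewrite E; ring.
Qed.

Lemma diag3_sym a b c : (diag3 a b c)^T = diag3 a b c.
Proof. by rewrite diag3E tr_mx3. Qed.

Lemma diag3_det a b c : \det (diag3 a b c) = a * b * c.
Proof. by rewrite diag3E det_mx3; ring. Qed.

Lemma diag3_odd a b c : ~~ (2 %| a)%Z -> ~ even_lattice (diag3 a b c).
Proof. by move=> /negP oa; rewrite diag3E => /even_smx3P[]. Qed.

Lemma A_perp_sym c : (A_perp c)^T = A_perp c.
Proof. by rewrite A_perpE tr_mx3. Qed.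

Lemma A_perp_det c : \det (A_perp c) = 3 * c.
Proof. by rewrite A_perpE det_mx3; ring. Qed.

Lemma A_perp_even c : even_lattice (A_perp (2 * c)).
Proof. by rewrite A_perpE; apply/even_smx3P; split=> //; apply: dvdz_mulr. Qed.

Lemma isotropic_split7 (n p q r : int) : p != 0 -> ((p * r - q ^+ 2) %% 8)%Z = 7 ->
  isotropic_at 2 (smx3 n p r 0 0 q).
Proof.
move=> p0 d8; have [|s _ Es] := @int_square8 1 (- (p * r - q ^+ 2)) isT; first by clear -d8; lia.
exists (rv3 0 (- q%:~R + s) p%:~R); first by rewrite rv3_neq0 intr_padic_eq0 // (negPf p0) !andbF.
rewrite ext_smx3 qform_rv3; transitivity (p%:~R * (s ^+ 2 - (- (p * r - q ^+ 2))%:~R));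
  first by ring.
by rewrite Es mul1r subrr mulr0.
Qed.

Lemma isotropic_diag113 : isotropic_at 2 (diag3 1 1 3).
Proof.
have [s _ Es] := @int_square8 1 (-7) isT isT.
exists (rv3 2 s 1); first by rewrite rv3_neq0 oner_eq0 !andbF.
rewrite diag3E (ext_smx3 _ 1 1 3 0 0 0) qform_rv3; transitivity (s ^+ 2 - (-7)%:~R); first by ring.
by rewrite Es mul1r subrr.
Qed.

Lemma anisotropic_split (n p q r : int) : ~~ (2 %| n)%Z -> ((4 * p * r - q ^+ 2) %% 8)%Z = 3 ->
  ~ isotropic_at 2 (smx3 n (2 * p) (2 * r) 0 0 q).
Proof.
move=> on d3 /(@iso_prim 2 isT)[x [y [z [E u]]]].
have [oq op orr] : [/\ ~~ (2 %| q)%Z, ~~ (2 %| p)%Z & ~~ (2 %| r)%Z].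
  have oq : ~~ (2 %| q)%Z.
    apply/negP => /evenE[t Et]; move: d3; rewrite Et (_ : _ - _ = 4 * (p * r - t ^+ 2));
      last by ring.
    by move: (_ - _) => w; clear; lia.
  have [t Et] := sq_mod8 oq; have : ~~ (2 %| p * r)%Z by move: d3; rewrite -mulrA Et;
    move: (p * r); clear; lia.
  by rewrite dvd2M negb_or => /andP[].
have un k : ~~ (2 %| k)%Z -> (k%:~R : padic_int 2) \is a GRing.unit by move=> o;
  rewrite padic_unit_int.
pose s : padic_int 2 := p%:~R * (y * y) + r%:~R * (z * z) + q%:~R * (y * z).
have E2 : n%:~R * (x * x) + 2 * s = 0 by rewrite -E ext_smx3 qform_rv3 /s; ring.
have dx : pi_dvd x.
  rewrite -[pi_dvd x]negbK -padic_unitE //; apply/negP => ux.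
  suff : n%:~R * (x * x) + 2 * s \is a GRing.unit by rewrite E2 unitr0.
  by apply: padic_unitD; rewrite ?unitrM ?un ?ux ?pi_dvd_double.
have [x' Ex] := pi_dvd_half dx; have : s \isn't a GRing.unit.
  rewrite padic_unitE // negbK (_ : s = 2 * - (n%:~R * (x' * x'))) ?pi_dvd_double //.
  apply: (mulfI (pi_neq0 (isT : prime 2))).
  by transitivity (n%:~R * (x * x) + 2 * s - n%:~R * (x * x)); [ring|rewrite E2 Ex; ring].
apply/negP; rewrite negbK; move: u; rewrite padic_unitE // dx /= /s.
have dM (a b c : padic_int 2) : ~~ (a \is a GRing.unit) ->
  pi_dvd (b * (c * a)) /\ pi_dvd (b * (a * c)).
  by rewrite padic_unitE // negbK => h; split; apply: pi_dvd_mull => //;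
    [apply: pi_dvd_mull|apply: pi_dvd_mulr].
have [uy|ny] := boolP (y \is a GRing.unit); have [uz|nz] //= := boolP (z \is a GRing.unit) => _.
- by rewrite addrC; apply: padic_unitD; rewrite ?pi_dvd_unitD // ?unitrM ?un ?uy ?uz.
- have [h1 _] := dM z q%:~R y nz; have [h2 _] := dM z r%:~R z nz.
  by rewrite -addrA; apply: padic_unitD; rewrite ?pi_dvdD // ?unitrM ?un ?uy.
- have [_ h1] := dM y q%:~R z ny; have [h2 _] := dM y p%:~R y ny.
  by rewrite -addrA addrCA; apply: padic_unitD; rewrite ?pi_dvdD // ?unitrM ?un ?uz.
Qed.

(* The vectors (1, 1, 1), (1, -1, 0), (0, 1, -1) span a sublattice of index 3. *)
Lemma anisotropic_diag333 : ~ isotropic_at 2 (diag3 3 3 3).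
Proof.
suff i : isometric (ext (padic_int 2) (diag3 3 3 3))
  (ext (padic_int 2) (smx3 9 (2 * 3) (2 * 3) 0 0 (- 3))).
  by move=> /(isometric_isotropic (isometric_sym i)); exact: anisotropic_split.
exists (mx3 1 1 1 1 (-1) 0 0 1 (-1)).
  by rewrite unitmxE det_mx3 (_ : _ + _ = 3%:~R) ?padic_unit_int //; ring.
by rewrite diag3E (ext_smx3 _ 3 3 3 0 0 0) ext_smx3 tr_mx3 !mul_mx3; congr mx3; ring.
Qed.

Section Tcoef.
Variables (L : 'M[int]_3) (D : int).
Hypotheses (sL : L^T = L).
Local Notation loc_iso2 := (locally_isometric 2).

Lemma not_loc_iso2_diag3 a b c : (8 %| \det L - D)%Z -> ~~ (8 %| a * b * c - D)%Z ->
  `[< loc_iso2 L (diag3 a b c) >] = false.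
Proof.
by move=> d8 n8; apply: asboolF => /loc2_det_odd; rewrite diag3_det; clear -d8 n8; lia.
Qed.

Lemma tcoef1_D1 : (8 %| \det L - D)%Z -> (D %% 4)%Z = 1 -> tcoef L 1 = 1 / 2.
Proof.
move=> d8 D1; rewrite /tcoef /=.
rewrite !not_loc_iso2_diag3 //; try by clear -D1; lia.
by rewrite (_ : (_ == _ %[mod 4])%Z) // eqz_mod_dvd; clear -d8 D1; lia.
Qed.

Lemma loc2_diag3 a b c : ~ even_lattice L -> (8 %| \det L - D)%Z -> (8 %| a * b * c - D)%Z ->
  ~~ (2 %| D)%Z -> (isotropic_at 2 L <-> isotropic_at 2 (diag3 a b c)) ->
  loc_iso2 L (diag3 a b c).
Proof.
move=> oL dL dabc oD iso; apply: loc2_odd => //; rewrite ?diag3_det; first exact: diag3_sym.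
- by clear -dL oD; lia.
- by clear -dL dabc; lia.
apply/diag3_odd/negP => a2; have : (2 %| a * b * c)%Z by rewrite -mulrA dvdz_mulr.
by clear -dabc oD; lia.
Qed.

Lemma tcoef1_D3_isotropic : ~ even_lattice L -> (8 %| \det L - D)%Z -> (D %% 8)%Z = 3 ->
  isotropic_at 2 L -> tcoef L 1 = 3.
Proof.
move=> oL d8 D1 iso; rewrite /tcoef /= asboolT //; apply: loc2_diag3 => //; try by clear -D1; lia.
by split=> // _; exact: isotropic_diag113.
Qed.

Lemma tcoef1_D3_anisotropic : ~ even_lattice L -> (8 %| \det L - D)%Z -> (D %% 8)%Z = 3 ->
  ~ isotropic_at 2 L -> tcoef L 1 = 1.
Proof.
move=> oL d8 D1 iso; rewrite /tcoef /= asboolF; last first.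
  by move=> i; apply: iso; apply: isometric_isotropic i isotropic_diag113.
rewrite asboolT //; apply: loc2_diag3 => //; try by clear -D1; lia.
by split=> // /anisotropic_diag333.
Qed.

Lemma tcoef1_D7 : ~ even_lattice L -> (8 %| \det L - D)%Z -> (D %% 8)%Z = 7 ->
  isotropic_at 2 L -> tcoef L 1 = 2.
Proof.
move=> oL d8 D1 iso; rewrite /tcoef /=.
rewrite (@not_loc_iso2_diag3 1 1 3) ?(@not_loc_iso2_diag3 3 3 3) //; try by clear -D1; lia.
rewrite asboolT //; apply: loc2_diag3 => //; try by clear -D1; lia.
by split=> // _; rewrite diag3E; apply: isotropic_split7.
Qed.

Lemma tcoef2_odd : ~ even_lattice L -> tcoef L 2 = 1 / 2.
Proof.
move=> oL; have nl c : ~ loc_iso2 L (A_perp (2 * c)).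
  move=> /isometric_sym i; apply: oL; apply: (local_even _ _ i) => //.
    exact: A_perp_sym.
  exact: A_perp_even.
rewrite /tcoef /= (asboolF (nl 1)) (asboolF (nl 7)) (asboolF (nl 3)) (asboolF (nl 5)) asboolT //.
have [x ox] : exists x, ~~ (2 %| qform L x)%Z.
  by apply: contra_notP oL => /forallNP h x; apply/negPn/negP/h.
apply/seteqP; split=> // r _.
have u : ((qform L x)%:~R : padic_int 2) \is a GRing.unit by rewrite padic_unit_int.
exists [:: (r / (qform L x)%:~R, (qform L x)%:~R)] => [t|].
  by rewrite inE => /eqP -> /=; exists (map_mx intr x); rewrite ?qform_ext.
by rewrite big_seq1 /= divrK.
Qed.

Lemma tcoef2_even a : even_lattice L -> \det L = 2 * a -> (8 %| a - D)%Z -> ~~ (2 %| D)%Z ->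
  tcoef L 2 = if (D %% 8)%Z == 3 then 4 else if (D %% 8)%Z == 7 then 2 else 1.
Proof.
move=> eL dL d8 oD.
have Y c : (8 %| 3 * c - D)%Z -> `[< loc_iso2 L (A_perp (2 * c)) >] = true.
  move=> h; rewrite asboolT //;
    apply: (loc2_even sL (A_perp_sym _) eL (@A_perp_even c) dL (b := 3 * c)).
  - by rewrite A_perp_det; ring.
  - by clear -oD d8; lia.
  - by clear -h d8; lia.
have N c : ~~ (8 %| 3 * c - D)%Z -> `[< loc_iso2 L (A_perp (2 * c)) >] = false.
  move=> /negP h; rewrite asboolF // => i; apply: h.
  have := loc2_det_even dL (b := 3 * c) _ i.
  by rewrite A_perp_det (_ : 3 * (2 * c) = 2 * (3 * c)) => [/(_ erefl)|]; [clear -d8; lia|ring].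
rewrite /tcoef /=.
have Y1 := Y 1; have Y7 := Y 7; have Y3 := Y 3; have Y5 := Y 5.
have N1 := N 1; have N7 := N 7; have N3 := N 3; have N5 := N 5.
have : [\/ (D %% 8)%Z = 1, (D %% 8)%Z = 3, (D %% 8)%Z = 5 | (D %% 8)%Z = 7].
  have : (D %% 8)%Z = 1 \/ (D %% 8)%Z = 3 \/ (D %% 8)%Z = 5 \/ (D %% 8)%Z = 7 by clear -oD; lia.
  by case=> [|[|[]]] h; [apply: Or41|apply: Or42|apply: Or43|apply: Or44].
case=> E; rewrite E /=.
- by rewrite N1 ?N7 ?Y3 //; clear -E; lia.
- by rewrite Y1 //; clear -E; lia.
- by rewrite N1 ?Y7 //; clear -E; lia.
- by rewrite N1 ?N7 ?N3 ?Y5 //; clear -E; lia.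
Qed.

End Tcoef.

Lemma isotropic_split3 (n p q r : int) : ~~ (2 %| n)%Z -> ~~ (2 %| q)%Z -> ~~ (2 %| r)%Z ->
  isotropic_at 2 (smx3 n (4 * p) r 0 0 q).
Proof.
move=> on oq orr.
have [||y _ Ey] := @hensel 2 isT p%:~R q%:~R (r + n)%:~R.
- by rewrite padic_unit_int.
- by rewrite pi_dvd_int //; clear -on orr; lia.
exists (rv3 2 y 2); first by rewrite rv3_neq0 (_ : 2 = 2%:~R) // intr_padic_eq0.
rewrite ext_smx3 qform_rv3.
transitivity (4 * (p%:~R * y ^+ 2 + q%:~R * y + (r + n)%:~R)); first by ring.
by rewrite Ey mulr0.
Qed.

(** * Ideals of imaginary quadratic fields *)

(* Stated for explicit factors: rmorphM would also split [ratr a] into its numerator and denominator. *)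
Lemma conjM (x y : algC) : (x * y)^* = x^* * y^*.
Proof. exact: rmorphM. Qed.

Definition zmod (M : set algC) := M 0 /\ forall x y, M x -> M y -> M (x - y).

(* The subgroup generated by the products; the impredicative form turns every
   inclusion between products into a closure property. *)
Definition prodI (I J : set algC) : set algC :=
  [set z | forall M, zmod M -> (forall x y, I x -> J y -> M (x * y)) -> M z].

Definition conjI (I : set algC) : set algC := [set x | I x^*].
Definition scl (x : algC) (I : set algC) : set algC := [set x * y | y in I].

Lemma zmodN M x : zmod M -> M x -> M (- x).
Proof. by move=> [M0 MB] Mx; rewrite -sub0r; apply: MB. Qed.

Lemma zmodD M x y : zmod M -> M x -> M y -> M (x + y).
Proof. by move=> zM Mx My; rewrite -[y]opprK; apply: (proj2 zM) => //; apply: zmodN. Qed.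

Lemma zmodZ M (i : int) x : zmod M -> M x -> M (i%:~R * x).
Proof.
move=> zM Mx; have P (n : nat) : M (n%:R * x).
  elim: n => [|n IH]; first by rewrite mul0r; case: zM.
  by rewrite -addn1 natrD mulrDl mul1r; apply: zmodD.
by case: i => n; rewrite ?NegzE ?rmorphN ?mulNr /=; [|apply: zmodN]; rewrite //; exact: P.
Qed.

Lemma prodI_in I J x y : I x -> J y -> prodI I J (x * y).
Proof. by move=> Ix Jy M _; apply. Qed.

Lemma prodI_zmod I J : zmod (prodI I J).
Proof.
split=> [M [_ _] _ //|x y Px Py M zM H].
by apply: (proj2 zM); [apply: Px|apply: Py].
Qed.

Lemma prodI_sub I J M : zmod M -> (forall x y, I x -> J y -> M (x * y)) -> prodI I J `<=` M.
Proof. by move=> zM H z; apply. Qed.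

Lemma prodIC I J : prodI I J = prodI J I.
Proof.
suff sub A B : prodI A B `<=` prodI B A by apply/seteqP; split; apply: sub.
apply: prodI_sub; first exact: prodI_zmod.
by move=> x y Ax By; rewrite mulrC; apply: prodI_in.
Qed.

Lemma prodIA I J L : prodI I (prodI J L) = prodI (prodI I J) L.
Proof.
suff sub A B C : prodI A (prodI B C) `<=` prodI (prodI A B) C.
  apply/seteqP; split; first exact: sub.
  by rewrite prodIC [prodI I J]prodIC [prodI I (prodI _ _)]prodIC [prodI J L]prodIC; apply: sub.
apply: prodI_sub; first exact: prodI_zmod.
move=> x z Ax; apply: (@prodI_sub _ _ [set z | prodI (prodI A B) C (x * z)]).
  split=> [|u v /= Pu Pv]; first by rewrite /= mulr0; case: (prodI_zmod (prodI A B) C).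
  by rewrite mulrBr; apply: (proj2 (prodI_zmod _ _)).
by move=> u v Bu Cv /=; rewrite mulrA; apply: prodI_in => //; apply: prodI_in.
Qed.

Lemma prodIAC I J L : prodI (prodI I J) L = prodI (prodI I L) J.
Proof. by rewrite -!prodIA [prodI J L]prodIC. Qed.

Lemma conjIK I : conjI (conjI I) = I.
Proof. by apply/seteqP; split=> x; rewrite /conjI /= conjCK. Qed.

Lemma conjI_zmod I : zmod I -> zmod (conjI I).
Proof.
by move=> [I0 IB]; split=> [|x y]; rewrite /conjI /= ?rmorph0 // rmorphB; apply: IB.
Qed.

Lemma conj_prodI I J : conjI (prodI I J) = prodI (conjI I) (conjI J).
Proof.
have sub A B : prodI A B `<=` conjI (prodI (conjI A) (conjI B)).
  apply: prodI_sub; first exact/conjI_zmod/prodI_zmod.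
  by move=> x y Ax By; rewrite /conjI /= rmorphM; apply: prodI_in; rewrite /conjI /= conjCK.
apply/seteqP; split=> z.
  by move/sub; rewrite /conjI /= conjCK.
by move/sub; rewrite !conjIK.
Qed.

Lemma scl_zmod x I : zmod I -> zmod (scl x I).
Proof.
move=> [I0 IB]; split; first by exists 0; rewrite ?mulr0.
by move=> _ _ [y Iy <-] [z Iz <-]; exists (y - z); [apply: IB|rewrite mulrBr].
Qed.

Lemma scl_prodI x I J : scl x (prodI I J) = prodI (scl x I) J.
Proof.
apply/seteqP; split.
  move=> _ [z Pz <-]; move: z Pz; apply: (@prodI_sub _ _ [set z | prodI (scl x I) J (x * z)]).
    split=> [|u v /= Pu Pv]; first by rewrite /= mulr0; case: (prodI_zmod (scl x I) J).
    by rewrite mulrBr; apply: (proj2 (prodI_zmod _ _)).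
  by move=> u v Iu Jv /=; rewrite mulrA; apply: prodI_in => //; exists u.
apply: prodI_sub; first exact/scl_zmod/prodI_zmod.
by move=> _ v [u Iu <-] Jv; exists (u * v); [apply: prodI_in|rewrite mulrA].
Qed.

Lemma scl_prodIr x I J : scl x (prodI I J) = prodI I (scl x J).
Proof. by rewrite prodIC scl_prodI prodIC. Qed.

Lemma sclM x y I : scl x (scl y I) = scl (x * y) I.
Proof.
apply/seteqP; split=> [_ [_ [z Iz <-] <-]|_ [z Iz <-]].
  by exists z; rewrite ?mulrA.
by exists (y * z); [exists z|rewrite mulrA].
Qed.

Lemma scl1 I : scl 1 I = I.
Proof.
apply/seteqP; split=> [_ [z Iz <-]|z Iz]; first by rewrite mul1r.
by exists z; rewrite ?mul1r.
Qed.

Lemma conj_scl x I : conjI (scl x I) = scl x^* (conjI I).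
Proof.
apply/seteqP; split=> z.
  move=> [y Iy E]; exists y^*; rewrite /conjI /= ?conjCK //.
  by rewrite -rmorphM /= E conjCK.
by move=> [y Iy <-]; exists y^*; rewrite // conjM conjCK.
Qed.

Lemma scl_inj x I J : x != 0 -> scl x I = scl x J -> I = J.
Proof.
by move=> x0 E; rewrite -[I]scl1 -[J]scl1 -(mulVf x0) -!sclM E.
Qed.

Record sqf := SqF { sqf_val :> int; sqf_gt0 : 0 < sqf_val; sqf_free : sqfreez sqf_val }.

Section Quad.
Variable dd : sqf.
Local Notation D := (sqf_val dd).
Let D0 : 0 < D := sqf_gt0 dd.
Let Dsq : sqfreez D := @sqf_free dd.
Local Notation E := (quad_field (- D)).
Local Notation O := (integers E).
Definition sqrtND : algC := sqrtC (- D)%:~R.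
Local Notation s := sqrtND.

Lemma sqrtND_sq : s ^+ 2 = - D%:~R.
Proof. by rewrite /s sqrtCK rmorphN. Qed.

Lemma sqrtND_conj : s^* = - s.
Proof.
have : (s^*) ^+ 2 = s ^+ 2 by rewrite -rmorphXn sqrtND_sq rmorphN /= rmorph_int.
move=> /eqP; rewrite eqf_sqr => /orP[/eqP sr|/eqP //].
have /CrealP rs := sr; have := real_exprn_even_ge0 rs (n := 2%N) isT.
by rewrite sqrtND_sq oppr_ge0 lerz0 leNgt D0.
Qed.

Lemma sqrtND_neq0 : s != 0.
Proof.
apply: contraTneq D0 => s0; have := sqrtND_sq; rewrite s0 expr0n /= => /eqP.
by rewrite eq_sym oppr_eq0 intr_eq0 => /eqP ->.
Qed.

Lemma quadP a b : E (ratr a + ratr b * s).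
Proof. by exists a, b. Qed.

Lemma quad_rat a : E (ratr a).
Proof. by exists a, 0; rewrite rmorph0 mul0r addr0. Qed.

Lemma quad_int (i : int) : E i%:~R.
Proof. by rewrite -(@ratr_int algC i); exact: quad_rat. Qed.

Lemma quadD x y : E x -> E y -> E (x + y).
Proof. by move=> [a [b ->]] [c [d ->]]; exists (a + c), (b + d); ring. Qed.

Lemma quadN x : E x -> E (- x).
Proof. by move=> [a [b ->]]; exists (- a), (- b); ring. Qed.

Lemma quadB x y : E x -> E y -> E (x - y).
Proof. by move=> Ex Ey; apply: quadD => //; apply: quadN. Qed.

Lemma quadM x y : E x -> E y -> E (x * y).
Proof.
move=> [a [b ->]] [c [d ->]]; exists (a * c - D%:~R * b * d), (a * d + b * c).
have := sqrtND_sq; rewrite -/s; have -> : (D%:~R : algC) = ratr D%:~R by rewrite ratr_int.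
by move=> h; ring: h.
Qed.

Lemma quad_sqrt : E s.
Proof. by exists 0, 1; rewrite rmorph0 rmorph1 add0r mul1r. Qed.

Lemma conj_quadE a b : (ratr a + ratr b * s)^* = ratr a - ratr b * s.
Proof. by rewrite rmorphD /= (conjM (ratr b)) !fmorph_rat sqrtND_conj mulrN. Qed.

Lemma quad_conj x : E x -> E x^*.
Proof.
move=> [a [b ->]]; exists a, (- b).
by rewrite -/s conj_quadE; ring.
Qed.

Lemma quad_normE a b : (ratr a + ratr b * s) * (ratr a + ratr b * s)^*
  = ratr (a ^+ 2 + D%:~R * b ^+ 2).
Proof.
rewrite conj_quadE.
have := sqrtND_sq; rewrite -/s; have -> : (D%:~R : algC) = ratr D%:~R by rewrite ratr_int.
by move=> h; ring: h.
Qed.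

Lemma quad_norm x : E x -> exists2 r, x * x^* = ratr r & 0 <= r.
Proof.
move=> [a [b ->]]; exists (a ^+ 2 + D%:~R * b ^+ 2); first exact: quad_normE.
by rewrite addr_ge0 ?sqr_ge0 // mulr_ge0 ?sqr_ge0 // ler0z ltW.
Qed.

Lemma quad_trace x : E x -> exists t, x + x^* = ratr t.
Proof.
move=> [a [b ->]]; exists (2 * a).
by rewrite -/s conj_quadE; ring.
Qed.

Lemma quadV x : E x -> E x^-1.
Proof.
move=> Ex; have [->|x0] := eqVneq x 0; first by rewrite invr0 -[0](@ratr_int algC 0);
  apply: quad_rat.
have [r Er _] := quad_norm Ex.
have r0 : (ratr r : algC) != 0 by rewrite -Er mulf_neq0 // fmorph_eq0.
have -> : x^-1 = x^* * ratr r^-1.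
  by apply: (mulfI x0); rewrite divff // mulrA Er fmorphV divff.
by apply: quadM; [apply: quad_conj|apply: quad_rat].
Qed.

Lemma norm_eq0 (x : algC) : x * x^* = 0 -> x = 0.
Proof. by move/eqP; rewrite mulf_eq0 fmorph_eq0 orbb => /eqP. Qed.

Definition qpar : bool := (D %% 4)%Z == 3.
Definition trw : int := qpar%:Z.
Definition nmw : int := if qpar then ((1 + D) %/ 4)%Z else D.
Definition omega : algC := if qpar then (1 + s) / 2 else s.
Definition disc : int := if qpar then - D else - (4 * D).

Lemma discE : disc = trw ^+ 2 - 4 * nmw.
Proof. by rewrite /disc /trw /nmw /qpar; case: eqP => h /=; rewrite ?expr0n ?expr1n /=; clear -h;
  lia. Qed.

Lemma quad_omega : E omega.
Proof.
rewrite /omega; case: ifP => _; last exact: quad_sqrt.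
apply: quadM; first by apply: quadD; [exact: (quad_int 1)|exact: quad_sqrt].
exact: quadV (quad_int 2).
Qed.

Lemma omega_conj : omega^* = trw%:~R - omega.
Proof.
rewrite /omega /trw; case: ifP => _ /=; last by rewrite sqrtND_conj; ring.
by rewrite rmorphM /= rmorphD /= rmorph1 sqrtND_conj fmorphV rmorph_nat; field.
Qed.

Lemma omega_sq : omega ^+ 2 = trw%:~R * omega - nmw%:~R.
Proof.
rewrite /omega /trw /nmw; case: ifP => h /=; last by rewrite sqrtND_sq; ring.
have E4 : (((1 + D) %/ 4)%Z)%:~R * 4 = 1 + D%:~R :> algC.
  have h4 : ((1 + D) %/ 4)%Z * 4 = 1 + D by move/eqP: h; clear; lia.
  transitivity ((((1 + D) %/ 4)%Z * 4)%:~R : algC); first by ring.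
  by rewrite h4; ring.
apply: (mulfI (_ : 4 != 0)); first by rewrite pnatr_eq0.
transitivity (1 + 2 * s + s ^+ 2); first by field.
rewrite sqrtND_sq mulrBr [4 * (_ %/ _)%Z%:~R]mulrC E4; by field.
Qed.

Lemma omega_norm : omega * omega^* = nmw%:~R.
Proof. by rewrite omega_conj mulrBr -expr2 omega_sq; ring. Qed.

Definition sqrtd : algC := 2 * omega - trw%:~R.

Lemma sqrtd_sq : sqrtd ^+ 2 = disc%:~R.
Proof. rewrite /sqrtd discE; have h := omega_sq; ring: h. Qed.

Lemma disc_lt0 : disc < 0.
Proof. by rewrite /disc; case: ifP => _; clear -D0; lia. Qed.

Lemma sqrtd_neq0 : sqrtd != 0.
Proof.
apply: contraTneq disc_lt0 => s0; have := sqrtd_sq; rewrite s0 expr0n /= => /eqP.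
by rewrite eq_sym intr_eq0 => /eqP ->.
Qed.

Lemma Aint2 (x : algC) (t n : int) : x ^+ 2 = t%:~R * x - n%:~R -> x \in Aint.
Proof.
move=> Ex; pose p : {poly algC} := 'X^2 - t%:~R%:P * 'X + n%:~R%:P.
have sp : (size (- (t%:~R%:P * 'X) + n%:~R%:P : {poly algC})%R < size ('X^2 : {poly algC}))%N.
  rewrite size_polyXn -mulNr -polyCN size_MXaddC; case: ifP => // _.
  by rewrite ltnS; apply: leq_ltn_trans (size_polyC_leq1 _) _.
apply: (@root_monic_Aint p).
- by rewrite /root /p !hornerE Ex; apply/eqP; ring.
- by rewrite monicE /p -addrA lead_coefDl // lead_coefXn.
- apply/polyOverP => i; rewrite /p coefD coefB coefXn coefCM coefX coefC.
  rewrite rpredD ?rpredB ?rpredM ?rpred_nat ?rpred_int //.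
  by case: ifP => _; rewrite ?rpred0 ?rpred_int.
Qed.

Lemma ratr_inj (a b : rat) : (ratr a : algC) = ratr b -> a = b.
Proof. exact: fmorph_inj. Qed.

Lemma rat_int (r : rat) : (ratr r : algC) \in Aint -> exists i : int, r = i%:~R.
Proof.
move=> h; have : (ratr r : algC) \in Num.int by rewrite Cint_rat_Aint ?Crat_rat.
by move/intrP => [i Ei]; exists i; apply: ratr_inj; rewrite Ei ratr_int.
Qed.

Lemma qint_quad x : O x -> E x. Proof. by case. Qed.

Lemma qint_trace_norm x : E x -> O x <-> exists t n : int, x + x^* = t%:~R /\ x * x^* = n%:~R.
Proof.
move=> Ex; split=> [[_ Ax]|[t [n [Et En]]]].
  have [r Er _] := quad_norm Ex; have [u Eu] := quad_trace Ex.
  have [|n En] := @rat_int r; first by rewrite -Er rpredM ?Aint_aut.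
  have [|t Et] := @rat_int u; first by rewrite -Eu rpredD ?Aint_aut.
  by exists t, n; rewrite Er Eu En Et !ratr_int.
split=> //; apply: (@Aint2 _ t n); rewrite -Et -En; ring.
Qed.

Lemma sqfree_den (d : int) (b : rat) (k : int) : sqfreez d -> d%:~R * b ^+ 2 = k%:~R ->
  exists j : int, b = j%:~R.
Proof.
move=> sq Eb; exists (numq b).
have dn0 := denq_neq0 b.
have Ez : d * numq b ^+ 2 = k * denq b ^+ 2.
  apply: (@intr_inj rat); transitivity (d%:~R * (numq b)%:~R ^+ 2 : rat); first by ring.
  rewrite numqE; transitivity (d%:~R * b ^+ 2 * (denq b)%:~R ^+ 2); first by ring.
  by rewrite Eb; ring.
have d1 : (denq b ^+ 2 %| d)%Z.
  have : (denq b ^+ 2 %| d * numq b ^+ 2)%Z by rewrite Ez dvdz_mull.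
  rewrite Gauss_dvdzl // coprimezXl // coprimezXr // coprimezE coprime_sym.
  exact: coprime_num_den.
have den1 : denq b = 1 by apply: (sqfreez_sq sq) d1; exact: denq_gt0.
by rewrite -[LHS]divq_num_den den1 divr1.
Qed.

Lemma norm4_parity (d t j n : int) : ~~ (4 %| d)%Z -> t ^+ 2 + d * j ^+ 2 = 4 * n ->
  if (d %% 4)%Z == 3 then (2 %| t - j)%Z else (2 %| t)%Z && (2 %| j)%Z.
Proof.
move=> d4 E; have [t' Et] := sq_mod4 t; have [j' Ej] := sq_mod4 j.
have : (t %% 2)%Z + d * (j %% 2)%Z = 4 * (n - t' - d * j').
  have -> : 4 * (n - t' - d * j') = t ^+ 2 + d * j ^+ 2 - 4 * t' - d * (4 * j') by rewrite E; ring.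
  by rewrite Et Ej; ring.
move: (n - t' - d * j') => k; have [h|h] : (j %% 2)%Z = 0 \/ (j %% 2)%Z = 1 by clear; lia.
  by rewrite h mulr0; case: ifP => _ Ek; [|apply/andP; split]; clear -h Ek; lia.
by rewrite h mulr1; case: eqP => d3 Ek; clear -h d3 d4 Ek; lia.
Qed.

Lemma qintP x : O x <-> exists i j : int, x = i%:~R + j%:~R * omega.
Proof.
split=> [Ox|[i [j ->]]]; last first.
  split; first by apply: quadD; [exact: quad_int|apply: quadM; [exact: quad_int|exact: quad_omega]].
  by rewrite rpredD ?rpredM ?rpred_int // (Aint2 omega_sq).
have Ex := qint_quad Ox; have [t [n [Et En]]] := (qint_trace_norm Ex).1 Ox.
have [a [b Eab]] := Ex.
have {}Et : 2 * a = t%:~R.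
  by apply: ratr_inj; rewrite ratr_int -Et Eab -/s conj_quadE; ring.
have {}En : a ^+ 2 + D%:~R * b ^+ 2 = n%:~R.
  by apply: ratr_inj; rewrite ratr_int -En Eab -quad_normE.
have [|j Ej] := @sqfree_den D (2 * b) (4 * n - t ^+ 2) Dsq.
  transitivity (4 * (n%:~R) - t%:~R ^+ 2 : rat); last by ring.
  by rewrite -En -Et; ring.
have Ez : t ^+ 2 + D * j ^+ 2 = 4 * n.
  apply: (@intr_inj rat); transitivity (t%:~R ^+ 2 + D%:~R * j%:~R ^+ 2 : rat); first by ring.
  by rewrite -Et -Ej; transitivity (4 * n%:~R : rat); [rewrite -En; ring|ring].
have a2 : a = t%:~R / 2 by rewrite -Et; field.
have b2 : b = j%:~R / 2 by rewrite -Ej; field.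
have half (z : int) : ratr (z%:~R / 2)
  = z%:~R / 2 :> algC by rewrite fmorph_div /= ratr_int rmorph_nat.
have D4 : ~~ (4 %| D)%Z by have := Dsq (isT : prime 2).
have := norm4_parity D4 Ez; rewrite Eab a2 b2 !half -/s /omega /qpar; case: ifP => _.
  move=> /dvdzP[i Ei]; exists i, j.
  have -> : t = i * 2 + j by rewrite -Ei; ring.
  by field.
by move=> /andP[/dvdzP[i ->] /dvdzP[k ->]]; exists i, k; field.
Qed.

Lemma qint1 : O 1. Proof. by apply/qintP; exists 1, 0; rewrite mul0r addr0. Qed.
Lemma qint_int (i : int) : O i%:~R. Proof. by apply/qintP; exists i, 0; rewrite mul0r addr0. Qed.
Lemma qint_omega : O omega. Proof. by apply/qintP; exists 0, 1; rewrite mul1r add0r. Qed.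
Lemma qintM x y : O x -> O y -> O (x * y).
Proof. by move=> [Ex Ax] [Ey Ay]; split; [apply: quadM|rewrite rpredM]. Qed.
Lemma qintB x y : O x -> O y -> O (x - y).
Proof. by move=> [Ex Ax] [Ey Ay]; split; [apply: quadB|rewrite rpredB]. Qed.
Lemma qint_conj x : O x -> O x^*.
Proof. by move=> [Ex Ax]; split; [apply: quad_conj|rewrite Aint_aut]. Qed.
Lemma conjI_qint : conjI O = O.
Proof. by apply/seteqP; split=> x /qint_conj; rewrite /conjI /= ?conjCK. Qed.
Lemma zmod_qint : zmod O.
Proof. by split; [exact: (qint_int 0)|exact: qintB]. Qed.

Definition omod (I : set algC) := [/\ zmod I, I `<=` E & forall a x, O a -> I x -> I (a * x)].

Lemma omodO : omod O.
Proof. by split; [exact: zmod_qint|exact: qint_quad|exact: qintM]. Qed.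

Lemma omod_omega I : zmod I -> I `<=` E -> (forall x, I x -> I (omega * x)) -> omod I.
Proof.
move=> zI IE Iw; split=> // _ x /qintP[i [j ->]] Ix.
by rewrite mulrDl; apply: zmodD => //; rewrite -?mulrA; apply: zmodZ => //; apply: Iw.
Qed.

Lemma omod_conj I : omod I -> omod (conjI I).
Proof.
move=> [zI IE Im]; split; first exact: conjI_zmod.
  by move=> x /IE/quad_conj; rewrite conjCK.
by move=> a x /qint_conj Oa Ix; rewrite /conjI /= rmorphM; apply: Im.
Qed.

Lemma omod_scl x I : E x -> omod I -> omod (scl x I).
Proof.
move=> Ex [zI IE Im]; split; first exact: scl_zmod.
  by move=> _ [y Iy <-]; apply: quadM => //; apply: IE.
by move=> a _ Oa [y Iy <-]; exists (a * y); [apply: Im|rewrite mulrCA].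
Qed.

Lemma omod_prodI I J : omod I -> omod J -> omod (prodI I J).
Proof.
move=> [_ IE Im] [_ JE _]; split; first exact: prodI_zmod.
  apply: prodI_sub; first by split; [exact: (quad_int 0)|exact: quadB].
  by move=> x y /IE Ex /JE Ey; apply: quadM.
move=> a x Oa Px; move: x Px; apply: (@prodI_sub _ _ [set x | prodI I J (a * x)]).
  split=> [|u v /= Pu Pv]; first by rewrite /= mulr0; case: (prodI_zmod I J).
  by rewrite mulrBr; apply: (proj2 (prodI_zmod _ _)).
by move=> u v Iu Jv /=; rewrite mulrA; apply: prodI_in => //; apply: Im.
Qed.

Lemma prod_O I : omod I -> prodI O I = I.
Proof.
move=> [zI _ Im]; apply/seteqP; split; first exact: prodI_sub.
by move=> x Ix; rewrite -[x]mul1r; apply: prodI_in => //; exact: qint1.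
Qed.

Lemma prodr_O I : omod I -> prodI I O = I.
Proof. by rewrite prodIC; exact: prod_O. Qed.

Definition fid (c : rat) (I : set algC) :=
  [/\ omod I, 0 < c & prodI I (conjI I) = scl (ratr c) O].

Lemma ratr_neq0 (c : rat) : 0 < c -> (ratr c : algC) != 0.
Proof. by move=> c0; rewrite fmorph_eq0 gt_eqF. Qed.

Lemma fid_omod c I : fid c I -> omod I. Proof. by case. Qed.

Lemma prod_scl_O x I : omod I -> prodI (scl x O) I = scl x I.
Proof. by move=> oI; rewrite -scl_prodI prod_O. Qed.

Lemma fid_mul c d I J : fid c I -> fid d J -> fid (c * d) (prodI I J).
Proof.
move=> [oI c0 EI] [oJ d0 EJ]; split; [exact: omod_prodI|exact: mulr_gt0|].
have oS : omod (scl (ratr d) O) by apply: omod_scl; [exact: quad_rat|exact: omodO].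
rewrite conj_prodI prodIA [prodI (prodI I J) _]prodIAC EI -prodIA EJ -scl_prodI prod_O //.
by rewrite sclM rmorphM.
Qed.

Lemma fid_conj c I : fid c I -> fid c (conjI I).
Proof.
move=> [oI c0 EI]; split=> //; first exact: omod_conj.
by rewrite conjIK prodIC EI.
Qed.

Lemma fid_scl c r x I : E x -> 0 < r -> x * x^* = ratr r -> fid c I -> fid (r * c) (scl x I).
Proof.
move=> Ex r0 Er [oI c0 EI]; split; [exact: omod_scl|exact: mulr_gt0|].
by rewrite conj_scl -scl_prodI -scl_prodIr EI !sclM Er rmorphM.
Qed.

Lemma fid_cancel c I J L : fid c I -> omod J -> omod L -> prodI I J = prodI I L -> J = L.
Proof.
move=> [_ c0 EI] oJ oL E; apply: (scl_inj (ratr_neq0 c0)).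
by rewrite -(prod_scl_O _ oJ) -(prod_scl_O _ oL) -EI [prodI I (conjI I)]prodIC -!prodIA E.
Qed.

Lemma scl_O_eq c d : 0 < c -> 0 < d -> scl (ratr c) O = scl (ratr d) O -> c = d.
Proof.
move=> c0 d0 E.
have integral_ratio (a b : rat) : 0 < a -> 0 < b -> scl (ratr a) O (ratr b) ->
  exists2 i : int, 0 < i & b = a * i%:~R.
  move=> a0 b0 [y Oy Ey].
  have Eb : y = ratr (b / a).
    apply: (mulfI (ratr_neq0 a0)); rewrite Ey -rmorphM; congr ratr; field; exact: lt0r_neq0.
  have [|i Ei] := @rat_int (b / a); first by rewrite -Eb; case: Oy.
  exists i; last by rewrite -Ei; field; exact: lt0r_neq0.
  by rewrite -(ltr0z rat) -Ei divr_gt0.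
have cin (a : rat) : scl (ratr a) O (ratr a) by exists 1; rewrite ?mulr1 //; exact: qint1.
have [|i i0 Ei] := integral_ratio c d c0 d0; first by rewrite E.
have [|j j0 Ej] := integral_ratio d c d0 c0; first by rewrite -E.
have ij : i * j = 1.
  apply: (@intr_inj rat); rewrite rmorphM /=; apply: (mulfI (lt0r_neq0 c0)).
  by rewrite mulrA -Ei -Ej mulr1.
have i1 : i = 1 by clear -ij i0 j0; nia.
by rewrite Ei i1 mulr1.
Qed.

Lemma fid_uniq c d I : fid c I -> fid d I -> c = d.
Proof. by move=> [_ c0 E1] [_ d0 E2]; apply: scl_O_eq => //; rewrite -E1. Qed.

Lemma fid_stab c I u : fid c I -> scl u I = I -> O u.
Proof.
move=> [_ c0 EI] Eu.
have : prodI (scl u I) (conjI I) = scl (ratr c) O by rewrite Eu EI.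
rewrite -scl_prodI EI sclM [u * _]mulrC -sclM => /(scl_inj (ratr_neq0 c0)) <-.
by exists 1; rewrite ?mulr1 //; exact: qint1.
Qed.

Definition nbasis (c : rat) (I : set algC) (y w : algC) (A B C : int) :=
  [/\ E y, E w, [/\ y * y^* = ratr c * A%:~R, w * w^* = ratr c * C%:~R & y * w^* + y^* * w
    = ratr c * B%:~R],
      B ^+ 2 - 4 * A * C = disc & I = [set z | exists i j : int, z = i%:~R * y + j%:~R * w]].

Lemma subgroupZ (P : int -> Prop) (x : int) : x != 0 -> P x ->
  (forall a b, P a -> P b -> P (a - b)) ->
  exists2 g, 0 < g & forall j, P j <-> (g %| j)%Z.
Proof.
move=> x0 Px PB.
have P0 : P 0 by rewrite -(subrr x); apply: PB.
have PN a : P a -> P (- a) by move=> Pa; rewrite -sub0r; apply: PB.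
have PM (k : int) a : P a -> P (k * a).
  move=> Pa; have PMn (n : nat) : P (n%:Z * a).
    elim: n => [|n IH]; first by rewrite mul0r.
    have -> : n.+1%:Z * a = n%:Z * a - (- a) by rewrite -addn1 PoszD; ring.
    by apply: PB => //; apply: PN.
  by case: k => n; rewrite ?NegzE ?mulNr; [|apply: PN]; exact: PMn.
have [|g [[g0 Pg] gmin]] := @ex_min_nat (fun n => (0 < n)%N /\ P n%:Z).
  exists `|x|%N; split; first by rewrite absz_gt0.
  by have [->|->] : (`|x|%N : int) = x \/ (`|x|%N : int) = - x by [clear; lia|]; [|apply: PN].
exists g%:Z; first by clear -g0; lia.
move=> j; split=> [Pj|/dvdzP[k ->]]; last exact: PM.
have Pr : P (j %% g)%Z.
  have -> : (j %% g)%Z = j - (j %/ g)%Z * g%:Z by rewrite {2}(divz_eq j g); ring.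
  by apply: PB => //; apply: PM.
have gn : g%:Z != 0 by clear -g0; lia.
have r0 := modz_ge0 j gn; have rl : (j %% g)%Z < g%:Z.
  by have := ltz_mod j gn; rewrite ger0_norm.
apply/dvdz_mod0P; apply/eqP; apply/negPn/negP => rn.
have := gmin `|(j %% g)%Z|%N; move: Pr r0 rl rn; move: (j %% g)%Z => r Pr r0 rl rn.
have -> : (`|r|%N : int) = r by clear -r0; lia.
by move/(_ (conj _ Pr)) => h; have := h; clear -r0 rl rn h; lia.
Qed.

Lemma omega_indep (i j : int) : i%:~R + j%:~R * omega = 0 -> i = 0 /\ j = 0.
Proof.
move=> h; have conjE := congr1 (@Num.conj algC) h.
move: conjE; rewrite rmorphD rmorphM /= !rmorph_int omega_conj rmorph0 => conjE.
have : j%:~R * sqrtd = 0.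
  rewrite -[RHS](subrr 0) -{1}h -conjE /sqrtd; ring.
move/eqP; rewrite mulf_eq0 (negPf sqrtd_neq0) orbF intr_eq0 => /eqP j0.
by move: h; rewrite j0 mul0r addr0 => /eqP; rewrite intr_eq0 => /eqP.
Qed.

Lemma omod_generators I : omod I -> I `<=` O -> (exists2 x, I x & x != 0) ->
  exists n g b : int, [/\ 0 < n, 0 < g, forall j, I j%:~R <-> (n %| j)%Z,
    forall j, (exists i : int, I (i%:~R + j%:~R * omega)) <-> (g %| j)%Z & I (b%:~R
      + g%:~R * omega)].
Proof.
move=> [zI _ Im] IO [x Ix x0]; have Ox := IO x Ix.
have [_ [N [_ EN]]] := (qint_trace_norm (qint_quad Ox)).1 Ox.
have N0 : N != 0 by apply: contra_neq x0 => N0; apply: norm_eq0; rewrite EN N0.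
have IN : I N%:~R by rewrite -EN mulrC; apply: Im => //; apply: qint_conj.
have [n n0 nP] : exists2 n, 0 < n & forall j, I j%:~R <-> (n %| j)%Z.
  by apply: (subgroupZ (x := N)) => // a b Ia Ib; rewrite rmorphB; exact: (proj2 zI).
have [g g0 gP] : exists2 g, 0 < g & forall j,
  (exists i : int, I (i%:~R + j%:~R * omega)) <-> (g %| j)%Z.
  apply: (subgroupZ (x := N)) => //.
    by exists 0; rewrite add0r mulrC; apply: Im => //; exact: qint_omega.
  move=> a b [i Ii] [i' Ii']; exists (i - i').
  have -> : (i - i')%:~R + (a - b)%:~R * omega = (i%:~R + a%:~R * omega)
    - (i'%:~R + b%:~R * omega) by ring.
  exact: (proj2 zI).
by have [b Ib] : exists i : int, I (i%:~R + g%:~R * omega) by [apply/gP]; exists n, g, b.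
Qed.

Lemma omod_basis I : omod I -> I `<=` O -> (exists2 x, I x & x != 0) ->
  exists g n b : int, [/\ 0 < g, 0 < n, (n %| b ^+ 2 + trw * b + nmw)%Z
    & I = [set z | exists i j : int, z = i%:~R * (g * n)%:~R + j%:~R * (g%:~R * (b%:~R + omega))]].
Proof.
move=> oI IO nz; have [zI _ Im] := oI.
have [n1 [g [b1 [n10 g0 n1P gP Ib1]]]] := omod_generators oI IO nz.
have /dvdzP[n En] : (g %| n1)%Z.
  apply/gP; exists 0; rewrite add0r mulrC; apply: Im; [exact: qint_omega|exact/n1P].
have n0 : 0 < n by clear -En n10 g0; nia.
have /dvdzP[b Eb] : (g %| b1)%Z.
  have h : I (n%:~R * (b1%:~R + g%:~R * omega) - omega * n1%:~R).
    by apply: (proj2 zI); [apply: zmodZ|apply: Im; [exact: qint_omega|exact/n1P]].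
  have : (n1 %| n * b1)%Z.
    by apply/n1P; rewrite (_ : _%:~R = n%:~R * (b1%:~R + g%:~R * omega) - omega * n1%:~R) // En;
      ring.
  by rewrite En dvdz_mul2l; rewrite ?gt_eqF.
have Iw : I (g%:~R * (b%:~R + omega)).
  by rewrite (_ : _ * _ = b1%:~R + g%:~R * omega) // Eb; ring.
exists g, n, b; split=> //.
  have h : I ((b + trw)%:~R * (g%:~R * (b%:~R + omega)) - omega * (g%:~R * (b%:~R + omega))).
    by apply: (proj2 zI); [apply: zmodZ|apply: Im; [exact: qint_omega|]].
  have : (n1 %| g * (b ^+ 2 + trw * b + nmw))%Z.
    apply/n1P; rewrite (_ : _%:~R = (b + trw)%:~R * (g%:~R * (b%:~R + omega))
      - omega * (g%:~R * (b%:~R + omega))) //.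
    have h2 := omega_sq; ring: h2.
  by rewrite En [n * g]mulrC dvdz_mul2l // gt_eqF.
apply/seteqP; split=> z.
  move=> Iz; have /qintP[i [j Ez]] := IO z Iz.
  have /dvdzP[j' Ej] : (g %| j)%Z by apply/gP; exists i; rewrite -Ez.
  have /n1P/dvdzP[i' Ei] : I (i - j' * b1)%:~R.
    have -> : (i - j' * b1)%:~R = z - j'%:~R * (b1%:~R + g%:~R * omega) by rewrite Ez Ej; ring.
    by apply: (proj2 zI) => //; apply: zmodZ.
  exists i', j'; rewrite Ez Ej.
  have -> : i = i' * n1 + j' * b1 by rewrite -Ei; ring.
  by rewrite En Eb; ring.
move=> [i [j ->]]; apply: zmodD => //; apply: zmodZ => //.
by rewrite [g * n]mulrC -En; apply/n1P.
Qed.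

Lemma nbasis_intro (g n b : int) I : (n %| b ^+ 2 + trw * b + nmw)%Z ->
  I = [set z | exists i j : int, z = i%:~R * (g * n)%:~R + j%:~R * (g%:~R * (b%:~R + omega))] ->
  exists C : int, nbasis (g ^+ 2 * n)%:~R I (g * n)%:~R (g%:~R * (b%:~R + omega)) n (2 * b + trw) C.
Proof.
move=> /dvdzP[C EC] EI; exists C.
have ECr : b%:~R ^+ 2 + trw%:~R * b%:~R + nmw%:~R = C%:~R * n%:~R :> algC.
  by transitivity ((b ^+ 2 + trw * b + nmw)%:~R : algC); [ring|rewrite EC; ring].
split=> //.
- exact: quad_int.
- by apply: quadM; [exact: quad_int|apply: quadD; [exact: quad_int|exact: quad_omega]].
- split; rewrite !rmorph_int; first by ring.
    rewrite !(rmorphM, rmorphD) /= !rmorph_int.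
    transitivity (g%:~R ^+ 2 * (b%:~R ^+ 2 + b%:~R * (omega + omega^*) + omega * omega^*));
      first by ring.
    by rewrite omega_norm omega_conj;
      transitivity ((g%:~R ^+ 2 * (b%:~R ^+ 2 + trw%:~R * b%:~R + nmw%:~R)) : algC);
        [ring|rewrite ECr; ring].
  by rewrite !(rmorphM, rmorphD) /= !rmorph_int omega_conj; ring.
- rewrite discE; have -> : 4 * n * C = 4 * (b ^+ 2 + trw * b + nmw) by rewrite EC; ring.
  ring.
Qed.

Section Bas.
Variables (c : rat) (I : set algC) (y w : algC) (A B C : int).
Hypotheses (c0 : 0 < c) (bI : nbasis c I y w A B C).
Let Ey : E y. Proof. by case: bI. Qed.
Let Ew : E w. Proof. by case: bI. Qed.
Let Ny : y * y^* = ratr c * A%:~R. Proof. by case: bI => _ _ []. Qed.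
Let Nw : w * w^* = ratr c * C%:~R. Proof. by case: bI => _ _ []. Qed.
Let Tyw : y * w^* + y^* * w = ratr c * B%:~R. Proof. by case: bI => _ _ []. Qed.
Let dABC : B ^+ 2 - 4 * A * C = disc. Proof. by case: bI. Qed.
Let EI : I = [set z | exists i j : int, z = i%:~R * y + j%:~R * w]. Proof. by case: bI. Qed.
Let rc : ratr c != 0 :> algC := ratr_neq0 c0.

Lemma basis_skew : exists2 e : int, e = 1 \/ e = -1 & y * w^* - y^* * w = e%:~R * ratr c * sqrtd.
Proof.
have : (y * w^* - y^* * w) ^+ 2 = (ratr c * sqrtd) ^+ 2.
  transitivity ((y * w^* + y^* * w) ^+ 2 - 4 * (y * y^*) * (w * w^*)); first by ring.
  by rewrite Ny Nw Tyw [(_ * sqrtd) ^+ 2]exprMn sqrtd_sq -dABC; ring.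
move=> /eqP; rewrite eqf_sqr => /orP[] /eqP ->; [exists 1|exists (-1)]; try ring; by [left|right].
Qed.

Lemma basis_uniq (i j : int) : i%:~R * y + j%:~R * w = 0 -> i = 0 /\ j = 0.
Proof.
move=> h; have hc := congr1 (@Num.conj algC) h.
move: hc; rewrite rmorphD !rmorphM /= !rmorph_int rmorph0 => hc.
have [e ee Ee] := basis_skew.
have e0 : (e%:~R : algC) != 0 by case: ee => ->; rewrite intr_eq0.
have ns : e%:~R * ratr c * sqrtd != 0 by exact: mulf_neq0 (mulf_neq0 e0 (ratr_neq0 c0)) sqrtd_neq0.
split; apply/eqP; rewrite -(intr_eq0 algC) -(mulIr_eq0 _ (mulIf ns)) -Ee.
  have -> : i%:~R * (y * w^* - y^* * w) = (i%:~R * y + j%:~R * w) * w^*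
    - (i%:~R * y^* + j%:~R * w^*) * w by ring.
  by rewrite h hc !mul0r subrr.
have -> : j%:~R * (y * w^* - y^* * w) = (i%:~R * y^* + j%:~R * w^*) * y
  - (i%:~R * y + j%:~R * w) * y^* by ring.
by rewrite h hc !mul0r subrr.
Qed.

Lemma basis_y : I y. Proof. by rewrite EI; exists 1, 0; ring. Qed.
Lemma basis_w : I w. Proof. by rewrite EI; exists 0, 1; ring. Qed.

Lemma basis_par : exists b, B = 2 * b + trw.
Proof.
have : ((B - trw) %% 2)%Z = 0.
  have : (2 %| B ^+ 2 - trw ^+ 2)%Z.
    have -> : B ^+ 2 - trw ^+ 2 = 2 * (2 * A * C - 2 * nmw).
      by move: dABC; rewrite discE => h; have ->
        : B ^+ 2 = (B ^+ 2 - 4 * A * C) + 4 * A * C by [ring|]; rewrite h; ring.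
    by rewrite dvdz_mulr.
  have -> : B ^+ 2 - trw ^+ 2 = (B - trw) * (B + trw) by ring.
  by rewrite dvd2M => /orP[]; clear; lia.
by move=> h; exists ((B - trw) %/ 2)%Z; clear -h; lia.
Qed.

(* Multiplication by the different: sqrtd y and sqrtd w are read off the form. *)
Lemma basis_sqrtd : exists2 e : int, e = 1 \/ e = -1 &
  sqrtd * y = e%:~R * (B%:~R * y - (2 * A)%:~R * w) /\ sqrtd * w
    = e%:~R * ((2 * C)%:~R * y - B%:~R * w).
Proof.
have [e ee Ee] := basis_skew; exists e => //.
have e2 : e%:~R * e%:~R = 1 :> algC by case: ee => ->; rewrite -rmorphM.
have Es : ratr c * sqrtd = e%:~R * (y * w^* - y^* * w) by rewrite Ee !mulrA e2 mul1r.
split; apply: (mulfI rc); rewrite mulrA Es.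
  transitivity (e%:~R * (y * (y * w^* + y^* * w) - 2 * (y * y^*) * w)); first by ring.
  by rewrite Tyw Ny; ring.
transitivity (e%:~R * (2 * (w * w^*) * y - w * (y * w^* + y^* * w))); first by ring.
by rewrite Tyw Nw; ring.
Qed.

Lemma basis_omod : omod I.
Proof.
have zI : zmod I.
  rewrite EI; split; first by exists 0, 0; ring.
  by move=> _ _ [i [j ->]] [k [l ->]]; exists (i - k), (j - l); ring.
have [e ee [Sy Sw]] := basis_sqrtd; have [b Eb] := basis_par.
have two : 2 != 0 :> algC by rewrite pnatr_eq0.
have Wy : I (omega * y).
  rewrite EI; case: ee => Ee; rewrite Ee in Sy.
    exists (b + trw), (- A); apply: (mulfI two).
    by transitivity (sqrtd * y + trw%:~R * y); [rewrite /sqrtd; ring|rewrite Sy Eb; ring].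
  exists (- b), A; apply: (mulfI two).
  by transitivity (sqrtd * y + trw%:~R * y); [rewrite /sqrtd; ring|rewrite Sy Eb; ring].
have Ww : I (omega * w).
  rewrite EI; case: ee => Ee; rewrite Ee in Sw.
    exists C, (- b); apply: (mulfI two).
    by transitivity (sqrtd * w + trw%:~R * w); [rewrite /sqrtd; ring|rewrite Sw Eb; ring].
  exists (- C), (b + trw); apply: (mulfI two).
  by transitivity (sqrtd * w + trw%:~R * w); [rewrite /sqrtd; ring|rewrite Sw Eb; ring].
apply: omod_omega => //.
  by rewrite EI => _ [i [j ->]]; apply: quadD; apply: quadM => //; apply: quad_int.
move=> x; rewrite {1}EI => -[i [j ->]].
rewrite mulrDr ![omega * (_ * _)]mulrCA; by apply: zmodD => //; apply: zmodZ.
Qed.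

Lemma basis_coprime : exists u v x : int, u * A + v * B + x * C = 1.
Proof.
have [u [v Euv]] := Bezoutz A B; have [z [x Ezx]] := Bezoutz (gcdz A B) C.
set g := gcdz (gcdz A B) C in Ezx.
suff g1 : g = 1 by exists (z * u), (z * v), x; rewrite -[RHS]g1 -Ezx -Euv; ring.
have [/dvdzP[A' EA] [/dvdzP[B' EB] /dvdzP[C' EC]]] : (g %| A)%Z /\ (g %| B)%Z /\ (g %| C)%Z.
  have h := dvdz_gcdl (gcdz A B) C.
  by split; [apply: dvdz_trans h (dvdz_gcdl _ _)|split;
    [apply: dvdz_trans h (dvdz_gcdr _ _)|exact: dvdz_gcdr]].
have Eg : g ^+ 2 * (B' ^+ 2 - 4 * A' * C') = disc by rewrite -dABC EA EB EC; ring.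
have g0 : 0 < g.
  rewrite lt_def; apply/andP; split; last by []; apply: contraTneq disc_lt0 => g0.
  by rewrite -Eg g0 expr0n mul0r.
move: Eg; rewrite /disc /qpar; case: eqP => D3 Eg.
  apply: (sqfreez_sq Dsq) => //; rewrite -[D]opprK -Eg -mulrN; exact: dvdz_mulr.
have [k Ek] : exists k, 4 * D = g ^+ 2 * k by exists (- (B' ^+ 2 - 4 * A' * C'));
  rewrite mulrN Eg opprK.
have Ek' : k = - (B' ^+ 2 - 4 * A' * C').
  by apply: (mulfI (expf_neq0 2 (lt0r_neq0 g0))); rewrite -Ek mulrN Eg opprK.
have [eg|og] : (2 %| g)%Z \/ ~~ (2 %| g)%Z by case: (2 %| g)%Z; [left|right].
  exfalso; have /dvdzP[g' Eg'] := eg.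
  have EDk : D = g' ^+ 2 * k by apply: (mulfI (_ : (4 : int) != 0)) => //; rewrite Ek Eg'; ring.
  have g'1 : g' = 1.
    by apply: (sqfreez_sq Dsq); [clear -Eg' g0; lia|rewrite EDk dvdz_mulr].
  have Dk : D = k by rewrite EDk g'1 expr1n mul1r.
  have D4 : ~~ (4 %| D)%Z by have := Dsq (isT : prime 2).
  have [q Eq] := sq_mod4 B'.
  move: D3 D4; rewrite Dk Ek' Eq -mulrA; move: (A' * C') => t; clear; lia.
apply: (sqfreez_sq Dsq) => //.
have : (g ^+ 2 %| 4 * D)%Z by rewrite Ek dvdz_mulr.
rewrite Gauss_dvdzr // coprimezXl // coprimezE (_ : absz 4 = (2 ^ 2)%N) // coprimeXr // coprimen2.
by clear -og; lia.
Qed.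

Lemma basis_fid : fid c I.
Proof.
have oI := basis_omod; split=> //.
have [_ _ _] := oI.
apply/seteqP; split.
  apply: prodI_sub; first exact/scl_zmod/zmod_qint.
  have zS := scl_zmod (ratr c) zmod_qint.
  have Ecj : (y * w^* / ratr c)^* = y^* * w / ratr c.
    have -> : (ratr c)^-1 = ratr c^-1 :> algC by rewrite fmorphV.
    by rewrite (conjM (y * w^*)) (conjM y) conjCK fmorph_rat.
  have Oyw : O (y * w^* / ratr c).
    apply/qint_trace_norm.
      by apply: quadM; [apply: quadM => //; apply: quad_conj|apply: quadV; apply: quad_rat].
    exists B, (A * C); rewrite Ecj.
    split; apply: (mulfI rc).
      by rewrite -Tyw; field.
    by apply: (mulfI rc); transitivity ((y * y^*) * (w * w^*)); [field|rewrite Ny Nw rmorphM; ring].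
  move=> z t; rewrite /conjI /= {1 2}EI => -[i [j ->]] [k [l Et]].
  have -> : t = k%:~R * y^* + l%:~R * w^*.
    by rewrite -[t]conjCK Et rmorphD !rmorphM /= !rmorph_int.
  exists ((i * k * A + j * l * C)%:~R + (i * l)%:~R * (y * w^* / ratr c)
    + (j * k)%:~R * (y * w^* / ratr c)^*).
    apply: zmodD; [exact: zmod_qint| |]; last by apply: zmodZ; [exact: zmod_qint|exact: qint_conj].
    by apply: zmodD; [exact: zmod_qint|exact: qint_int|apply: zmodZ => //; exact: zmod_qint].
  rewrite Ecj.
  transitivity ((i * k)%:~R * (ratr c * A%:~R) + (j * l)%:~R * (ratr c * C%:~R)
    + (i * l)%:~R * (y * w^*) + (j * k)%:~R * (y^* * w)).
    by field.
  by rewrite -Ny -Nw; ring.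
have oII := omod_prodI oI (omod_conj oI).
move=> _ [a Oa <-]; rewrite mulrC; have [zII _ mII] := oII; apply: mII => //.
have [u [v [x Eu]]] := basis_coprime.
have cy : conjI I y^* by rewrite /conjI /= conjCK; exact: basis_y.
have cw : conjI I w^* by rewrite /conjI /= conjCK; exact: basis_w.
have -> : ratr c = u%:~R * (y * y^*) + v%:~R * (y * w^* + w * y^*) + x%:~R * (w * w^*) :> algC.
  rewrite [w * y^*]mulrC Tyw Ny Nw.
  by transitivity (ratr c * (u * A + v * B + x * C)%:~R : algC); [rewrite Eu mulr1|ring].
have Iy := basis_y; have Iw := basis_w.
apply: (zmodD zII); [apply: (zmodD zII)|]; apply: (zmodZ _ zII); try exact: prodI_in.
by apply: (zmodD zII); exact: prodI_in.
Qed.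

End Bas.

Lemma omod_fid I : omod I -> I `<=` O -> (exists2 x, I x & x != 0) -> exists c, fid c I.
Proof.
move=> oI IO nz; have [g [n [b [g0 n0 dv EI]]]] := omod_basis oI IO nz.
have [C bI] := nbasis_intro dv EI; exists (g ^+ 2 * n)%:~R.
by apply: (basis_fid _ bI); rewrite ltr0z mulr_gt0 // exprn_gt0.
Qed.

Lemma basis_scl c r x I y w A B C : E x -> x * x^* = ratr r -> nbasis c I y w A B C ->
  nbasis (r * c) (scl x I) (x * y) (x * w) A B C.
Proof.
move=> Ex Er [Ey Ew [Ny Nw T] dABC EI]; split=> //; try exact: quadM.
  rewrite !rmorphM /=; split.
  - by transitivity ((x * x^*) * (y * y^*)); [ring|rewrite Er Ny; ring].
  - by transitivity ((x * x^*) * (w * w^*)); [ring|rewrite Er Nw; ring].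
  - by transitivity ((x * x^*) * (y * w^* + y^* * w)); [ring|rewrite Er T; ring].
rewrite EI; apply/seteqP; split=> [_ [_ [i [j ->]] <-]|_ [i [j ->]]].
  by exists i, j; ring.
by exists (i%:~R * y + j%:~R * w); [exists i, j|ring].
Qed.

Lemma fid_neq0 c I : fid c I -> exists2 x, I x & x != 0.
Proof.
move=> [[_ _ _] c0 EI]; apply: contrapT => h.
have z x : I x -> x = 0 by move=> Ix; apply: contrapT => /eqP x0; apply: h; exists x.
have : prodI I (conjI I) (ratr c) by rewrite EI; exists 1; rewrite ?mulr1 //; exact: qint1.
move/(_ [set 0]) => h2; have /eqP : ratr c = 0 :> algC.
  apply: h2; first by split=> // x y -> ->; rewrite /= subrr.
  by move=> x y /z -> _; rewrite /= mul0r.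
by rewrite fmorph_eq0 gt_eqF.
Qed.

Lemma quad_norm_gt0 x : E x -> x != 0 -> exists2 r, 0 < r & x * x^* = ratr r.
Proof.
move=> Ex x0; have [r Er r0] := quad_norm Ex; exists r => //; rewrite lt_def r0 andbT.
by apply: contra_neq x0 => rr; apply: norm_eq0; rewrite Er rr rmorph0.
Qed.

Lemma fid_integral c I : fid c I ->
  exists z r, [/\ E z, z != 0, 0 < r, z * z^* = ratr r & scl z I `<=` O].
Proof.
move=> fI; have [x Ix x0] := fid_neq0 fI; have [[_ IE _] c0 EI] := fI.
have Ez : E (x^* * ratr c^-1) by apply: quadM; [apply/quad_conj/IE|exact: quad_rat].
have z0 : x^* * ratr c^-1 != 0 by rewrite mulf_neq0 ?fmorph_eq0 // invr_eq0 gt_eqF.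
have [r r0 Er] := quad_norm_gt0 Ez z0.
exists (x^* * ratr c^-1), r; split=> // _ [y Iy <-].
have : prodI I (conjI I) (y * x^*) by apply: prodI_in => //; rewrite /conjI /= conjCK.
rewrite EI => -[a Oa Ea]; rewrite (_ : _ * y = a) //.
by rewrite mulrAC [x^* * y]mulrC -Ea fmorphV mulrC mulKf // ratr_neq0.
Qed.

Lemma fid_basis c I : fid c I -> exists y w A B C, nbasis c I y w A B C.
Proof.
move=> fI; have [z [r [Ez z0 r0 Er zI]]] := fid_integral fI.
have [x Ix x0] := fid_neq0 fI.
have oz : omod (scl z I) by apply: omod_scl => //; case: fI.
have [|g [n [b [g0 n0 dv EI]]]] := omod_basis oz zI.
  by exists (z * x); [exists x|rewrite mulf_neq0].
have [C bI] := nbasis_intro dv EI.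
have Er' : z^-1 * (z^-1)^* = ratr r^-1 by rewrite fmorphV -invfM Er fmorphV.
have := basis_scl (quadV Ez) Er' bI; rewrite sclM mulVf // scl1 => bI'.
have gn0 : 0 < (g ^+ 2 * n)%:~R :> rat by rewrite ltr0z mulr_gt0 // exprn_gt0.
have fI' := basis_fid (mulr_gt0 (_ : 0 < r^-1) gn0) bI'.
rewrite (fid_uniq fI (fI' _)) ?invr_gt0 //; by do 5 eexists; exact: bI'.
Qed.

End Quad.

(** * Ideal classes and ambiguous ideals *)

Definition sumI (I J : set algC) : set algC := [set z | exists a b, [/\ I a, J b & z = a + b]].

Lemma sumIC I J : sumI I J = sumI J I.
Proof. by apply/seteqP; split=> _ [a [b [Ia Jb ->]]]; exists b, a; rewrite addrC. Qed.

Lemma sumI_zmod I J : zmod I -> zmod J -> zmod (sumI I J).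
Proof.
move=> zI zJ; split; first by exists 0, 0; rewrite addr0; split=> //; [case: zI|case: zJ].
move=> _ _ [a [b [Ia Jb ->]]] [a' [b' [Ia' Jb' ->]]]; exists (a - a'), (b - b').
by split; [apply: (proj2 zI)|apply: (proj2 zJ)|ring].
Qed.

Lemma conj_sumI I J : conjI (sumI I J) = sumI (conjI I) (conjI J).
Proof.
apply/seteqP; split=> z.
  move=> [a [b [Ia Jb Ez]]]; exists a^*, b^*; rewrite /conjI /= !conjCK; split=> //.
  by rewrite -rmorphD /= -Ez conjCK.
by move=> [a [b [Ia Jb ->]]]; exists a^*, b^*; rewrite rmorphD.
Qed.

Lemma prod_sumI I A B : zmod A -> zmod B ->
  prodI I (sumI A B) = sumI (prodI I A) (prodI I B).
Proof.
move=> zA zB; apply/seteqP; split.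
  apply: prodI_sub; first by apply: sumI_zmod; exact: prodI_zmod.
  move=> x _ Ix [a [b [Aa Bb ->]]]; exists (x * a), (x * b).
  by split; [exact: prodI_in|exact: prodI_in|rewrite mulrDr].
have zP := prodI_zmod I (sumI A B).
move=> _ [a [b [Pa Pb ->]]]; apply: (zmodD zP).
  move: a Pa; apply: prodI_sub => // x y Ix Ay; apply: prodI_in => //.
  by exists y, 0; rewrite addr0; split=> //; case: zB.
move: b Pb; apply: prodI_sub => // x y Ix By; apply: prodI_in => //.
by exists 0, y; rewrite add0r; split=> //; case: zA.
Qed.

Lemma sqfree_part (n : nat) : (0 < n)%N -> exists r k : nat,
  [/\ (0 < r)%N, (0 < k)%N, sqfreez r%:Z & n = (r * k ^ 2)%N].
Proof.
elim/ltn_ind: n => n IH n0.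
have [sq|nsq] := pselect (sqfreez n%:Z); first by exists n, 1%N; rewrite muln1.
have [q pq sq_dvd] : exists2 q, prime q & (q ^ 2 %| n)%N.
  apply: contrapT => h; apply: nsq => q pq; apply/negP; rewrite dvdzE !absz_nat => sq_dvd.
  by apply: h; exists q.
have /dvdnP[n' En] := sq_dvd.
have q1 := prime_gt1 pq.
have n'0 : (0 < n')%N by move: n0; rewrite En; case: (n').
have [|r [k [r0 k0 sq Ek]]] := IH n' _ n'0.
  by rewrite En -[X in (X < _)%N]muln1 ltn_pmul2l // (ltn_trans _ (ltn_expl 2 q1)).
exists r, (k * q)%N; split=> //; first by rewrite muln_gt0 k0 prime_gt0.
by rewrite En Ek expnMn mulnA.
Qed.

Lemma rat_sqfree_part (f : rat) : 0 < f -> exists (r : nat) (q : rat),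
  [/\ (0 < r)%N, 0 < q, sqfreez r%:Z & f = r%:R * q ^+ 2].
Proof.
move=> f0; have n0 : 0 < numq f by rewrite numq_gt0.
have d0 := denq_gt0 f.
have [|r [k [r0 k0 sq Ek]]] := @sqfree_part (absz (numq f * denq f)%R).
  by rewrite absz_gt0 mulf_neq0 // gt_eqF.
exists r, (k%:R / (denq f)%:~R); split=> //.
  by rewrite divr_gt0 ?ltr0n ?ltr0z.
have dn : (denq f)%:~R != 0 :> rat by rewrite intr_eq0 gt_eqF.
have E2 : (numq f * denq f)%:~R = r%:R * k%:R ^+ 2 :> rat.
  rewrite -natrX -natrM -Ek -[RHS]/((absz (numq f * denq f)%R)%:Z%:~R); congr (_%:~R).
  by rewrite gez0_abs // mulr_ge0 // ltW.
rewrite exprMn mulrA -E2 -{1}[f]divq_num_den rmorphM /=; by field.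
Qed.

Lemma sqfree_logn (r p : nat) : (0 < r)%N -> sqfreez r%:Z -> prime p -> (logn p r <= 1)%N.
Proof.
move=> r0 sq pp; have := sq p pp; rewrite dvdzE !absz_nat pfactor_dvdn //.
by rewrite -ltnNge ltnS.
Qed.

Lemma sqfree_square (r r' z : nat) : (0 < r)%N -> (0 < r')%N -> sqfreez r%:Z -> sqfreez r'%:Z ->
  (r * r' = z ^ 2)%N -> r = r'.
Proof.
move=> r0 r'0 sr sr' E; apply: eqn_from_log => // p.
have [pp|np] := boolP (prime p); last by rewrite [LHS]lognE [RHS]lognE (negPf np).
have := congr1 (logn p) E; rewrite lognM // lognX.
have := sqfree_logn r0 sr pp; have := sqfree_logn r'0 sr' pp.
by move: (logn p r) (logn p r') (logn p z) => a b c; clear; lia.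
Qed.

Lemma sqfree1 : sqfreez 1.
Proof.
move=> q pq; have q1 := prime_gt1 pq; rewrite dvdzE absz_nat dvdn1 gtn_eqF //.
by apply: (leq_trans q1); rewrite -[X in (X <= _)%N]expn1 leq_exp2l.
Qed.

Lemma rat_sqrt_int (b : rat) (k : int) : b ^+ 2 = k%:~R -> exists j : int, b = j%:~R.
Proof. by move=> h; apply: (@sqfree_den 1 b k sqfree1); rewrite mul1r. Qed.

Lemma prodIACA A B C F : prodI (prodI A B) (prodI C F) = prodI (prodI A C) (prodI B F).
Proof. by rewrite -!prodIA [prodI B (prodI C F)]prodIA [prodI B C]prodIC
  -[prodI (prodI C B) F]prodIA. Qed.

Lemma nuM a b : (0 < a)%N -> (0 < b)%N -> coprime a b -> nu (a * b) = (nu a + nu b)%N.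
Proof.
move=> a0 b0 cop; rewrite /nu -size_cat; apply: perm_size; apply: uniq_perm;
  first exact: primes_uniq.
  by rewrite cat_uniq !primes_uniq andbT /= -coprime_has_primes.
by move=> x; rewrite mem_cat primesM.
Qed.

Lemma size_divisors_sqfree (n : nat) : (0 < n)%N -> sqfreez n%:Z ->
  size (divisors n) = (2 ^ nu n)%N.
Proof.
elim/ltn_ind: n => n IH n0 sq; have [n1|n1] := eqVneq n 1%N; first by rewrite n1.
have n2 : (1 < n)%N by clear -n0 n1; lia.
have pp := pdiv_prime n2; set p := pdiv n in pp.
have /dvdnP[n' En] := pdiv_dvd n; rewrite -/p mulnC in En.
have n'0 : (0 < n')%N by move: n0; rewrite En muln_gt0 => /andP[].
have cop : coprime p n'.
  rewrite prime_coprime //; apply/negP => /dvdnP[k Ek]; have := sq p pp.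
  by rewrite dvdzE !absz_nat En Ek mulnCA mulnn dvdn_mull.
have sq' : sqfreez n'%:Z.
  by apply: (sqfreez_dvd sq); rewrite dvdzE !absz_nat En dvdn_mull.
have lt : (n' < n)%N by rewrite En ltn_Pmull // prime_gt1.
have IH' := IH n' lt n'0 sq'.
have p0 := prime_gt0 pp.
have pd : perm_eq (divisors n) (divisors n' ++ [seq (p * d)%N | d <- divisors n']).
  apply: uniq_perm; first exact: divisors_uniq.
    rewrite cat_uniq divisors_uniq map_inj_uniq ?divisors_uniq ?andbT; last first.
      by move=> a b /eqP; rewrite eqn_pmul2l // => /eqP.
    apply/hasPn => _ /mapP[d _ ->]; rewrite -dvdn_divisors //; apply/negP => h.
    have : (p %| n')%N by apply: dvdn_trans h; rewrite dvdn_mulr.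
    by move: cop; rewrite prime_coprime // => /negP.
  move=> d; rewrite mem_cat -!dvdn_divisors //; apply/idP/orP.
    move=> dn; have [pd|npd] := boolP (p %| d)%N; [right|left].
      have /dvdnP[d' Ed] := pd; rewrite mulnC in Ed; apply/mapP; exists d' => //.
      by rewrite -dvdn_divisors //; move: dn; rewrite En Ed dvdn_pmul2l.
    by move: dn; rewrite En Gauss_dvdr // coprime_sym prime_coprime.
  case=> [h|/mapP[d' h ->]]; first by rewrite En dvdn_mull.
  by rewrite En dvdn_pmul2l // dvdn_divisors.
rewrite (perm_size pd) size_cat size_map IH' En nuM // (_ : nu p = 1%N);
  last by rewrite /nu primes_prime.
by rewrite expnS mul2n addnn.
Qed.

Section ClassNumber.
Variable dd : sqf.
Local Notation D := (sqf_val dd).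
Local Notation E := (quad_field (- D)).
Local Notation O := (integers E).
Local Notation fid := (fid dd).
Local Notation omod := (omod dd).
Local Notation omega := (omega dd).
Local Notation trw := (trw dd).
Local Notation nmw := (nmw dd).
Local Notation disc := (disc dd).
Local Notation s := (sqrtND dd).
Let D0 : 0 < D := sqf_gt0 dd.
Let Dsq : sqfreez D := @sqf_free dd.

Definition norm1 (u : algC) := E u /\ u * u^* = 1.
Definition equiv1 (I J : set algC) := exists2 u, norm1 u & J = scl u I.

Lemma norm1_neq0 u : norm1 u -> u != 0.
Proof.
by move=> [_ Eu]; apply: contraTneq (oner_neq0 algC) => u0; rewrite -Eu u0 mul0r eqxx.
Qed.

Lemma norm1_conj u : norm1 u -> norm1 u^*.
Proof. by move=> [Eu uu]; split; [exact: quad_conj|rewrite conjCK mulrC]. Qed.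

Lemma norm1M u v : norm1 u -> norm1 v -> norm1 (u * v).
Proof.
move=> [Eu uu] [Ev vv]; split; first exact: quadM.
by rewrite conjM mulrACA uu vv mulr1.
Qed.

Lemma norm1_div x : E x -> x != 0 -> norm1 (x / x^*).
Proof.
move=> Ex x0; split; first by apply: quadM => //; apply/quadV/quad_conj.
by rewrite (conjM x) fmorphV /= conjCK; field; rewrite x0 fmorph_eq0.
Qed.

Lemma equiv1_refl I : equiv1 I I.
Proof. by exists 1; rewrite ?scl1 //; split; [exact: (quad_int dd 1)|rewrite rmorph1 mulr1]. Qed.

Lemma equiv1_sym I J : equiv1 I J -> equiv1 J I.
Proof.
move=> [u Eu ->]; exists u^*; first exact: norm1_conj.
by rewrite sclM mulrC (proj2 Eu) scl1.
Qed.

Lemma equiv1_trans I J L : equiv1 I J -> equiv1 J L -> equiv1 I L.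
Proof. by move=> [u Eu ->] [v Ev ->]; exists (v * u); [exact: norm1M|rewrite sclM]. Qed.

Lemma hilbert90 u : norm1 u -> exists x, [/\ E x, x != 0 & u * x^* = x].
Proof.
move=> [Eu uu]; have [u1|u1] := eqVneq u (-1).
  by exists s; split; [exact: quad_sqrt|exact: sqrtND_neq0|rewrite sqrtND_conj u1; ring].
exists (1 + u); split.
- by apply: quadD => //; exact: (quad_int dd 1).
- by rewrite addrC addr_eq0.
- by rewrite rmorphD rmorph1 mulrDr mulr1 uu addrC.
Qed.

Lemma quad_denom x : E x -> exists2 k : int, k != 0 & O (k%:~R * x).
Proof.
move=> [a [b ->]]; exists (denq a * denq b); first by rewrite mulf_neq0 ?denq_neq0.
have -> : (denq a * denq b)%:~R * (ratr a + ratr b * sqrtC (- D)%:~R) =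
   (numq a * denq b)%:~R + (denq a * numq b)%:~R * s :> algC.
  have Ea : (denq a)%:~R * ratr a = (numq a)%:~R :> algC.
    by rewrite -ratr_int -rmorphM /= mulrC -numqE ratr_int.
  have Eb : (denq b)%:~R * ratr b = (numq b)%:~R :> algC.
    by rewrite -ratr_int -rmorphM /= mulrC -numqE ratr_int.
  by rewrite !rmorphM /= -Ea -Eb -/s; ring.
apply: (zmodD (zmod_qint dd)); first exact: qint_int.
apply: (zmodZ _ (zmod_qint dd)); split; first exact: quad_sqrt.
by apply: (@Aint2 _ 0 D); rewrite sqrtND_sq; ring.
Qed.

Lemma omod_fid_scl I z : omod I -> (exists2 x, I x & x != 0) -> E z -> z != 0 -> scl z I `<=` O ->
  exists c, fid c I.
Proof.
move=> oI [x Ix x0] Ez z0 zI.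
have [|n fn] := omod_fid (omod_scl Ez oI) zI; first by exists (z * x); [exists x|rewrite mulf_neq0].
have zi : z^-1 != 0 by rewrite invr_eq0.
have [r r0 Er] := quad_norm_gt0 (quadV Ez) zi; exists (r * n).
by rewrite -[I]scl1 -(mulVf z0) -sclM; apply: fid_scl => //; exact: quadV.
Qed.

Lemma prod_sq_O x : E x -> O (x * x) -> O x.
Proof.
move=> Ex Oxx; have [r Er _] := quad_norm Ex; have [t Et] := quad_trace Ex.
have [T [N [ET EN]]] := (qint_trace_norm (quadM Ex Ex)).1 Oxx.
have [n En] : exists n : int, r = n%:~R.
  apply: (@rat_sqrt_int r N); apply: ratr_inj; rewrite rmorphXn /= ratr_int -EN (conjM x) -Er; ring.
have [t' Et'] : exists t' : int, t = t'%:~R.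
  apply: (@rat_sqrt_int t (T + 2 * n)); apply: ratr_inj.
  rewrite rmorphXn /= -Et ratr_int; transitivity (T%:~R + 2 * n%:~R : algC); last by ring.
  by rewrite -ET -[n%:~R]ratr_int -En -Er (conjM x); ring.
by apply/(qint_trace_norm Ex); exists t', n; rewrite Et Er En Et' !ratr_int.
Qed.

Definition amb (r : nat) (F : set algC) := fid r%:R F /\ conjI F = F.

Lemma amb_integral r F : amb r F -> F `<=` O.
Proof.
move=> [[[_ FE _] _ EF] cF] x Fx; apply: prod_sq_O; first exact: FE.
have : prodI F (conjI F) (x * x) by rewrite cF; exact: prodI_in.
rewrite EF => -[a Oa <-]; apply: qintM => //.
by rewrite ratr_nat; exact: (qint_int dd r).
Qed.

Lemma amb_basis r F : sqfreez r%:Z -> amb r F -> exists b : int,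
  [/\ (r%:Z %| b ^+ 2 + trw * b + nmw)%Z, (r%:Z %| 2 * b + trw)%Z
    & F = [set z | exists i j : int, z = i%:~R * r%:~R + j%:~R * (b%:~R + omega)]].
Proof.
move=> sr aF; have FO := amb_integral aF; have [fF cF] := aF.
have [g [n [b [g0 n0 dv EF]]]] := omod_basis (fid_omod fF) FO (fid_neq0 fF).
have [C bF] := nbasis_intro dv EF.
have fF' := basis_fid (_ : 0 < (g ^+ 2 * n)%:~R) bF.
have Er : r%:Z = g ^+ 2 * n.
  apply: (@intr_inj rat); apply: (fid_uniq fF); apply: fF'.
  by rewrite ltr0z mulr_gt0 // exprn_gt0.
have g1 : g = 1 by apply: (sqfreez_sq sr) => //; rewrite Er dvdz_mulr.
have nr : n = r by rewrite Er g1 expr1n mul1r.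
exists b; rewrite -nr; split=> //; last by rewrite EF g1 mul1r; apply/seteqP;
  split=> _ [i [j ->]]; exists i, j; ring.
have : conjI F (b%:~R + omega).
  by rewrite cF EF; exists 0, 1; rewrite g1; ring.
rewrite /conjI /= EF => -[i [j]]; rewrite rmorphD /= rmorph_int omega_conj g1 => h.
have h0 : (b + trw - i * n - j * b)%:~R + (- 1 - j)%:~R * omega = 0.
  transitivity (b%:~R + (trw%:~R - omega)
    - (i%:~R * (1 * n)%:~R + j%:~R * (1%:~R * (b%:~R + omega)))); first by ring.
  by rewrite h subrr.
have [h1 h2] := omega_indep h0.
by apply/dvdzP; exists i; clear -h1 h2; nia.
Qed.

Definition ram : nat := if (D %% 4)%Z == 1 then (2 * `|D|)%N else `|D|%N.

Lemma ram_gt0 : (0 < ram)%N.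
Proof. by rewrite /ram; case: ifP => _; clear -D0; lia. Qed.

Lemma dvd_ram (r : nat) : sqfreez r%:Z -> (r%:Z %| disc)%Z -> (r %| ram)%N.
Proof.
move=> sr rq; have r0 : (0 < r)%N.
  by case: (r) rq => //; rewrite dvd0z => /eqP q0; have := disc_lt0 dd; rewrite q0.
have D4 : ~~ (4 %| D)%Z by have := Dsq (isT : prime 2).
rewrite -[r]absz_nat -[ram]absz_nat -dvdzE.
apply: (sqfree_dvd r0) => [p pp|p pp pr]; first exact: sqfree_logn.
have : (p %| `|disc|)%N by apply: dvdn_trans pr _; rewrite dvdzE in rq.
rewrite dvdzE /disc /qpar /ram; case: eqP => D3.
  by rewrite abszN absz_nat; case: eqP => // _ h; rewrite dvdn_mull.
rewrite abszN abszM absz_nat Euclid_dvdM // => /orP[p4|pD]; last by case: ifP => // _;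
  rewrite dvdn_mull.
have -> : p = 2.
  by move: p4; rewrite -[absz 4]/(2 ^ 2)%N Euclid_dvdX // => /andP[];
    rewrite dvdn_prime2 // => /eqP.
by case: eqP => D1; [rewrite dvdn_mulr|clear -D1 D3 D4; lia].
Qed.

Lemma amb_ram r F : sqfreez r%:Z -> amb r F -> (r %| ram)%N.
Proof.
move=> sr aF; have [b [d1 d2 _]] := amb_basis sr aF.
apply: dvd_ram => //; rewrite discE.
have -> : trw ^+ 2 - 4 * nmw = (2 * b + trw) * (2 * b + trw) - 4 * (b ^+ 2 + trw * b + nmw) by ring.
by rewrite rpredB // dvdz_mull.
Qed.

Lemma amb_scl F q : conjI F = F -> conjI (scl (ratr q) F) = scl (ratr q) F.
Proof. by move=> cF; rewrite conj_scl fmorph_rat cF. Qed.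

Lemma fid_sclr c q I : 0 < q -> fid c I -> fid (q ^+ 2 * c) (scl (ratr q) I).
Proof.
move=> q0; apply: fid_scl; [exact: quad_rat|exact: exprn_gt0|].
by rewrite fmorph_rat -rmorphM -expr2.
Qed.

Lemma amb_uniq r F F' : (0 < r)%N -> amb r F -> amb r F' -> F = F'.
Proof.
move=> r0 [fF cF] [fF' cF'].
have rr0 : 0 < r%:R :> rat by rewrite ltr0n.
have q0 : 0 < (r%:R)^-1 :> rat by rewrite invr_gt0.
pose C := scl (ratr (r%:R)^-1) (prodI F F').
have aC : amb 1 C.
  split; last by apply: amb_scl => //; rewrite conj_prodI cF cF'.
  have := fid_sclr q0 (fid_mul fF fF').
  by rewrite (_ : _ * (_ * _) = 1%:R) // expr2; field; rewrite gt_eqF.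
have CO : C = O.
  have [b [_ _ EC]] := amb_basis sqfree1 aC.
  apply/seteqP; split; first exact: amb_integral aC.
  move=> x Ox; have C1 : C 1 by rewrite EC; exists 1, 0; ring.
  have [[[_ _ mC] _ _] _] := aC; by rewrite -[x]mulr1; apply: mC.
have rn : ratr (r%:R)^-1 != 0 :> algC by apply: ratr_neq0.
have EFF : prodI F F = prodI F F'.
  apply: (scl_inj rn); rewrite -/C CO; have [_ _ EF] := fF; rewrite cF in EF.
  by rewrite EF sclM -rmorphM mulVf ?gt_eqF // rmorph1 scl1.
exact: (fid_cancel fF (fid_omod fF) (fid_omod fF') EFF).
Qed.

Lemma amb_of_b (r : nat) (b : int) : (0 < r)%N -> (r%:Z %| b ^+ 2 + trw * b + nmw)%Z ->
  (r%:Z %| 2 * b + trw)%Z -> exists F, amb r F.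
Proof.
move=> r0 d1 /dvdzP[k Ek].
pose F := [set z : algC | exists i j : int,
  z = i%:~R * (1 * r%:Z)%:~R + j%:~R * (1%:~R * (b%:~R + omega))].
have [C bF] := nbasis_intro (g := 1) d1 (erefl F).
have fF : fid r%:R F.
  have := basis_fid (_ : 0 < (1 ^+ 2 * r%:Z)%:~R) bF.
  by rewrite expr1n mul1r; apply; rewrite ltr0z.
exists F; split=> //.
have sub : F `<=` conjI F.
  move=> z [i [j ->]]; exists (i + j * k), (- j).
  rewrite rmorphD !(rmorphM, rmorphD) /= !rmorph_int omega_conj.
  have Ekr : 2 * b%:~R + trw%:~R = k%:~R * r%:~R :> algC.
    by transitivity ((2 * b + trw)%:~R : algC); [ring|rewrite Ek; ring].
  transitivity (i%:~R * r%:~R + j%:~R * (2 * b%:~R + trw%:~R) - j%:~R * (b%:~R + omega));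
    first by ring.
  by rewrite Ekr; ring.
apply/seteqP; split=> [z /sub|]; last exact: sub.
by rewrite /conjI /= conjCK.
Qed.

Lemma amb_ex_qpar r : qpar dd -> (r %| `|D|)%N -> exists F, amb r F.
Proof.
move=> par rD; have D3 : (D %% 4)%Z = 3 by apply/eqP.
have {}rD : (r%:Z %| D)%Z by rewrite dvdzE absz_nat.
have r0 : (0 < r)%N by case: (r) rD => //; rewrite dvd0z; clear -D0; lia.
have odd_r : odd r.
  apply/negPn/negP => er; have /dvdzP[k Ek] := rD.
  have : (2 %| D)%Z by rewrite Ek dvdz_mull // dvdzE absz_nat dvdn2.
  by clear -D3; lia.
have [b Eb] : exists b, r%:Z = 2 * b + 1 by exists (r./2)%:Z; clear -odd_r; lia.
apply: (@amb_of_b r b) => //; last by rewrite /trw par -Eb.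
have -> : b ^+ 2 + trw * b + nmw = b ^+ 2 + b + ((1 + D) %/ 4)%Z by rewrite /trw /nmw par mul1r.
have E4 : 4 * (b ^+ 2 + b + ((1 + D) %/ 4)%Z) = r%:Z * r%:Z + D.
  have h : 4 * ((1 + D) %/ 4)%Z = 1 + D by clear -D3; lia.
  by rewrite !mulrDr h Eb; ring.
have : (r%:Z %| 4 * (b ^+ 2 + b + ((1 + D) %/ 4)%Z))%Z by rewrite E4 rpredD // dvdz_mull.
by rewrite (odd_dvdz_pmull 2).
Qed.

Lemma amb_ex r : (r %| ram)%N -> exists F, amb r F.
Proof.
move=> rR; have r0 : (0 < r)%N := dvdn_gt0 ram_gt0 rR.
have [par|npar] := boolP (qpar dd).
  have /eqP D3 := par; apply: amb_ex_qpar => //.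
  by move: rR; rewrite /ram; case: eqP => //; clear -D3; lia.
have qt0 : trw = 0 by rewrite /trw (negPf npar).
have qnD : nmw = D by rewrite /nmw (negPf npar).
have [rD|nrD] := boolP (r %| `|D|)%N.
  by apply: (@amb_of_b r 0);
    rewrite // qt0 ?qnD ?mulr0 ?expr0n ?add0r ?addr0 ?dvdz0 // dvdzE absz_nat.
have D1 : (D %% 4)%Z = 1 by apply/eqP; move: rR nrD; rewrite /ram; case: ifP => // _ ->.
have r2D : (r %| 2 * `|D|)%N by move: rR; rewrite /ram D1 eqxx.
have er : ~~ odd r.
  by apply: contra nrD => or_; move: r2D; rewrite Gauss_dvdr // coprimen2.
have [r' Er] : exists r', r = (2 * r')%N by exists r./2; clear -er; lia.
have r'D : (r'%:Z %| D)%Z by rewrite dvdzE absz_nat -(@dvdn_pmul2l 2) // -Er.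
apply: (@amb_of_b r r'%:Z) => //; rewrite qt0 ?qnD ?mul0r ?addr0; last by rewrite Er PoszM dvdzz.
have [k Ek] := dvdzP r'D.
have : (2 %| k + r'%:Z)%Z.
  apply/negPn/negP => h; have : (2 %| D)%Z by rewrite Ek dvd2M; clear -h; lia.
  by clear -D1; lia.
move=> /dvdzP[x Ex]; rewrite Er PoszM Ek (_ : _ + _ = (k + r'%:Z) * r'%:Z); last by ring.
by rewrite Ex -mulrA dvdz_mull.
Qed.

Definition gen_ram : nat := if D == 1 then 2%N else `|D|%N.

Lemma gen_ram_elt : exists x,
  [/\ E x, x != 0, x * x^* = ratr gen_ram%:R & conjI (scl x O) = scl x O].
Proof.
rewrite /gen_ram; case: eqP => D1; last first.
  exists s; split; [exact: quad_sqrt|exact: sqrtND_neq0| |].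
    rewrite sqrtND_conj mulrN -expr2 sqrtND_sq opprK ratr_nat -[LHS]/(_%:~R)
      -[RHS]/((absz D)%:Z%:~R).
    by congr (_%:~R); clear -D0; lia.
  have ON y : O y -> O (- y) by exact: (zmodN (zmod_qint dd)).
  by rewrite conj_scl sqrtND_conj conjI_qint; apply/seteqP; split=> _ [y Oy <-]; exists (- y);
    rewrite ?mulrNN ?mulrN ?mulNr //; exact: ON.
have s2 : s ^+ 2 = -1 by rewrite sqrtND_sq D1.
have Os : O s by split; [exact: quad_sqrt|apply: (@Aint2 _ 0 1); rewrite s2; ring].
exists (1 + s); split.
- by apply: quadD; [exact: (quad_int dd 1)|exact: quad_sqrt].
- apply/eqP => h; have s1 : s = -1 by apply/eqP; rewrite -addr_eq0 addrC h.
  have := sqrtND_conj dd; rewrite s1 rmorphN rmorph1 opprK => h1.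
  have /eqP : 2 = 0 :> algC by rewrite -[2]/(1 + 1) -{1}h1 addNr.
  by rewrite pnatr_eq0.
- have cj1 : (1 + s)^* = 1 - s by rewrite [LHS]rmorphD rmorph1 /= sqrtND_conj.
  by rewrite cj1 ratr_nat; ring: s2.
- have cj : (1 + s)^* = (1 + s) * - s by rewrite [LHS]rmorphD rmorph1 /= sqrtND_conj; ring: s2.
  rewrite conj_scl conjI_qint cj -sclM; congr (scl _ _).
  apply/seteqP; split=> [_ [y Oy <-]|y Oy].
    by apply: qintM => //; exact: (zmodN (zmod_qint dd)).
  exists (s * y); first exact: qintM.
  by rewrite mulrA mulNr -expr2 s2 opprK mul1r.
Qed.

Lemma gen_ram_gt1 : (1 < gen_ram)%N.
Proof. by rewrite /gen_ram; case: eqP => // D1; clear -D0 D1; lia. Qed.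

Lemma gen_ram_dvd : (gen_ram %| ram)%N.
Proof.
rewrite /gen_ram /ram; case: eqP => [->|_] //.
by case: ifP => _ //; rewrite dvdn_mull.
Qed.

Lemma ram_sqfree : sqfreez ram%:Z.
Proof.
move=> q pq; rewrite dvdzE !absz_nat /ram.
have := Dsq pq; rewrite dvdzE absz_nat => h.
case: eqP => // D1; apply: contra h.
have D2 : ~~ (2 %| `|D|)%N by clear -D1; lia.
have [->|q2] := eqVneq q 2; first by rewrite expnS expn1 dvdn_pmul2l // (negPf D2).
by rewrite Gauss_dvdr // coprime_sym coprimeXr // prime_coprime // dvdn_prime2 // eq_sym.
Qed.

Lemma unit_trace_bound u (t : int) : E u -> u * u^* = 1 -> u + u^* = t%:~R -> -2 <= t <= 2.
Proof.
move=> Eu uu Et.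
have [r1 E1' h1] := quad_norm (quadD (quad_int dd 1) Eu).
have [r2 E2' h2] := quad_norm (quadB (quad_int dd 1) Eu).
have F1 : r1 = (2 + t)%:~R.
  apply: ratr_inj; rewrite -E1' ratr_int rmorphD rmorph_int.
  transitivity (1 + (u + u^*) + u * u^*); first by ring.
  by rewrite Et uu; ring.
have F2 : r2 = (2 - t)%:~R.
  apply: ratr_inj; rewrite -E2' ratr_int rmorphB rmorph_int.
  transitivity (1 - (u + u^*) + u * u^*); first by ring.
  by rewrite Et uu; ring.
by move: h1 h2; rewrite F1 F2 !ler0z; clear; lia.
Qed.

Lemma unit_trace_disc u (t : int) : E u -> u * u^* = 1 -> u + u^* = t%:~R ->
  exists j : int, D * j ^+ 2 = 4 - t ^+ 2.
Proof.
move=> [a [b Eab]] uu Et.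
have Ea : 2 * a = t%:~R by apply: ratr_inj; rewrite ratr_int -Et Eab -/s conj_quadE; ring.
have En : a ^+ 2 + D%:~R * b ^+ 2 = 1 by apply: ratr_inj; rewrite rmorph1 -uu Eab -quad_normE.
have Eb : D%:~R * (2 * b) ^+ 2 = (4 - t ^+ 2)%:~R.
  transitivity (4 * (a ^+ 2 + D%:~R * b ^+ 2) - (2 * a) ^+ 2); first by ring.
  by rewrite En Ea; ring.
have [j Ej] := sqfree_den Dsq Eb; exists j.
by apply: (@intr_inj rat); rewrite -Eb Ej; ring.
Qed.

Lemma norm_trace0 x (r : rat) : E x -> x + x^* = 0 -> x * x^* = ratr r ->
  exists b : rat, r = D%:~R * b ^+ 2.
Proof.
move=> [a [b Ex]] tr0 Nx; exists b.
have a0 : a = 0.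
  apply: (mulfI (_ : (2 : rat) != 0)) => //; rewrite mulr0; apply: ratr_inj.
  by rewrite rmorph0 -tr0 Ex -/s conj_quadE; ring.
by apply: ratr_inj; rewrite -Nx Ex quad_normE a0; congr ratr; ring.
Qed.

(* The element x generates an ambiguous ideal, hence x / x^* is a root of unity. *)
Lemma norm_unit_ratio x : E x -> x != 0 -> O (x / x^*) ->
  exists2 q : rat, q != 0 & x * x^* = ratr (q ^+ 2) \/ x * x^* = ratr (gen_ram%:R * q ^+ 2).
Proof.
move=> Ex x0 Ou; have [Eu uu] := norm1_div Ex x0; have [t [_ [Et _]]] := (qint_trace_norm Eu).1 Ou.
have t2 := unit_trace_bound Eu uu Et; have [j Ej] := unit_trace_disc Eu uu Et.
have [r r0 Er] := quad_norm_gt0 Ex x0; have [T ET] := quad_trace Ex.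
have ETr : (2 + t)%:~R * r = T ^+ 2.
  apply: ratr_inj; rewrite rmorphXn /= -ET rmorphM /= ratr_int -Er rmorphD /= -Et.
  by rewrite (conjM x) fmorphV /= conjCK; field; rewrite x0 fmorph_eq0.
have T0 : 2 + t != 0 -> T != 0.
  move=> h; apply: contraTneq r0 => TT; move/eqP: ETr.
  by rewrite TT expr0n mulf_eq0 intr_eq0 (negPf h) /= => /eqP ->.
rewrite Er; have : t = -2 \/ t = -1 \/ t = 0 \/ t = 1 \/ t = 2 by clear -t2; lia.
case=> [|[|[|[]]]] t_; rewrite t_ in ETr T0 Ej.
- have TT : T = 0 by apply/eqP; move/eqP: ETr; rewrite mul0r eq_sym expf_eq0.
  have [|b Eb] := norm_trace0 Ex _ Er; first by rewrite ET TT rmorph0.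
  have b0 : b != 0 by apply: contraTneq r0 => b0; rewrite Eb b0 expr0n mulr0.
  exists b => //; rewrite Eb /gen_ram; case: eqP => [->|_]; first by left; rewrite mul1r.
  by right; rewrite -[(absz D)%:R]/((absz D)%:Z%:~R) gez0_abs // ltW.
- by exists T; [apply: T0|left; rewrite -ETr mul1r].
- have D1 : D = 1.
    have D4 : ~~ (4 %| D)%Z by have := Dsq (isT : prime 2).
    have jb : -2 <= j <= 2 by clear -Ej D0; nia.
    have : j = -2 \/ j = -1 \/ j = 0 \/ j = 1 \/ j = 2 by clear -jb; lia.
    by case=> [h|[h|[h|[h|h]]]]; move: Ej; rewrite h expr2; clear -D4; lia.
  exists (T / 2); first by rewrite mulf_neq0 // T0.
  right; rewrite /gen_ram D1 /=; congr ratr.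
  by apply: (mulfI (_ : (2 : rat) != 0)) => //; rewrite [LHS]ETr; field.
- have D3 : D = 3.
    have jb : -1 <= j <= 1 by clear -Ej D0; nia.
    have : j = -1 \/ j = 0 \/ j = 1 by clear -jb; lia.
    by case=> [h|[h|h]]; move: Ej; rewrite h expr2; clear; lia.
  exists (T / 3); first by rewrite mulf_neq0 // T0.
  right; rewrite /gen_ram D3 /=; congr ratr.
  by apply: (mulfI (_ : (3 : rat) != 0)) => //; rewrite [LHS]ETr; field.
- exists (T / 2); first by rewrite mulf_neq0 // T0.
  left; congr ratr.
  by apply: (mulfI (_ : (4 : rat) != 0)) => //; rewrite [LHS]ETr; field.
Qed.

Definition half_ram : seq nat := divisors (ram %/ pdiv gen_ram).
Local Notation p0 := (pdiv gen_ram).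

Lemma p0_prime : prime p0. Proof. by apply: pdiv_prime; exact: gen_ram_gt1. Qed.
Lemma p0_ram : (p0 %| ram)%N. Proof. exact: dvdn_trans (pdiv_dvd _) (gen_ram_dvd). Qed.
Lemma ramE : ram = (p0 * (ram %/ p0))%N. Proof. by rewrite mulnC divnK // p0_ram. Qed.
Lemma ram_div_gt0 : (0 < ram %/ p0)%N.
Proof. by have := ram_gt0; rewrite {1}ramE muln_gt0 => /andP[]. Qed.

Lemma p0_ndvd : ~~ (p0 %| ram %/ p0)%N.
Proof.
apply/negP => /dvdnP[k Ek]; have := ram_sqfree p0_prime; rewrite dvdzE !absz_nat.
by rewrite ramE Ek mulnCA mulnn dvdn_mull.
Qed.

Lemma half_ramP r : r \in half_ram <-> (r %| ram)%N /\ ~~ (p0 %| r)%N.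
Proof.
rewrite /half_ram -dvdn_divisors; last exact: ram_div_gt0.
split=> [h|[h np]].
  split; first by rewrite ramE dvdn_mull.
  by apply: contra p0_ndvd => h2; apply: dvdn_trans h2 h.
by move: h; rewrite {1}ramE Gauss_dvdr // coprime_sym prime_coprime // p0_prime.
Qed.

Lemma size_half_ram : size half_ram = (2 ^ (nu ram).-1)%N.
Proof.
have sq : sqfreez (ram %/ p0)%N%:Z.
  by apply: (sqfreez_dvd ram_sqfree); rewrite dvdzE !absz_nat {2}ramE dvdn_mull.
rewrite /half_ram size_divisors_sqfree ?ram_div_gt0 //; congr (_ ^ _)%N.
rewrite [in RHS]ramE nuM ?ram_div_gt0 ?prime_gt0 ?p0_prime ?prime_coprime ?p0_ndvd ?p0_prime //.
by rewrite (_ : nu p0 = 1%N) // /nu primes_prime ?p0_prime.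
Qed.

Lemma ram_dvd_gt0 r : (r %| ram)%N -> (0 < r)%N. Proof. exact: dvdn_gt0 (ram_gt0). Qed.

Lemma ram_dvd_sqfree r : (r %| ram)%N -> sqfreez r%:Z.
Proof. by move=> h; apply: (sqfreez_dvd ram_sqfree); rewrite dvdzE. Qed.

Lemma logn_gen_ram : logn p0 gen_ram = 1%N.
Proof.
have g0 : (0 < gen_ram)%N := ltnW (gen_ram_gt1).
apply/eqP; rewrite eqn_leq sqfree_logn ?p0_prime //=; last exact/ram_dvd_sqfree/gen_ram_dvd.
by rewrite logn_gt0 mem_primes p0_prime g0 pdiv_dvd.
Qed.

Definition ambI (r : nat) : set algC := xget O [set F | amb r F].

Lemma ambIP r : (r %| ram)%N -> amb r (ambI r).
Proof. by move=> h; rewrite /ambI; case: xgetP => [F -> //|no]; have [F aF] := amb_ex h;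
  case: (no F). Qed.

Lemma amb_scaled r k F : (0 < k)%N -> fid (r * k ^ 2)%N%:R F -> conjI F = F ->
  amb r (scl (ratr (k%:R)^-1) F).
Proof.
move=> k0 fF cF; have ki : 0 < (k%:R)^-1 :> rat by rewrite invr_gt0 ltr0n.
split; last exact: amb_scl.
have := fid_sclr ki fF; rewrite (_ : _ * _ = r%:R) // natrM natrX; field.
by rewrite pnatr_eq0 -lt0n.
Qed.

Lemma amb_sqfree_class r F : (0 < r)%N -> sqfreez r%:Z -> amb r F ->
  exists r' x, [/\ r' \in half_ram, E x, x != 0 & F = scl x (ambI r')].
Proof.
move=> r0 sr aF; have rR := amb_ram sr aF; have [fF cF] := aF.
have [p0r|np0r] := boolP (p0 %| r)%N; last first.
  exists r, 1; rewrite scl1 oner_neq0 (amb_uniq r0 aF (ambIP rR)).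
  by split=> //; [exact/half_ramP|exact: (quad_int dd 1)].
have [x [Ex x0 Nx cx]] := gen_ram_elt.
have g0 : (0 < gen_ram)%N := ltnW (gen_ram_gt1).
have f2 : fid (gen_ram * r)%N%:R (scl x F).
  by rewrite natrM; apply: fid_scl => //; rewrite ltr0n.
have c2 : conjI (scl x F) = scl x F.
  by rewrite -(prod_scl_O _ (fid_omod fF)) conj_prodI cx cF.
have [|r' [k [r'0 k0 sr' Ek]]] := @sqfree_part (gen_ram * r)%N; first by rewrite muln_gt0 g0.
rewrite Ek in f2; have a2 := amb_scaled k0 f2 c2.
have rR' := amb_ram sr' a2.
have np : ~~ (p0 %| r')%N.
  have := congr1 (logn p0) Ek; rewrite (lognM _ g0 r0) (lognM _ r'0) ?expn_gt0 ?k0 // lognX.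
  have l1 : logn p0 r = 1%N.
    by apply/eqP; rewrite eqn_leq sqfree_logn ?p0_prime //= logn_gt0 mem_primes p0_prime r0.
  have l3 := sqfree_logn r'0 sr' p0_prime.
  rewrite l1 logn_gen_ram => h; apply/negP => h2.
  have : (0 < logn p0 r')%N by rewrite logn_gt0 mem_primes p0_prime r'0.
  by clear -h l3; lia.
have zn : ratr (k%:R)^-1 * x != 0 :> algC.
  by rewrite mulf_neq0 // ratr_neq0 // invr_gt0 ltr0n.
exists r', (ratr (k%:R)^-1 * x)^-1; rewrite invr_eq0 zn; split=> //.
- exact/half_ramP.
- by apply/quadV/quadM => //; exact: quad_rat.
- by rewrite -(amb_uniq r'0 a2 (ambIP rR')) (sclM (ratr (k%:R)^-1)) sclM mulVf // scl1.
Qed.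

Lemma amb_class f F : fid f F -> conjI F = F ->
  exists r x, [/\ r \in half_ram, E x, x != 0 & F = scl x (ambI r)].
Proof.
move=> fF cF; have f0 : 0 < f by case: fF.
have [r [q [r0 q0 sr Ef]]] := rat_sqfree_part f0.
have qi : 0 < q^-1 by rewrite invr_gt0.
have aF : amb r (scl (ratr q^-1) F).
  split; last exact: amb_scl.
  by have := fid_sclr qi fF; rewrite (_ : _ * _ = r%:R) // Ef; field; rewrite gt_eqF.
have [r' [x [hr' Ex x0 EF]]] := amb_sqfree_class r0 sr aF.
exists r', (ratr q * x); split=> //; first by apply: quadM => //; exact: quad_rat.
  by rewrite mulf_neq0 // ratr_neq0.
by rewrite -sclM -EF sclM -rmorphM divff ?gt_eqF // rmorph1 scl1.
Qed.

Lemma amb_equiv r r' x : r \in half_ram -> r' \in half_ram -> E x -> x != 0 ->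
  ambI r' = scl x (ambI r) -> r = r'.
Proof.
move=> /half_ramP[rR np] /half_ramP[rR' np'] Ex x0 Ed.
have r0 := ram_dvd_gt0 rR; have r'0 := ram_dvd_gt0 rR'.
have [fidr cr] := ambIP rR; have [fidr' cr'] := ambIP rR'.
have xc0 : x^* != 0 by rewrite fmorph_eq0.
have Ou : O (x / x^*).
  apply: (fid_stab fidr); have := cr'; rewrite Ed conj_scl cr => h.
  by apply: (scl_inj xc0); rewrite sclM mulrC divfK.
have [n n0 En] := quad_norm_gt0 Ex x0.
have := fid_scl Ex n0 En fidr; rewrite -Ed => /(fid_uniq fidr') En'.
have [q _ Nq] := norm_unit_ratio Ex x0 Ou.
have sq_nat (z : rat) (a : nat) : a%:R = z ^+ 2 -> exists k : nat, a = (k ^ 2)%N.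
  move=> h; have [|j Ej] := @rat_sqrt_int z a%:Z; first by rewrite -h.
  exists `|j|%N; apply/eqP; rewrite -(eqr_nat rat) h Ej natrX; apply/eqP.
  rewrite -[(absz j)%:R]/((absz j)%:Z%:~R).
  by have [->|->] : (absz j)%:Z = j \/ (absz j)%:Z = - j by [clear; lia|]; [|ring].
case: Nq => Nq.
  have {}Nq : n = q ^+ 2 by apply: ratr_inj; rewrite -En.
  have [|k Ek] := sq_nat (q * r%:R) (r' * r)%N.
    by rewrite natrM En' Nq exprMn; ring.
  exact/esym/(sqfree_square r'0 r0 (ram_dvd_sqfree rR') (ram_dvd_sqfree rR) Ek).
have {}Nq : n = gen_ram%:R * q ^+ 2 by apply: ratr_inj; rewrite -En.
exfalso; have [|k Ek] := sq_nat (gen_ram%:R * q * r%:R) (gen_ram * (r' * r))%N.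
  by rewrite !natrM En' Nq; ring.
have g0 : (0 < gen_ram)%N := ltnW (gen_ram_gt1).
have := congr1 (logn p0) Ek;
  rewrite (lognM _ g0) ?muln_gt0 ?r0 ?r'0 // (lognM _ r'0 r0) lognX logn_gen_ram.
have -> : logn p0 r = 0%N by apply/eqP; rewrite -leqn0 leqNgt logn_gt0 mem_primes (negPf np) !andbF.
have -> : logn p0 r' = 0%N by apply/eqP;
  rewrite -leqn0 leqNgt logn_gt0 mem_primes (negPf np') !andbF.
by clear; lia.
Qed.

Lemma ideal_equivP I J : ideal_equiv E I J <-> exists x, [/\ E x, x != 0 & I = scl x J].
Proof.
split=> [[a [b [[Oa a0] [Ob b0] Eab]]]|[x [Ex x0 ->]]].
  exists (a^-1 * b); split.
  - by apply: quadM; [apply: quadV; case: Oa|case: Ob].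
  - by rewrite mulf_neq0 // invr_eq0.
  - have {}Eab : scl a I = scl b J := Eab.
    by rewrite -sclM -Eab sclM mulVf // scl1.
have [k k0 Ok] := quad_denom Ex.
exists k%:~R, (k%:~R * x); split.
- by split; [exact: qint_int|rewrite intr_eq0].
- by split; [|rewrite mulf_neq0 // intr_eq0].
- by rewrite -[LHS]/(scl k%:~R (scl x J)) sclM.
Qed.

Lemma ideal_equiv_refl I : ideal_equiv E I I.
Proof.
by apply/ideal_equivP; exists 1; rewrite oner_neq0 scl1; split=> //; exact: (quad_int dd 1).
Qed.

Lemma ideal_equiv_sym I J : ideal_equiv E I J -> ideal_equiv E J I.
Proof.
move=> /ideal_equivP[x [Ex x0 ->]]; apply/ideal_equivP; exists x^-1.
by rewrite sclM mulVf // scl1 invr_eq0; split=> //; exact: quadV.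
Qed.

Lemma ideal_equiv_trans I J F : ideal_equiv E I J -> ideal_equiv E J F -> ideal_equiv E I F.
Proof.
move=> /ideal_equivP[x [Ex x0 ->]] /ideal_equivP[y [Ey y0 ->]]; apply/ideal_equivP; exists (x * y).
by rewrite sclM mulf_neq0 //; split=> //; exact: quadM.
Qed.

Lemma integral_ideal_fid A : integral_ideal E A -> exists N, fid N A.
Proof.
move=> [AO [x Ax x0] AD AM]; apply: omod_fid => //; last by exists x.
split; [|by move=> a /AO[]|by []]; split; first by rewrite -(mul0r x); apply: AM => //;
  exact: (qint_int dd 0).
move=> a b Aa Ab; apply: AD => //; rewrite -mulN1r; apply: AM => //; exact: (qint_int dd (-1)).
Qed.

Section Count.
Variables (c : rat) (J0 : set algC).
Hypothesis f0 : fid c J0.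
Let c0 : 0 < c. Proof. by case: f0. Qed.

Definition contentI (J : set algC) := sumI (prodI J (conjI J0)) (scl (ratr c) O).

Lemma contentI_fid J : fid c J -> exists n, fid n (contentI J).
Proof.
move=> fJ; have fP := fid_mul fJ (fid_conj f0).
have [zP PE mP] := fid_omod fP.
have [zS SE mS] : omod (scl (ratr c) O) by apply: omod_scl; [exact: quad_rat|exact: omodO].
have oA : omod (contentI J).
  split; first exact: sumI_zmod.
    by move=> _ [a [b [Pa Sb ->]]]; apply: quadD; [exact: PE|exact: SE].
  move=> x _ Ox [a [b [Pa Sb ->]]]; exists (x * a), (x * b).
  by split; [exact: mP|exact: mS|rewrite mulrDr].
have [z [_ [Ez z0 _ _ zO]]] := fid_integral fP.
have [k k0 Ok] := quad_denom (quadM Ez (quad_rat dd c)).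
have kn : (k%:~R : algC) != 0 by rewrite intr_eq0.
apply: (omod_fid_scl (z := k%:~R * z)) => //.
- exists (ratr c); last exact: ratr_neq0.
  exists 0, (ratr c); split; [by case: zP| |by rewrite add0r].
  by exists 1; rewrite ?mulr1 //; exact: qint1.
- by apply: quadM => //; exact: quad_int.
- by rewrite mulf_neq0.
move=> _ [_ [a [b [Pa [y Oy <-] ->]]] <-]; rewrite mulrDr.
apply: (zmodD (zmod_qint dd)).
  by rewrite -mulrA; apply: (zmodZ _ (zmod_qint dd)); apply: zO; exists a.
have -> : k%:~R * z * (ratr c * y) = (k%:~R * (z * ratr c)) * y by ring.
exact: qintM.
Qed.

Lemma contentI_scl J : fid c J -> prodI J (conjI (contentI J)) = prodI J0 (contentI J).
Proof.
move=> fJ; have [oJ _ EJ] := fJ; have [o0 _ E0] := f0.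
have zS := scl_zmod (ratr c) (zmod_qint dd).
rewrite /contentI conj_sumI conj_scl fmorph_rat conjI_qint conj_prodI conjIK.
rewrite !prod_sumI //; try exact: prodI_zmod.
rewrite prodIA EJ prod_scl_O // [prodI J (scl _ _)]prodIC prod_scl_O //.
rewrite [prodI J (conjI J0)]prodIC prodIA E0 prod_scl_O // [prodI J0 (scl _ _)]prodIC prod_scl_O //.
exact: sumIC.
Qed.

Definition imult (I : set algC) : set algC :=
  scl (xget 1 [set z | [/\ E z, z != 0 & scl z I `<=` O]]) I.

Lemma imultP n I : fid n I ->
  integral_ideal E (imult I) /\ exists z, [/\ E z, z != 0 & imult I = scl z I].
Proof.
move=> fI; rewrite /imult; set P := [set z | _]; set z := xget 1 P.
have [Ez z0 zO] : P z.
  have [y [_ [Ey y0 _ _ yO]]] := fid_integral fI.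
  by rewrite /z; case: xgetP => [_ -> //|no]; case: (no y).
split; last by exists z.
have [zs _ ms] := omod_scl Ez (fid_omod fI).
split=> //; last by move=> x y; exact: (zmodD zs).
by have [x Ix x0] := fid_neq0 fI; exists (z * x); [exists x|rewrite mulf_neq0].
Qed.

Variable Js : seq (set algC).
Hypothesis repJs : reps (fid c) equiv1 Js.
Let fid_Js J : J \in Js -> fid c J. Proof. by case: repJs => -[_ + _] _; apply. Qed.

Definition torsorI (J : set algC) (r : nat) : set algC := prodI (contentI J) (ambI r).

Lemma torsorI_fid J r : J \in Js -> r \in half_ram -> exists n, fid n (torsorI J r).
Proof.
move=> /fid_Js fJ /half_ramP[rR _]; have [n fn] := contentI_fid fJ; have [fidr _] := ambIP rR.
by exists (n * r%:R); exact: fid_mul.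
Qed.

Lemma torsorI_eq J r : J \in Js -> r \in half_ram ->
  prodI J (conjI (torsorI J r)) = prodI J0 (torsorI J r).
Proof.
move=> /fid_Js fJ /half_ramP[rR _]; have [_ cr] := ambIP rR.
by rewrite /torsorI conj_prodI cr !prodIA contentI_scl.
Qed.

Lemma torsorI_inj J r J' r' x : J \in Js -> r \in half_ram -> J' \in Js -> r' \in half_ram ->
  E x -> x != 0 -> torsorI J r = scl x (torsorI J' r') -> J = J' /\ r = r'.
Proof.
move=> JJ rr JJ' rr' Ex x0 ET; have xc0 : x^* != 0 by rewrite fmorph_eq0.
have oJ := fid_omod (fid_Js JJ); have oJ' := fid_omod (fid_Js JJ').
have EJ : J = J'.
  have [[_ _ Jeq] _] := repJs; apply/esym/Jeq => //; exists (x / x^*); first exact: norm1_div.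
  have [n' fn'] := torsorI_fid JJ' rr'.
  have h : prodI (conjI (torsorI J' r')) (scl x^* J) = prodI (conjI (torsorI J' r')) (scl x J').
    have := torsorI_eq JJ rr; rewrite ET conj_scl -scl_prodIr => h.
    rewrite -[LHS]scl_prodIr [prodI _ J]prodIC h -scl_prodIr -(torsorI_eq JJ' rr').
    by rewrite -[RHS]scl_prodIr [prodI J' _]prodIC.
  have {}h := fid_cancel (fid_conj fn') (omod_scl (quad_conj Ex) oJ) (omod_scl Ex oJ') h.
  by apply: (scl_inj xc0); rewrite h sclM mulrC divfK.
split=> //; have [n fn] := contentI_fid (fid_Js JJ).
move/half_ramP: (rr) => [rR _]; move/half_ramP: (rr') => [rR' _].
have [fidr _] := ambIP rR; have [fidr' _] := ambIP rR'.
apply: esym; apply: (@amb_equiv r' r x) => //.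
apply: (fid_cancel fn); [exact: fid_omod fidr|exact: omod_scl Ex (fid_omod fidr')|].
by rewrite -scl_prodIr {2}EJ -/(torsorI J' r') -ET.
Qed.

(* For J = J0 A / conj(A) and J1 = u J in Js, the ideal A / contentI J1 becomes
   ambiguous after scaling by y, where u = y / conj(y). *)
Lemma torsorI_cover N A : fid N A -> exists J r x,
  [/\ J \in Js, r \in half_ram, E x, x != 0 & A = scl x (torsorI J r)].
Proof.
move=> fidN; have N0 : 0 < N by case: fidN.
pose J := scl (ratr N^-1) (prodI J0 (prodI A A)).
have fJ : fid c J.
  have Ni : 0 < N^-1 by rewrite invr_gt0.
  have := fid_sclr Ni (fid_mul f0 (fid_mul fidN fidN)).
  by have -> : N^-1 ^+ 2 * (c * (N * N)) = c by field; rewrite gt_eqF.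
have eqA : prodI J (conjI A) = prodI J0 A.
  rewrite /J -scl_prodI -!prodIA; have [_ _ ->] := fidN.
  rewrite -scl_prodIr (prodr_O (fid_omod fidN)) -scl_prodIr sclM -rmorphM mulVf ?gt_eqF //.
  by rewrite rmorph1 scl1.
have [J1 JJ1 [u E1u EJ1]] := repJs.2 J fJ; have Eu : E u by case: E1u.
have [n1 fn1] := contentI_fid (fid_Js JJ1); set a1 := contentI J1 in fn1.
have eq1 : scl u (prodI J (conjI a1)) = prodI J0 a1.
  by rewrite scl_prodI -EJ1 contentI_scl //; exact: fid_Js.
have [y [Ey y0 uy]] := hilbert90 E1u; have [ny ny0 Eny] := quad_norm_gt0 Ey y0.
have fAa := fid_mul fidN (fid_conj fn1).
have eqF : prodI (conjI A) a1 = scl u (prodI A (conjI a1)).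
  have oa := omod_prodI (omod_conj (fid_omod fidN)) (fid_omod fn1).
  apply: (fid_cancel (fid_mul f0 fJ) oa (omod_scl Eu (fid_omod fAa))).
  rewrite [prodI J0 J]prodIC prodIACA eqA -eq1 -scl_prodIr -scl_prodIr; congr (scl _ _).
  by rewrite prodIACA [prodI J0 J]prodIC.
pose F := scl y (prodI A (conjI a1)); have fF : fid (ny * (N * n1)) F by apply: fid_scl.
have cF : conjI F = F.
  by rewrite /F conj_scl conj_prodI conjIK eqF sclM mulrC uy.
have [r [x [rr Ex x0 EF]]] := amb_class fF cF.
have n10 : 0 < n1 by case: fn1.
have EA : scl (y * ratr n1) A = scl x (torsorI J1 r).
  transitivity (prodI F a1); last by rewrite EF -scl_prodI /torsorI prodIC.
  rewrite /F -scl_prodI -prodIA [prodI (conjI a1) a1]prodIC; have [_ _ ->] := fn1.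
  by rewrite -scl_prodIr (prodr_O (fid_omod fidN)) sclM.
have yn0 : y * ratr n1 != 0 by rewrite mulf_neq0 // ratr_neq0.
exists J1, r, ((y * ratr n1)^-1 * x); split=> //.
- by apply: quadM => //; apply/quadV/quadM => //; exact: quad_rat.
- by rewrite mulf_neq0 // invr_eq0.
- by rewrite -sclM -EA sclM mulVf // scl1.
Qed.

Lemma torsorI_equiv_inj J r J' r' : J \in Js -> r \in half_ram -> J' \in Js -> r' \in half_ram ->
  ideal_equiv E (imult (torsorI J r)) (imult (torsorI J' r')) -> J = J' /\ r = r'.
Proof.
move=> JJ rr JJ' rr' /ideal_equivP[x [Ex x0 Ei]].
have [n fn] := torsorI_fid JJ rr; have [n' fn'] := torsorI_fid JJ' rr'.
have [_ [z [Ez z0 Iz]]] := imultP fn; have [_ [z' [Ez' z0' Iz']]] := imultP fn'.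
apply: (torsorI_inj JJ rr JJ' rr' (x := z^-1 * (x * z'))).
- by apply: quadM; [exact: quadV|exact: quadM].
- by rewrite !mulf_neq0 // invr_eq0.
- by rewrite -sclM -(sclM x) -Iz' -Ei Iz sclM mulVf // scl1.
Qed.

Lemma torsorI_reps : reps (integral_ideal E) (ideal_equiv E)
  [seq imult (torsorI J r) | J <- Js, r <- half_ram].
Proof.
have [[uJ _ _] _] := repJs; split; first split.
- apply: allpairs_uniq => //; first exact: divisors_uniq.
  move=> _ _ /allpairsP[[a b] /= [aJ br ->]] /allpairsP[[a' b'] /= [aJ' br' ->]] /= h.
  by have [|-> ->] := torsorI_equiv_inj aJ br aJ' br'; first by rewrite h; exact: ideal_equiv_refl.
- move=> _ /allpairsP[[J r] /= [JJ rr ->]]; have [n fn] := torsorI_fid JJ rr.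
  by have [] := imultP fn.
- move=> _ _ /allpairsP[[J r] /= [JJ rr ->]] /allpairsP[[J' r'] /= [JJ' rr' ->]] h.
  by have [-> ->] := torsorI_equiv_inj JJ rr JJ' rr' h.
move=> A /integral_ideal_fid[N fidA]; have [J [r [x [JJ rr Ex x0 ->]]]] := torsorI_cover fidA.
exists (imult (torsorI J r)); first by apply/allpairsP; exists (J, r).
have [n fn] := torsorI_fid JJ rr; have [_ [z [Ez z0 ->]]] := imultP fn.
apply/ideal_equivP; exists (x * z^-1); split; first by apply: quadM => //; exact: quadV.
  by rewrite mulf_neq0 // invr_eq0.
by rewrite sclM mulfVK.
Qed.

Theorem class_count : field_class_number E = (size Js * 2 ^ (nu ram).-1)%N.
Proof.
rewrite /field_class_number (ncard_eq_classes _ _ _ torsorI_reps) ?size_allpairs ?size_half_ram //.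
- by move=> I _; exact: ideal_equiv_refl.
- by move=> I H _ _; exact: ideal_equiv_sym.
- by move=> I H G _ _ _; exact: ideal_equiv_trans.
Qed.

End Count.

Lemma unit_root12 u : O u -> u * u^* = 1 -> u ^+ 12 = 1.
Proof.
move=> Ou uu; have Eu := qint_quad Ou.
have [t [_ [Et _]]] := (qint_trace_norm Eu).1 Ou.
have u2 : u ^+ 2 = t%:~R * u - 1 by rewrite -Et -uu; ring.
have t2 := unit_trace_bound Eu uu Et.
have : t = -2 \/ t = -1 \/ t = 0 \/ t = 1 \/ t = 2 by clear -t2; lia.
have two (e : algC) : u ^+ 2 = 2 * e * u - 1 -> e * e = 1 -> u = e.
  move=> h ee; apply/eqP; rewrite -subr_eq0 -sqrf_eq0; apply/eqP.
  by transitivity (u ^+ 2 - 2 * e * u + e * e); [ring|rewrite ee h; ring].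
case=> [t_|[t_|[t_|[t_|t_]]]]; rewrite t_ in u2.
- rewrite (two (-1)); [by rewrite -signr_odd expr0|by rewrite u2; ring|by ring].
- by rewrite (_ : 12 = 3 * 4)%N // exprM (_ : u ^+ 3 = 1) ?expr1n // exprS u2; ring: u2.
- by rewrite (_ : 12 = 2 * 6)%N // exprM u2; ring.
- by rewrite (_ : 12 = 3 * 4)%N // exprM (_ : u ^+ 3 = -1); [ring|rewrite exprS u2; ring: u2].
- rewrite (two 1); [by rewrite expr1n|by rewrite u2; ring|by ring].
Qed.

Lemma root_unit u : roots_of_unity E u -> O u /\ u * u^* = 1.
Proof.
move=> [Eu [k k0 uk]]; split.
  split=> //; apply: (@Aint_unity_root k) => //; by apply/unity_rootP.
rewrite -normCK; have : `|u| ^+ k = 1 by rewrite -normrX uk normr1.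
by move/eqP; rewrite (pexpr_eq1 k0 (normr_ge0 u)) => /eqP ->; rewrite expr1n.
Qed.

Lemma rootsP u : roots_of_unity E u <-> O u /\ u * u^* = 1.
Proof.
split; first exact: root_unit.
by move=> [Ou uu]; split; [exact: qint_quad|exists 12%N => //; exact: unit_root12].
Qed.

Lemma finite_roots : finite_set (roots_of_unity E).
Proof.
have [r Er] := closed_field_poly_normal ('X^12 - 1 : {poly algC}).
apply: (sub_finite_set _ (finite_seq r)) => u /rootsP[Ou uu].
have mon : ('X^12 - 1 : {poly algC}) \is monic by rewrite -[1]/(1%:P) monicXnsubC.
have : root ('X^12 - 1 : {poly algC}) u by rewrite /root !hornerE unit_root12 // subrr.
by rewrite Er (monicP mon) scale1r root_prod_XsubC.
Qed.

End ClassNumber.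

(** * Counting vectors by ideal classes *)

Definition cv3 (x y z : algC) : 'cV[algC]_3 := \col_i [:: x; y; z]`_i.

Lemma mul_cv3 (a b c d e f g h i x y z : algC) :
  mx3 a b c d e f g h i *m cv3 x y z =
  cv3 (a * x + b * y + c * z) (d * x + e * y + f * z) (g * x + h * y + i * z).
Proof. by apply/colP; apply: I3P; rewrite !mxE sum_ord3 !mxE. Qed.

Lemma cv3_inj x y z x' y' z' : cv3 x y z = cv3 x' y' z' -> [/\ x = x', y = y' & z = z'].
Proof.
move=> /colP E; split; [have := E o0|have := E o1|have := E o2]; by rewrite !mxE.
Qed.

Lemma ncard_fiber (T U : choiceType) (A : set (T * U)) (s : seq T) : uniq s ->
  (forall p, A p -> p.1 \in s) -> (forall x, x \in s -> finite_set [set z | A (x, z)]) ->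
  finite_set A /\ ncard A = (\sum_(x <- s) ncard [set z | A (x, z)])%N.
Proof.
move=> us As fin.
have /choice[l lP] : forall x, exists l : seq U, x \in s ->
  uniq l /\ forall z, A (x, z) <-> z \in l.
  move=> x; have [xs|_] := boolP (x \in s); last by exists [::].
  by have [l ul lP] := finite_enum (fin x xs); exists l.
pose L := flatten [seq [seq (x, z) | z <- l x] | x <- s].
have LP p : A p <-> p \in L.
  split=> [Ap|/flattenP[_ /mapP[x xs ->] /mapP[z zl ->]]]; last by have [_ h] := lP x xs; apply/h.
  case: p Ap => x z Ap; have xs := As _ Ap; have [_ h] := lP x xs.
  apply/flattenP; exists [seq (x, z') | z' <- l x]; first exact: map_f.
  by apply: map_f; apply/h.
have uL : uniq L.
  rewrite /L; elim: s us lP {As fin LP L} => //= x s IH /andP[xs us] lP.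
  rewrite cat_uniq; apply/and3P; split.
  - rewrite map_inj_uniq; last by move=> z z' [].
    by have [] := lP x (mem_head _ _).
  - apply/hasPn => p /flattenP[_ /mapP[x' xs' ->] /mapP[z _ ->]].
    by apply/negP => /mapP[z' _ [E _]]; rewrite -E xs' in xs.
  - by apply: IH => // x' xs'; apply: lP; rewrite inE xs' orbT.
split; first by apply: (sub_finite_set _ (finite_seq L)) => p /LP.
rewrite (ncard_seq uL LP) /L size_flatten /shape -map_comp sumnE big_map big_seq [RHS]big_seq.
apply: eq_bigr => x xs /=; rewrite size_map; have [ul h] := lP x xs.
by rewrite (ncard_seq ul h).
Qed.

Lemma ncard0 (T : choiceType) (A : set T) : (forall x, ~ A x) -> ncard A = 0%N.
Proof. by move=> h; apply: (@ncard_seq _ _ [::]) => // x; split=> // /h. Qed.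

Lemma positive_reflection (G : 'M[rat]_3) (x y : 'rV[rat]_3) : G^T = G ->
  (forall z : 'rV[rat]_3, z != 0 -> 0 < qform G z) -> qform G x = qform G y ->
  exists Q : 'M[rat]_3, Q *m G *m Q^T = G /\ x *m Q = y.
Proof.
move=> sG pG Exy; have [->|xy] := eqVneq x y.
  by exists 1%:M; rewrite mul1mx trmx1 !mulmx1.
pose u := x - y; have u0 : u != 0 by rewrite subr_eq0.
pose t := G *m u^T; pose d := qform G u; have d0 : 0 < d := pG u u0.
have tT : t^T = u *m G by rewrite /t trmx_mul trmxK sG.
have ut : u *m t = d%:M.
  by rewrite [LHS]mx11_scalar /d /qform /bform /t mulmxA.
pose Q := 1%:M - (2 / d) *: (t *m u); exists Q.
have QT : Q^T = 1%:M - (2 / d) *: (u^T *m t^T) by rewrite /Q linearB linearZ /= trmx1 trmx_mul.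
have QG : Q *m G = G - (2 / d) *: (t *m t^T).
  by rewrite /Q mulmxBl mul1mx -scalemxAl -mulmxA -tT.
have tQ : t^T *m Q^T = - t^T.
  rewrite QT mulmxBr mulmx1 -scalemxAr mulmxA tT.
  have -> : u *m G *m u^T = d%:M by rewrite -mulmxA.
  rewrite mul_scalar_mx scalerA (_ : 2 / d * d = 2) ?divfK ?gt_eqF // scaler_nat mulr2n.
  by rewrite opprD addrA subrr add0r.
have GQ : G *m Q^T = G - (2 / d) *: (t *m t^T).
  by rewrite -[LHS]trmxK trmx_mul trmxK sG QG linearB linearZ /= sG trmx_mul trmxK.
split.
  have ttQ : t *m t^T *m Q^T = - (t *m t^T) by rewrite -(mulmxA t) tQ mulmxN.
  by rewrite QG mulmxBl GQ -scalemxAl ttQ scalerN opprK subrK.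
rewrite /Q mulmxBr mulmx1 -scalemxAr mulmxA.
have -> : x *m t = (d / 2)%:M.
  rewrite [LHS]mx11_scalar; congr (_%:M); rewrite /t mulmxA -/(bform G x u).
  have b_lin : bform G x u = qform G x - bform G x y.
    by rewrite /u /bform /qform /bform linearB /= mulmxBr !mxE.
  have E : d = qform G x + qform G y - 2 * bform G x y.
    rewrite /d /u qformD //.
    by rewrite bformNr qformN; ring.
  by rewrite b_lin E -Exy; field.
rewrite mul_scalar_mx scalerA (_ : 2 / d * (d / 2) = 1); last by field; rewrite gt_eqF.
by rewrite scale1r /u opprB addrCA subrr addr0.
Qed.

Definition unimod (i j k l : int) := i * l - j * k = 1 \/ i * l - j * k = -1.
Definition bqf (A B C i j : int) : int := A * i ^+ 2 + B * i * j + C * j ^+ 2.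
Definition bqfB (A B C i j k l : int) : int := 2 * A * i * k + B * (i * l + j * k) + 2 * C * j * l.

Lemma unimod_sqr i j k l : unimod i j k l -> (i * l - j * k) * (i * l - j * k) = 1.
Proof. by case=> ->. Qed.

Lemma form_change_disc A B C i j k l : unimod i j k l ->
  bqfB A B C i j k l ^+ 2 - 4 * bqf A B C i j * bqf A B C k l = B ^+ 2 - 4 * A * C.
Proof.
move=> /unimod_sqr u; rewrite /bqf /bqfB.
by transitivity (((i * l - j * k) * (i * l - j * k)) * (B ^+ 2 - 4 * A * C));
  [ring|rewrite u mul1r].
Qed.

(* A unimodular matrix (i, j; k, l) carries the basis (y, w) to (i y + j w, k y + l w);
   only the class of (k, l) modulo be, up to sign, matters for gluing. *)
Definition gluing_transversal (be : int) (ok : int -> int -> int -> int -> Prop)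
    (gs : seq (int * int * int * int)) :=
  [/\ uniq gs, forall i j k l, (i, j, k, l) \in gs -> unimod i j k l /\ ok i j k l,
    forall i j k l i' j' k' l', (i, j, k, l) \in gs -> (i', j', k', l') \in gs ->
      (be %| k * l' - l * k')%Z -> (i, j, k, l) = (i', j', k', l')
  & forall i j k l, unimod i j k l -> ok i j k l ->
      exists i' j' k' l', (i', j', k', l') \in gs /\ (be %| k' * l - l' * k)%Z].

Definition genus_total (Hs : seq 'M[int]_3) (F : 'M[int]_3 -> set 'rV[int]_3) : rat :=
  \sum_(H <- Hs) (ncard (F H))%:R / (ncard (Defs.ortho H))%:R.

Definition class_value (dd : sqf) (k : nat) : rat := let E := quad_field (- sqf_val dd) in
  k%:R * (field_class_number E)%:R / (2 ^+ nu (ram dd) * (mu E)%:R).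

Section Bases.
Variable dd : sqf.
Local Notation D := (sqf_val dd).
Local Notation E := (quad_field (- D)).
Local Notation O := (integers E).
Local Notation fid := (fid dd).
Local Notation nbasis := (nbasis dd).
Local Notation disc := (disc dd).
Local Notation norm1 := (norm1 dd).
Local Notation equiv1 := (equiv1 dd).

Lemma basis_form_change c I y w A B C i j k l : nbasis c I y w A B C -> unimod i j k l ->
  nbasis c I (i%:~R * y + j%:~R * w) (k%:~R * y + l%:~R * w)
    (bqf A B C i j) (bqfB A B C i j k l) (bqf A B C k l).
Proof.
move=> [Ey Ew [Ny Nw T] dABC EI] u; have u2 := unimod_sqr u.
have EL (i' j' : int) : E (i'%:~R * y + j'%:~R * w).
  by apply: quadD; apply: quadM => //; exact: quad_int.
have cj (i' j' : int) : (i'%:~R * y + j'%:~R * w)^* = i'%:~R * y^* + j'%:~R * w^*.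
  by rewrite rmorphD !rmorphM /= !rmorph_int.
split=> //.
- rewrite !cj /bqf /bqfB; split.
  + transitivity (i%:~R ^+ 2 * (y * y^*) + i%:~R * j%:~R * (y * w^* + y^* * w)
      + j%:~R ^+ 2 * (w * w^*)); first by ring.
    by rewrite Ny Nw T; ring.
  + transitivity (k%:~R ^+ 2 * (y * y^*) + k%:~R * l%:~R * (y * w^* + y^* * w)
      + l%:~R ^+ 2 * (w * w^*)); first by ring.
    by rewrite Ny Nw T; ring.
  + transitivity (2 * i%:~R * k%:~R * (y * y^*) + (i%:~R * l%:~R + j%:~R * k%:~R) * (y * w^*
      + y^* * w) + 2 * j%:~R * l%:~R * (w * w^*)); first by ring.
    by rewrite Ny Nw T; ring.
- by rewrite form_change_disc.
rewrite EI; apply/seteqP; split=> _ [p [q ->]].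
  have [e [ee E0]] : exists e : int, e * e = 1 /\ i * l - j * k = e.
    by exists (i * l - j * k).
  exists (e * (p * l - q * k)), (e * (q * i - p * j)).
  transitivity ((e * (i * l - j * k))%:~R * (p%:~R * y + q%:~R * w)); last by ring.
  by rewrite E0 ee mul1r.
by exists (p * i + q * k), (p * j + q * l); ring.
Qed.

Lemma basis_form c I y w A B C y' w' A' B' C' : 0 < c -> nbasis c I y w A B C ->
  nbasis c I y' w' A' B' C' ->
  y = y' -> w = w' -> [/\ A = A', B = B' & C = C'].
Proof.
move=> c0 [_ _ [Ny Nw T] _ _] [_ _ [Ny' Nw' T'] _ _] Ey Ew; subst y' w'.
have rc := ratr_neq0 c0.
have inj (a b : int) : ratr c * a%:~R = ratr c * b%:~R :> algC -> a = b.
  by move/(mulfI rc)/eqP; rewrite eqr_int => /eqP.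
by split; apply: inj; [rewrite -Ny Ny'|rewrite -T T'|rewrite -Nw Nw'].
Qed.

Lemma basis_two c I y w A B C y' w' A' B' C' : 0 < c -> nbasis c I y w A B C ->
  nbasis c I y' w' A' B' C' ->
  exists i j k l, [/\ unimod i j k l, y' = i%:~R * y + j%:~R * w, w' = k%:~R * y + l%:~R * w
   & [/\ A' = bqf A B C i j, B' = bqfB A B C i j k l & C' = bqf A B C k l]].
Proof.
move=> c0 b b'; have [_ _ _ _ EI] := b; have [_ _ _ _ EI'] := b'.
have := basis_y b'; rewrite EI => -[i [j Ey]].
have := basis_w b'; rewrite EI => -[k [l Ew]].
have := basis_y b; rewrite EI' => -[i' [j' Ey']].
have := basis_w b; rewrite EI' => -[k' [l' Ew']].
have y_rel : (i' * i + j' * k - 1)%:~R * y + (i' * j + j' * l)%:~R * w = 0.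
  transitivity (i'%:~R * (i%:~R * y + j%:~R * w) + j'%:~R * (k%:~R * y + l%:~R * w) - y);
    first by ring.
  by rewrite -Ey -Ew -Ey' subrr.
have w_rel : (k' * i + l' * k)%:~R * y + (k' * j + l' * l - 1)%:~R * w = 0.
  transitivity (k'%:~R * (i%:~R * y + j%:~R * w) + l'%:~R * (k%:~R * y + l%:~R * w) - w);
    first by ring.
  by rewrite -Ey -Ew -Ew' subrr.
have [e1 e2] := basis_uniq c0 b y_rel; have [e3 e4] := basis_uniq c0 b w_rel.
have u : unimod i j k l.
  have dd1 : (i' * l' - j' * k') * (i * l - j * k) = 1.
    transitivity ((i' * i + j' * k) * (k' * j + l' * l) - (i' * j + j' * l) * (k' * i + l' * k));
      first by ring.
    have -> : i' * i + j' * k = 1 by apply/eqP; rewrite -subr_eq0 e1.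
    have -> : k' * j + l' * l = 1 by apply/eqP; rewrite -subr_eq0 e4.
    by rewrite e2 e3.
  have : i * l - j * k \is a GRing.unit by apply/unitrP; exists (i' * l' - j' * k');
    rewrite dd1 mulrC dd1.
  move=> /intr_unit; rewrite /unimod; move: (i * l - j * k) => e /eqP.
  by rewrite sqrf_eq1 => /orP[]/eqP ->; [left|right].
exists i, j, k, l; split=> //.
have b2 := basis_form_change b u; rewrite -Ey -Ew in b2.
exact: (basis_form c0 b' b2 erefl erefl).
Qed.

Lemma pair_orbit c I I' y w y' w' A B C : 0 < c -> nbasis c I y w A B C ->
  nbasis c I' y' w' A B C ->
  (exists2 u, norm1 u & y' = u * y /\ w' = u * w) \/ (exists2 u, norm1 u & y' = u * y^* /\ w'
    = u * w^*).
Proof.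
move=> c0 b b'; have [Ey _ [Ny Nw T] _ _] := b; have [Ey' _ [Ny' Nw' T'] _ _] := b'.
have nz I1 y1 w1 : nbasis c I1 y1 w1 A B C -> y1 != 0.
  move=> b1; apply/eqP => y0.
  by have [] : (1 : int) = 0 /\ (0 : int) = 0 by apply: (basis_uniq c0 b1); rewrite y0; ring.
have y0 := nz _ _ _ b; have y'0 := nz _ _ _ b'.
have yc0 : y^* != 0 by rewrite fmorph_eq0.
have y'c0 : y'^* != 0 by rewrite fmorph_eq0.
have NN : y * y^* = y' * y'^* by rewrite Ny Ny'.
have TT : y * w^* + y^* * w = y' * w'^* + y'^* * w' by rewrite T T'.
have WW : w * w^* = w' * w'^* by rewrite Nw Nw'.
have : (y' * w'^* - y * w^*) * (y' * w'^* - y^* * w) = 0.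
  transitivity ((y' * w'^*) ^+ 2 - (y * w^* + y^* * w) * (y' * w'^*) + (y * y^*) * (w * w^*));
    first by ring.
  by rewrite TT NN WW; ring.
move/eqP; rewrite mulf_eq0 !subr_eq0 => /orP[]/eqP h; [left|right].
  have skewE : y'^* * w' = y^* * w.
    by have := congr1 (@Num.conj algC) h; rewrite !conjM !conjCK.
  exists (y' / y).
    split; first by apply: quadM => //; exact: quadV.
    by rewrite (conjM y') fmorphV /=; transitivity ((y' * y'^*) / (y * y^*));
      [field; rewrite y0 yc0|rewrite NN divff // -NN mulf_neq0].
  split; first by rewrite divfK.
  apply: (mulfI y'c0); rewrite skewE; transitivity ((y' * y'^*) * w / y); last by field.
  by rewrite -NN; field.
have skewE : y'^* * w' = y * w^*.
  by have := congr1 (@Num.conj algC) h; rewrite !conjM !conjCK.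
exists (y' / y^*).
  split; first by apply: quadM => //; apply/quadV/quad_conj.
  by rewrite (conjM y') fmorphV /= conjCK; transitivity ((y' * y'^*) / (y * y^*));
    [field; rewrite y0 yc0|rewrite NN divff // -NN mulf_neq0].
split; first by rewrite divfK.
apply: (mulfI y'c0); rewrite skewE; transitivity ((y' * y'^*) * w^* / y^*); last by field.
by rewrite -NN; field.
Qed.

Lemma basis_conj c I y w A B C : nbasis c I y w A B C -> nbasis c (conjI I) y^* w^* A B C.
Proof.
move=> [Ey Ew [Ny Nw T] dABC EI]; split; try exact: quad_conj; rewrite ?conjCK //.
  by split; rewrite 1?mulrC //; rewrite -T addrC [y^* * w]mulrC; congr (_ + _); rewrite mulrC.
rewrite EI; apply/seteqP; split=> z.
  move=> [i [j Ez]]; exists i, j; by rewrite -[z]conjCK Ez rmorphD !rmorphM /= !rmorph_int.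
by move=> [i [j ->]]; exists i, j; rewrite rmorphD !rmorphM /= !rmorph_int !conjCK.
Qed.

Lemma torsor c I J : fid c I ->
  [/\ finite_set [set u | norm1 u /\ scl u I = J],
      equiv1 I J -> ncard [set u | norm1 u /\ scl u I = J] = mu E
    & ~ equiv1 I J -> ncard [set u | norm1 u /\ scl u I = J] = 0%N].
Proof.
move=> fI; have finR := finite_roots dd.
have no : ~ equiv1 I J -> forall u, ~ (norm1 u /\ scl u I = J).
  by move=> h u [Eu EJ]; apply: h; exists u.
have [[u0 Eu0 EJ]|h] := pselect (equiv1 I J); last first.
  split; [|by []|by move=> _; exact/ncard0/no].
  by apply: sub_finite_set (finite_set0 algC) => u /(no h).
have [s us sP] := finite_enum finR.
have u00 := norm1_neq0 Eu0.
have LP u : (norm1 u /\ scl u I = J) <-> u \in [seq e * u0 | e <- s].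
  split=> [[Eu EuJ]|/mapP[e /sP/rootsP[Oe ee] ->]].
    apply/mapP; exists (u / u0); last by rewrite divfK.
    apply/sP/rootsP; split.
      apply: (fid_stab fI); rewrite mulrC -sclM EuJ EJ sclM mulVf // scl1 //.
    rewrite (conjM u) fmorphV /=; have [_ h1] := Eu; have [_ h2] := Eu0.
    transitivity ((u * u^*) / (u0 * u0^*)); first by field; rewrite u00 fmorph_eq0 u00.
    by rewrite h1 h2 divr1.
  have E1e : norm1 e by split; [exact: qint_quad|].
  split; first exact: norm1M.
  rewrite mulrC -sclM (_ : scl e I = I) -?EJ //.
  apply/seteqP; have [_ _ mI] := fid_omod fI; split=> [_ [x Ix <-]|x Ix]; first exact: mI.
  exists (e^* * x); last by rewrite mulrA ee mul1r.
  by apply: mI => //; exact: qint_conj.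
have ul : uniq [seq e * u0 | e <- s] by rewrite map_inj_uniq //; exact: mulIf.
split; first by apply: (sub_finite_set _ (finite_seq [seq e * u0 | e <- s])) => u /LP.
  by move=> _; rewrite (ncard_seq ul LP) size_map /mu (ncard_seq us sP).
by case; exists u0.
Qed.

Lemma torsor_sum c I Js : fid c I -> indep (fid c) equiv1 Js ->
  (\sum_(J <- Js) ncard [set u | norm1 u /\ scl u I = J] <= mu E)%N /\
  ((exists2 J, J \in Js & equiv1 I J) ->
    (\sum_(J <- Js) ncard [set u | norm1 u /\ scl u I = J])%N = mu E).
Proof.
move=> fI [uJ _ Jeq].
have sum_eq : (exists2 J, J \in Js & equiv1 I J) ->
  (\sum_(J <- Js) ncard [set u | norm1 u /\ scl u I = J])%N = mu E.
  move=> [J1 JJ1 e1]; rewrite (bigD1_seq J1) //=; have [_ -> // _] := torsor J1 fI.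
  rewrite big_seq_cond big1 ?addn0 // => J /andP[JJ JJ1'].
  have [_ _ ->] := torsor J fI => //; apply: contra_neq_not JJ1' => e.
  by apply: Jeq => //; apply: equiv1_trans (equiv1_sym e) e1.
split=> //; have [ex|ex] := pselect (exists2 J, J \in Js & equiv1 I J); first by rewrite sum_eq.
rewrite big_seq big1 // => J JJ; have [_ _ ->] := torsor J fI => // e.
by apply: ex; exists J.
Qed.

Definition rational_split K (n : nat) (a : rat) :=
  isometric (ext rat K) (smx3 n%:R a (a * D%:~R) 0 0 0).

(* A family of pairs (H, v): in a basis starting with v, H is the Gram matrix of
   v, y, al v + w / be, where y and w span an ideal of norm ga / a with norm form
   (A, B, C) subject to a congruence condition. *)
Section Family.
Variables (K : 'M[int]_3) (n be : nat) (al ga a : rat).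
Variables (cond : int -> int -> int -> Prop) (kk : nat).
Local Notation e0 := (rv3 1 0 0 : 'rV[int]_3).

Definition glued_gram (A B C : int) : 'M[rat]_3 :=
  smx3 n%:R (ga * A%:~R) (n%:R * al ^+ 2 + ga * C%:~R / be%:R ^+ 2) 0 (n%:R * al)
    (ga * B%:~R / (2 * be%:R)).
Definition admissible (A B C : int) := cond A B C /\ B ^+ 2 - 4 * A * C = disc.

Definition admissible_change A B C (i j k l : int) :=
  admissible (bqf A B C i j) (bqfB A B C i j k l) (bqf A B C k l).

Definition fam_vecs H (v : 'rV[int]_3) := exists U A B C,
  [/\ U \in unitmx, v = e0 *m U, ext rat (U *m H *m U^T) = glued_gram A B C & admissible A B C].

Hypotheses (sK : stable K) (n0 : (0 < n)%N) (be0 : (0 < be)%N) (ga0 : 0 < ga) (a0 : 0 < a).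
Hypothesis K_diag : rational_split K n a.
Hypothesis shape_integral : forall A B C, admissible A B C -> exists H : 'M[int]_3,
  [/\ ext rat H = glued_gram A B C, \det H = \det K & even_lattice K -> even_lattice H].
Hypothesis be_dvd : forall A B C A' B' C' i j, admissible A B C -> admissible A' B' C' ->
  A'%:~R = A%:~R * i%:~R ^+ 2 + B%:~R * i%:~R * j%:~R / be%:R
    + C%:~R * j%:~R ^+ 2 / be%:R ^+ 2 :> rat ->
  (exists t : int, al * j%:~R = t%:~R) -> (be%:Z %| j)%Z.
Hypothesis al_be_int : exists t : int, al * be%:R = t%:~R.
Hypothesis al_int : forall l : int, (be == 1)%N \/ ~~ (2 %| l)%Z ->
  exists t : int, al * (1 - l%:~R) = t%:~R.
Hypothesis be_even : (be == 1)%N \/ (2 %| be)%N.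
Hypothesis transversal_ex : forall A B C, (exists J y w, nbasis (ga / a) J y w A B C) ->
  exists2 gs, gluing_transversal be%:Z (admissible_change A B C) gs & size gs = kk.

Let c : rat := ga / a.
Let c0 : 0 < c. Proof. exact: divr_gt0. Qed.
Let be_neq0 : be%:R != 0 :> rat. Proof. by rewrite pnatr_eq0 -lt0n. Qed.
Let be_neq0C : be%:R != 0 :> algC. Proof. by rewrite pnatr_eq0 -lt0n. Qed.
Let n_neq0 : n%:R != 0 :> rat. Proof. by rewrite pnatr_eq0 -lt0n. Qed.
Let ga_neq0 : ga != 0. Proof. exact: lt0r_neq0. Qed.

Definition coords (y w : algC) := cv3 0 y (w / be%:R).

Definition frame H (v : 'rV[int]_3) (z : 'cV[algC]_3) (I : set algC) :=
  exists U A B C y w,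
  [/\ U \in unitmx, v = e0 *m U, ext rat (U *m H *m U^T) = glued_gram A B C & admissible A B C] /\
  (nbasis c I y w A B C /\ ext algC U *m z = coords y w).

Lemma coords_inj y w y' w' : coords y w = coords y' w' -> y = y' /\ w = w'.
Proof. by move=> /cv3_inj[_ -> h]; split=> //; apply: (mulIf (_ : be%:R^-1 != 0)) h;
  rewrite invr_eq0. Qed.

Lemma ext_mulc (A : 'M[int]_3) (B : 'M[int]_3) (z : 'cV[algC]_3) :
  ext algC A *m (ext algC B *m z) = ext algC (A *m B) *m z.
Proof. by rewrite mulmxA ext_mul. Qed.

Definition econj (W : 'M[int]_3) (S : 'M[rat]_3) := ext rat W *m S *m (ext rat W)^T.

Lemma econjM W W' S : econj (W *m W') S = econj W (econj W' S).
Proof. by rewrite /econj ext_mul trmx_mul !mulmxA. Qed.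

Lemma econj_ext W H : econj W (ext rat H) = ext rat (W *m H *m W^T).
Proof. by rewrite /econj tr_ext -!ext_mul. Qed.

Lemma econjK W : W \in unitmx -> cancel (econj W) (econj (invmx W)).
Proof. by move=> uW S; rewrite -econjM mulVmx // /econj ext1 trmx1 mul1mx mulmx1. Qed.

Lemma shape_change (W : 'M[int]_3) A B C A' B' C' : W \in unitmx -> e0 *m W = e0 ->
  econj W (glued_gram A B C) = glued_gram A' B' C' -> admissible A B C -> admissible A' B' C' ->
  exists x i j z k l, [/\ W = mx3 1 0 0 x i (be%:Z * j) z k l,
    x%:~R = - al * (be%:Z * j)%:~R :> rat, z%:~R = al * (1 - l%:~R) :> rat, unimod i j (be%:Z * k) l
    & [/\ A' = bqf A B C i j, B' = bqfB A B C i j (be%:Z * k) l & C' = bqf A B C (be%:Z * k) l]].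
Proof.
move=> uW /fix_e0P[x [i [j0 [z [k [l EWm]]]]]] EW gA gA'.
rewrite EWm /econj ext_mx3 /glued_gram tr_mx3 !mul_mx3 in EW.
have [[_ q01 q02] [[_ q11 q12] [_ _ q22]]] := mx3_inj EW.
have Ex : x%:~R = - al * j0%:~R :> rat.
  by apply: (mulfI n_neq0); apply/eqP; rewrite -subr_eq0 -[X in _ == X]q01; apply/eqP; ring.
have Ez : z%:~R = al * (1 - l%:~R) :> rat.
  apply: (mulfI n_neq0); apply/eqP; rewrite -subr_eq0.
  rewrite (_ : _ - _ = n%:R * z%:~R + n%:R * al * l%:~R - n%:R * al); last by ring.
  by rewrite -[X in _ - X]q02 subr_eq0; apply/eqP; ring.
have EA : A'%:~R = A%:~R * i%:~R ^+ 2 + B%:~R * i%:~R * j0%:~R / be%:R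
  + C%:~R * j0%:~R ^+ 2 / be%:R ^+ 2 :> rat.
  by apply: (mulfI ga_neq0); rewrite -q11 Ex; field; rewrite ?be_neq0.
have [|j Ej] := dvdzP (be_dvd gA gA' EA _).
  by exists (- x); rewrite rmorphN /= Ex; ring.
rewrite mulrC in Ej.
have jr : j0%:~R = be%:R * j%:~R :> rat by rewrite Ej rmorphM.
exists x, i, j, z, k, l; split; rewrite -?Ej //.
- have : \det W \is a GRing.unit by rewrite -unitmxE.
  rewrite EWm det_mx3 => /intr_unit; rewrite /unimod.
  have -> : i * l - j * (be%:Z * k) = i * l - j0 * k by rewrite Ej; ring.
  rewrite (_ : _ + _ = i * l - j0 * k); last by ring.
  by move=> /eqP; rewrite sqrf_eq1 => /orP[]/eqP ->; [left|right].
- split; apply: (@intr_inj rat).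
  + by rewrite EA jr /bqf; field; rewrite ?be_neq0.
  + apply: (mulfI ga_neq0); apply: (mulfI (_ : (2 * be%:R)^-1 != 0 :> rat));
      first by rewrite invr_eq0 mulf_neq0.
    transitivity (ga * B'%:~R / (2 * be%:R)); first by field; rewrite ?be_neq0.
    by rewrite -q12 Ex Ez jr /bqfB; field; rewrite ?be_neq0.
  + apply: (mulfI ga_neq0); apply: (mulfI (_ : (be%:R ^+ 2)^-1 != 0 :> rat));
      first by rewrite invr_eq0 expf_neq0.
    transitivity (n%:R * al ^+ 2 + ga * C'%:~R / be%:R ^+ 2 - n%:R * al ^+ 2); first by field;
      rewrite ?be_neq0.
    by rewrite -q22 Ez /bqf; field; rewrite ?be_neq0.
Qed.

Lemma shape_change_coords x i j z k l y w : ext algC (mx3 1 0 0 x i (be%:Z * j) z k l) *m coords y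
  w =
  coords (i%:~R * y + j%:~R * w) ((be%:Z * k)%:~R * y + l%:~R * w).
Proof. by rewrite ext_mx3 /coords mul_cv3; congr cv3; rewrite ?rmorphM /=; field. Qed.

Lemma shape_change_ex A B C r1 r2 r3 r4 : unimod r1 r2 r3 r4 -> (be%:Z %| r3)%Z ->
  exists W, [/\ W \in unitmx, e0 *m W = e0,
    econj W (glued_gram A B C)
      = glued_gram (bqf A B C r1 r2) (bqfB A B C r1 r2 r3 r4) (bqf A B C r3 r4)
    & forall y w, ext algC W *m coords y w = coords (r1%:~R * y + r2%:~R * w) (r3%:~R * y
      + r4%:~R * w)].
Proof.
move=> un dr3; have [q Eq] := dvdzP dr3; rewrite mulrC in Eq.
have [t1 Et1] := al_be_int; have [|t2 Et2] := @al_int r4.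
  case: be_even => [->|be2]; [by left|right].
  apply/negP => r42; have r32 : (2 %| r3)%Z by apply: dvdz_trans dr3; rewrite dvdzE.
  have : (2 %| r1 * r4 - r2 * r3)%Z by rewrite rpredB // dvdz_mull.
  by case: un => ->.
exists (mx3 1 0 0 (- (t1 * r2)) r1 (be%:Z * r2) t2 q r4); split.
- rewrite unitmxE det_mx3 (_ : _ + _ = r1 * r4 - r2 * r3); last by rewrite Eq; ring.
  by case: un => ->.
- by rewrite mul_rv3; congr rv3; ring.
- rewrite /econj ext_mx3 /glued_gram tr_mx3 !mul_mx3 -Et2 !rmorphN !rmorphM /= -Et1 /bqf /bqfB Eq.
  by congr mx3; field; rewrite ?be_neq0.
- by move=> y w; rewrite shape_change_coords Eq.
Qed.

Lemma frame_gram H v z I U A B C : frame H v z I -> U \in unitmx -> v = e0 *m U ->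
  ext rat (U *m H *m U^T) = glued_gram A B C -> admissible A B C ->
  exists y w, nbasis c I y w A B C /\ ext algC U *m z = coords y w.
Proof.
move=> [U' [A' [B' [C' [y [w [[uU' vU' EU' g'] [b Uz]]]]]]]] uU vU EU g.
pose W := U *m invmx U'.
have uW : W \in unitmx by rewrite unitmx_mul uU unitmx_inv.
have e0W : e0 *m W = e0 by rewrite mulmxA -vU vU' mulmxK.
have WU : W *m U' = U by rewrite mulmxKV.
clearbody W.
have EW : econj W (glued_gram A' B' C') = glued_gram A B C.
  by rewrite -EU' -EU -WU -!econj_ext econjM.
have [x [i [j [z' [k [l [EWm _ _ un [-> -> ->]]]]]]]] := shape_change uW e0W EW g' g.
exists (i%:~R * y + j%:~R * w), ((be%:Z * k)%:~R * y + l%:~R * w).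
split; first exact: basis_form_change.
by rewrite -WU -ext_mulc Uz EWm shape_change_coords.
Qed.

Lemma frame_fid H v z I : frame H v z I -> fid c I.
Proof. by move=> [U [A [B [C [y [w [_ [b _]]]]]]]]; exact: basis_fid b. Qed.

Lemma frame_fam_vecs H v z I : frame H v z I -> fam_vecs H v.
Proof. by move=> [U [A [B [C [_ [_ [[uU vU EU g] _]]]]]]]; exists U, A, B, C. Qed.

Lemma frame_uniq H v z I I' : frame H v z I -> frame H v z I' -> I = I'.
Proof.
move=> f; case=> U [A [B [C [y [w [[uU vU EU g] [b Uz]]]]]]].
have [y' [w' [b' Uz']]] := frame_gram f uU vU EU g.
have [Ey Ew] : y = y' /\ w = w' by apply: coords_inj; rewrite -Uz.
by have [_ _ _ _ ->] := b; have [_ _ _ _ ->] := b'; rewrite Ey Ew.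
Qed.

Lemma frame_scl H v z I u : norm1 u -> frame H v z I -> frame H v (u *: z) (scl u I).
Proof.
move=> [Eu uu] [U [A [B [C [y [w [hU [b Uz]]]]]]]]; exists U, A, B, C, (u * y), (u * w).
split=> //; split; first by rewrite -[c]mul1r; apply: basis_scl => //; rewrite uu rmorph1.
rewrite -scalemxAr Uz; apply/colP; apply: I3P; rewrite !mxE /= ?mulr0 ?mulrA //.
Qed.

Lemma ext_conj (U : 'M[int]_3) (z : 'cV[algC]_3) :
  ext algC U *m map_mx (@Num.conj algC) z = map_mx (@Num.conj algC) (ext algC U *m z).
Proof.
apply/colP => i; rewrite !mxE rmorph_sum; apply: eq_bigr => j _.
by rewrite !mxE rmorphM /= rmorph_int.
Qed.

Lemma frame_conj H v z I : frame H v z I -> frame H v (map_mx (@Num.conj algC) z) (conjI I).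
Proof.
move=> [U [A [B [C [y [w [hU [b Uz]]]]]]]]; exists U, A, B, C, y^*, w^*.
split=> //; split; first exact: basis_conj.
rewrite ext_conj Uz; apply/colP; apply: I3P; rewrite !mxE /= ?rmorph0 //.
by rewrite (conjM w) fmorphV rmorph_nat.
Qed.

Lemma frame_orbit H v z I z' I' : frame H v z I -> frame H v z' I' ->
  (exists2 u, norm1 u & z' = u *: z) \/ (exists2 u, norm1 u & z' = u *: map_mx (@Num.conj algC) z).
Proof.
move=> [U [A [B [C [y [w [[uU vU EU g] [b Uz]]]]]]]] f'.
have [y' [w' [b' Uz']]] := frame_gram f' uU vU EU g.
have uUC : ext algC U \in unitmx by apply: unitmx_ext.
have inj (p q : 'cV[algC]_3) : ext algC U *m p = ext algC U *m q -> p = q.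
  by move=> h; rewrite -[p](mulKmx uUC) h mulKmx.
have [[u Eu [Ey Ew]]|[u Eu [Ey Ew]]] := pair_orbit c0 b b'; [left|right]; exists u => //;
  apply: inj.
  rewrite -scalemxAr Uz Uz' Ey Ew; apply/colP; apply: I3P; rewrite !mxE /= ?mulr0 ?mulrA //.
rewrite -scalemxAr ext_conj Uz Uz' Ey Ew; apply/colP; apply: I3P;
  rewrite !mxE /= ?rmorph0 ?mulr0 //.
by rewrite (conjM w) fmorphV rmorph_nat mulrA.
Qed.

Lemma frame_skew H v z I u u' : frame H v z I -> norm1 u -> norm1 u' ->
  u *: z <> u' *: map_mx (@Num.conj algC) z.
Proof.
move=> [U [A [B [C [y [w [_ [b Uz]]]]]]]] [_ uu] [_ uu'] h.
have := congr1 (fun t => ext algC U *m t) h; rewrite -!scalemxAr ext_conj Uz => /colP h'.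
have hy := h' o1; have hw := h' o2; move: hy hw; rewrite !mxE /= => hy hw.
have {}hw : u * w = u' * w^*.
  apply: (mulIf (_ : be%:R^-1 != 0)); first by rewrite invr_eq0.
  by rewrite -mulrA hw (conjM w) fmorphV rmorph_nat mulrA.
have [e ee Ee] := basis_skew b.
have sk : y * w^* - y^* * w = 0.
  have e1 : y * w^* = (u * y) * (u * w)^* by rewrite (conjM u) mulrACA uu mul1r.
  have e2 : y^* * w = (u' * y^*) * (u' * w^*)^* by rewrite (conjM u') conjCK mulrACA uu' mul1r.
  by rewrite e1 e2 hy hw subrr.
move/eqP: Ee; rewrite sk eq_sym; apply/negP; apply: mulf_neq0; last exact: sqrtd_neq0.
by apply: mulf_neq0; [case: ee => ->; rewrite intr_eq0|exact: ratr_neq0].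
Qed.

Lemma diag_pos (x : 'rV[rat]_3) : x != 0 -> 0 < qform (smx3 n%:R a (a * D%:~R) 0 0 0) x.
Proof.
have [x0 [x1 [x2 ->]]] := rv3P x; rewrite qform_rv3 => nz.
have {}nz : [|| x0 != 0, x1 != 0 | x2 != 0].
  apply: contraNT nz; rewrite !negb_or !negbK => /and3P[/eqP -> /eqP -> /eqP ->].
  by apply/eqP/rowP; apply: I3P; rewrite !mxE.
have D0 : 0 < D%:~R :> rat by rewrite ltr0z sqf_gt0.
have nr0 : 0 < n%:R :> rat by rewrite ltr0n.
rewrite (_ : _ + _ = n%:R * x0 ^+ 2 + a * (x1 ^+ 2 + D%:~R * x2 ^+ 2)); last by ring.
have p0 := sqr_ge0 x0; have p1 := sqr_ge0 x1; have p2 := sqr_ge0 x2.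
have q2 : 0 <= D%:~R * x2 ^+ 2 by rewrite mulr_ge0 // ltW.
move: nz => /or3P[] h.
- apply: ltr_pwDl; first by rewrite mulr_gt0 // exprn_even_gt0.
  by rewrite mulr_ge0 ?addr_ge0 // ltW.
- apply: ltr_wpDl; first by rewrite mulr_ge0 // ltW.
  by rewrite mulr_gt0 // ltr_pwDl // exprn_even_gt0.
- apply: ltr_wpDl; first by rewrite mulr_ge0 // ltW.
  by rewrite mulr_gt0 // ltr_wpDl // mulr_gt0 // exprn_even_gt0.
Qed.

Lemma shape_rational_basis H U A B C : genus K H -> U \in unitmx ->
  ext rat (U *m H *m U^T) = glued_gram A B C -> exists x y1 y2 z w1 w2 : rat,
  let R := mx3 1 0 0 x y1 y2 z w1 w2 in R *m smx3 n%:R a (a * D%:~R) 0 0 0 *m R^T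
    = glued_gram A B C.
Proof.
move=> [_ iH _] uU EU; set G := smx3 n%:R _ _ _ _ _.
have sG : G^T = G by rewrite /G tr_mx3.
have [R0 _ ER0] : isometric G (glued_gram A B C).
  apply: isometric_trans (isometric_sym K_diag) (isometric_trans iH _).
  by rewrite -EU; apply: isometric_ext; exists U.
have [|Q [EQ xQ]] := @positive_reflection G (rv3 1 0 0 *m R0) (rv3 1 0 0) sG diag_pos.
  by rewrite -qform_conj ER0 /glued_gram /G !qform_rv3; ring.
have /fix_e0P[x [y1 [y2 [z [w1 [w2 ER]]]]]] : rv3 1 0 0 *m (R0 *m Q) = rv3 1 0 0 by rewrite mulmxA.
exists x, y1, y2, z, w1, w2; rewrite /= -ER.
by rewrite trmx_mul -ER0 -[in RHS]EQ !mulmxA.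
Qed.

Lemma norm_coords (y1 y2 w1 w2 : rat) (A B C : int) :
  let y := ratr y1 + ratr y2 * sqrtND dd in let w := ratr w1 + ratr w2 * sqrtND dd in
  [/\ y * y^* = ratr c * A%:~R, w * w^* = ratr c * C%:~R & y * w^* + y^* * w = ratr c * B%:~R] <->
  [/\ a * (y1 ^+ 2 + D%:~R * y2 ^+ 2) = ga * A%:~R, a * (w1 ^+ 2 + D%:~R * w2 ^+ 2) = ga * C%:~R
    & a * (2 * (y1 * w1 + D%:~R * y2 * w2)) = ga * B%:~R].
Proof.
move=> y w; have an : a != 0 := lt0r_neq0 a0.
have scaled (p : rat) (r : int) : ratr p = ratr c * r%:~R :> algC <-> a * p = ga * r%:~R.
  have -> : ratr c * r%:~R
    = ratr (c * r%:~R) :> algC by rewrite -[in LHS](@ratr_int algC r) -rmorphM.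
  split=> [/ratr_inj ->|h]; first by rewrite /c; field.
  by congr ratr; apply: (mulfI an); rewrite h /c; field.
have -> : y * w^* + y^* * w = ratr (2 * (y1 * w1 + D%:~R * y2 * w2)).
  rewrite /y /w !conj_quadE.
  have := sqrtND_sq dd; have -> : (D%:~R : algC) = ratr D%:~R by rewrite ratr_int.
  by move=> h; ring: h.
by rewrite /y /w !quad_normE; split=> -[Ey Ew Eyw]; split; apply/scaled.
Qed.

Lemma frame_ex H v : genus K H -> fam_vecs H v -> exists z I, frame H v z I.
Proof.
move=> gH [U [A [B [C [uU vU EU g]]]]].
have [x [y1 [y2 [x' [t1 [t2 /= ER]]]]]] := shape_rational_basis gH uU EU.
rewrite /glued_gram tr_mx3 !mul_mx3 in ER.
have [[_ q01 q02] [[_ q11 q12] [_ _ q22]]] := mx3_inj ER.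
have Ex : x = 0 by apply: (mulfI n_neq0); rewrite mulr0 -[RHS]q01; ring.
have Ex' : x' = al by apply: (mulfI n_neq0); rewrite -[RHS]q02; ring.
pose y := ratr y1 + ratr y2 * sqrtND dd;
  pose w := ratr (be%:R * t1) + ratr (be%:R * t2) * sqrtND dd.
pose I := [set z : algC | exists i j : int, z = i%:~R * y + j%:~R * w].
have b : nbasis c I y w A B C.
  split; [exact: quadP|exact: quadP| |by case: g|by []].
  apply/norm_coords; split.
  - by rewrite -q11 Ex; ring.
  - apply: (mulfI (_ : (be%:R ^+ 2)^-1 != 0 :> rat)); first by rewrite invr_eq0 expf_neq0.
    transitivity (n%:R * al ^+ 2 + ga * C%:~R / be%:R ^+ 2 - n%:R * al ^+ 2); last by field;
      rewrite ?be_neq0.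
    by rewrite -q22 Ex'; field; rewrite ?be_neq0.
  - apply: (mulfI (_ : (2 * be%:R)^-1 != 0 :> rat)); first by rewrite invr_eq0 mulf_neq0.
    transitivity (ga * B%:~R / (2 * be%:R)); last by field; rewrite ?be_neq0.
    by rewrite -q12 Ex; field; rewrite ?be_neq0.
have uUC : ext algC U \in unitmx by apply: unitmx_ext.
exists (invmx (ext algC U) *m coords y w), I, U, A, B, C, y, w; split=> //; split=> //.
by rewrite mulKVmx.
Qed.

Lemma shape_genus I y w A B C : nbasis c I y w A B C -> admissible A B C ->
  exists2 H, genus K H & ext rat H = glued_gram A B C.
Proof.
move=> [[y1 [y2 ->]] [w1 [w2 ->]] /norm_coords[qy qw qyw] _ _] gABC.
have [H [EH dH evH]] := shape_integral gABC; exists H => //.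
apply: stable_genus => //; apply: isometric_trans K_diag _.
pose S : 'M[rat]_3 := mx3 1 0 0 0 y1 y2 al (w1 / be%:R) (w2 / be%:R).
have ES : S *m smx3 n%:R a (a * D%:~R) 0 0 0 *m S^T = ext rat H.
  rewrite EH /S /glued_gram tr_mx3 !mul_mx3 -qy -qw -qyw.
  by congr mx3; field; rewrite ?be_neq0.
exists S => //; rewrite unitmxE unitfE.
have := congr1 determinant ES; rewrite !det_mulmx det_tr det_ext dH => hd.
have : (\det K)%:~R != 0 :> rat by rewrite intr_eq0 gt_eqF // lattice_det_gt0 //; case: sK.
by rewrite -hd !mulf_eq0 !negb_or => /andP[/andP[]].
Qed.

Lemma frame_fiber H v z1 I1 J : frame H v z1 I1 ->
  finite_set [set z | frame H v z J] /\ ncard [set z | frame H v z J] =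
  (ncard [set u | norm1 u /\ scl u I1 = J] + ncard [set u | norm1 u /\ scl u (conjI I1) = J])%N.
Proof.
move=> f1; have fI := frame_fid f1; have f2 := frame_conj f1; have fI2 := frame_fid f2.
set z2 := map_mx _ z1 in f2.
have [fin1 _ _] := torsor J fI; have [fin2 _ _] := torsor J fI2.
have [l1 u1 l1P] := finite_enum fin1; have [l2 u2 l2P] := finite_enum fin2.
pose L := [seq u *: z1 | u <- l1] ++ [seq u *: z2 | u <- l2].
have nz z I : frame H v z I -> z != 0.
  move=> [U [A [B [C [y [w [_ [b Uz]]]]]]]]; apply/eqP => z0.
  move: Uz; rewrite z0 mulmx0 => /colP/(_ o1); rewrite !mxE /= => y0.
  by have [] : (1 : int) = 0 /\ (0 : int) = 0 by apply: (basis_uniq c0 b); rewrite -y0; ring.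
have LP z : frame H v z J <-> z \in L.
  rewrite mem_cat; split.
    move=> f; have [[u Eu Ez]|[u Eu Ez]] := frame_orbit f1 f; apply/orP; [left|right];
      apply/mapP; exists u => //.
      by apply/l1P; split=> //; apply: (frame_uniq _ f); rewrite Ez; exact: frame_scl.
    by apply/l2P; split=> //; apply: (frame_uniq _ f); rewrite Ez; exact: frame_scl.
  by move=> /orP[]/mapP[u]; [move=> /l1P|move=> /l2P]; move=> [Eu <-] ->; exact: frame_scl.
have uL : uniq L.
  rewrite cat_uniq !map_inj_uniq ?u1 ?u2 ?andbT /=.
  - apply/hasPn => _ /mapP[u /l2P[Eu _] ->]; apply/negP => /mapP[u' /l1P[Eu' _]] h.
    by apply: (frame_skew f1 Eu' Eu); rewrite h.
  - by move=> p q /eqP; rewrite -subr_eq0 -scalerBl scaler_eq0 (negPf (nz _ _ f2)) orbF subr_eq0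
      => /eqP.
  - by move=> p q /eqP; rewrite -subr_eq0 -scalerBl scaler_eq0 (negPf (nz _ _ f1)) orbF subr_eq0
      => /eqP.
split; first by apply: (sub_finite_set _ (finite_seq L)) => z /LP.
by rewrite (ncard_seq uL LP) size_cat !size_map (ncard_seq u1 l1P) (ncard_seq u2 l2P).
Qed.

Definition frames H J : set ('rV[int]_3 * 'cV[algC]_3) := [set p | frame H p.1 p.2 J].

Lemma fam_vecs_norm H v : fam_vecs H v -> qform H v = n%:Z.
Proof.
move=> [U [A [B [C [_ -> EU _]]]]].
apply: (@intr_inj rat); rewrite -row0E rowE -qform_conj /qform bform_delta.
by have /matrixP/(_ o0 o0) := EU; rewrite [LHS]mxE [RHS]mxE.
Qed.

Lemma finite_fam_vecs H : lattice H -> finite_set (fam_vecs H).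
Proof. by move=> lH; apply: sub_finite_set (finite_vec n%:Z lH) => v /fam_vecs_norm. Qed.

Lemma frames_sum H Js : genus K H -> indep (fid c) equiv1 Js ->
  (\sum_(J <- Js) ncard (frames H J) <= 2 * mu E * ncard (fam_vecs H))%N /\
  (reps (fid c) equiv1 Js ->
    (\sum_(J <- Js) ncard (frames H J))%N = (2 * mu E * ncard (fam_vecs H))%N).
Proof.
move=> gH iJ; have lH := genus_lattice gH.
have [Xs uX XP] := finite_enum (finite_fam_vecs lH).
have ex v : v \in Xs -> exists z I, frame H v z I by move/XP; exact: frame_ex.
have E2 J : ncard (frames H J) = (\sum_(v <- Xs) ncard [set z | frame H v z J])%N.
  have [] := @ncard_fiber _ _ (frames H J) Xs uX.
  - by move=> [v z] /frame_fam_vecs /XP.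
  - by move=> v /ex[z [I f]]; have [] := frame_fiber J f.
  - by [].
under eq_bigr do rewrite E2.
rewrite exchange_big /= (ncard_seq uX XP).
have fiber_sum v : v \in Xs -> (\sum_(J <- Js) ncard [set z | frame H v z J] <= 2 * mu E)%N /\
   (reps (fid c) equiv1 Js -> (\sum_(J <- Js) ncard [set z | frame H v z J])%N = (2 * mu E)%N).
  move=> /ex[z [I f]]; have fI := frame_fid f; have fI2 := fid_conj fI.
  have -> : (\sum_(J <- Js) ncard [set z | frame H v z J]
    = \sum_(J <- Js) ncard [set u | norm1 u /\ scl u I = J] +
      \sum_(J <- Js) ncard [set u | norm1 u /\ scl u (conjI I) = J])%N.
    by rewrite -big_split /=; apply: eq_bigr => J _; have [_ ->] := frame_fiber J f.
  have [b1 t1] := torsor_sum fI iJ; have [b2 t2] := torsor_sum fI2 iJ.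
  split; first by rewrite mul2n -addnn leq_add.
  move=> [_ cov]; rewrite t1 ?t2 ?mul2n ?addnn //; exact: cov.
split.
  rewrite (_ : (2 * mu E * size Xs = \sum_(v <- Xs) 2 * mu E)%N);
    last by rewrite big_const_seq count_predT iter_addn_0.
  by rewrite big_seq [leqRHS]big_seq; apply: leq_sum => v /fiber_sum[].
move=> rJ; rewrite big_seq; under eq_bigr => v vX do rewrite (proj2 (fiber_sum v vX) rJ).
by rewrite -big_seq big_const_seq count_predT iter_addn_0.
Qed.

Section Realizations.
Variables (J : set algC) (y0 w0 : algC) (A B C : int) (gs : seq (int * int * int * int)).
Hypotheses (b : nbasis c J y0 w0 A B C) (trans_gs : gluing_transversal be%:Z
  (admissible_change A B C) gs).
Implicit Types g : (int * int * int * int)%type.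

Definition gluing_y g : algC := let: (i, j, k, l) := g in i%:~R * y0 + j%:~R * w0.
Definition gluing_w g : algC := let: (i, j, k, l) := g in k%:~R * y0 + l%:~R * w0.
Definition gluing_A g := let: (i, j, k, l) := g in bqf A B C i j.
Definition gluing_B g := let: (i, j, k, l) := g in bqfB A B C i j k l.
Definition gluing_C g := let: (i, j, k, l) := g in bqf A B C k l.
Definition gluing_shape g := glued_gram (gluing_A g) (gluing_B g) (gluing_C g).
Definition gluing_coords g := coords (gluing_y g) (gluing_w g).

Lemma basis_gluing g : g \in gs ->
  nbasis c J (gluing_y g) (gluing_w g) (gluing_A g) (gluing_B g) (gluing_C g) /\
  admissible (gluing_A g) (gluing_B g) (gluing_C g).
Proof.
have [_ gsP _ _] := trans_gs.
by case: g => [[[i j] k] l] /gsP[un gg]; split=> //; exact: basis_form_change.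
Qed.

Lemma gluing_ex y w A' B' C' : nbasis c J y w A' B' C' -> admissible A' B' C' -> exists g W,
  [/\ g \in gs, W \in unitmx, e0 *m W = e0, econj W (gluing_shape g) = glued_gram A' B' C'
    & ext algC W *m gluing_coords g = coords y w].
Proof.
move=> b' go; have [_ gsP _ cover] := trans_gs.
have [i [j [k [l [un _ Ew [EA EB EC]]]]]] := basis_two c0 b b'.
have := cover i j k l un;
  rewrite /admissible_change -EA -EB -EC => /(_ go)[i' [j' [k' [l' [gg dv]]]]].
pose g := (i', j', k', l'); have [bb _] := basis_gluing gg; have [un' _] := gsP _ _ _ _ gg.
have [r1 [r2 [r3 [r4 [unr Eyr Ewr [EAr EBr ECr]]]]]] := basis_two c0 bb b'.
(* the transition matrix from g to (i, j, k, l) has lower left entry +-(k l' - l k') *)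
have dr3 : (be%:Z %| r3)%Z.
  have rel : (k - (r3 * i' + r4 * k'))%:~R * y0 + (l - (r3 * j' + r4 * l'))%:~R * w0 = 0.
    transitivity ((k%:~R * y0 + l%:~R * w0) -
      (r3%:~R * (i'%:~R * y0 + j'%:~R * w0) + r4%:~R * (k'%:~R * y0 + l'%:~R * w0))); first by ring.
    by rewrite -Ew Ewr subrr.
  have [s1 s2] := basis_uniq c0 b rel.
  have Ek : k = r3 * i' + r4 * k' by apply/eqP; rewrite -subr_eq0 s1.
  have El : l = r3 * j' + r4 * l' by apply/eqP; rewrite -subr_eq0 s2.
  have : (be%:Z %| (i' * l' - j' * k') * r3)%Z.
    have -> : (i' * l' - j' * k') * r3 = - (k' * l - l' * k) by rewrite Ek El; ring.
    by rewrite rpredN.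
  by case: un' => ->; rewrite ?mul1r ?mulN1r ?rpredN.
have [W [uW e0W EW WT]] := shape_change_ex (gluing_A g) (gluing_B g) (gluing_C g) unr dr3.
by exists g, W; split=> //; [rewrite EW -EAr -EBr -ECr|rewrite /gluing_coords WT -Eyr -Ewr].
Qed.

Lemma gluing_change_eq g g' (k l : int) : g \in gs -> g' \in gs ->
  (be%:Z * k)%:~R * gluing_y g + l%:~R * gluing_w g = gluing_w g' -> g = g'.
Proof.
have [_ _ sep _] := trans_gs.
case: g => [[[gi gj] gk] gl]; case: g' => [[[gi' gj'] gk'] gl'] gin gin' /= Ew.
apply: sep => //.
have rel : (be%:Z * k * gi + l * gk - gk')%:~R * y0 + (be%:Z * k * gj + l * gl - gl')%:~R * w0 = 0.
  transitivity ((be%:Z * k)%:~R * (gi%:~R * y0 + gj%:~R * w0)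
    + l%:~R * (gk%:~R * y0 + gl%:~R * w0) -
    (gk'%:~R * y0 + gl'%:~R * w0)); first by ring.
  by rewrite Ew subrr.
have [s1 s2] := basis_uniq c0 b rel.
have -> : gk' = be%:Z * k * gi + l * gk by apply/esym/eqP; rewrite -subr_eq0 s1.
have -> : gl' = be%:Z * k * gj + l * gl by apply/esym/eqP; rewrite -subr_eq0 s2.
by apply/dvdzP; exists (k * (gk * gj - gl * gi)); ring.
Qed.

Lemma gluing_rigid Z g g' : g \in gs -> g' \in gs -> Z \in unitmx -> e0 *m Z = e0 ->
  econj Z (gluing_shape g) = gluing_shape g' -> ext algC Z *m gluing_coords g = gluing_coords g' ->
  g = g' /\ Z = 1%:M.
Proof.
move=> gin gin' uZ e0Z EZ; have [bb go] := basis_gluing gin; have [_ go'] := basis_gluing gin'.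
have [x [i [j [t [k [l [-> Ex Et _ _]]]]]]] := shape_change uZ e0Z EZ go go'.
rewrite shape_change_coords => /coords_inj[Ey Ew].
have Egg := gluing_change_eq gin gin' Ew; split=> //; rewrite -Egg in Ey Ew.
have [i1 j0] : i - 1 = 0 /\ j = 0.
  by apply: (basis_uniq c0 bb); rewrite rmorphB /= mulrBl mul1r addrAC Ey subrr.
have [k0 l1] : be%:Z * k = 0 /\ l - 1 = 0.
  by apply: (basis_uniq c0 bb); rewrite rmorphB /= mulrBl mul1r addrA Ew subrr.
have {}i1 : i = 1 by apply/eqP; rewrite -subr_eq0 i1.
have {}l1 : l = 1 by apply/eqP; rewrite -subr_eq0 l1.
have {}k0 : k = 0 by apply/eqP; move/eqP: k0; rewrite mulf_eq0 eqz_nat gtn_eqF.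
have x0 : x = 0 by apply: (@intr_inj rat); rewrite Ex j0 !mulr0.
have t0 : t = 0 by apply: (@intr_inj rat); rewrite Et l1 subrr mulr0.
by rewrite i1 j0 k0 l1 x0 t0 mulr0 mx3_1.
Qed.

Variables (Hs : seq 'M[int]_3) (base : int * int * int * int -> 'M[int]_3)
  (latt : int * int * int * int -> 'M[int]_3).
Hypothesis repHs : class_reps K Hs.
Hypothesis baseP : forall g, g \in gs ->
  [/\ base g \in unitmx, latt g \in Hs & ext rat (latt g) = econj (base g) (gluing_shape g)].

Definition glued g (V : 'M[int]_3) : 'rV[int]_3 * 'cV[algC]_3 :=
  (e0 *m invmx (V *m base g), ext algC (V *m base g) *m gluing_coords g).

Lemma glued_base g V : g \in gs -> Defs.ortho (latt g) V ->
  V *m base g \in unitmx /\ ext rat (latt g) = econj (V *m base g) (gluing_shape g).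
Proof.
move=> gg [uV EV]; have [uVg _ EVg] := baseP gg.
by rewrite unitmx_mul uV econjM -EVg econj_ext EV.
Qed.

Lemma glued_frame g V : g \in gs -> Defs.ortho (latt g) V -> frames (latt g) J (glued g V).
Proof.
move=> gg oV; have [uW EW] := glued_base gg oV; have [bb go] := basis_gluing gg.
exists (invmx (V *m base g)), (gluing_A g), (gluing_B g), (gluing_C g), (gluing_y g), (gluing_w g).
split; first by split; rewrite ?unitmx_inv // -econj_ext EW econjK.
by split=> //; rewrite /glued /= ext_mulc mulVmx // ext1 mul1mx.
Qed.

Lemma glued_surj H p : H \in Hs -> frames H J p -> exists g V,
  [/\ g \in gs, latt g = H, Defs.ortho H V & p = glued g V].
Proof.
case: p => v z HH [U [A' [B' [C' [y [w [[uU /= vU EU go] [b' /= Uz]]]]]]]].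
have [g [W [gg uW e0W EW WT]]] := gluing_ex b' go.
have [uVg HHg EVg] := baseP gg.
pose V := invmx U *m W *m invmx (base g).
have VV : V *m base g = invmx U *m W by rewrite mulmxKV.
have uV : V \in unitmx by rewrite !unitmx_mul !unitmx_inv uU uW.
have EV : V *m latt g *m V^T = H.
  by apply: ext_inj; rewrite -econj_ext EVg -econjM VV econjM EW -EU -econj_ext econjK.
have EHg : latt g = H by have [[_ _ Heq] _] := repHs; apply: Heq => //; exists V.
exists g, V; split=> //; first by split; rewrite // -{1}EHg.
rewrite /glued VV; congr pair.
  have -> : invmx (invmx U *m W) = invmx W *m U.
    apply: (can_inj (mulmxK (_ : invmx U *m W \in unitmx))).
      by rewrite unitmx_mul unitmx_inv uU.
    by rewrite mulVmx ?unitmx_mul ?unitmx_inv ?uU // mulmxA mulmxK // mulVmx.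
  by rewrite mulmxA -{1}e0W mulmxK.
by rewrite -ext_mulc WT -Uz ext_mulc mulVmx // ext1 mul1mx.
Qed.

Lemma glued_inj g V g' V' : g \in gs -> g' \in gs -> latt g = latt g' ->
  Defs.ortho (latt g) V -> Defs.ortho (latt g) V' -> glued g V = glued g' V' -> g = g' /\ V = V'.
Proof.
move=> gg gg' EH oV; rewrite EH => oV' [Ev Ez].
have [uW EW] := glued_base gg oV; have [uW' EW'] := glued_base gg' oV'.
pose Z := invmx (V' *m base g') *m (V *m base g).
have uZ : Z \in unitmx by rewrite unitmx_mul unitmx_inv uW'.
have e0Z : e0 *m Z = e0 by rewrite mulmxA -Ev mulmxKV.
have EZ : econj Z (gluing_shape g) = gluing_shape g' by rewrite econjM -EW EH EW' econjK.
have ZT : ext algC Z *m gluing_coords g = gluing_coords g'.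
  have := congr1 (fun M => ext algC (invmx (V' *m base g')) *m M) Ez.
  by rewrite !ext_mulc mulVmx // -/Z ext1 mul1mx.
have [Egg Z1] := gluing_rigid gg gg' uZ e0Z EZ ZT; split=> //.
have WW : V *m base g = V' *m base g' by rewrite -[LHS](mulKVmx uW') -/Z Z1 mulmx1.
have [uVg _ _] := baseP gg.
by rewrite -(mulmxK uVg V) WW -Egg mulmxK.
Qed.

Lemma ncard_frames H : H \in Hs ->
  ncard (frames H J) = (count (fun g => latt g == H) gs * ncard (Defs.ortho H))%N.
Proof.
move=> HH; have [[_ HP _] _] := repHs; have [ugs _ _ _] := trans_gs.
have [os uo oP] := finite_enum (finite_ortho (genus_lattice (HP H HH))).
pose gH := [seq g <- gs | latt g == H].
have gHP g : g \in gH -> g \in gs /\ latt g = H by rewrite mem_filter => /andP[/eqP].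
have LP p : frames H J p <-> p \in [seq glued g V | g <- gH, V <- os].
  split=> [/(glued_surj HH)[g [V [gg EH oV ->]]]|/allpairsP[[g V] /= [/gHP[gg EH] /oP oV ->]]].
    by apply/allpairsP; exists (g, V); split; rewrite //= ?mem_filter ?EH ?eqxx //; apply/oP.
  by rewrite -EH in oV *; apply: glued_frame.
have uL : uniq [seq glued g V | g <- gH, V <- os].
  apply: allpairs_uniq => //; first exact: filter_uniq.
  move=> _ _ /allpairsP[[g V] /= [/gHP[gg EH] /oP oV ->]]
    /allpairsP[[g' V'] /= [/gHP[gg' EH'] /oP oV' ->]] /=.
  by move=> e; have [|||-> ->] := glued_inj gg gg' _ _ _ e; rewrite ?EH ?EH'.
by rewrite (ncard_seq uL LP) size_allpairs size_filter (ncard_seq uo oP).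
Qed.

End Realizations.

Lemma ncard_ortho_neq0 G : lattice G -> (ncard (Defs.ortho G))%:R != 0 :> rat.
Proof.
move=> lG; have [os uo oP] := finite_enum (finite_ortho lG).
rewrite (ncard_seq uo oP) pnatr_eq0 size_eq0; apply/eqP => os0.
have : 1%:M \in os by apply/oP; split; rewrite ?unitmx1 // mul1mx trmx1 mulmx1.
by rewrite os0.
Qed.

Lemma frames_class J (Hs : seq 'M[int]_3) : fid c J -> class_reps K Hs ->
  \sum_(H <- Hs) ((ncard (frames H J))%:R / (ncard (Defs.ortho H))%:R : rat) = kk%:R.
Proof.
move=> fJ rH; have [[uH HP _] Hcov] := rH; have [y0 [w0 [A [B [C b]]]]] := fid_basis fJ.
have [|gs trans_gs <-] := @transversal_ex A B C; first by exists J, y0, w0.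
have /choice[f fP] : forall g, exists p : 'M[int]_3 * 'M[int]_3, g \in gs ->
    [/\ p.1 \in unitmx, p.2 \in Hs & ext rat p.2 = econj p.1 (gluing_shape A B C g)].
  move=> g; have [gg|_] := boolP (g \in gs); last by exists (0, 0).
  have [bb go] := basis_gluing b trans_gs gg; have [H0 gH0 EH0] := shape_genus bb go.
  have [H' HH' [W uW EW]] := Hcov H0 gH0; exists (W, H'); split=> //=.
  by rewrite /gluing_shape -EH0 econj_ext EW.
pose base g := (f g).1; pose latt g := (f g).2.
rewrite -sum1_size natr_sum [RHS]big_seq (eq_bigr (fun g => \sum_(H <- Hs) (latt g == H)%:R));
  last first.
  move=> g /fP[_ HHg _].
  by rewrite (bigD1_seq (latt g)) //= eqxx big1 ?addr0 // => H; rewrite eq_sym => /negPf ->.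
rewrite -big_seq exchange_big /= big_seq [RHS]big_seq; apply: eq_bigr => H HH.
rewrite (ncard_frames b trans_gs rH (base := base) (latt := latt) fP HH) natrM.
rewrite mulfK; last exact: ncard_ortho_neq0 (genus_lattice (HP H HH)).
by elim: (gs) => [|g s IH]; rewrite ?big_nil // big_cons /= natrD IH.
Qed.

Lemma frames_double_sum (Hs : seq 'M[int]_3) Js : class_reps K Hs ->
  indep (fid c) equiv1 Js ->
  \sum_(H <- Hs) ((\sum_(J <- Js) ncard (frames H J))%N%:R / (ncard (Defs.ortho H))%:R : rat) =
  (kk * size Js)%:R.
Proof.
move=> rH [_ JP _]; under eq_bigr do rewrite natr_sum mulr_suml.
rewrite exchange_big /=; transitivity (\sum_(J <- Js) (kk%:R : rat)).
  by apply: eq_big_seq => J JJ; apply: frames_class => //; exact: JP.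
by rewrite big_const_seq count_predT iter_addr_0 natrM mulr_natr.
Qed.

Lemma norm_class_reps (Hs : seq 'M[int]_3) : (0 < kk)%N ->
  class_reps K Hs -> exists Js, reps (fid c) equiv1 Js.
Proof.
move=> k0 rH; have [[_ HP _] _] := rH.
apply: (@reps_bound _ _ _ _ _ (\sum_(H <- Hs) 2 * mu E * ncard (fam_vecs H))%N).
- by move=> I _; exact: equiv1_refl.
- by move=> I J _ _; exact: equiv1_sym.
move=> Js iJ; apply: (@leq_trans (kk * size Js)%N); first by rewrite leq_pmull.
rewrite -(ler_nat rat) -(frames_double_sum rH iJ) natr_sum big_seq [leRHS]big_seq.
apply: ler_sum => H HH; have [b1 _] := frames_sum (HP H HH) iJ.
apply: (@le_trans _ _ ((\sum_(J <- Js) ncard (frames H J))%N%:R)); last by rewrite ler_nat.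
have o0 := ncard_ortho_neq0 (genus_lattice (HP H HH)); rewrite pnatr_eq0 in o0.
by rewrite ler_pdivrMr ?ltr0n ?lt0n // ler_peMr // ler1n lt0n.
Qed.

Theorem family_sum (Hs : seq 'M[int]_3) : (0 < kk)%N -> (exists J, fid c J) ->
  class_reps K Hs ->
  genus_total Hs fam_vecs = class_value dd kk.
Proof.
rewrite /genus_total /class_value =>  k0 [J0 fJ0] rH; have [[_ HP _] _] := rH.
have [Js rJ] := norm_class_reps k0 rH; have iJ := rJ.1.
have m0 : (mu E)%:R != 0 :> rat.
  have [s us sP] := finite_enum (finite_roots dd).
  rewrite /mu (ncard_seq us sP) pnatr_eq0 size_eq0; apply/eqP => s0.
  have : 1 \in s by apply/sP; split; [exact: (quad_int dd 1)|exists 1%N].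
  by rewrite s0.
have weighted : 2 * (mu E)%:R *
  (\sum_(H <- Hs) ((ncard (fam_vecs H))%:R / (ncard (Defs.ortho H))%:R)) =
    (kk * size Js)%:R :> rat.
  rewrite -(frames_double_sum rH iJ) mulr_sumr big_seq [RHS]big_seq; apply: eq_bigr => H HH.
  have [_ ->] := frames_sum (HP H HH) iJ => //.
  by rewrite !natrM !mulrA.
have nu0 : (0 < nu (ram dd))%N.
  rewrite /nu -has_predT; apply/hasP; exists (pdiv (gen_ram dd)) => //.
  by rewrite mem_primes p0_prime ram_gt0 p0_ram.
rewrite (class_count fJ0 rJ); apply: (mulfI (_ : 2 * (mu E)%:R != 0 :> rat));
  first by rewrite mulf_neq0.
rewrite weighted !natrM natrX -[nu _]prednK // exprS; field.
by rewrite m0 expf_neq0.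
Qed.

End Family.

End Bases.

(** * The families of vectors of norm m and 2m *)

Lemma bqf_swap A B C k l : bqf C B A l k = bqf A B C k l.
Proof. by rewrite /bqf; ring. Qed.

Lemma bqf_shear A B C k l : bqf A (B + 2 * A) (A + B + C) (k - l) l = bqf A B C k l.
Proof. by rewrite /bqf; ring. Qed.

Section Glue.
Variables (be : int) (q : int -> Prop).

Definition glue_rep (A B C : int) (o : option int) :=
  if o is Some t then q (bqf A B C (2 * t) 1) /\ (forall k l, (2 %| k)%Z -> ~~ (2 %| l)%Z ->
    q (bqf A B C k l) -> (be %| 2 * t * l - k)%Z)
  else forall k l, (2 %| k)%Z -> ~~ (2 %| l)%Z -> ~ q (bqf A B C k l).

Variables (A B C : int) (dd : sqf).

Definition gluing (sz : nat) := exists2 gs,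
  gluing_transversal be (admissible_change dd (fun _ _ C => q C) A B C) gs & size gs = sz.

Definition option_seq (g : int -> int * int * int * int) (o : option int) :=
  if o is Some t then [:: g t] else [::].

Variables r0 r1 r2 : option int.

Definition glue_seq : seq (int * int * int * int) :=
  option_seq (fun t => (1, 0, 2 * t, 1)) r0 ++ option_seq (fun t => (0, 1, 1, 2 * t)) r1 ++
  option_seq (fun t => (1, 0, 1 + 2 * t, 1)) r2.

(* The swap and the shear carry the vectors (odd, even) and (odd, odd) to (even, odd). *)
Hypotheses (r0P : glue_rep A B C r0) (r1P : glue_rep C B A r1).
Hypothesis r2P : glue_rep A (B + 2 * A) (A + B + C) r2.

Lemma glue_seq_admissible i j k l : B ^+ 2 - 4 * A * C = disc dd -> (i, j, k, l) \in glue_seq ->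
  unimod i j k l /\ admissible_change dd (fun _ _ C => q C) A B C i j k l.
Proof.
move=> dABC; suff: (i, j, k, l) \in glue_seq -> unimod i j k l /\ q (bqf A B C k l).
  by move=> h /h[u qkl]; split=> //; split=> //; rewrite form_change_disc.
rewrite !mem_cat => /or3P[].
- case: (r0) r0P => [t [qt _]|//]; rewrite inE => /eqP[-> -> -> ->].
  by split=> //; left; ring.
- case: (r1) r1P => [t [qt _]|//]; rewrite inE => /eqP[-> -> -> ->].
  by rewrite -bqf_swap; split=> //; right; ring.
- case: (r2) r2P => [t [qt _]|//]; rewrite inE => /eqP[-> -> -> ->].
  by rewrite -bqf_shear [1 + _ - 1]addrAC subrr add0r; split=> //; left; ring.
Qed.

Lemma glue_seq_sep i j k l i' j' k' l' : (i, j, k, l) \in glue_seq ->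
  (i', j', k', l') \in glue_seq -> (2 %| k * l' - l * k')%Z -> (i, j, k, l) = (i', j', k', l').
Proof.
rewrite !mem_cat => h h'; case/or3P: h => h; case/or3P: h' => h'; move: h h';
  case: (r0) => [t0|]; case: (r1) => [t1|]; case: (r2) => [t2|] //;
  rewrite !inE => /eqP[-> -> -> ->] /eqP[-> -> -> ->] //; clear; nia.
Qed.

Lemma glue_seq_cover i j k l : unimod i j k l -> q (bqf A B C k l) ->
  exists i' j' k' l', (i', j', k', l') \in glue_seq /\ (be %| k' * l - l' * k)%Z.
Proof.
move=> u qk; have kl2 : ~~ ((2 %| k)%Z && (2 %| l)%Z).
  apply/negP => /andP[k2 l2]; have : (2 %| i * l - j * k)%Z by rewrite rpredB // dvdz_mull.
  by case: u => ->.
have in_option g o t : o = Some t -> g t \in option_seq g o by move=> ->; rewrite inE.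
have [k2|k2] := boolP (2 %| k)%Z.
  have l2 : ~~ (2 %| l)%Z by move: kl2; rewrite k2.
  move: r0P; case Eo : {1}r0 => [t|] => [[_ rep]|no_rep]; last by case: (no_rep k l).
  exists 1, 0, (2 * t), 1; rewrite mem_cat (in_option _ _ _ Eo) mul1r; split=> //.
  exact: rep.
have [l2|l2] := boolP (2 %| l)%Z.
  move: r1P; case Eo : {1}r1 => [t|] => [[_ rep]|no_rep]; last by case: (no_rep l k l2 k2);
    rewrite bqf_swap.
  exists 0, 1, 1, (2 * t); rewrite !mem_cat (in_option _ _ _ Eo) orbT mul1r; split=> //.
  by rewrite -rpredN opprB; apply: rep => //; rewrite bqf_swap.
have k_l2 : (2 %| k - l)%Z by clear -k2 l2; lia.
move: r2P; case Eo : {1}r2 => [t|] => [[_ rep]|no_rep]; last by case: (no_rep (k - l) l k_l2 l2);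
  rewrite bqf_shear.
exists 1, 0, (1 + 2 * t), 1; rewrite !mem_cat (in_option _ _ _ Eo) !orbT; split=> //.
rewrite (_ : _ - _ = 2 * t * l - (k - l)); last by ring.
by apply: rep => //; rewrite bqf_shear.
Qed.

Lemma gluing_glue_seq : (2 %| be)%Z -> B ^+ 2 - 4 * A * C = disc dd ->
  gluing (isSome r0 + isSome r1 + isSome r2)%N.
Proof.
move=> be2 dABC; exists glue_seq; last first.
  by rewrite !size_cat addnA; case: (r0); case: (r1); case: (r2).
split.
- rewrite /glue_seq; case: (r0) => [t0|]; case: (r1) => [t1|]; case: (r2) => [t2|];
    rewrite /= ?inE ?andbT // !xpair_eqE /= ?andbF //; clear; lia.
- by move=> i j k l; apply: glue_seq_admissible.
- by move=> i j k l i' j' k' l' h h' d; apply: glue_seq_sep h h' (dvdz_trans be2 d).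
- by move=> i j k l u [qk _]; apply: glue_seq_cover u qk.
Qed.

End Glue.

Definition glue_parity_rep (s : bool) (z : int) : option int :=
  if (2 %| z)%Z == s then Some 0 else None.

Lemma glue_parity_repP q (s : bool) A B C : (forall z, q z -> (2 %| z)%Z = s) ->
  ((2 %| C)%Z = s -> q C) -> glue_rep 2 q A B C (glue_parity_rep s C).
Proof.
move=> qs sC; rewrite /glue_parity_rep; case: eqP => [Cs|nCs].
  split=> [|k l k2 _ _]; last by rewrite mulr0 mul0r sub0r rpredN.
  by rewrite (_ : bqf _ _ _ _ _ = C); [exact: sC|rewrite /bqf; ring].
move=> _ _ /evenE[k ->] /oddE[l ->]; rewrite /bqf => /qs Es; apply: nCs; rewrite -Es.
rewrite (_ : _ + _ = C + 2 * (2 * A * k ^+ 2 + B * k * (2 * l + 1) + C * (2 * l ^+ 2 + 2 * l)));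
  last by ring.
by move: (_ + C * _) => z; clear; lia.
Qed.

Lemma glue_parity q (A B C : int) dd (s : bool) : (forall z, q z -> (2 %| z)%Z = s) ->
  (forall i j k l, unimod i j k l -> (2 %| bqf A B C k l)%Z = s -> q (bqf A B C k l)) ->
  B ^+ 2 - 4 * A * C = disc dd ->
  gluing 2 q A B C dd (((2 %| C)%Z == s) + ((2 %| A)%Z == s) + ((2 %| A + B + C)%Z == s)).
Proof.
move=> qs sq dABC.
have value i j k l z : unimod i j k l -> bqf A B C k l = z -> (2 %| z)%Z = s -> q z.
  by move=> u <-; exact: sq u.
have rep_some z : isSome (glue_parity_rep s z) = ((2 %| z)%Z == s).
  by rewrite /glue_parity_rep; case: (_ == _).
rewrite -!rep_some; apply: gluing_glue_seq => //; apply: glue_parity_repP => //.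
- by apply: (value 1 0 0 1); [left; ring|rewrite /bqf; ring].
- by apply: (value 0 1 1 0); [right; ring|rewrite /bqf; ring].
- by apply: (value 1 0 1 1); [left; ring|rewrite /bqf; ring].
Qed.

(* When the middle coefficient is odd the three classes modulo 2 split modulo 4. *)
Section ClassesOdd.
Variable m : int.
Hypothesis m_odd : ~~ (2 %| m)%Z.
Local Notation q := (fun z : int => ((z + m) %% 4)%Z = 0).

Definition shift4 (z : int) : int := if ((z + m) %% 4)%Z == 0 then 0 else 1.
Definition glue_shift (z : int) := if (2 %| z)%Z then None else Some (shift4 z).

Lemma shift4P z : ~~ (2 %| z)%Z -> ((z + 2 * shift4 z + m) %% 4)%Z = 0.
Proof. by rewrite /shift4; case: eqP => h o; clear -h m_odd o; lia. Qed.

Lemma shift4_even z k : ~~ (2 %| z)%Z -> ((z + 2 * k + m) %% 4)%Z = 0 ->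
  exists s, k = shift4 z - 2 * s.
Proof.
move=> /shift4P; move: (shift4 z) => t h1 h2; exists ((t - k) %/ 2)%Z.
by clear -h1 h2; lia.
Qed.

Lemma bqf_odd_mod4 A b C k l : ~~ (2 %| l)%Z ->
  exists z, bqf A (2 * b + 1) C (2 * k) l = C + 2 * k + 4 * z.
Proof.
move=> /oddE[l' ->]; exists (A * k ^+ 2 + k * (2 * b * l' + b + l') + C * (l' ^+ 2 + l')).
by rewrite /bqf; ring.
Qed.

Lemma glue_shiftP A b C : glue_rep 4 q A (2 * b + 1) C (glue_shift C).
Proof.
rewrite /glue_shift; case: ifP => [C2 _ l /evenE[k ->] hl|/negbT oC].
  by have [z ->] := bqf_odd_mod4 A b C k hl; clear -C2 m_odd; lia.
split=> /= [|_ l /evenE[k ->] hl].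
  have [//|z ->] := @bqf_odd_mod4 A b C (shift4 C) 1.
  by have := shift4P oC; move: (shift4 C); clear; lia.
have [z ->] := bqf_odd_mod4 A b C k hl; have [l' El] := oddE hl => Q.
have [|s ->] := @shift4_even C k oC; first by move: Q; clear; lia.
by apply/dvdzP; exists (s + l' * shift4 C); rewrite El; ring.
Qed.

Lemma glue_odd (A b C : int) dd : (2 * b + 1) ^+ 2 - 4 * A * C = disc dd ->
  gluing 4 q A (2 * b + 1) C dd (~~ (2 %| C)%Z + ~~ (2 %| A)%Z
    + ~~ (2 %| (A + (2 * b + 1) + C)%R)%Z).
Proof.
have shift_some z : isSome (glue_shift z) = ~~ (2 %| z)%Z by rewrite /glue_shift; case: ifP.
rewrite -!shift_some; apply: gluing_glue_seq => //; [exact: glue_shiftP|exact: glue_shiftP|].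
by rewrite (_ : 2 * b + 1 + 2 * A = 2 * (b + A) + 1); [exact: glue_shiftP|ring].
Qed.

End ClassesOdd.

Section Instances.
Variables (K : 'M[int]_3) (dd : sqf) (n : nat) (a : rat) (Hs : seq 'M[int]_3).
Local Notation D := (sqf_val dd).
Local Notation E := (quad_field (- D)).
Local Notation split_family ga := (fam_vecs dd n 1 0 ga (fun _ _ _ => True)).
Local Notation odd_family := (fam_vecs dd n 2 0 4 (fun _ _ C => ~~ (2 %| C)%Z)).
Local Notation half_family2 := (fam_vecs dd n 2 (1 / 2) 1 (fun _ _ C => (2 %| C)%Z)).
Local Notation half_family be ga m :=
  (fam_vecs dd n be (1 / 2) ga (fun _ _ C => ((C + m) %% 4)%Z = 0)).
Hypotheses (sK : stable K) (n0 : (0 < n)%N) (a0 : 0 < a).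
Hypothesis K_diag : rational_split dd K n a.
Hypothesis rH : class_reps K Hs.

Lemma disc_odd : (D %% 4)%Z = 3 -> disc dd = - D.
Proof. by rewrite /disc /qpar => ->. Qed.

Lemma disc_even : (D %% 4)%Z <> 3 -> disc dd = - (4 * D).
Proof. by rewrite /disc /qpar => /eqP/negPf ->. Qed.

Lemma even_disc (A B C : int) : (D %% 4)%Z <> 3 -> B ^+ 2 - 4 * A * C = disc dd ->
  exists b, B = 2 * b /\ b ^+ 2 - A * C = - D.
Proof.
move=> D3; rewrite disc_even // => d; have /evenE[b Eb] : (2 %| B)%Z.
  have : (2 %| B * B)%Z; last by rewrite dvd2M orbb.
  rewrite (_ : B * B = 2 * (2 * (A * C) - 2 * D)) ?dvdz_mulr //.
  by transitivity (B ^+ 2 - 4 * A * C + 4 * A * C); [ring|rewrite d; ring].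
exists b; split=> //; apply: (mulfI (_ : (4 : int) != 0)) => //.
by transitivity (B ^+ 2 - 4 * A * C); [rewrite Eb; ring|rewrite d; ring].
Qed.

Lemma split_total (ga : rat) : 0 < ga -> (exists J, fid dd (ga / a) J) ->
  (forall A B C, B ^+ 2 - 4 * A * C = disc dd -> exists H : 'M[int]_3,
     [/\ ext rat H = glued_gram n 1 0 ga A B C, \det H = \det K & even_lattice K ->
       even_lattice H]) ->
  genus_total Hs (split_family ga) = class_value dd 1%N.
Proof.
move=> ga0 exJ shape_ex; apply: (family_sum (a := a) (K := K)) => //.
- by move=> A B C [_ d]; exact: shape_ex.
- by exists 0; rewrite mul0r.
- by move=> l _; exists 0; rewrite mul0r.
- by left.
move=> A B C [_ [_ [_ [_ _ _ d _]]]]; exists [:: (1, 0, 0, 1)] => //; split=> //.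
- move=> i j k l; rewrite inE => /eqP[-> -> -> ->]; split; first by left; ring.
  by split=> //; rewrite /bqf /bqfB -d; ring.
- by move=> i j k l i' j' k' l'; rewrite !inE => /eqP -> /eqP ->.
- by move=> i j k l _ _; exists 1, 0, 0, 1; rewrite inE eqxx; split=> //; rewrite dvd1z.
Qed.

Lemma half_odd (l : int) : ~~ (2 %| l)%Z -> exists t : int, 1 / 2 * (1 - l%:~R) = t%:~R :> rat.
Proof. by case/oddE => c ->; exists (- c); field. Qed.

Lemma half_int (j : int) : (exists t : int, 1 / 2 * j%:~R = t%:~R :> rat) -> (2 %| j)%Z.
Proof.
move=> [t Et]; apply/dvdzP; exists t; apply: (@intr_inj rat); rewrite rmorphM /= -Et.
by field.
Qed.

Lemma glue_quarter (A B C A' i j : int) : ~~ (2 %| C)%Z ->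
  A'%:~R = A%:~R * i%:~R ^+ 2 + B%:~R * i%:~R * j%:~R / 2 + C%:~R * j%:~R ^+ 2 / 4 :> rat ->
    (2 %| j)%Z.
Proof.
move=> oC E1; have Ez : 4 * A' = 4 * A * i ^+ 2 + 2 * B * i * j + C * j ^+ 2.
  apply: (@intr_inj rat); transitivity (4 * A'%:~R : rat); first by ring.
  by rewrite E1; field.
have : (2 %| C * (j * j))%Z.
  have -> : C * (j * j) = 2 * (2 * A' - 2 * A * i ^+ 2 - B * i * j).
    transitivity (C * j ^+ 2); first by ring.
    by rewrite (_ : C * j ^+ 2 = 4 * A' - (4 * A * i ^+ 2 + 2 * B * i * j));
      [ring|rewrite Ez; ring].
  by rewrite dvdz_mulr.
by rewrite !dvd2M (negPf oC) orbb.
Qed.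

Lemma odd_disc (A B C : int) : (D %% 4)%Z = 3 -> B ^+ 2 - 4 * A * C = disc dd ->
  ~~ (2 %| B)%Z /\ ((2 %| A * C)%Z = ((D %% 8)%Z == 7)).
Proof.
move=> D3; rewrite disc_odd // => d.
have oB : ~~ (2 %| B)%Z.
  apply/negP => /evenE[b Eb]; move: d; rewrite Eb.
  have -> : (2 * b) ^+ 2 - 4 * A * C = 4 * (b ^+ 2 - A * C) by ring.
  by move: (b ^+ 2 - A * C) => z; clear -D3; lia.
split=> //; have [t Et] := sq_mod8 oB; move: d; rewrite Et -mulrA; move: (A * C) => z d.
by apply/idP/eqP; clear -d D3; lia.
Qed.

Lemma odd_family_total (m : int) : n%:R = m%:~R :> rat -> (D %% 4)%Z = 3 -> ~ even_lattice K ->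
  \det K = m * D -> (exists J, fid dd (4 / a) J) ->
  genus_total Hs odd_family = class_value dd (if (D %% 8)%Z == 7 then 1%N else 3%N).
Proof.
move=> nm D3 oK dK exJ; apply: (family_sum (a := a) (K := K)) => //; last by case: ifP.
- move=> A B C [oC]; rewrite disc_odd // => d; exists (smx3 m (4 * A) C 0 0 B); split=> //.
  + by rewrite ext_smx3 /glued_gram nm; congr mx3; rewrite ?rmorphM /=; field.
  + rewrite dK; have -> : D = 4 * A * C - B ^+ 2 by rewrite -[D]opprK -d; ring.
    by rewrite det_mx3; ring.
- move=> A B C A' _ _ i j [oC _] _ EA _;
    apply: (glue_quarter oC (A' := A') (A := A) (B := B) (i := i)).
  by rewrite EA; field.
- by exists 0; rewrite mul0r.
- by move=> l _; exists 0; rewrite mul0r.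
- by right.
move=> A B C [_ [_ [_ [_ _ _ d _]]]]; have [oB AC] := odd_disc D3 d.
have [||gs tgs sz] := @glue_parity (fun C => ~~ (2 %| C)%Z) A B C dd false _ _ d.
- by move=> z /negPf.
- by move=> i j k l _ ->.
exists gs => //; rewrite sz -AC dvd2M.
have S2 : (2 %| A + B + C)%Z = ((2 %| A)%Z != (2 %| C)%Z) by clear -oB; lia.
by rewrite S2; case: (2 %| A)%Z; case: (2 %| C)%Z.
Qed.

Lemma half_family2_total (m : int) : n%:R = (2 * m)%:~R :> rat -> ~~ (2 %| m)%Z ->
  (D %% 4)%Z = 2 -> ~ even_lattice K ->
  2 * \det K = m * D -> (exists J, fid dd (1 / a) J) ->
    genus_total Hs half_family2 = class_value dd 1%N.
Proof.
move=> nm om D2 oK dK exJ; have D3 : (D %% 4)%Z <> 3 by rewrite D2.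
apply: (family_sum (a := a) (K := K)) => //.
- move=> A B C [C2 d]; have [b [Eb db]] := even_disc D3 d; have [c Ec] := evenE C2.
  have [z Ez] := sq_mod4 b.
  have [oc eb] : ~~ (2 %| c)%Z /\ (2 %| b)%Z.
    move: db; rewrite Ez Ec mulrCA; have [/evenE[c' Ec']|/oddE[c' Ec']] := boolP (2 %| c)%Z.
      by rewrite Ec' mulrCA mulrA; move: (A * c') => t; clear -D2; lia.
    by rewrite Ec' mulrDr mulr1 mulrCA; move: (A * c') => t; clear -D2; lia.
  have [b' Eb'] := evenE eb.
  have [r Er] : exists r, 4 * r = C + 2 * m by exists ((C + 2 * m) %/ 4)%Z; rewrite Ec;
    clear -oc om; lia.
  have Ebb : B = 4 * b' by rewrite Eb Eb'; ring.
  have EC : C = 4 * r - 2 * m by rewrite Er; ring.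
  exists (smx3 (2 * m) A r 0 m b'); split=> //.
  + by rewrite ext_smx3 /glued_gram nm Ebb EC; congr mx3; rewrite ?(rmorphM, rmorphB) /=; field.
  + apply: (mulfI (_ : (2 : int) != 0)) => //; rewrite dK.
    have -> : D = A * C - b ^+ 2 by rewrite -[D]opprK -db; ring.
    by rewrite EC Eb' det_mx3; ring.
- by move=> A B C A' _ C' _ j _ _ _; exact: half_int.
- by exists 1; field.
- by move=> l [//|]; exact: half_odd.
- by right.
move=> A B C [_ [_ [_ [_ _ _ d _]]]]; have [b [Eb db]] := even_disc D3 d; rewrite Eb in d *.
have [z Ez] := sq_mod4 b.
pose q C : Prop := (2 %| C)%Z.
have AC : ~~ ((2 %| A)%Z && (2 %| C)%Z).
  apply/negP => /andP[/evenE[A' EA] /evenE[C' EC]]; move: db; rewrite Ez EA EC mulrACA.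
  by move: (A' * C') => t; clear -D2; lia.
have [//|//|gs tgs sz] := @glue_parity q A (2 * b) C dd true _ _ d.
exists gs => //; rewrite sz.
have S2 : (2 %| A + 2 * b + C)%Z = ((2 %| A)%Z == (2 %| C)%Z) by clear; lia.
by rewrite S2; move: AC; case: (2 %| A)%Z; case: (2 %| C)%Z.
Qed.

(* Descent on the 2-part of N. *)
Lemma norm_ratio_mod4 (C C' X Y : int) (N : nat) : (D %% 4)%Z = 1 -> ~~ (2 %| C)%Z ->
  ~~ (2 %| C')%Z ->
  (0 < N)%N -> (X ^+ 2 + D * Y ^+ 2) * C' = C * N%:Z ^+ 2 -> (4 %| C - C')%Z.
Proof.
move=> D1 oC oC'; have [D' ED] : exists D', D = 4 * D' + 1 by exists (D %/ 4)%Z; clear -D1; lia.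
elim/ltn_ind: N X Y => N IH X Y N0 EQ.
have [x Ex] := sq_mod4 X; have [y0 Ey] := sq_mod4 Y; have [z0 En] := sq_mod4 N%:Z.
have [/evenE[N' EN]|oN] := boolP (2 %| N%:Z)%Z; last first.
  have nm : (N%:Z %% 2)%Z = 1 by clear -oN; lia.
  move: EQ; rewrite Ex Ey En nm ED.
  move=> EQ; have EC : C = 4 * (x * C' + (D' * (4 * y0 + (Y %% 2)%Z) + y0) * C' - C * z0)
    + ((X %% 2)%Z + (Y %% 2)%Z) * C'.
    by transitivity (C * (4 * z0 + 1) - 4 * C * z0); [ring|rewrite -EQ; ring].
  move: EC; move: (_ + _ - _) => s; have [->|->] : (X %% 2)%Z = 0 \/ (X %% 2)%Z = 1 by clear; lia.
    by have [->|->] : (Y %% 2)%Z = 0 \/ (Y %% 2)%Z = 1 by [clear; lia|]; clear -oC; lia.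
  by have [->|->] : (Y %% 2)%Z = 0 \/ (Y %% 2)%Z = 1 by [clear; lia|]; clear -oC; lia.
have [hX hY] : (2 %| X)%Z /\ (2 %| Y)%Z.
  have : (4 %| C' * (X ^+ 2 + D * Y ^+ 2))%Z.
    by rewrite mulrC EQ EN; apply/dvdzP; exists (C * N' ^+ 2); ring.
  rewrite (@dvdz_pow2_odd 2) // Ex Ey ED.
  have -> : 4 * x + (X %% 2)%Z + (4 * D' + 1) * (4 * y0 + (Y %% 2)%Z) =
     4 * (x + D' * (4 * y0 + (Y %% 2)%Z) + y0) + ((X %% 2)%Z + (Y %% 2)%Z) by ring.
  by move: (x + _ + _) => u; clear; lia.
have [X' EX] := evenE hX; have [Y' EY] := evenE hY.
have N'0 : 0 <= N' by clear -EN; lia.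
apply: (IH `|N'|%N _ X' Y').
- by clear -EN N0 N'0; lia.
- by clear -EN N0 N'0; lia.
- rewrite gez0_abs //; apply: (mulfI (_ : (4 : int) != 0)) => //.
  by transitivity ((X ^+ 2 + D * Y ^+ 2) * C'); [rewrite EX EY; ring|rewrite EQ EN; ring].
Qed.

(* The ratio of the two values is a rational value of X^2 + D Y^2. *)
Lemma odd_values_mod4 c J y w A B C J' y' w' A' B' C' : 0 < c -> (D %% 4)%Z = 1 ->
  nbasis dd c J y w A B C -> nbasis dd c J' y' w' A' B' C' -> ~~ (2 %| C)%Z -> ~~ (2 %| C')%Z ->
    (4 %| C - C')%Z.
Proof.
move=> c0 D1 b b' oC oC'; have [_ Ew [_ Nw _] _ _] := b; have [_ Ew' [_ Nw' _] _ _] := b'.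
have rc := ratr_neq0 c0; have C'0 : C' != 0 by apply: contraNneq oC' => ->.
have w'0 : w' != 0.
  apply/eqP => h; have := Nw'; rewrite h mul0r => /esym/eqP.
  by rewrite mulf_eq0 (negPf rc) /= intr_eq0 (negPf C'0).
have Et : quad_field (- D) (w / w') by apply: quadM => //; exact: quadV.
have [p [r Epr]] := Et.
have Ez : p ^+ 2 + D%:~R * r ^+ 2 = C%:~R / C'%:~R.
  apply: ratr_inj; rewrite -quad_normE -/(sqrtND dd) -Epr (conjM w) fmorphV /= fmorph_div /=
    !ratr_int.
  transitivity ((w * w^*) / (w' * w'^*)); first by field; rewrite fmorph_eq0 w'0.
  by rewrite Nw Nw' -mulf_div divff // mul1r.
have [N N0 [X [Y [EX EY]]]] : exists2 N : nat, (0 < N)%N & exists X Y : int,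
  p * N%:R = X%:~R /\ r * N%:R = Y%:~R.
  exists (absz (denq p * denq r)); first by rewrite absz_gt0 mulf_neq0 ?denq_neq0.
  have -> : (absz (denq p * denq r))%:R = (denq p)%:~R * (denq r)%:~R :> rat.
    by rewrite natr_absz ger0_norm ?rmorphM // mulr_ge0 // ltW // denq_gt0.
  exists (numq p * denq r), (numq r * denq p); rewrite !rmorphM /= !numqE; split; ring.
apply: (norm_ratio_mod4 D1 oC oC' N0 (X := X) (Y := Y)).
apply: (@intr_inj rat); transitivity ((X%:~R ^+ 2 + D%:~R * Y%:~R ^+ 2) * C'%:~R : rat);
  first by ring.
rewrite -EX -EY; transitivity ((p ^+ 2 + D%:~R * r ^+ 2) * C'%:~R * N%:R ^+ 2); first by ring.
by rewrite Ez divfK ?intr_eq0 // rmorphM rmorphXn.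
Qed.

Lemma half_family_total_D1 (m : int) J0 y0 w0 A0 B0 C0 : n%:R = (2 * m)%:~R :> rat ->
  ~~ (2 %| m)%Z -> (D %% 4)%Z = 1 ->
  \det K = 2 * m * D -> nbasis dd (2 / a) J0 y0 w0 A0 B0 C0 -> ((C0 + m) %% 4)%Z = 0 ->
    genus_total Hs (half_family 2 2 m) = class_value dd 2%N.
Proof.
move=> nm om D1 dK b0 C0m; have D3 : (D %% 4)%Z <> 3 by rewrite D1.
have ca : 0 < 2 / a by exact: divr_gt0.
have oC0 : ~~ (2 %| C0)%Z by clear -C0m om; lia.
apply: (family_sum (a := a) (K := K)) => //; last by exists J0; exact: basis_fid b0.
- move=> A B C [Cm d]; have [b [Eb db]] := even_disc D3 d.
  have [r Er] : exists r, 4 * r = C + m by exists ((C + m) %/ 4)%Z; clear -Cm; lia.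
  have EC : C = 4 * r - m by rewrite Er; ring.
  exists (smx3 (2 * m) (2 * A) (2 * r) 0 m b); split=> //.
  + by rewrite ext_smx3 /glued_gram nm Eb EC; congr mx3; rewrite ?(rmorphM, rmorphB) /=; field.
  + rewrite dK; have -> : D = A * C - b ^+ 2 by rewrite -[D]opprK -db; ring.
    by rewrite EC det_mx3; ring.
  + by move=> _; apply/even_smx3P; rewrite !dvdz_mulr.
- by move=> A B C A' _ C' i j _ _ _; exact: half_int.
- by exists 1; field.
- by move=> l [//|]; exact: half_odd.
- by right.
move=> A B C [J [y [w bJ]]]; have [_ _ _ d _] := bJ; have [b [Eb db]] := even_disc D3 d;
  rewrite Eb in d bJ *.
have AC : ~~ ((2 %| A)%Z && (2 %| C)%Z).
  apply/negP => /andP[/evenE[A' EA] /evenE[C' EC]]; move: db; rewrite EA EC mulrACA.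
  have [/evenE[b' ->]|/sq_mod8[t ->]] := boolP (2 %| b)%Z; last by move: (A' * C') => t';
    clear -D1; lia.
  by rewrite exprMn; move: (A' * C') (b' ^+ 2) => t' s'; clear -D1; lia.
pose q C : Prop := ((C + m) %% 4)%Z = 0.
have oddq i j k l : unimod i j k l -> ~~ (2 %| bqf A (2 * b) C k l)%Z -> q (bqf A (2 * b) C k l).
  move=> u o; have := odd_values_mod4 ca D1 (basis_form_change bJ u) b0 o oC0.
  by rewrite /q; move: (bqf _ _ _ _ _) => z; clear -C0m; lia.
have [||gs tgs sz] := @glue_parity q A (2 * b) C dd false _ _ d.
- by move=> z; rewrite /q; clear -om; lia.
- by move=> i j k l un /negbT; exact: oddq un.
exists gs => //; rewrite sz.
have S2 : (2 %| A + 2 * b + C)%Z = ((2 %| A)%Z == (2 %| C)%Z) by clear; lia.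
by rewrite S2; move: AC; case: (2 %| A)%Z; case: (2 %| C)%Z.
Qed.

Lemma half_family_total_D3 (m : int) : n%:R = (2 * m)%:~R :> rat -> ~~ (2 %| m)%Z ->
  (D %% 4)%Z = 3 ->
  \det K = 2 * m * D -> (exists J, fid dd (8 / a) J) ->
  genus_total Hs (half_family 4 8 m) = class_value dd (if (D %% 8)%Z == 7 then 1%N else 3%N).
Proof.
move=> nm om D3 dK exJ; apply: (family_sum (a := a) (K := K)) => //; last by case: ifP.
- move=> A B C [Cm]; rewrite disc_odd // => d.
  have [r Er] : exists r, 4 * r = C + m by exists ((C + m) %/ 4)%Z; clear -Cm; lia.
  have EC : C = 4 * r - m by rewrite Er; ring.
  exists (smx3 (2 * m) (8 * A) (2 * r) 0 m B); split=> //.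
  + by rewrite ext_smx3 /glued_gram nm EC; congr mx3; rewrite ?(rmorphM, rmorphB) /=; field.
  + rewrite dK; have -> : D = 4 * A * C - B ^+ 2 by rewrite -[D]opprK -d; ring.
    by rewrite EC det_mx3; ring.
  + by move=> _; apply/even_smx3P; rewrite !dvdz_mulr //; apply: dvdz_mulr.
- move=> A B C A' _ _ i j [Cm _] _ EA /half_int/evenE[j' Ej].
  have oC : ~~ (2 %| C)%Z by clear -Cm om; lia.
  have /evenE[j2 Ej2] : (2 %| j')%Z.
    by apply: (glue_quarter oC (A' := A') (A := A) (B := B) (i := i)); rewrite EA Ej rmorphM /=;
      field.
  by apply/dvdzP; exists j2; rewrite Ej Ej2; ring.
- by exists 2; field.
- by move=> l [//|]; exact: half_odd.
- by right.
move=> A B C [_ [_ [_ [_ _ _ d _]]]]; have [oB AC] := odd_disc D3 d; have [b Eb] := oddE oB;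
  rewrite Eb in d *.
have [gs tgs sz] := glue_odd om d.
exists gs => //; rewrite sz -AC dvd2M.
have S2 : (2 %| A + (2 * b + 1) + C)%Z = ((2 %| A)%Z != (2 %| C)%Z) by clear; lia.
by rewrite S2; case: (2 %| A)%Z; case: (2 %| C)%Z.
Qed.

End Instances.

(** * Counting the vectors of norm m and 2m over a genus *)

Local Notation e0 := (rv3 1 0 0 : 'rV[int]_3).

Definition gram_from H (v : 'rV[int]_3) (M : 'M[int]_3) :=
  exists U, [/\ U \in unitmx, v = e0 *m U & U *m H *m U^T = M].

Lemma gram_from_isometric H v M : gram_from H v M -> isometric H M.
Proof. by move=> [U [uU _ EU]]; exists U. Qed.

Lemma gram_from_change H v M W : W \in unitmx -> e0 *m W = e0 ->
  gram_from H v M -> gram_from H v (W *m M *m W^T).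
Proof.
move=> uW eW [U [uU -> <-]]; exists (W *m U); split; first by rewrite unitmx_mul uW.
  by rewrite mulmxA eW.
by rewrite trmx_mul !mulmxA.
Qed.

Lemma gram_from_smx3 H v n p r d e q i j x k l z p' r' e' q' :
  unimod i j k l -> x * n + i * d + j * e = 0 -> e' = z * n + k * d + l * e ->
  p' = n * x ^+ 2 + p * i ^+ 2 + r * j ^+ 2 + 2 * (d * x * i + e * x * j + q * i * j) ->
  r' = n * z ^+ 2 + p * k ^+ 2 + r * l ^+ 2 + 2 * (d * z * k + e * z * l + q * k * l) ->
  q' = n * x * z + p * i * k + r * j * l + d * (x * k + z * i) + e * (x * l + z * j)
    + q * (i * l + j * k) ->
  gram_from H v (smx3 n p r d e q) -> gram_from H v (smx3 n p' r' 0 e' q').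
Proof.
move=> u d0 -> -> -> -> g; set M := smx3 _ _ _ _ _ _.
have -> : M = mx3 1 0 0 x i j z k l *m smx3 n p r d e q *m (mx3 1 0 0 x i j z k l)^T.
  by rewrite tr_mx3 !mul_mx3 /M /smx3; congr mx3; try ring; rewrite -[LHS]d0; ring.
apply: gram_from_change g.
- by rewrite unit_mx3P det_mx3; case: u => u; apply/orP; [left|right]; apply/eqP; rewrite -[RHS]u;
    ring.
- by rewrite mul_rv3; congr rv3; ring.
Qed.

Lemma gram_from_swap H v n p r q :
  gram_from H v (smx3 n p r 0 0 q) -> gram_from H v (smx3 n r p 0 0 q).
Proof.
move=> g; apply: (gram_from_smx3 (i := 0) (j := 1) (x := 0)
  (k := 1) (l := 0) (z := 0) _ _ _ _ _ _ g);
  by [right; ring|ring].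
Qed.

Lemma gram_from_shear H v n p r q :
  gram_from H v (smx3 n p r 0 0 q) -> gram_from H v (smx3 n (p + r + 2 * q) r 0 0 (r + q)).
Proof.
move=> g; apply: (gram_from_smx3 (i := 1) (j := 1) (x := 0)
  (k := 0) (l := 1) (z := 0) _ _ _ _ _ _ g);
  by [left; ring|ring].
Qed.

Lemma gram_from_rel H v n p r e q p' r' e' q' :
  gram_from H v (smx3 n p r 0 e q) -> gram_from H v (smx3 n p' r' 0 e' q') ->
  exists z k l, z * n + l * e = e' /\
    r' = n * z ^+ 2 + p * k ^+ 2 + r * l ^+ 2 + 2 * (e * z * l + q * k * l).
Proof.
move=> [U [uU vU EU]] [U' [_ vU' EU']]; pose W := U' *m invmx U.
have eW : e0 *m W = e0 by rewrite mulmxA -vU' vU mulmxK.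
have : W *m smx3 n p r 0 e q *m W^T = smx3 n p' r' 0 e' q'.
  have UE : U' = W *m U by rewrite /W mulmxKV.
  by clearbody W; rewrite -EU -EU' UE trmx_mul !mulmxA.
have [x [i [j [z [k [l ->]]]]]] := fix_e0P eW.
rewrite tr_mx3 !mul_mx3 => E; have [[_ _ q02] [_ [_ _ q22]]] := mx3_inj E.
by exists z, k, l; split; rewrite -?q02 -?q22; ring.
Qed.

Lemma gram_from_reflvec (m dl : nat) H v p r e q : (m%:Z %| e)%Z ->
  gram_from H v (smx3 (m * dl)%N%:Z p r 0 e q) -> reflvec_at m dl H v.
Proof.
move=> /dvdzP[e' Ee] [U [uU -> EU]]; split.
  by rewrite -qform_conj EU qform_rv3; ring.
exists (rv3 dl%:Z 0 e' *m invmx U^T); have uT : U^T \in unitmx by rewrite unitmx_tr.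
rewrite scalemxAl; apply: (canRL (mulmxK uT)).
transitivity (e0 *m (U *m H *m U^T)); first by rewrite !mulmxA.
rewrite EU mul_rv3; apply/rowP; apply: I3P; rewrite !mxE /= ?Ee ?PoszM; ring.
Qed.

Lemma reflvec_gram_dvd K H (m dl : nat) v : stable K -> (m %| PQ K)%N -> genus K H ->
  dl \in [:: 1; 2]%N -> reflvec_at m dl H v ->
  exists p r d e q, gram_from H v (smx3 (m * dl)%N%:Z p r (m%:Z * d) (m%:Z * e) q).
Proof.
move=> sK mP gH dl12 rv; have [sH _] := genus_lattice gH.
have [U uU vU] := reflvec_primitive sK mP dl12 rv; have [Qv [c Hc]] := rv; rewrite row0E in vU.
have [n [p [r [d [e [q EM]]]]]] := smx3P (congr_mx_sym U sH).
have En : n = (m * dl)%N%:Z by rewrite -Qv vU -qform_conj EM qform_rv3; ring.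
have [c' /rowP Hc'] : exists c', e0 *m smx3 n p r d e q = m%:Z *: c'.
  by exists (c *m U^T); rewrite -EM scalemxAl -Hc vU !mulmxA.
exists p, r, (c' 0 o1), (c' 0 o2), q; exists U; split=> //.
have := (Hc' o1, Hc' o2); rewrite mul_rv3 !mxE /= => -[<- <-].
by rewrite EM En; congr smx3; ring.
Qed.

Lemma reflvec_gram K H (m dl : nat) v : stable K -> (m %| PQ K)%N -> genus K H ->
  dl \in [:: 1; 2]%N -> reflvec_at m dl H v ->
  exists p r e q, gram_from H v (smx3 (m * dl)%N%:Z p r 0 e q) /\ (e = 0 \/ dl = 2%N /\ e = m%:Z).
Proof.
move=> sK mP gH dl12 /(reflvec_gram_dvd sK mP gH dl12)[p [r [d [e [q g]]]]].
have clear_d i j x k l z e' : unimod i j k l -> x * dl%:Z + i * d + j * e = 0 ->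
    z * dl%:Z + k * d + l * e = e' ->
    exists p r q, gram_from H v (smx3 (m * dl)%N%:Z p r 0 (m%:Z * e') q).
  move=> u d0 <-; do 3 eexists;
    apply: (gram_from_smx3 (x := x) (z := z) u _ _ erefl erefl erefl g); rewrite PoszM.
    by rewrite -[RHS](mulr0 m%:Z) -d0; ring.
  by ring.
move: dl12; rewrite !inE => /orP[] /eqP Edl.
  have [||| p' [r' [q' g']]] := clear_d 1 0 (- d) 0 1 (- e) 0; rewrite ?Edl;
    [by left; ring|by ring|by ring|].
  by exists p', r', 0, q'; split; [rewrite Edl mulr0 in g'|left].
suff [e' [e01 [p' [r' [q' g']]]]] : exists e', (e' = 0 \/ e' = 1) /\
    exists p r q, gram_from H v (smx3 (m * dl)%N%:Z p r 0 (m%:Z * e') q).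
  exists p', r', (m%:Z * e'), q'; split=> //.
  by case: e01 => ->; [left|right; split=> //]; ring.
have parity (z : int) : exists t, z = 2 * t \/ z = 2 * t + 1.
  by have [/evenE[t ->]|/oddE[t ->]] := boolP (2 %| z)%Z; exists t; [left|right].
have [td [Ed|Ed]] := parity d; have [te [Ee|Ee]] := parity e.
- exists 0; split; first by left.
  by apply: (clear_d 1 0 (- td) 0 1 (- te)); rewrite ?Edl ?Ed ?Ee; [left| |]; ring.
- exists 1; split; first by right.
  by apply: (clear_d 1 0 (- td) 0 1 (- te)); rewrite ?Edl ?Ed ?Ee; [left| |]; ring.
- exists 1; split; first by right.
  by apply: (clear_d 0 1 (- te) 1 0 (- td)); rewrite ?Edl ?Ed ?Ee; [right| |]; ring.
- exists 1; split; first by right.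
  by apply: (clear_d 1 (-1) (te - td) 0 1 (- te)); rewrite ?Edl ?Ed ?Ee; [left| |]; ring.
Qed.

Lemma fam_vecs_gram dd n be al ga cond H v (e : int) : H^T = H -> n%:R * al = e%:~R ->
  fam_vecs dd n be al ga cond H v -> exists p r q A B C,
  [/\ gram_from H v (smx3 n%:Z p r 0 e q), ext rat (smx3 n%:Z p r 0 e q)
    = glued_gram n be al ga A B C
    & admissible dd cond A B C].
Proof.
move=> sH Ee [U [A [B [C [uU vU EU g]]]]].
have [n' [p [r [d [e' [q EM]]]]]] := smx3P (congr_mx_sym U sH).
have EU' := EU; rewrite EM ext_smx3 /glued_gram in EU'.
have [[En Ed Ee'] _] := mx3_inj EU'.
have {}En : n' = n%:Z by apply: (@intr_inj rat); rewrite En.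
have {}Ed : d = 0 by apply: (@intr_inj rat); rewrite Ed.
have {}Ee' : e' = e by apply: (@intr_inj rat); rewrite Ee'.
rewrite En Ed Ee' in EM; rewrite EM in EU.
by exists p, r, q, A, B, C; split=> //; exists U.
Qed.

Lemma gram_fam_vecs dd n be al ga cond H v M A B C : gram_from H v M ->
  ext rat M = glued_gram n be al ga A B C -> admissible dd cond A B C ->
    fam_vecs dd n be al ga cond H v.
Proof. by move=> [U [uU vU EU]] EM g; exists U, A, B, C; rewrite EU. Qed.

Lemma quadratic_root (dd : sqf) (A B C : int) : A != 0 -> B ^+ 2 - 4 * A * C = disc dd ->
  exists w1 w2 : rat, [/\ A%:~R * w1 = B%:~R / 2, w2 != 0
    & A%:~R * (w1 ^+ 2 + (sqf_val dd)%:~R * w2 ^+ 2) = C%:~R].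
Proof.
move=> A0 d; have An : A%:~R != 0 :> rat by rewrite intr_eq0.
have [f f0 Ef] : exists2 f : rat, f != 0 & f ^+ 2 * (sqf_val dd)%:~R = - (disc dd)%:~R.
  by rewrite /disc; case: ifP => _; [exists 1|exists 2] => //; rewrite ?rmorphN ?rmorphM /=; ring.
exists (B%:~R / (2 * A%:~R)), (f / (2 * A%:~R)); split; first by field.
  by rewrite mulf_neq0 // invr_eq0 mulf_neq0.
transitivity ((B%:~R ^+ 2 + f ^+ 2 * (sqf_val dd)%:~R) / (4 * A%:~R)); first by field.
by rewrite Ef -d !(rmorphB, rmorphM) /=; field.
Qed.

Lemma shape_isometric_diag (dd : sqf) n be (al ga : rat) A B C : (0 < be)%N -> 0 < A ->
  B ^+ 2 - 4 * A * C = disc dd -> let a := ga * A%:~R in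
  isometric (smx3 n%:R a (a * (sqf_val dd)%:~R) 0 0 0) (glued_gram n be al ga A B C).
Proof.
move=> be0 A0 d a; have [w1 [w2 [Ew1 w20 Ew]]] := quadratic_root (lt0r_neq0 A0) d.
have bn : be%:R != 0 :> rat by rewrite pnatr_eq0 -lt0n.
exists (mx3 1 0 0 0 1 0 al (w1 / be%:R) (w2 / be%:R)).
  by rewrite unitmxE unitfE det_mx3 (_ : _ + _ = w2 / be%:R); [rewrite mulf_neq0 ?invr_eq0|ring].
rewrite tr_mx3 !mul_mx3 /glued_gram /smx3 /a; congr mx3; try ring.
- by transitivity (ga * (A%:~R * w1) / be%:R); [ring|rewrite Ew1; field].
- by transitivity (ga * (A%:~R * w1) / be%:R); [ring|rewrite Ew1; field].
- rewrite -Ew; field; exact: bn.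
Qed.

Lemma disc_basis (dd : sqf) (A B C : int) : 0 < A -> B ^+ 2 - 4 * A * C = disc dd ->
  exists J w, nbasis dd A%:~R^-1 J 1 w A B C.
Proof.
move=> A0 d; have [w1 [w2 [Ew1 _ Ew]]] := quadratic_root (lt0r_neq0 A0) d.
have An : A%:~R != 0 :> rat by rewrite intr_eq0 gt_eqF.
pose w := ratr w1 + ratr w2 * sqrtND dd.
exists [set z | exists i j : int, z = i%:~R * 1 + j%:~R * w], w.
rewrite /w; split=> //; [exact: (quad_int dd 1)|exact: quadP|split].
- by rewrite rmorph1 mulr1 -(ratr_int algC A) -rmorphM /= mulVf ?rmorph1.
- by rewrite quad_normE -(ratr_int algC C) -rmorphM /= -Ew mulKf.
- rewrite rmorph1 !mul1r conj_quadE -(ratr_int algC B) -rmorphM /=.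
  transitivity (ratr (w1 + w1) : algC); first by rewrite (raddfD (@ratr algC)) /=; ring.
  by congr ratr; apply: (mulfI An); rewrite mulVKf // mulrDr Ew1; field.
Qed.

Lemma fam_vecs_basis K H v dd n be al ga cond : genus K H -> (0 < be)%N -> 0 < ga ->
  fam_vecs dd n be al ga cond H v -> exists a : rat, [/\ 0 < a,
    rational_split dd K n a
    & exists J y w A B C, nbasis dd (ga / a) J y w A B C /\ cond A B C].
Proof.
move=> gH be0 ga0 [U [A [B [C [uU _ EU [hc d]]]]]]; have [lH iKH _] := gH.
have lM : lattice (U *m H *m U^T) by apply: isometric_lattice lH; exists U.
have A0 : 0 < A.
  have /matrixP/(_ o1 o1) := EU; rewrite [LHS]mxE [RHS]mxE /= => EA.
  by rewrite -(ltr0z rat) -(pmulr_rgt0 _ ga0) -EA ltr0z lattice_diag.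
exists (ga * A%:~R); split; first by rewrite mulr_gt0 ?ltr0z.
  apply: isometric_trans iKH (isometric_trans (isometric_ext rat (_ : isometric H _)) _).
    by exists U; last reflexivity.
  by rewrite EU; apply: isometric_sym; exact: shape_isometric_diag.
have [J [w b]] := disc_basis A0 d; exists J, 1, w, A, B, C.
by rewrite invfM mulVKf // gt_eqF.
Qed.

Lemma fam_vecs_fid K H v dd n be al ga cond : genus K H -> (0 < be)%N -> 0 < ga ->
  fam_vecs dd n be al ga cond H v -> exists a : rat, [/\ 0 < a,
    rational_split dd K n a & exists J, fid dd (ga / a) J].
Proof.
move=> gH be0 ga0 /(fam_vecs_basis gH be0 ga0)[a [a0 iK [J [y [w [A [B [C [b _]]]]]]]]].
by exists a; split=> //; exists J; exact: basis_fid (divr_gt0 ga0 a0) b.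
Qed.

Lemma ncard_disjoint (T : choiceType) (A B C : set T) : finite_set A -> finite_set B ->
  (forall x, C x <-> A x \/ B x) -> (forall x, A x -> ~ B x) -> ncard C = (ncard A + ncard B)%N.
Proof.
move=> /finite_enum[s us sP] /finite_enum[t ut tP] CP dis.
rewrite (ncard_seq us sP) (ncard_seq ut tP) -size_cat; apply: ncard_seq.
  rewrite cat_uniq us ut andbT; apply/hasPn => x /tP Bx; apply/negP => /sP Ax; exact: (dis x).
by move=> x; rewrite mem_cat CP sP tP; split=> [[]->|/orP[]]; rewrite ?orbT; auto.
Qed.

Lemma class_valueD dd k l : class_value dd k + class_value dd l = class_value dd (k + l).
Proof. by rewrite /class_value natrD -!mulrDl. Qed.

Lemma fid_ex_sqr dd c r : 0 < r -> (exists J, fid dd c J) -> exists J, fid dd (r ^+ 2 * c) J.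
Proof. by move=> r0 [J fJ]; exists (scl (ratr r) J); exact: fid_sclr. Qed.

Lemma fid_ex_double (dd : sqf) c : (sqf_val dd %% 8)%Z = 7 ->
  (exists J, fid dd c J) -> exists J, fid dd (2 * c) J.
Proof.
move=> D7 [J fJ].
pose P := [set z | exists i j : int,
  z = i%:~R * (1 * 2)%:~R + j%:~R * (1%:~R * (0%:~R + omega dd))].
have [|C b] := @nbasis_intro dd 1 2 0 P _ erefl.
  by rewrite expr0n mulr0 !add0r /nmw /qpar; case: ifP => [_|/eqP h]; [clear -D7|clear -D7 h]; lia.
by exists (prodI P J); exact: fid_mul (basis_fid _ b) fJ.
Qed.

Lemma disc3_cases (D p r q : int) : (D %% 4)%Z = 3 -> D = p * r - q ^+ 2 ->
  (2 %| p)%Z /\ (2 %| r)%Z \/ (4 %| p)%Z /\ ~~ (2 %| r)%Z \/ (4 %| r)%Z /\ ~~ (2 %| p)%Z \/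
  (4 %| p + r + 2 * q)%Z /\ ~~ (2 %| r)%Z.
Proof.
move=> D3 DE; have prE : (p * r = D + q ^+ 2) by rewrite DE subrK.
have := modzMm p r 4; rewrite prE; have [z ->] := sq_mod4 q.
have residue (t : int) : (t %% 4)%Z = 0 \/ (t %% 4)%Z = 1 \/ (t %% 4)%Z = 2 \/ (t %% 4)%Z = 3.
  by clear; lia.
by case: (residue p) => [|[|[]]] Ep; case: (residue r) => [|[|[]]] Er; rewrite Ep Er;
  clear -D3 Ep Er; lia.
Qed.

Section Totals.
Variables (K : 'M[int]_3) (m : nat) (dd : sqf) (Hs : seq 'M[int]_3).
Local Notation D := (sqf_val dd).
Local Notation total F := (genus_total Hs F).
Local Notation isoK := (isotropic_at 2 K).
Hypotheses (sK : stable K) (mP : (m %| PQ K)%N) (rH : class_reps K Hs).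

Definition reflective_in_genus dl := exists H v, genus K H /\ reflvec_at m dl H v.

Let m_odd : ~~ (2 %| m%:Z)%Z. Proof. by rewrite dvdzE /= dvdn2 (PQ_dvd_odd mP). Qed.
Let m_gt0 : (0 < m)%N. Proof. exact: PQ_dvd_gt0 mP. Qed.
Let m2_gt0 : (0 < m * 2)%N. Proof. by rewrite muln_gt0 m_gt0. Qed.
Let m_neq0 : m%:Z != 0. Proof. by rewrite eqz_nat -lt0n. Qed.
Let m2_neq0 : 2 * m%:Z != 0. Proof. by rewrite mulf_neq0. Qed.
Let natz_m : m%:R = m%:Z%:~R :> rat. Proof. by []. Qed.
Let natz_m2 : (m * 2)%N%:R = (2 * m%:Z)%:~R :> rat. Proof. by rewrite natrM rmorphM /= mulrC. Qed.
Let Posz_m2 : (m * 2)%N%:Z = 2 * m%:Z. Proof. by rewrite PoszM mulrC. Qed.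

Lemma genus_total_ext (F G : 'M[int]_3 -> set 'rV[int]_3) :
  (forall H, genus K H -> forall v, F H v <-> G H v) -> total F = total G.
Proof.
move=> FG; have [[_ HP _] _] := rH; apply: eq_big_seq => H /HP gH; do 2 f_equal.
by congr ncard; apply/seteqP; split=> v /(FG H gH).
Qed.

Lemma genus_total0 (F : 'M[int]_3 -> set 'rV[int]_3) :
  (forall H, genus K H -> forall v, ~ F H v) -> total F = 0.
Proof.
move=> F0; have [[_ HP _] _] := rH; rewrite /genus_total big_seq big1 // => H /HP gH.
by rewrite ncard0 ?mul0r //; exact: F0.
Qed.

Lemma genus_total_disjoint (F F1 F2 : 'M[int]_3 -> set 'rV[int]_3) :
  (forall H, genus K H -> finite_set (F1 H) /\ finite_set (F2 H)) ->
  (forall H, genus K H -> forall v, F H v <-> F1 H v \/ F2 H v) ->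
  (forall H, genus K H -> forall v, F1 H v -> ~ F2 H v) -> total F = total F1 + total F2.
Proof.
move=> fin FP dis; have [[_ HP _] _] := rH; rewrite /genus_total -big_split.
apply: eq_big_seq => H /HP gH; have [f1 f2] := fin H gH.
by rewrite /= -mulrDl -natrD (ncard_disjoint f1 f2 (FP H gH) (dis H gH)).
Qed.

Lemma gram_from_det H v n p r e q : genus K H -> gram_from H v (smx3 n p r 0 e q) ->
  \det K = n * (p * r - q ^+ 2) - e ^+ 2 * p.
Proof.
move=> gH g; have lK : lattice K by case: sK.
by rewrite -(genus_det lK gH) (isometric_det_int (gram_from_isometric g)) det_mx3; ring.
Qed.

Lemma gram_from_even H v n p r e q : genus K H -> gram_from H v (smx3 n p r 0 e q) ->
  even_lattice K -> exists p' r', p = 2 * p' /\ r = 2 * r'.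
Proof.
move=> gH g /(genus_even _ gH) evH; have lK : lattice K by case: sK.
have /even_smx3P[_ /evenE[p' ->] /evenE[r' ->]] := isometric_even (gram_from_isometric g) (evH lK).
by exists p', r'.
Qed.

Lemma gram_from_disc H v n p r q : n != 0 -> \det K = n * D -> genus K H ->
  gram_from H v (smx3 n p r 0 0 q) -> D = p * r - q ^+ 2.
Proof.
by move=> n0 dK gH g; apply: (mulfI n0); rewrite -dK (gram_from_det gH g); ring.
Qed.

Lemma gram_from_iso2 H v M : genus K H -> gram_from H v M ->
  isometric (ext (padic_int 2) K) (ext (padic_int 2) M).
Proof.
move=> [_ _ /(_ 2 isT) l] /gram_from_isometric/(isometric_ext (padic_int 2)).
exact: isometric_trans.
Qed.

Lemma reflvec1P H v : genus K H ->
  reflvec_at m 1 H v <-> exists p r q, gram_from H v (smx3 m%:Z p r 0 0 q).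
Proof.
move=> gH; split=> [/(reflvec_gram sK mP gH (isT : 1%N \in [:: 1; 2]%N))|].
  by rewrite muln1 => -[p [r [e [q [g [e0|[]//]]]]]]; exists p, r, q; rewrite e0 in g.
by move=> [p [r [q g]]]; apply: (@gram_from_reflvec m 1 H v p r 0 q); rewrite ?dvdz0 // muln1.
Qed.

Lemma reflvec2P H v : genus K H -> reflvec_at m 2 H v <->
  (exists p r q, gram_from H v (smx3 (2 * m%:Z) p r 0 0 q)) \/
  (exists p r q, gram_from H v (smx3 (2 * m%:Z) p r 0 m%:Z q)).
Proof.
move=> gH; split=> [/(reflvec_gram sK mP gH (isT : 2%N \in [:: 1; 2]%N))|].
  move=> [p [r [e [q []]]]]; rewrite Posz_m2 => g [e0|[_ em]]; [left|right]; exists p, r, q.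
    by rewrite e0 in g.
  by rewrite em in g.
by case=> -[p [r [q]]]; rewrite -Posz_m2; apply: gram_from_reflvec; rewrite ?dvdz0.
Qed.

Section OddNorm.
Hypothesis dK : \det K = m%:Z * D.

Lemma reflvec1_fam H v : (D %% 4)%Z <> 3 -> genus K H ->
  reflvec_at m 1 H v <-> fam_vecs dd m 1 0 1 (fun _ _ _ => True) H v.
Proof.
move=> D3 gH; have [sH _] := genus_lattice gH; split=> [/(reflvec1P v gH)[p [r [q g]]]|].
  have DE := gram_from_disc m_neq0 dK gH g.
  apply: (gram_fam_vecs g (A := p) (B := 2 * q) (C := r)).
    by rewrite ext_smx3 /glued_gram natz_m; congr mx3; rewrite ?rmorphM /=; field.
  by split=> //; rewrite disc_even // DE; ring.
move=> /(fam_vecs_gram sH (e := 0))[|p [r [q [A [B [C [g _ _]]]]]]]; first by rewrite mulr0.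
by apply/(reflvec1P v gH); exists p, r, q.
Qed.

Lemma total_delta1_D1 : (D %% 4)%Z = 1 -> reflective_in_genus 1 ->
  total (reflvec_at m 1) = class_value dd 1.
Proof.
move=> D1 [H [v [gH]]]; have D3 : (D %% 4)%Z <> 3 by rewrite D1.
rewrite (genus_total_ext (fun H gH v => reflvec1_fam v D3 gH)).
move=> /(reflvec1_fam _ D3 gH)/(fam_vecs_fid gH (ltn0Sn _) ltr01)[a [a0 iK exJ]].
apply: (split_total sK m_gt0 a0 iK rH) => // A _ C /(even_disc D3)[b [-> db]].
exists (smx3 m%:Z A C 0 0 b); split.
- by rewrite ext_smx3 /glued_gram natz_m; congr mx3; rewrite ?rmorphM /=; field.
- by rewrite dK -[D]opprK -db det_mx3; ring.
- move=> /(stable_even2 sK); rewrite dK dvd2M (negPf m_odd) /= => D2.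
  by clear -D1 D2; lia.
Qed.

Lemma reflvec1_isotropic : (D %% 8)%Z = 7 -> reflective_in_genus 1 -> isoK.
Proof.
move=> D7 [H [v [gH /(reflvec1P v gH)[p [r [q g]]]]]].
have DE := gram_from_disc m_neq0 dK gH g; apply: (isometric_isotropic (gram_from_iso2 gH g)).
apply: isotropic_split7; last by rewrite -DE.
by rewrite gt_eqF // (lattice_diag1 (isometric_lattice (gram_from_isometric g) (genus_lattice gH))).
Qed.

End OddNorm.

Section EvenPlanes.
Variable n : nat.
Hypotheses (n_gt0 : (0 < n)%N) (D3 : (D %% 4)%Z = 3) (dK : \det K = n%:Z * D).

Definition even_plane_vecs := fam_vecs dd n 1 0 2 (fun _ _ _ => True).

Lemma even_plane_vecsP H v : genus K H -> even_plane_vecs H v <->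
  exists p r q, gram_from H v (smx3 n%:Z (2 * p) (2 * r) 0 0 q).
Proof.
move=> gH; split.
  move=> /(fam_vecs_gram (genus_lattice gH).1 (e := 0))[|p [r [q [A [B [C [g EM _]]]]]]].
    by rewrite mulr0.
  move: EM; rewrite ext_smx3 /glued_gram => E; have [_ [[_ Ep _] [_ _ Er]]] := mx3_inj E.
  exists A, C, q; suff [<- <-] : p = 2 * A /\ r = 2 * C by [].
  by split; apply: (@intr_inj rat); rewrite ?Ep ?Er rmorphM /=; field.
move=> [p [r [q g]]]; apply: (gram_fam_vecs g (A := p) (B := q) (C := r)).
  by rewrite ext_smx3 /glued_gram; congr mx3; rewrite ?rmorphM /=; field.
have n0 : n%:Z != 0 by rewrite eqz_nat -lt0n.
by split=> //; rewrite disc_odd // (gram_from_disc n0 dK gH g); ring.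
Qed.

Lemma even_plane_total a : 0 < a -> rational_split dd K n a ->
  (even_lattice K -> (2 %| n%:Z)%Z) -> (exists J, fid dd (2 / a) J) ->
  total even_plane_vecs = class_value dd 1.
Proof.
move=> a0 iK ev exJ; apply: (split_total sK n_gt0 a0 iK rH) => // A B C.
rewrite disc_odd // => d; exists (smx3 n%:Z (2 * A) (2 * C) 0 0 B); split.
- by rewrite ext_smx3 /glued_gram; congr mx3; rewrite ?rmorphM /=; field.
- by rewrite dK -[D]opprK -d det_mx3; ring.
- by move=> /ev n2; apply/even_smx3P; split=> //; exact: dvdz_mulr.
Qed.

End EvenPlanes.

Section OddNormThree.
Hypotheses (D3 : (D %% 4)%Z = 3) (dK : \det K = m%:Z * D).

Let K_odd : ~ even_lattice K.
Proof.
move=> /(stable_even2 sK); rewrite dK dvd2M (negPf m_odd) /=.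
by apply/negP; clear -D3; lia.
Qed.

Definition odd_plane_vecs := fam_vecs dd m 2 0 4 (fun _ _ C => ~~ (2 %| C)%Z).

Lemma odd_plane_vecsP H v : genus K H -> odd_plane_vecs H v <->
  exists p r q, gram_from H v (smx3 m%:Z (4 * p) r 0 0 q) /\ ~~ (2 %| r)%Z.
Proof.
move=> gH; split.
  move=> /(fam_vecs_gram (genus_lattice gH).1 (e := 0))[|p [r [q [A [B [C [g EM [oC _]]]]]]]].
    by rewrite mulr0.
  move: EM; rewrite ext_smx3 /glued_gram => E; have [_ [[_ Ep _] [_ _ Er]]] := mx3_inj E.
  exists A, r, q; suff [<- rC] : p = 4 * A /\ r = C by split=> //; rewrite rC.
  by split; apply: (@intr_inj rat); rewrite ?Ep ?Er ?rmorphM /=; field.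
move=> [p [r [q [g r_odd]]]]; apply: (gram_fam_vecs g (A := p) (B := q) (C := r)).
  by rewrite ext_smx3 /glued_gram natz_m; congr mx3; rewrite ?rmorphM /=; field.
by split=> //; rewrite disc_odd // (gram_from_disc m_neq0 dK gH g); ring.
Qed.

Lemma reflvec1_even_or_odd H v : genus K H ->
  reflvec_at m 1 H v <-> even_plane_vecs m H v \/ odd_plane_vecs H v.
Proof.
move=> gH; have evP := even_plane_vecsP m_gt0 D3 dK v gH; have odP := odd_plane_vecsP v gH; split.
  move=> /(reflvec1P v gH)[p [r [q g]]].
  have odd_of p' r' q' : gram_from H v (smx3 m%:Z p' r' 0 0 q') ->
      (4 %| p')%Z -> ~~ (2 %| r')%Z -> odd_plane_vecs H v.
    by move=> g' /dvdzP[p1 Ep] o; apply/odP; exists p1, r', q'; rewrite mulrC -Ep.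
  have := disc3_cases D3 (gram_from_disc m_neq0 dK gH g).
  move=> [[/evenE[p' Ep] /evenE[r' Er]]|[[p4 o]|[[r4 o]|[s4 o]]]].
  - by left; apply/evP; exists p', r', q; rewrite -Ep -Er.
  - by right; exact: odd_of g p4 o.
  - by right; exact: odd_of (gram_from_swap g) r4 o.
  - by right; exact: odd_of (gram_from_shear g) s4 o.
by case=> [/evP[p [r [q g]]]|/odP[p [r [q [g _]]]]]; apply/(reflvec1P v gH); do 3 eexists; exact: g.
Qed.

Lemma even_odd_plane_disjoint H v : genus K H -> even_plane_vecs m H v -> ~ odd_plane_vecs H v.
Proof.
move=> gH /(even_plane_vecsP m_gt0 D3 dK v gH)[p [r [q g]]].
move=> /(odd_plane_vecsP v gH)[p' [r' [q' [g' o]]]].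
have [z [k [l [Ez Er]]]] := gram_from_rel g g'.
have z0 : z = 0 by apply: (mulIf m_neq0); rewrite mul0r -[RHS]Ez; ring.
move: o; rewrite Er z0 (_ : _ + _ = 2 * (p * k ^+ 2 + r * l ^+ 2 + q * k * l)); last by ring.
by rewrite dvdz_mulr.
Qed.

Lemma odd_plane_isotropic H v : genus K H -> odd_plane_vecs H v -> isoK.
Proof.
move=> gH /(odd_plane_vecsP _ gH)[p [r [q [g o]]]].
apply: (isometric_isotropic (gram_from_iso2 gH g)); apply: isotropic_split3 => //.
apply/negP => /evenE[q' Eq]; have := gram_from_disc m_neq0 dK gH g; rewrite Eq => DE.
move: D3; rewrite DE (_ : _ - _ = 4 * (p * r - q' ^+ 2)); last by ring.
by rewrite modzMr.
Qed.

Lemma even_plane_anisotropic H v : (D %% 8)%Z <> 7 -> genus K H -> even_plane_vecs m H v -> ~ isoK.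
Proof.
move=> D7 gH /(even_plane_vecsP m_gt0 D3 dK _ gH)[p [r [q g]]] i.
have DE := gram_from_disc m_neq0 dK gH g.
apply: (@anisotropic_split m%:Z p q r m_odd); last first.
  exact: (isometric_isotropic (isometric_sym (gram_from_iso2 gH g)) i).
by rewrite (_ : _ - _ = D); [clear -D3 D7; lia|rewrite DE; ring].
Qed.

Lemma odd_plane_total a : 0 < a -> rational_split dd K m a ->
  (exists J, fid dd (4 / a) J) ->
  total odd_plane_vecs = class_value dd (if (D %% 8)%Z == 7 then 1%N else 3%N).
Proof. by move=> a0 iK; exact: (odd_family_total sK m_gt0 a0 iK rH natz_m D3 K_odd dK). Qed.

Lemma reflvec1_norm : reflective_in_genus 1 ->
  exists a : rat, [/\ 0 < a, rational_split dd K m a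
   & (exists J, fid dd (2 / a) J) /\ (exists H v, genus K H /\ even_plane_vecs m H v) \/
     (exists J, fid dd (4 / a) J) /\ (exists H v, genus K H /\ odd_plane_vecs H v)].
Proof.
move=> [H [v [gH /(reflvec1_even_or_odd v gH)[X|X]]]].
  have [a [a0 iK exJ]] := fam_vecs_fid gH (isT : (0 < 1)%N) (isT : 0 < 2 :> rat) X.
  by exists a; split=> //; left; split=> //; exists H, v.
have [a [a0 iK exJ]] := fam_vecs_fid gH (isT : (0 < 2)%N) (isT : 0 < 4 :> rat) X.
by exists a; split=> //; right; split=> //; exists H, v.
Qed.

Lemma total_delta1_D3 : reflective_in_genus 1 -> total (reflvec_at m 1) =
  class_value dd (if (D %% 8)%Z == 7 then 2%N else if `[< isoK >] then 3%N else 1%N).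
Proof.
move=> /reflvec1_norm[a [a0 iK exJ]].
rewrite (genus_total_disjoint _ (fun H gH v => reflvec1_even_or_odd v gH)
  (fun H gH v => even_odd_plane_disjoint gH)); last first.
  by move=> H /genus_lattice lH; split; exact: finite_fam_vecs.
have even_total := even_plane_total m_gt0 D3 dK a0 iK (fun ev => False_ind _ (K_odd ev)).
have odd_total := odd_plane_total a0 iK.
case: eqP odd_total => [D7|D7] odd_total.
  have [ex2 ex4] : (exists J, fid dd (2 / a) J) /\ (exists J, fid dd (4 / a) J).
    case: exJ => -[exJ _]; split=> //; have := fid_ex_double D7 exJ.
      by rewrite (_ : 2 * (2 / a) = 4 / a) //; field; rewrite gt_eqF.
    move=> /(fid_ex_sqr (isT : 0 < 1 / 2 :> rat)).
    by rewrite (_ : _ ^+ 2 * _ = 2 / a) //; field; rewrite gt_eqF.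
  by rewrite even_total // odd_total // class_valueD.
case: asboolP => iso2.
  have even0 : total (even_plane_vecs m) = 0.
    by apply: genus_total0 => H gH v ev; exact: even_plane_anisotropic D7 gH ev iso2.
  case: exJ => [[_ [H [v [gH /(even_plane_anisotropic D7 gH)]]]]|[ex4 _]] //.
  by rewrite even0 add0r odd_total.
have odd0 : total odd_plane_vecs = 0.
  by apply: genus_total0 => H gH v /(odd_plane_isotropic gH).
by case: exJ => [[ex2 _]|[_ [H [v [gH /(odd_plane_isotropic gH)]]]]] //;
  rewrite odd0 addr0 even_total.
Qed.

End OddNormThree.

Lemma reflvec2_fam H v : (D %% 4)%Z = 2 -> 2 * \det K = m%:Z * D -> genus K H ->
  reflvec_at m 2 H v <-> fam_vecs dd (m * 2) 2 (1 / 2) 1 (fun _ _ C => (2 %| C)%Z) H v.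
Proof.
move=> D2 dK gH; have [sH _] := genus_lattice gH; have D3 : (D %% 4)%Z <> 3 by rewrite D2.
split=> [/(reflvec2P v gH)[[p [r [q g]]]|[p [r [q g]]]]|].
- suff DE : D = 4 * (p * r - q ^+ 2) by move: D2; rewrite DE modzMr.
  by apply: (mulfI m_neq0); rewrite -dK (gram_from_det gH g); ring.
- apply: (gram_fam_vecs g (A := p) (B := 4 * q) (C := 4 * r - 2 * m%:Z)).
    by rewrite ext_smx3 /glued_gram natz_m2; congr mx3; rewrite ?(rmorphM, rmorphB) /=; field.
  split; first by rewrite (_ : _ - _ = 2 * (2 * r - m%:Z)); [rewrite dvdz_mulr|ring].
  rewrite disc_even //; apply: (mulfI m_neq0); transitivity (- 4 * (m%:Z * D)); last by ring.
  by rewrite -dK (gram_from_det gH g); ring.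
move=> /(fam_vecs_gram sH (e := m%:Z))[|p [r [q [A [B [C [g _ _]]]]]]].
  by rewrite natz_m2 rmorphM /=; field.
by apply/(reflvec2P v gH); right; exists p, r, q; rewrite -Posz_m2.
Qed.

Lemma total_delta2_D2 : (D %% 4)%Z = 2 -> ~ even_lattice K -> 2 * \det K = m%:Z * D ->
  reflective_in_genus 2 -> total (reflvec_at m 2) = class_value dd 1.
Proof.
move=> D2 K_odd dK [H [v [gH /(reflvec2_fam v D2 dK gH)]]].
rewrite (genus_total_ext (fun H gH v => reflvec2_fam v D2 dK gH)).
move=> /(fam_vecs_fid gH (ltn0Sn _) ltr01)[a [a0 iK exJ]].
exact: (half_family2_total sK m2_gt0 a0 iK rH natz_m2 m_odd D2 K_odd dK).
Qed.

Section EvenNorm.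
Hypothesis dK : \det K = 2 * m%:Z * D.

Let K_even : even_lattice K.
Proof. by apply/(stable_even2 sK); rewrite dK -mulrA dvdz_mulr. Qed.

Lemma gram_from_half_disc H v p r q : genus K H ->
  gram_from H v (smx3 (2 * m%:Z) p r 0 m%:Z q) ->
  exists p' r', [/\ p = 2 * p', r = 2 * r' & D = 4 * (p' * r') - q ^+ 2 - m%:Z * p'].
Proof.
move=> gH g; have [p' [r' [Ep Er]]] := gram_from_even gH g K_even; exists p', r'; split=> //.
by apply: (mulfI m2_neq0); rewrite -dK (gram_from_det gH g) Ep Er; ring.
Qed.

Definition half_vecs be ga :=
  fam_vecs dd (m * 2) be (1 / 2) ga (fun _ _ C => ((C + m%:Z) %% 4)%Z = 0).

Lemma half_vecs_gram be ga H v : genus K H -> half_vecs be ga H v ->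
  exists p r q, gram_from H v (smx3 (2 * m%:Z) p r 0 m%:Z q).
Proof.
move=> gH /(fam_vecs_gram (genus_lattice gH).1 (e := m%:Z))[|p [r [q [A [B [C [g _ _]]]]]]].
  by rewrite natz_m2 rmorphM /=; field.
by exists p, r, q; rewrite -Posz_m2.
Qed.

Lemma reflvec2_half_vecs H v : (D %% 4)%Z = 1 -> genus K H ->
  reflvec_at m 2 H v <-> half_vecs 2 2 H v.
Proof.
move=> D1 gH; split=> [/(reflvec2P v gH)[[p [r [q g]]]|[p [r [q g]]]]|X]; last first.
- by apply/(reflvec2P v gH); right; exact: half_vecs_gram X.
- have [p' [r' [Ep Er DE]]] := gram_from_half_disc gH g.
  apply: (gram_fam_vecs g (A := p') (B := 2 * q) (C := 2 * r - m%:Z)).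
    by rewrite ext_smx3 /glued_gram natz_m2 Ep; congr mx3; rewrite ?(rmorphM, rmorphB) /=; field.
  split; first by rewrite Er; clear; lia.
  by rewrite disc_even ?D1 // DE Er; ring.
have [p' [r' [Ep Er]]] := gram_from_even gH g K_even.
have := gram_from_disc m2_neq0 dK gH g; rewrite Ep Er mulrACA => DE.
by move: D1; rewrite DE; have [z ->] := sq_mod4 q; move: (p' * r') => s; clear; lia.
Qed.

Lemma total_delta2_D1 : (D %% 4)%Z = 1 -> reflective_in_genus 2 ->
  total (reflvec_at m 2) = class_value dd 2.
Proof.
move=> D1 [H [v [gH /(reflvec2_half_vecs v D1 gH)]]].
rewrite (genus_total_ext (fun H gH v => reflvec2_half_vecs v D1 gH)).
move=> /(fam_vecs_basis gH (ltn0Sn _) (isT : 0 < 2 :> rat))[a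
  [a0 iK [J [y [w [A [B [C [b Cm]]]]]]]]].
exact: (half_family_total_D1 sK m2_gt0 a0 iK rH natz_m2 m_odd D1 dK b Cm).
Qed.

Hypothesis D3 : (D %% 4)%Z = 3.

Let dK_m2 : \det K = (m * 2)%N%:Z * D. Proof. by rewrite dK Posz_m2. Qed.

Lemma gram_from_half_vecs H v p r q : genus K H ->
  gram_from H v (smx3 (2 * m%:Z) p r 0 m%:Z q) -> half_vecs 4 8 H v.
Proof.
move=> gH; have odd_case p' r' q' : gram_from H v (smx3 (2 * m%:Z) p' r' 0 m%:Z q') ->
    ~~ (2 %| q')%Z -> half_vecs 4 8 H v.
  move=> g o; have [p1 [r1 [Ep Er DE]]] := gram_from_half_disc gH g.
  have : (4 %| m%:Z * p1)%Z.
    have [t Et] := sq_mod8 o; move: D3; rewrite DE Et.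
    by move: (p1 * r1) (m%:Z * p1) => s s'; clear; lia.
  rewrite (@dvdz_pow2_odd 2) // => /dvdzP[A EA].
  apply: (gram_fam_vecs g (A := A) (B := q') (C := 2 * r' - m%:Z)).
    by rewrite ext_smx3 /glued_gram natz_m2 Ep EA; congr mx3; rewrite ?(rmorphM, rmorphB) /=; field.
  by split; [rewrite Er; clear; lia|rewrite disc_odd // DE EA Er; ring].
have [q2|] := boolP (2 %| q)%Z; last by move=> o g; exact: odd_case g o.
move=> g; apply: (odd_case _ _ (q + 2 * r - m%:Z)); last by clear -q2 m_odd; lia.
by apply: (gram_from_smx3 (i := 1) (j := 2) (x := -1)
  (k := 0) (l := 1) (z := 0) _ _ _ erefl erefl _ g);
  [left| | |]; ring.
Qed.

Lemma reflvec2_even_or_half H v : genus K H ->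
  reflvec_at m 2 H v <-> even_plane_vecs (m * 2) H v \/ half_vecs 4 8 H v.
Proof.
move=> gH; have evP := even_plane_vecsP m2_gt0 D3 dK_m2 v gH.
split=> [/(reflvec2P v gH)[[p [r [q g]]]|[p [r [q g]]]]|].
- have [p' [r' [Ep Er]]] := gram_from_even gH g K_even.
  by left; apply/evP; exists p', r', q; rewrite Posz_m2 -Ep -Er.
- by right; exact: gram_from_half_vecs gH g.
case=> [/evP[p [r [q g]]]|/(half_vecs_gram gH) ex]; apply/(reflvec2P v gH); [left|right] => //.
by rewrite Posz_m2 in g; do 3 eexists; exact: g.
Qed.

Lemma even_half_disjoint H v : genus K H -> even_plane_vecs (m * 2) H v -> ~ half_vecs 4 8 H v.
Proof.
move=> gH /(even_plane_vecsP m2_gt0 D3 dK_m2 _ gH)[p [r [q g]]].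
move=> /(half_vecs_gram gH)[p' [r' [q']]]; rewrite -Posz_m2 => g'.
have [z [_ [l [Em _]]]] := gram_from_rel g g'; move: m_odd.
by rewrite -Em Posz_m2 mulr0 addr0 mulrCA dvdz_mulr.
Qed.

Lemma reflvec2_norm : reflective_in_genus 2 ->
  exists a : rat, [/\ 0 < a, rational_split dd K (m * 2)%N a,
    exists J, fid dd (2 / a) J & exists J, fid dd (8 / a) J].
Proof.
move=> [H [v [gH /(reflvec2_even_or_half v gH)[X|X]]]].
  have [a [a0 iK exJ]] := fam_vecs_fid gH (isT : (0 < 1)%N) (isT : 0 < 2 :> rat) X.
  exists a; split=> //; have := fid_ex_sqr (isT : 0 < 2 :> rat) exJ.
  by rewrite (_ : _ ^+ 2 * _ = 8 / a) //; field; rewrite gt_eqF.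
have [a [a0 iK exJ]] := fam_vecs_fid gH (isT : (0 < 4)%N) (isT : 0 < 8 :> rat) X.
exists a; split=> //; have := fid_ex_sqr (isT : 0 < 1 / 2 :> rat) exJ.
by rewrite (_ : _ ^+ 2 * _ = 2 / a) //; field; rewrite gt_eqF.
Qed.

Lemma total_delta2_D3 : reflective_in_genus 2 ->
  total (reflvec_at m 2) = class_value dd (if (D %% 8)%Z == 7 then 2%N else 4%N).
Proof.
move=> /reflvec2_norm[a [a0 iK ex2 ex8]].
rewrite (genus_total_disjoint _ (fun H gH v => reflvec2_even_or_half v gH)
  (fun H gH v => even_half_disjoint gH)); last first.
  by move=> H /genus_lattice lH; split; exact: finite_fam_vecs.
rewrite (even_plane_total m2_gt0 D3 dK_m2 a0 iK _ ex2); last by rewrite Posz_m2 dvdz_mulr.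
rewrite (half_family_total_D3 sK m2_gt0 a0 iK rH natz_m2 m_odd D3 dK ex8) class_valueD.
by case: ifP.
Qed.

End EvenNorm.

End Totals.
(** * The class number formula *)

Lemma quad_field_sq (dd : sqf) (k : int) : k != 0 ->
  quad_field (- (k ^+ 2 * sqf_val dd)) = quad_field (- sqf_val dd).
Proof.
move=> k0; have kn : ratr k%:~R != 0 :> algC by rewrite ratr_int intr_eq0.
have [e ee Es] : exists2 e : rat, e != 0 & sqrtC (- (k ^+ 2 * sqf_val dd))%:~R = ratr e * sqrtND dd.
  have : sqrtC (- (k ^+ 2 * sqf_val dd))%:~R ^+ 2 = (k%:~R * sqrtND dd) ^+ 2.
    by rewrite sqrtCK exprMn sqrtND_sq rmorphN rmorphM rmorphXn /= mulrN.
  move=> /eqP; rewrite eqf_sqr => /orP[] /eqP ->; [exists k%:~R|exists (- k%:~R)];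
    rewrite ?oppr_eq0 ?intr_eq0 //.
    by rewrite ratr_int.
  by rewrite rmorphN /= ratr_int mulNr.
rewrite /quad_field Es -/(sqrtND dd); apply/seteqP; split=> _ [a [b ->]].
  by exists a, (b * e); rewrite (rmorphM (@ratr algC) b) /= mulrA.
by exists a, (b / e); rewrite mulrA -(rmorphM (@ratr algC) (b / e)) /= divfK.
Qed.

Lemma sqfreez_coprime (a b : nat) : (0 < a)%N -> sqfreez (a * b)%N%:Z -> coprime a b.
Proof.
move=> a0 sq; rewrite /coprime eqn_leq gcdn_gt0 a0 andbT leqNgt; apply/negP => h.
have := sq _ (pdiv_prime h); rewrite dvdzE /= expnS expn1.
by rewrite dvdn_mul // (dvdn_trans (pdiv_dvd _)) ?dvdn_gcdl ?dvdn_gcdr.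
Qed.

Lemma sqfreez_double (n : nat) : odd n -> sqfreez n%:Z -> sqfreez (2 * n)%N%:Z.
Proof.
move=> on sn q pq; apply/negP; rewrite dvdzE /=.
have [->|q2] := eqVneq q 2%N; first by move: on; clear; lia.
rewrite Gauss_dvdr; first by move=> h; have := sn q pq; rewrite dvdzE /= h.
by rewrite coprimeXl // coprime_sym prime_coprime // dvdn_prime2 // eq_sym.
Qed.

Section Term.
Variables (K : 'M[int]_3) (m : nat) (Hs : seq 'M[int]_3).
Hypotheses (sK : stable K) (mP : (m %| PQ K)%N) (rH : class_reps K Hs).
Local Notation L := (lambda m K).
Local Notation e := (PQ K %/ m)%N.

Definition term dl : rat := let E := quad_field (- (dl%:Z * \det L)) in
  tcoef L dl * 2 ^ ((nu m)%:Z - (nu (PQ K))%:Z) * ((field_class_number E)%:R / (mu E)%:R).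

Let PQ_factor : PQ K = (m * e)%N. Proof. by rewrite mulnC divnK. Qed.
Let m_odd : odd m. Proof. exact: PQ_dvd_odd mP. Qed.
Let m_gt0 : (0 < m)%N. Proof. exact: PQ_dvd_gt0 mP. Qed.
Let m_neq0 : m%:Z != 0. Proof. by rewrite eqz_nat -lt0n. Qed.
Let e_dvd : (e %| PQ K)%N. Proof. by rewrite [X in (_ %| X)%N]PQ_factor dvdn_mull. Qed.
Let e_odd : odd e. Proof. exact: PQ_dvd_odd e_dvd. Qed.
Let e_gt0 : (0 < e)%N. Proof. exact: PQ_dvd_gt0 e_dvd. Qed.
Let det_factor : \det K = (m * e * (if `[< even_lattice K >] then 2 else 1))%N%:Z.
Proof. by rewrite -PQ_factor -PQ_det // gez0_abs // ltW // lattice_det_gt0; case: sK. Qed.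
Let PQ_sqfree : sqfreez (m * e)%N%:Z.
Proof. by apply: sqfreez_dvd (stable_sqfree sK) _; rewrite det_factor PoszM dvdz_mulr. Qed.
Let e_sqfree : sqfreez e%:Z.
Proof. by apply: sqfreez_dvd PQ_sqfree _; rewrite PoszM dvdz_mull. Qed.
Let e_pos : 0 < e%:Z. Proof. by rewrite ltz_nat. Qed.
Let e_disc := SqF e_pos e_sqfree.
Let L_sym := lambda_sym sK mP.

Let nu_PQ : nu (PQ K) = (nu m + nu e)%N.
Proof. by rewrite {1}PQ_factor nuM // sqfreez_coprime. Qed.

Let nu_double : nu (2 * e) = (1 + nu e)%N.
Proof. by rewrite nuM // coprime2n. Qed.

Let m_sq8 D : (8 %| m%:Z ^+ 2 * D - D)%Z.
Proof.
have /sq_mod8[t ->] : ~~ (2 %| m%:Z)%Z by rewrite dvdzE /= dvdn2 m_odd.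
by apply/dvdzP; exists (t * D); ring.
Qed.

Let e_mod4 : ((e%:Z %% 4)%Z = 1) \/ ((e%:Z %% 4)%Z = 3).
Proof. by move: e_odd; clear; lia. Qed.

Lemma term_value (dl : nat) (dd : sqf) (k : int) (j kk : nat) : k != 0 ->
  dl%:Z * \det L = k ^+ 2 * sqf_val dd -> nu (ram dd) = (j + nu e)%N ->
  tcoef L dl = kk%:R / 2 ^+ j -> term dl = class_value dd kk.
Proof.
move=> k0 Ed En Et; rewrite /term /class_value Ed quad_field_sq // Et En nu_PQ.
by rewrite PoszD opprD addrA subrr add0r exprD invfM invfM -exprnN; ring.
Qed.

Lemma total_delta1 : reflective_in_genus K m 1 -> genus_total Hs (reflvec_at m 1) = term 1.
Proof.
move=> ex; have [H [v [gH [Qv _]]]] := ex.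
have K_odd : ~ even_lattice K.
  have lK : lattice K by case: sK.
  by move=> /(genus_even lK gH) /(_ v); rewrite Qv muln1 dvdzE /= dvdn2 m_odd.
have L_odd : ~ even_lattice L by rewrite lambda_even.
have dK : \det K = m%:Z * e%:Z by rewrite det_factor asboolF // muln1 PoszM.
have dL : \det L = m%:Z ^+ 2 * e%:Z by rewrite lambda_det // dK; ring.
have dL8 : (8 %| \det L - e%:Z)%Z by rewrite dL.
have dE : 1%N%:Z * \det L = m%:Z ^+ 2 * sqf_val e_disc by rewrite mul1r dL.
case: e_mod4 => e4.
  rewrite (@total_delta1_D1 K m e_disc Hs) // (term_value (j := 1) (kk := 1) m_neq0 dE) //.
    by rewrite /ram e4 /= nu_double.
  by rewrite (tcoef1_D1 dL8 e4).
have ramE : nu (ram e_disc) = (0 + nu e)%N by rewrite /ram e4.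
rewrite (@total_delta1_D3 K m e_disc Hs) //; symmetry; apply: (term_value m_neq0 dE ramE).
rewrite expr0 divr1 /e_disc /=; case: ifP => [/eqP e8|e8].
  by rewrite (tcoef1_D7 L_sym L_odd dL8 e8) // lambda_isotropic //;
    exact: (@reflvec1_isotropic K m e_disc).
have e83 : (e%:Z %% 8)%Z = 3 by move: e4 e8; clear; lia.
case: asboolP => isoK.
  by rewrite (tcoef1_D3_isotropic L_sym L_odd dL8 e83) // lambda_isotropic.
by rewrite (tcoef1_D3_anisotropic L_sym L_odd dL8 e83) // lambda_isotropic.
Qed.

Lemma total_delta2_odd : ~ even_lattice K -> reflective_in_genus K m 2 ->
  genus_total Hs (reflvec_at m 2) = term 2.
Proof.
move=> K_odd ex; have L_odd : ~ even_lattice L by rewrite lambda_even.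
have dK : \det K = m%:Z * e%:Z by rewrite det_factor asboolF // muln1 PoszM.
have e2_pos : 0 < (2 * e)%N%:Z by rewrite ltz_nat muln_gt0.
pose dd := SqF e2_pos (sqfreez_double e_odd e_sqfree).
have e4 : ((2 * e)%N%:Z %% 4)%Z = 2 by move: e_odd; clear; lia.
have dE : 2%N%:Z * \det L = m%:Z ^+ 2 * sqf_val dd by rewrite lambda_det // dK /= PoszM; ring.
rewrite (@total_delta2_D2 K m dd Hs) //; last by rewrite dK /= PoszM; ring.
rewrite (term_value (j := 1) (kk := 1) m_neq0 dE) ?tcoef2_odd //.
by rewrite /ram e4 /= nu_double.
Qed.

Lemma total_delta2_even : even_lattice K -> reflective_in_genus K m 2 ->
  genus_total Hs (reflvec_at m 2) = term 2.
Proof.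
move=> K_even ex; have L_even : even_lattice L by rewrite lambda_even.
have dK : \det K = 2 * m%:Z * e%:Z by rewrite det_factor asboolT // !PoszM; ring.
have dL : \det L = 2 * (m%:Z ^+ 2 * e%:Z) by rewrite lambda_det // dK; ring.
have m2_neq0 : 2 * m%:Z != 0 by rewrite mulf_neq0.
have dE : 2%N%:Z * \det L = (2 * m%:Z) ^+ 2 * sqf_val e_disc by rewrite dL /=; ring.
have tE := tcoef2_even L_sym L_even dL (m_sq8 e%:Z) _; rewrite dvdzE /= dvdn2 e_odd in tE.
case: e_mod4 => e4.
  rewrite (@total_delta2_D1 K m e_disc Hs) // (term_value (j := 1) (kk := 2) m2_neq0 dE) //.
    by rewrite /ram e4 /= nu_double.
  by rewrite tE // !ifF ?divff //; apply/eqP; move: e4; clear; lia.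
have ramE : nu (ram e_disc) = (0 + nu e)%N by rewrite /ram e4.
rewrite (@total_delta2_D3 K m e_disc Hs) //; symmetry; apply: (term_value m2_neq0 dE ramE).
rewrite tE // expr0 divr1 /=; have [e8|e8] : (e%:Z %% 8)%Z = 7 \/ (e%:Z %% 8)%Z = 3.
- by move: e4; clear; lia.
- by rewrite e8.
- by rewrite e8.
Qed.

Lemma total_term dl : dl \in [:: 1; 2]%N -> genus_total Hs (reflvec_at m dl) =
  if `[< represented_by_genus L dl%:Z >] then term dl else 0.
Proof.
move=> dlP; case: asboolP => [/(represented_reflvec sK mP) ex|nr]; last first.
  by apply: (genus_total0 rH) => H gH v /(reflvec_represented sK mP gH).
move: dlP ex; rewrite !inE => /orP[] /eqP ->; first exact: total_delta1.
by case: (pselect (even_lattice K)); [exact: total_delta2_even|exact: total_delta2_odd].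
Qed.

End Term.

Lemma unimodular_cubic G : lattice G -> \det G = 1 -> isometric G (diag3 1 1 1).
Proof.
move=> lG dG; have [a [b [c [d [e [f [iG red]]]]]]] := reduced_shape lG.
have [a0 _ _] := lattice_minors (isometric_lattice iG lG).
have D1 : \det (smx3 a b c d e f) = 1 by rewrite -(isometric_det_int iG).
have a1 : a = 1.
  have := reduced_cube a0 red; rewrite D1 => a3.
  have [//|a2] := leP a 1; first by move: a0; clear; lia.
  have : 2 ^+ 3 <= a ^+ 3 by rewrite lerXn2r ?nnegrE ?(ltW a0).
  by move: a3; clear; lia.
have := reduced_minor a0 red; move: red; rewrite D1 a1.
case=> d2 e2 ab g23 hh; have {}d2 : d = 0 by move: d2; clear; lia.
have {}e2 : e = 0 by move: e2; clear; lia.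
rewrite d2 !mul1r expr0n subr0 => b2; have b1 : b = 1 by move: ab b2; clear; nia.
have f0 : f = 0 by move: hh; rewrite d2 e2 b1; clear; lia.
have c1 : c = 1 by move: D1; rewrite det_mx3 a1 b1 d2 e2 f0; clear; lia.
by rewrite diag3E; move: iG; rewrite a1 b1 c1 d2 e2 f0.
Qed.

Section GenusSums.
Variables (K : 'M[int]_3) (Hs : seq 'M[int]_3).
Hypothesis rH : class_reps K Hs.

Let genus_iso_refl H : genus K H -> isometric H H. Proof. by move=> _; exact: isometric_refl. Qed.
Let genus_iso_sym H H' : genus K H -> genus K H' -> isometric H H' -> isometric H' H.
Proof. by move=> _ _; exact: isometric_sym. Qed.
Let genus_iso_trans (H H' H'' : 'M[int]_3) : genus K H -> genus K H' -> genus K H'' ->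
  isometric H H' -> isometric H' H'' -> isometric H H''.
Proof. by move=> _ _ _; exact: isometric_trans. Qed.

Lemma class_number_reps : class_number K = size Hs.
Proof. exact: (ncard_eq_classes genus_iso_refl genus_iso_sym genus_iso_trans rH). Qed.

Lemma ortho_order_rclass H : H \in Hs ->
  ortho_order (rclass (genus K) (@isometric 3 int) H) = ncard (Defs.ortho H).
Proof.
case: rH => -[_ hs _] _ /hs gH; rewrite /ortho_order; case: xgetP => [H' -> [gH' i]|/(_ H) []].
  by have [-> _] := ncard_ortho_isometric (genus_lattice gH) i.
by split=> //; exact: isometric_refl.
Qed.

Lemma mass_reps : mass K = \sum_(H <- Hs) (ncard (Defs.ortho H))%:R^-1.
Proof.
rewrite /mass (fsbig_eq_classes genus_iso_refl genus_iso_sym genus_iso_trans _ rH).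
by apply: eq_big_seq => H hH; rewrite ortho_order_rclass.
Qed.

Lemma b_reps t : b_ t K = count (fun H => ncard (Defs.ortho H) == t) Hs.
Proof.
have [[us _ _] _] := rH; rewrite -size_filter -(size_map (rclass (genus K) (@isometric 3 int))).
apply: ncard_seq.
  rewrite map_inj_in_uniq ?filter_uniq // => x y; rewrite !mem_filter => /andP[_ hx] /andP[_ hy].
  exact: (rclass_inj genus_iso_refl rH.1).
move=> C; split=> [[/(eq_classesE genus_iso_sym genus_iso_trans rH)/mapP[H hH ->]]|/mapP[H]].
  by rewrite ortho_order_rclass // => oH; apply/mapP; exists H; rewrite // mem_filter oH eqxx.
rewrite mem_filter => /andP[/eqP oH hH] ->; split; last by rewrite ortho_order_rclass.
by apply/(eq_classesE genus_iso_sym genus_iso_trans rH)/mapP; exists H.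
Qed.

End GenusSums.

Lemma sum_terms K Hs : stable K -> class_reps K Hs ->
  \sum_(m <- divisors (PQ K)) \sum_(dl <- [:: 1%N; 2%N] |
    `[< represented_by_genus (lambda m K) dl%:Z >]) term K m dl = genus_total Hs reflvec.
Proof.
move=> sK rH; have [[_ HP _] _] := rH.
transitivity (\sum_(m <- divisors (PQ K)) \sum_(dl <- [:: 1%N;
  2%N]) genus_total Hs (reflvec_at m dl)).
  apply: eq_big_seq => m; rewrite -dvdn_divisors; last by case: (PQ K) (PQ_odd K).
  move=> mP; rewrite big_mkcond; apply: eq_big_seq => dl dlP.
  by rewrite (total_term sK mP rH dlP).
under eq_bigr => m _ do rewrite exchange_big.
rewrite exchange_big /=; apply: eq_big_seq => H /HP gH.
rewrite (ncard_reflvec sK gH) natr_sum mulr_suml.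
by apply: eq_bigr => m _; rewrite natr_sum mulr_suml.
Qed.

Lemma isometry_class_weight H : lattice H -> sqfreez (\det H) ->
  ~ isometric H (diag3 1 1 1) -> let o := ncard (Defs.ortho H) in
  2 / o%:R + (ncard (reflvec H))%:R / o%:R + 1 / 3 * ((o == 12)%:R + (o == 24)%:R)
    + 1 / 4 * (o == 16)%:R = 1 :> rat.
Proof.
move=> lH sH nH /=; have := ortho_cases lH sH nH; rewrite ncard_involutions //.
move: (ncard _) (ncard (reflvec H)) => o r [[-> le8]|[-> [->]]|[-> [->]]|[-> [->]]] //.
rewrite !ltn_eqF ?(leq_ltn_trans le8) //= addr0 !mulr0 !addr0 -mulrDl -natrD add2n divff //.
by rewrite pnatr_eq0.
Qed.

Theorem theorem8p10 (K : 'M[int]_3) (hK : stable K)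
    (hK1 : ~ isometric K (diag3 1 1 1)) :
  let PQ := (frakP K * frakQ K)%N in
  (class_number K)%:R =
    2 * mass K
    + (\sum_(m <- divisors PQ)
        \sum_(delta <- [:: 1%N; 2%N] |
              `[< represented_by_genus (lambda m K) delta%:Z >])
          (let E := quad_field (- (delta%:Z * \det (lambda m K))) in
           tcoef (lambda m K) delta
           * 2 ^ ((nu m)%:Z - (nu PQ)%:Z)
           * ((field_class_number E)%:R / (mu E)%:R)))
    + 1 / 3 * ((b_ 12 K)%:R + (b_ 24 K)%:R)
    + 1 / 4 * (b_ 16 K)%:R
    :> rat.
Proof.
move=> PQ0; rewrite {}/PQ0 -/(PQ K).
have lK : lattice K by case: hK.
have [Hs rH] := genus_reps lK; have [[_ gHs _] _] := rH.
rewrite (sum_terms hK rH).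
have bE t : (b_ t K)%:R = \sum_(H <- Hs) (ncard (Defs.ortho H) == t)%:R :> rat.
  by rewrite (b_reps rH) -sum1_count natr_sum big_mkcond; apply: eq_bigr => H _; case: ifP.
rewrite (class_number_reps rH) (mass_reps rH) !bE -big_split /= !mulr_sumr -!big_split /=.
rewrite -sum1_size natr_sum; apply: eq_big_seq => H /gHs gH.
have dH := genus_det lK gH; rewrite (isometry_class_weight (genus_lattice gH)) //.
- by rewrite dH; exact: stable_sqfree.
- by move=> /isometric_det_int; rewrite dH diag3_det => d1; exact/hK1/unimodular_cubic.
Qed.
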